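(* Let $\varphi\colon R\to S$ be a homomorphism of commutative Noetherian rings of finite flat dimension (i.e. $\operatorname{fd}_R(S)<\infty$) and let $C,C',X$ be homologically degreewise finite $R$-complexes. Assume that every maximal ideal of $R$ is contracted from $S$, i.e. is of the form $\varphi^{-1}(\mathfrak q)$ for some prime ideal $\mathfrak q$ of $S$. (a) The complex $C\otimes^{\mathbf L}_R S$ is $S$-semidualizing if and only if $C$ is $R$-semidualizing. (b) When $C$ is semidualizing for $R$, there is an equality $$\mathrm{G}_{C}\text{-}\dim_R(X)=\mathrm{G}_{C\otimes^{\mathbf L}_R S}\text{-}\dim_S(X\otimes^{\mathbf L}_R S).$$ In particular, $X\otimes^{\mathbf L}_R S$ is $C\otimes^{\mathbf L}_R S$-reflexive if and only if $X$ is $C$-reflexive. (c) If the induced map on Picard groups $\operatorname{Pic}(R)\to\operatorname{Pic}(S)$ is injective and $C,C'$ are semidualizing $R$-complexes, then $C\otimes^{\mathbf L}_R S$ is isomorphic to $C'\otimes^{\mathbf L}_R S$ in $\mathsf D(S)$ if and only if $C$ is isomorphic to $C'$ in $\mathsf D(R)$.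
   Context: $\mathsf D(R)$ is the derived category of $R$-complexes, indexed homologically. $\inf(X)$ is the infimum of $\{i\mid\operatorname{H}_i(X)\neq0\}$. A complex is homologically finite (respectively, homologically degreewise finite) if its total homology (respectively, each homology module) is finitely generated; it is homologically bounded if $\operatorname{H}_i=0$ for all but finitely many $i$. An $R$-complex $C$ is semidualizing if it is homologically finite and the homothety morphism $R\to\mathbf R\mathrm{Hom}_R(C,C)$ is an isomorphism in $\mathsf D(R)$. For $C$ semidualizing, an $R$-complex $X$ is $C$-reflexive if $X$ is homologically finite, $\mathbf R\mathrm{Hom}_R(X,C)$ is homologically bounded, and the biduality morphism $X\to\mathbf R\mathrm{Hom}_R(\mathbf R\mathrm{Hom}_R(X,C),C)$ is an isomorphism in $\mathsf D(R)$. Set $\mathrm{G}_{C}\text{-}\dim_R(X)=\inf(C)-\inf(\mathbf R\mathrm{Hom}_R(X,C))$ if $X$ is $C$-reflexive, and $\mathrm{G}_{C}\text{-}\dim_R(X)=\infty$ otherwise. $\operatorname{Pic}(R)$ is the group of isomorphism classes of finitely generated projective $R$-modules of rank 1 under tensor product; the induced map sends $[L]$ to $[L\otimes_RS]$. *)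

(* Defs.v *)
From HB Require Import structures.
From mathcomp Require Import all_boot all_order all_algebra.
From mathcomp Require Import mathcomp_extra boolp classical_sets constructive_ereal.
Set Implicit Arguments.
Unset Strict Implicit.
Unset Printing Implicit Defensive.
Import Order.TTheory GRing.Theory Num.Theory.
Local Open Scope ring_scope.

Section Ideals.
Variable R : comPzRingType.
Implicit Types I J : R -> Prop.

Definition is_ideal I :=
  [/\ I 0, forall x y, I x -> I y -> I (x + y) & forall a x, I x -> I (a * x)].

Definition is_prime I :=
  [/\ is_ideal I, ~ I 1 & forall x y, I (x * y) -> I x \/ I y].

Definition is_maximal I :=
  [/\ is_ideal I, ~ I 1 &
      forall J, is_ideal J -> (forall x, I x -> J x) ->
        (forall x, J x -> I x) \/ J 1].

Definition noetherian := forall I, is_ideal I ->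
  exists (n : nat) (g : 'I_n -> R), (forall k, I (g k)) /\
    forall x, I x -> exists c : 'I_n -> R, x = \sum_(k < n) c k * g k.

End Ideals.

Definition fg_module (R : comPzRingType) (M : lmodType R) :=
  exists (n : nat) (g : 'I_n -> M),
    forall x, exists c : 'I_n -> R, x = \sum_(k < n) c k *: g k.

Definition projective (R : comPzRingType) (P : lmodType R) :=
  forall (M N : lmodType R) (g : {linear M -> N}) (f : {linear P -> N}),
    (forall y, exists x, g x = y) ->
    exists h : {linear P -> M}, forall x, g (h x) = f x.

Definition mod_iso (R : comPzRingType) (M N : lmodType R) :=
  exists f : {linear M -> N}, bijective f.

(* The localization of [L] at the prime [p] is free of rank 1 over that of [R].
   A basis vector may be multiplied by a unit, hence taken of the form [e / 1];
   the two clauses say that it generates and that it has zero annihilator. *)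
Definition rank1_at (R : comPzRingType) (p : R -> Prop) (L : lmodType R) :=
  exists e : L,
    (forall x : L, exists r s, ~ p s /\ s *: x = r *: e) /\
    (forall r, (exists s, ~ p s /\ (s * r) *: e = 0) ->
               exists s, ~ p s /\ s * r = 0).

(* The modules whose isomorphism classes form the Picard group. *)
Definition pic (R : comPzRingType) (L : lmodType R) :=
  [/\ fg_module L, projective L & forall p, is_prime p -> rank1_at p L].

Section Tensor.
Variables (R : comPzRingType) (M N : lmodType R).

(* The sequence [(m1, n1); ...; (mk, nk)] stands for the sum of the
   [mi (x) ni]; [tens_eq] is the congruence generated by the usual relations. *)
Inductive tens_eq : seq (M * N) -> seq (M * N) -> Prop :=
| tens_refl s : tens_eq s s
| tens_sym s t : tens_eq s t -> tens_eq t s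
| tens_trans s t u : tens_eq s t -> tens_eq t u -> tens_eq s u
| tens_cat s s' t t' :
    tens_eq s s' -> tens_eq t t' -> tens_eq (s ++ t) (s' ++ t')
| tens_catC s t : tens_eq (s ++ t) (t ++ s)
| tens_0l n : tens_eq [:: (0, n)] [::]
| tens_Dl m m' n : tens_eq [:: (m + m', n)] [:: (m, n); (m', n)]
| tens_Dr m n n' : tens_eq [:: (m, n + n')] [:: (m, n); (m, n')]
| tens_bal r m n : tens_eq [:: (r *: m, n)] [:: (m, r *: n)].

Definition tens_eqb (s t : seq (M * N)) := `[< tens_eq s t >].

Lemma tens_eqb_equiv : equiv_class_of tens_eqb.
Proof.
split=> [s|s t|t s u].
- by apply/asboolP; apply: tens_refl.
- by apply/asboolP/asboolP; apply: tens_sym.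
- move=> /asboolP st /asboolP tu; apply/asboolP; exact: tens_trans st tu.
Qed.

Canonical tens_equiv := EquivRelPack tens_eqb_equiv.

Definition tens := {eq_quot tens_equiv}%qT.
HB.instance Definition _ := Choice.on tens.

Definition tens_pi (s : seq (M * N)) : tens := (\pi_({eq_quot tens_equiv}) s)%qT.

Lemma tens_piP s t : tens_pi s = tens_pi t <-> tens_eq s t.
Proof.
split=> [/eqmodP/asboolP //|st]; by apply/eqmodP/asboolP.
Qed.

Lemma tens_piK (x : tens) : tens_pi (repr x) = x.
Proof. exact: reprK. Qed.

Lemma tens_repr s : tens_eq (repr (tens_pi s)) s.
Proof. by apply/tens_piP; rewrite tens_piK. Qed.

End Tensor.

Section TensorMap.
Variables (R : comPzRingType) (M N M' N' : lmodType R).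
Variables (f : {linear M -> M'}) (g : {linear N -> N'}).

Definition tens_map_seq (s : seq (M * N)) := [seq (f p.1, g p.2) | p <- s].

Definition tens_map (x : tens M N) : tens M' N' := tens_pi (tens_map_seq (repr x)).

Lemma tens_map_eq s t : tens_eq s t -> tens_eq (tens_map_seq s) (tens_map_seq t).
Proof.
rewrite /tens_map_seq.
elim=> [u|u v _|u v w _ uv _|u u' v v' _ uu _|u v|n|m m' n|m n n'|r m n] /=.
- exact: tens_refl.
- exact: tens_sym.
- exact: tens_trans uv.
- by rewrite !map_cat; apply: tens_cat.
- by rewrite !map_cat; apply: tens_catC.
- by rewrite linear0; apply: tens_0l.
- by rewrite linearD; apply: tens_Dl.
- by rewrite linearD; apply: tens_Dr.
- by rewrite !linearZ; apply: tens_bal.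
Qed.

Lemma tens_mapE s : tens_map (tens_pi s) = tens_pi (tens_map_seq s).
Proof. by apply/tens_piP; apply: tens_map_eq; apply: tens_repr. Qed.

End TensorMap.

Section TensorZmod.
Variables (R : comPzRingType) (M N : lmodType R).
Implicit Types x y z : tens M N.

Definition tens0 : tens M N := tens_pi [::].
Definition tens_opp x := tens_map (-%R : {linear M -> M}) (idfun : {linear N -> N}) x.
Definition tens_add x y := tens_pi (repr x ++ repr y).

Lemma tens_addE (s t : seq (M * N)) :
  tens_add (tens_pi s) (tens_pi t) = tens_pi (s ++ t).
Proof. by apply/tens_piP; apply: tens_cat; apply: tens_repr. Qed.

Fact tens_addA : associative tens_add.
Proof.
move=> x y z; rewrite -(tens_piK x) -(tens_piK y) -(tens_piK z).
by rewrite !tens_addE catA.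
Qed.

Fact tens_addC : commutative tens_add.
Proof.
move=> x y; rewrite -(tens_piK x) -(tens_piK y) !tens_addE.
by apply/tens_piP/tens_catC.
Qed.

Fact tens_add0 : left_id tens0 tens_add.
Proof. by move=> x; rewrite -(tens_piK x) tens_addE. Qed.

Fact tens_addN : left_inverse tens0 tens_opp tens_add.
Proof.
move=> x; rewrite -(tens_piK x) /tens_opp tens_mapE tens_addE.
apply/tens_piP; elim: (repr x) => [|[m n] s IH] /=; first exact: tens_refl.
set t := tens_map_seq _ _ s in IH *.
apply: (@tens_trans _ _ _ _ ([:: (- m, n); (m, n)] ++ (t ++ s))).
  rewrite -cat1s -[X in _ ++ X ++ _]cats0 -[(m, n) :: s]cat1s.
  rewrite cats0 -[[:: (- m, n); (m, n)]]/([:: (- m, n)] ++ [:: (m, n)]) -!catA.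
  apply: tens_cat; first exact: tens_refl.
  rewrite !catA; apply: tens_cat; [exact: tens_catC|exact: tens_refl].
rewrite -[[::]]cats0; apply: tens_cat => //.
apply: tens_trans (tens_sym (tens_Dl _ _ _)) _.
by rewrite addNr; apply: tens_0l.
Qed.

HB.instance Definition _ := GRing.isZmodule.Build (tens M N)
  tens_addA tens_addC tens_add0 tens_addN.

End TensorZmod.

Definition flat (R : comPzRingType) (F : lmodType R) :=
  forall (M N : lmodType R) (f : {linear M -> N}),
    injective f -> injective (tens_map f (idfun : {linear F -> F})).

Definition restr (R S : comPzRingType) (phi : {rmorphism R -> S})
  (N : lmodType S) : Type := N.

Section Restr.
Variables (R S : comPzRingType) (phi : {rmorphism R -> S}) (N : lmodType S).
HB.instance Definition _ := GRing.Zmodule.copy (restr phi N) N.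

Definition restr_scale (r : R) (x : restr phi N) : restr phi N :=
  phi r *: (x : N).

Fact restr_scaleA a b v : restr_scale a (restr_scale b v) = restr_scale (a * b) v.
Proof. by rewrite /restr_scale scalerA rmorphM. Qed.
Fact restr_scale1 : left_id 1 restr_scale.
Proof. by move=> v; rewrite /restr_scale rmorph1 scale1r. Qed.
Fact restr_scaleDr : right_distributive restr_scale +%R.
Proof. by move=> a u v; rewrite /restr_scale scalerDr. Qed.
Fact restr_scaleDl v : {morph restr_scale^~ v : a b / a + b}.
Proof. by move=> a b; rewrite /restr_scale rmorphD scalerDl. Qed.

HB.instance Definition _ := GRing.Zmodule_isLmodule.Build R (restr phi N)
  restr_scaleA restr_scale1 restr_scaleDr restr_scaleDl.
End Restr.

Section BaseChange.
Variables (R S : comPzRingType) (phi : {rmorphism R -> S}).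

Definition ringmod : lmodType R := restr phi S^o.

Definition base_change (M : lmodType R) : Type := tens M ringmod.

Section Scale.
Variable M : lmodType R.
HB.instance Definition _ := GRing.Zmodule.copy (base_change M) (tens M ringmod).

Definition mulS (s : S) (t : ringmod) : ringmod := (s * (t : S))%R.

Fact mulS_linear s : linear (mulS s).
Proof.
by move=> r t u; rewrite /mulS mulrDr; congr (_ + _); rewrite [LHS]mulrCA.
Qed.
HB.instance Definition _ s :=
  GRing.isLinear.Build R ringmod ringmod _ (mulS s) (@mulS_linear s).

Definition bc_scale (s : S) (x : base_change M) : base_change M :=
  tens_map (idfun : {linear M -> M}) (mulS s) x.

Lemma bc_scaleE s (l : seq (M * ringmod)) :
  bc_scale s (tens_pi l) = tens_pi [seq (p.1, mulS s p.2) | p <- l].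
Proof. exact: tens_mapE. Qed.

Fact bc_scaleA a b v : bc_scale a (bc_scale b v) = bc_scale (a * b) v.
Proof.
rewrite -(tens_piK v) !bc_scaleE -map_comp; congr tens_pi.
by apply: eq_map => -[m t] /=; rewrite /mulS mulrA.
Qed.
Fact bc_scale1 : left_id 1 bc_scale.
Proof.
move=> v; rewrite -(tens_piK v) !bc_scaleE; congr tens_pi.
by rewrite -[RHS]map_id; apply: eq_map => -[m t] /=; rewrite /mulS mul1r.
Qed.
Fact bc_scaleDr : right_distributive bc_scale +%R.
Proof.
move=> a u v; rewrite -(tens_piK u) -(tens_piK v).
by rewrite [_ + _]tens_addE !bc_scaleE [RHS]tens_addE map_cat.
Qed.
Fact bc_scaleDl v : {morph bc_scale^~ v : a b / a + b}.
Proof.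
move=> a b; rewrite -(tens_piK v) !bc_scaleE [RHS]tens_addE.
apply/tens_piP; elim: (repr v) => [|[m t] s IH] /=; first exact: tens_refl.
set v1 := [seq (p.1, mulS a p.2) | p <- s] in IH *.
set v2 := [seq (p.1, mulS b p.2) | p <- s] in IH *.
apply: (@tens_trans _ _ _ _ ([:: (m, mulS a t); (m, mulS b t)] ++ (v1 ++ v2))).
  apply: (@tens_cat _ _ _ [:: (m, mulS (a + b) t)]) => //.
  rewrite [mulS (a + b) t]mulrDl; exact: tens_Dr.
apply: (@tens_cat _ _ _ [:: (m, mulS a t)] [:: (m, mulS a t)]
  ([:: (m, mulS b t)] ++ v1 ++ v2) (v1 ++ [:: (m, mulS b t)] ++ v2)).
  exact: tens_refl.
by rewrite !catA; apply: tens_cat; [apply: tens_catC|apply: tens_refl].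
Qed.

HB.instance Definition _ := GRing.Zmodule_isLmodule.Build S (base_change M)
  bc_scaleA bc_scale1 bc_scaleDr bc_scaleDl.
End Scale.

Section Map.
Variables (M N : lmodType R) (f : {linear M -> N}).

Definition bc_map (x : base_change M) : base_change N :=
  tens_map f (idfun : {linear ringmod -> ringmod}) x.

Fact bc_map_linear : linear bc_map.
Proof.
move=> a u v; rewrite -(tens_piK u) -(tens_piK v).
rewrite /bc_map [a *: _]bc_scaleE [_ + _]tens_addE !tens_mapE.
rewrite [a *: _]bc_scaleE [RHS]tens_addE; congr tens_pi.
by rewrite /tens_map_seq map_cat -!map_comp.
Qed.
HB.instance Definition _ := GRing.isLinear.Build S
  (base_change M) (base_change N) _ bc_map bc_map_linear.
End Map.

Lemma bc_map_comp (M N P : lmodType R) (f : {linear M -> N})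
  (g : {linear N -> P}) x : bc_map g (bc_map f x) = bc_map (g \o f) x.
Proof. by rewrite -(tens_piK x) /bc_map !tens_mapE /tens_map_seq -map_comp. Qed.

Lemma bc_map0 (M N : lmodType R) (f : {linear M -> N}) x :
  (forall m, f m = 0) -> bc_map f x = 0.
Proof.
move=> f0; rewrite -(tens_piK x) /bc_map tens_mapE.
apply/tens_piP; elim: (repr x) => [|[m t] s IH] /=; first exact: tens_refl.
rewrite f0 -cat1s -[[::]]cats0; apply: tens_cat => //; exact: tens_0l.
Qed.

Definition pic_injective :=
  forall L L' : lmodType R, pic L -> pic L' ->
    mod_iso (base_change L) (base_change L') -> mod_iso L L'.

End BaseChange.
Arguments bc_map {R S} phi {M N} f x.

(* The differential is given as maps [d i j] between all pairs of degrees that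
   vanish unless [i = j + 1]; no transport along equalities of degrees such as
   [i - 1 + n = i + n - 1] is then needed. *)
Record complex (R : comPzRingType) := Complex {
  obj :> int -> lmodType R;
  diff : forall i j : int, {linear obj i -> obj j};
  diff_shape : forall (i j : int) (x : obj i), i != j + 1 -> diff i j x = 0;
  diff_diff : forall (i j k : int) (x : obj i), diff j k (diff i j x) = 0
}.
Arguments diff {R} c i j.

Record chain_map (R : comPzRingType) (X Y : complex R) := ChainMap {
  cmap :> forall i : int, {linear X i -> Y i};
  cmap_diff : forall (i j : int) (x : X i),
    cmap j (diff X i j x) = diff Y i j (cmap i x)
}.

Section Complexes.
Variable R : comPzRingType.
Implicit Types X Y Z : complex R.

Definition chain_id X : chain_map X X :=
  @ChainMap R X X (fun i => idfun) (fun i j x => erefl).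

Fact chain_comp_subproof X Y Z (g : chain_map Y Z) (f : chain_map X Y) i j x :
  (g j \o f j) (diff X i j x) = diff Z i j ((g i \o f i) x).
Proof. by rewrite /= !cmap_diff. Qed.

Definition chain_comp X Y Z (g : chain_map Y Z) (f : chain_map X Y) :
  chain_map X Z :=
  @ChainMap R X Z (fun i => g i \o f i) (chain_comp_subproof g f).

Definition homotopic X Y (f g : chain_map X Y) :=
  exists h : forall i j : int, {linear X i -> Y j}, forall (i : int) (x : X i),
    f i x - g i x
    = diff Y (i + 1) i (h i (i + 1) x) + h (i - 1) i (diff X i (i - 1) x).

Definition is_cycle X (i : int) (z : X i) := diff X i (i - 1) z = 0.

Definition is_boundary X (i : int) (z : X i) :=
  exists y : X (i + 1), diff X (i + 1) i y = z.

(* [H_i X = 0] *)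
Definition homology_zero X (i : int) := forall z : X i, is_cycle z -> is_boundary z.

Definition acyclic X := forall i, homology_zero X i.

(* [H_i X] is finitely generated. *)
Definition homology_fg X (i : int) :=
  exists (n : nat) (g : 'I_n -> X i), (forall k, is_cycle (g k)) /\
    forall z : X i, is_cycle z -> exists c : 'I_n -> R,
      is_boundary (z - \sum_(k < n) c k *: g k).

Definition degreewise_finite X := forall i, homology_fg X i.

(* The families of cycles with finite support, which represent the elements of
   the total homology [\bigoplus_i H_i X]. *)
Definition total_cycle X (z : forall i, X i) :=
  (exists s : seq int, forall i, i \notin s -> z i = 0) /\
  (forall i, is_cycle (z i)).

Definition homologically_finite X :=
  exists (n : nat) (g : 'I_n -> forall i, X i), (forall k, total_cycle (g k)) /\
    forall z : forall i, X i, total_cycle z -> exists c : 'I_n -> R,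
      forall i, is_boundary (z i - \sum_(k < n) c k *: g k i).

Definition homologically_bounded X :=
  exists s : seq int, forall i, i \notin s -> homology_zero X i.

(* The infimum of the empty set is [+oo]. *)
Definition hinf X : \bar int :=
  infimum +oo%E [set (i%:E)%E | i in [set i : int | ~ homology_zero X i]].

(* [H_i f] is bijective for every [i]. *)
Definition quasi_iso X Y (f : chain_map X Y) := forall i : int,
  (forall x : X i, is_cycle x -> is_boundary (f i x) -> is_boundary x) /\
  (forall y : Y i, is_cycle y -> exists x : X i, is_cycle x /\
     is_boundary (y - f i x)).

End Complexes.

Section Stalk.
Variables (R : comPzRingType) (M : lmodType R).

Definition stalk_obj (i : int) : lmodType R :=
  match i with Posz 0 => M | _ => 'rV[R]_0 end.

Definition stalk : complex R :=
  @Complex R stalk_obj (fun i j => \0) (fun i j x _ => erefl)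
    (fun i j k x => erefl).

Variables (Y : complex R) (g : {linear M -> Y 0}).
Hypothesis g_cycle : forall m, is_cycle (g m).

Definition stalk_map_fun (i : int) : {linear stalk i -> Y i} :=
  match i return {linear stalk_obj i -> Y i} with
  | Posz 0 => g
  | _ => \0
  end.

Fact stalk_map_diff (i j : int) (x : stalk i) :
  stalk_map_fun j (diff stalk i j x) = diff Y i j (stalk_map_fun i x).
Proof.
rewrite /= raddf0; case: i x => [[|i]|i] x /=; rewrite ?raddf0 //.
have [/eqP j1|j1] := boolP (0 == j + 1 :> int); last by rewrite diff_shape.
have -> : j = 0 - 1 by apply: (addIr 1); rewrite subrK -j1.
by rewrite g_cycle.
Qed.

Definition stalk_map : chain_map stalk Y := ChainMap stalk_map_diff.
End Stalk.

(* An element of degree [n] is a family of maps [X i -> Y (i + n)], given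
   here as maps [X i -> Y j] that vanish unless [j = i + n]. *)
Record hom_deg (R : comPzRingType) (X Y : complex R) (n : int) := HomDeg {
  hom_fun :> forall i j : int, X i -> Y j;
  hom_linear : forall i j, linear (@hom_fun i j);
  hom_shape : forall (i j : int) (x : X i), j != i + n -> @hom_fun i j x = 0
}.
Arguments hom_fun {R X Y n} h i j x.

Section HomDeg.
Variables (R : comPzRingType) (X Y : complex R).

Section Module.
Variable n : int.
Local Notation H := (hom_deg X Y n).

HB.instance Definition _ := gen_eqMixin H.
HB.instance Definition _ := gen_choiceMixin H.

Lemma hom_ext (f g : H) : (forall i j x, f i j x = g i j x) -> f = g.
Proof.
case: f g => [f fl fs] [g gl gs] /= fg.
have e : f = g by apply: functional_extensionality_dep => i;
  apply: functional_extensionality_dep => j; apply/funext => x; exact: fg.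
by subst g; congr HomDeg; apply: Prop_irrelevance.
Qed.

Fact hom_zero_lin i j : linear (fun _ : X i => 0 : Y j).
Proof. by move=> a x y; rewrite scaler0 addr0. Qed.
Definition hom_zero : H := HomDeg hom_zero_lin (fun _ _ _ _ => erefl).

Fact hom_opp_lin (f : H) i j : linear (fun x => - f i j x).
Proof. by move=> a x y; rewrite hom_linear opprD scalerN. Qed.
Fact hom_opp_shape (f : H) i j x : j != i + n -> - f i j x = 0.
Proof. by move=> /hom_shape->; rewrite oppr0. Qed.
Definition hom_opp f : H := HomDeg (hom_opp_lin f) (@hom_opp_shape f).

Fact hom_add_lin (f g : H) i j : linear (fun x => f i j x + g i j x).
Proof. by move=> a x y; rewrite !hom_linear scalerDr addrACA. Qed.
Fact hom_add_shape (f g : H) i j x : j != i + n -> f i j x + g i j x = 0.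
Proof. by move=> ne; rewrite !hom_shape // addr0. Qed.
Definition hom_add f g : H := HomDeg (hom_add_lin f g) (@hom_add_shape f g).

Fact hom_scale_lin r (f : H) i j : linear (fun x => r *: f i j x).
Proof. by move=> a x y; rewrite hom_linear scalerDr !scalerA mulrC. Qed.
Fact hom_scale_shape r (f : H) i j x : j != i + n -> r *: f i j x = 0.
Proof. by move=> /hom_shape->; rewrite scaler0. Qed.
Definition hom_scale r f : H := HomDeg (hom_scale_lin r f) (@hom_scale_shape r f).

Fact hom_addA : associative hom_add.
Proof. by move=> f g h; apply: hom_ext => i j x /=; rewrite addrA. Qed.
Fact hom_addC : commutative hom_add.
Proof. by move=> f g; apply: hom_ext => i j x /=; rewrite addrC. Qed.
Fact hom_add0 : left_id hom_zero hom_add.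
Proof. by move=> f; apply: hom_ext => i j x /=; rewrite add0r. Qed.
Fact hom_addN : left_inverse hom_zero hom_opp hom_add.
Proof. by move=> f; apply: hom_ext => i j x /=; rewrite addNr. Qed.
HB.instance Definition _ :=
  GRing.isZmodule.Build H hom_addA hom_addC hom_add0 hom_addN.

Fact hom_scaleA a b v : hom_scale a (hom_scale b v) = hom_scale (a * b) v.
Proof. by apply: hom_ext => i j x /=; rewrite scalerA. Qed.
Fact hom_scale1 : left_id 1 hom_scale.
Proof. by move=> v; apply: hom_ext => i j x /=; rewrite scale1r. Qed.
Fact hom_scaleDr : right_distributive hom_scale +%R.
Proof. by move=> a u v; apply: hom_ext => i j x /=; rewrite scalerDr. Qed.
Fact hom_scaleDl v : {morph hom_scale^~ v : a b / a + b}.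
Proof. by move=> a b; apply: hom_ext => i j x /=; rewrite scalerDl. Qed.
HB.instance Definition _ := GRing.Zmodule_isLmodule.Build R H
  hom_scaleA hom_scale1 hom_scaleDr hom_scaleDl.

Lemma hom0E i j x : (0 : H) i j x = 0. Proof. by []. Qed.
Lemma homDE (f g : H) i j x : (f + g) i j x = f i j x + g i j x.
Proof. by []. Qed.
Lemma homZE r (f : H) i j x : (r *: f) i j x = r *: f i j x.
Proof. by []. Qed.
End Module.

Definition hsign (n : int) : R := (-1) ^+ `|n|%N.

(* [d f = d_Y f - (-1)^n f d_X] for [f] of degree [n] *)
Definition hom_diff_fun (n m : int) (f : hom_deg X Y n) (i j : int) (x : X i) :
  Y j :=
  if n == m + 1 then
    diff Y (j + 1) j (f i (j + 1) x)
    - hsign n *: f (i - 1) j (diff X i (i - 1) x)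
  else 0.

Fact hom_diff_lin (n m : int) (f : hom_deg X Y n) (i j : int) :
  linear (@hom_diff_fun n m f i j).
Proof.
move=> a x y; rewrite /hom_diff_fun; case: ifP => _; last first.
  by rewrite scaler0 addr0.
rewrite linearP !hom_linear linearP scalerBr scalerDr opprD !scalerA.
by rewrite [a * _]mulrC addrACA.
Qed.
Fact hom_diff_shape (n m : int) (f : hom_deg X Y n) (i j : int) (x : X i) :
  j != i + m -> hom_diff_fun m f j x = 0.
Proof.
move=> ne; rewrite /hom_diff_fun; case: (n =P m + 1) => // nm.
rewrite !hom_shape ?raddf0 ?scaler0 ?addr0 ?subr0 //; rewrite nm.
  by rewrite addrCA addrNK addrC.
by rewrite addrA (inj_eq (addIr _)).
Qed.
Definition hom_diff (n m : int) (f : hom_deg X Y n) : hom_deg X Y m :=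
  HomDeg (@hom_diff_lin n m f) (@hom_diff_shape n m f).

Fact hom_diff_linear (n m : int) : linear (@hom_diff n m).
Proof.
move=> a f g; apply: hom_ext => i j x; rewrite homDE homZE /= /hom_diff_fun.
case: ifP => _; last by rewrite scaler0 addr0.
rewrite !(homDE, homZE) linearP scalerBr scalerDr opprD !scalerA.
by rewrite [a * _]mulrC addrACA.
Qed.
HB.instance Definition _ (n m : int) := GRing.isLinear.Build R
  (hom_deg X Y n) (hom_deg X Y m) _ (@hom_diff n m) (@hom_diff_linear n m).

Fact hom_complex_shape (n m : int) (f : hom_deg X Y n) :
  n != m + 1 -> hom_diff m f = 0.
Proof.
by move=> /negPf ne; apply: hom_ext => i j x; rewrite /= /hom_diff_fun ne.
Qed.

Lemma hsignS (n : int) : hsign (n + 1) = - hsign n.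
Proof.
rewrite /hsign -signr_odd -[in RHS]signr_odd.
suff -> : odd (absz (n + 1)) = ~~ odd (absz n).
  by case: odd; rewrite ?opprK.
case: n => [n|[|n]] //; first by rewrite -PoszD addn1.
have -> : Negz n.+1 + 1 = Negz n by rewrite !NegzE -[n.+2]addn1 PoszD opprD subrK.
by rewrite /= !negbK.
Qed.

Lemma hsignD (m n : int) : hsign (m + n) = hsign m * hsign n.
Proof.
elim/int_rect: n => [|n IH|n IH]; first by rewrite addr0 mulr1.
  by rewrite -addn1 PoszD addrA !hsignS IH mulrN.
apply: oppr_inj; rewrite -mulrN -!hsignS -addn1 PoszD opprD addrA !subrK.
exact: IH.
Qed.

Lemma hsign_sq (n : int) : hsign n * hsign n = 1.
Proof. by rewrite /hsign -expr2 sqrr_sign. Qed.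

Fact hom_complex_diff (n m k : int) (f : hom_deg X Y n) : hom_diff k (hom_diff m f) = 0.
Proof.
apply: hom_ext => i j x; rewrite /= {1}/hom_diff_fun.
case: (m =P k + 1) => [mk|//] /=; rewrite /hom_diff_fun.
case: (n =P m + 1) => [nm|_]; last by rewrite linear0 scaler0 subr0.
rewrite !linearB !linearZ /= !diff_diff.
have f0 i' j' : f i' j' 0 = 0.
  by have := @hom_linear _ _ _ _ f i' j' (-1) 0 0; rewrite scaler0 addr0 scaleN1r addNr.
have -> : hsign n = - hsign m by rewrite nm hsignS.
by rewrite f0 !oppr0 !scaler0 addr0 add0r scaleNr addNr.
Qed.

Definition hom_complex : complex R :=
  @Complex R (fun n => hom_deg X Y n) (fun n m => @hom_diff n m)
    hom_complex_shape hom_complex_diff.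
End HomDeg.

Section BaseChangeComplex.
Variables (R S : comPzRingType) (phi : {rmorphism R -> S}).

Section Complex.
Variable X : complex R.

Fact bc_shape (i j : int) (x : base_change phi (X i)) :
  i != j + 1 -> bc_map phi (diff X i j) x = 0.
Proof. by move=> ne; apply: bc_map0 => m; apply: diff_shape. Qed.

Fact bc_diff (i j k : int) (x : base_change phi (X i)) :
  bc_map phi (diff X j k) (bc_map phi (diff X i j) x) = 0.
Proof. by rewrite bc_map_comp; apply: bc_map0 => m; apply: diff_diff. Qed.

Definition bc_complex : complex S :=
  @Complex S (fun i => base_change phi (X i)) (fun i j => bc_map phi (diff X i j))
    bc_shape bc_diff.
End Complex.

Definition finite_flat_dim :=
  exists (F : complex R) (n : nat) (e : chain_map F (stalk (ringmod phi))),
    [/\ forall i, flat (F i),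
        forall i : int, ~~ (0 <= i <= n%:Z) -> forall x : F i, x = 0 &
        quasi_iso e].

End BaseChangeComplex.

Section Derived.
Variable R : comPzRingType.
Implicit Types X Y Z P : complex R.

(* By mapping cones, [Hom(P, -)] preserves acyclicity if and only if it
   preserves quasi-isomorphisms. *)
Definition semiprojective P :=
  (forall i, projective (P i)) /\
  (forall A, acyclic A -> acyclic (hom_complex P A)).

Record complex_over X := ComplexOver {
  over_dom : complex R;
  over_map : chain_map over_dom X
}.

Definition is_resolution X (P : complex_over X) :=
  semiprojective (over_dom P) /\ quasi_iso (over_map P).

(* A chosen semiprojective resolution. Every complex has one (Spaltenstein),
   so the second branch, which only makes the choice total, is never taken. *)
Definition resolution X : complex_over X :=
  match pselect (exists P : complex_over X, is_resolution P) with
  | left e => projT1 (cid e)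
  | right _ => ComplexOver (chain_id X)
  end.

Definition res X : complex R := over_dom (resolution X).
Definition res_map X : chain_map (res X) X := over_map (resolution X).

(* The derived category has the complexes as objects and as morphisms from [X]
   to [Y] the homotopy classes of chain maps between resolutions. *)
Definition dmor X Y := chain_map (res X) (res Y).

Definition dmor_iso X Y (f : dmor X Y) := exists g : dmor Y X,
  homotopic (chain_comp g f) (chain_id (res X)) /\
  homotopic (chain_comp f g) (chain_id (res Y)).

Definition disomorphic X Y := exists f : dmor X Y, dmor_iso f.

(* [u] is the morphism defined by the chain map [f]. *)
Definition dmor_of X Y (f : chain_map X Y) (u : dmor X Y) :=
  homotopic (chain_comp (res_map Y) u) (chain_comp f (res_map X)).

(* [f] becomes an isomorphism in the derived category. *)
Definition diso X Y (f : chain_map X Y) :=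
  exists u : dmor X Y, dmor_of f u /\ dmor_iso u.

Definition RHom X Y : complex R := hom_complex (res X) Y.

Section Homothety.
Variables (X Y : complex R) (f : chain_map X Y).

(* [f] as an element of degree 0 of the complex of homomorphisms. *)
Definition diag_fun (i j : int) (x : X i) : Y j :=
  match i =P j with
  | ReflectT e => ecast k (Y k) e (f i x)
  | ReflectF _ => 0
  end.

Fact diag_linear i j : linear (@diag_fun i j).
Proof.
move=> a x y; rewrite /diag_fun; case: (i =P j) => [e|_].
  by case: j / e; rewrite linearP.
by rewrite scaler0 addr0.
Qed.

Fact diag_shape (i j : int) (x : X i) : j != i + 0 -> diag_fun j x = 0.
Proof.
by rewrite addr0 eq_sym /diag_fun; case: (i =P j).
Qed.

Definition diag : hom_deg X Y 0 := HomDeg diag_linear diag_shape.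

Fact diag_cycle : is_cycle (diag : hom_complex X Y 0).
Proof.
apply: hom_ext => i j x /=; rewrite /hom_diff_fun /= /hsign expr0 scale1r /diag_fun.
case: (i =P j + 1) => [e|ne]; last first.
  rewrite raddf0; case: (i - 1 =P j) => [e|_]; last by rewrite subr0.
  by case: ne; rewrite -e subrK.
have e' : i - 1 = j by rewrite e addrK.
case: (i - 1 =P j) => // {}e'; apply/eqP; rewrite subr_eq0; apply/eqP.
transitivity (diff Y i j (f i x)); first by case: (j + 1) / e.
by rewrite cmap_diff; case: j / e' {e}.
Qed.
End Homothety.

Section HomothetyMap.
Variable C : complex R.

(* [r] is sent to [r] times the class of the identity of [C], which is the
   resolution map [res C -> C] seen in [RHom C C]. *)
Definition homothety_fun (r : R^o) : RHom C C 0 := (r : R) *: diag (res_map C).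

Fact homothety_linear : linear homothety_fun.
Proof. by move=> a x y; rewrite /homothety_fun scalerDl scalerA. Qed.
HB.instance Definition _ :=
  GRing.isLinear.Build R R^o (RHom C C 0) _ homothety_fun homothety_linear.

Fact homothety_cycle r : is_cycle (homothety_fun r).
Proof.
have e : diff (RHom C C) 0 (0 - 1) (diag (res_map C)) = 0 := diag_cycle (res_map C).
apply: etrans (linearZ_LR (diff (RHom C C) 0 (0 - 1)) r (diag (res_map C))) _.
by rewrite e scaler0.
Qed.

Definition homothety : chain_map (stalk R^o) (RHom C C) :=
  stalk_map homothety_cycle.
End HomothetyMap.

Section Biduality.
Variables C X : complex R.
Local Notation D := (RHom X C).

(* [p] of degree [n] is sent to [u |-> (-1)^(n i) u p] for [u] of degree [i]. *)
Definition eval_fun (n : int) (p : res X n) (i j : int) (u : res D i) : C j :=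
  hsign R (n * i) *: (res_map D i u : hom_deg (res X) C i) n j p.

Fact eval_linear n p i j : linear (@eval_fun n p i j).
Proof.
move=> a u v; rewrite /eval_fun linearP homDE homZE scalerDr !scalerA.
by rewrite [a * _]mulrC.
Qed.

Fact eval_shape n p (i j : int) (u : res D i) :
  j != i + n -> @eval_fun n p i j u = 0.
Proof.
by move=> ne; rewrite /eval_fun hom_shape ?scaler0 // [n + i]addrC.
Qed.

Definition eval n (p : res X n) : hom_deg (res D) C n :=
  HomDeg (eval_linear p) (@eval_shape n p).

Definition biduality_fun (n : int) (p : res X n) : RHom D C n := eval p.

Fact biduality_linear n : linear (@biduality_fun n).
Proof.
move=> a p q; apply: hom_ext => i j u; rewrite homDE homZE /= /eval_fun.
by rewrite hom_linear scalerDr !scalerA [a * _]mulrC.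
Qed.
HB.instance Definition _ n := GRing.isLinear.Build R
  (res X n) (RHom D C n) _ (@biduality_fun n) (@biduality_linear n).

Fact biduality_diff (n m : int) (p : res X n) :
  biduality_fun (diff (res X) n m p) = diff (RHom D C) n m (biduality_fun p).
Proof.
apply: hom_ext => i j u; rewrite /= /hom_diff_fun /= /eval_fun.
case: (n =P m + 1) => [nm|/eqP ne]; last first.
  rewrite diff_shape //.
  set f := (res_map D i u : hom_deg _ _ _).
  have := @hom_linear _ _ _ _ f m j (-1) 0 0; rewrite scaler0 addr0 scaleN1r addNr.
  by move=> ->; rewrite scaler0.
have {nm} e : n - 1 = m by rewrite nm addrK.
case: m / e; rewrite cmap_diff /= /hom_diff_fun subrK eqxx linearZ_LR.
rewrite scalerA -hsignD scalerBr scalerA -hsignD.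
have -> : n + n * (i - 1) = n * i by rewrite mulrBr mulr1 addrCA subrr addr0.
rewrite subKr; congr (_ *: _).
have -> : n * i = (n - 1) * i + i by rewrite mulrBl mul1r subrK.
by rewrite !hsignD -mulrA hsign_sq mulr1.
Qed.

(* The biduality morphism, with its source [X] replaced by the isomorphic
   object [res X]. *)
Definition biduality : chain_map (res X) (RHom D C) :=
  @ChainMap R (res X) (RHom D C) (fun n => @biduality_fun n) biduality_diff.
End Biduality.

Definition semidualizing C := homologically_finite C /\ diso (homothety C).

Definition C_reflexive C X :=
  [/\ homologically_finite X, homologically_bounded (RHom X C) &
      diso (biduality C X)].

Definition Gdim C X : \bar int :=
  if `[< C_reflexive C X >] then (hinf C - hinf (RHom X C))%E else +oo%E.

End Derived.

Definition Ltensor (R S : comPzRingType) (phi : {rmorphism R -> S})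
  (X : complex R) : complex S := bc_complex phi (res X).

(* Main.v *)
(* Only a weak form of faithful flatness is available: every maximal ideal of
   [R] is contracted from [S]. It suffices because, for a semiprojective [W]
   with finitely generated homology, [H_i (W (x) S) = 0] for all [i < a] forces
   [H_i W = 0] for all [i < a]: a contraction of [W -> W (x) S] in these degrees
   is pushed to [W / m W] by a functional [S -> R / m], lifted to [W], and
   gives vanishing on [W // (generators of m)], whence Nakayama applies.
   Tensor evaluation [RHom (L, B) (x) S = RHom_S (L (x) S, B (x) S)] holds by
   induction on the flat dimension, so this descends the homothety and
   biduality morphisms.
   For descent of the semidualizing property the homology of [C] has to be
   shown bounded above. Otherwise let [p = (xs)] be maximal such that
   [C // xs] is unbounded. Then [p] is prime and not maximal, some [H_l C] is
   not killed by any element outside [p], and comparing [R // (xs, y)] with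
   [RHom (C, C // (xs, y))] bounds [C // (xs, y)] uniformly in [y] outside [p].
   Hence every such [y] acts bijectively on high homology of [C // xs], which
   contradicts Nakayama.
   For (c), an isomorphism over [S] and its inverse are combinations of base
   changes of morphisms [a_i : C -> C'] and [a'_j : C' -> C]; the scalars
   [a_i a'_j] and [a'_j a_i] define an invertible [R]-module that becomes free
   over [S], and a generator of it is an isomorphism [C -> C']. *)
Require Import Defs.
From HB Require Import structures.
From mathcomp Require Import all_boot all_order all_algebra.
From mathcomp Require Import mathcomp_extra boolp classical_sets constructive_ereal.
From mathcomp Require Import zify ring.
Set Implicit Arguments.
Unset Strict Implicit.
Unset Printing Implicit Defensive.
Import Order.TTheory GRing.Theory Num.Theory.
Local Open Scope ring_scope.

(** A map that is null-homotopic modulo [m] vanishes on homology only with coefficients killed by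
    [m]. Koszul complexes on generators of [m] repair this: each generator [x] acts on them by a
    null-homotopic map, and the sequences [0 -> ker x -> N -> x N -> 0] and
    [0 -> x N -> N -> N / x N -> 0] remove one generator at the price of composing two such maps. A
    composite of [2^n] of them, for [n] generators, therefore vanishes with coefficients [R]; where
    it is also an isomorphism on homology, the homology is zero. This serves twice: with a constant
    system of identities for vanishing in low degrees, and with a tower of partial resolutions,
    whose maps are isomorphisms in high degrees only, for the upper bound on [L // xs]. Tensor
    evaluation requires a target that is bounded above, so the homothety of [L] cannot be descended
    before [L] is known to be bounded. The circle is broken by Koszul quotients: once [L // zs] is
    bounded above, the homothety over [S] descends to an isomorphism [R // zs -> RHom (L, L // zs)],
    even if no bound on [L] itself is known. *)

Section ZmodReflection.
(** Reified expressions in an abelian group. Equal integer coefficients at every atom imply equal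
    values, and this is decided by computation; the tactic [zmod] rests on it. *)
Inductive zexp := ZV of nat | ZA of zexp & zexp | ZN of zexp | Z0.
Variable V : zmodType.
Fixpoint zexp_eval (env : seq V) e := match e with
  | ZV n => nth 0 env n | ZA a b => zexp_eval env a + zexp_eval env b
  | ZN a => - zexp_eval env a | Z0 => 0 end.
Fixpoint zexp_coef e (n : nat) : int := match e with
  | ZV m => (m == n)%:Z | ZA a b => zexp_coef a n + zexp_coef b n
  | ZN a => - zexp_coef a n | Z0 => 0 end.
Fixpoint zexp_wf k e := match e with
  | ZV m => (m < k)%N | ZA a b => zexp_wf k a && zexp_wf k b
  | ZN a => zexp_wf k a | Z0 => true end.
Lemma zexp_evalE env e : zexp_wf (size env) e ->
  zexp_eval env e = \sum_(i < size env) nth 0 env i *~ zexp_coef e i.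
Proof.
elim: e => [n|a IHa b IHb|a IH|] /=.
- move=> h; rewrite (bigD1 (Ordinal h)) //= eqxx mulr1z big1 ?addr0 // => i ne.
  case: eqP => [e|_]; last by rewrite mulr0z.
  by case/eqP: ne; apply: val_inj; rewrite /= e.
- case/andP => /IHa -> /IHb ->; rewrite -big_split; apply: eq_bigr => i _.
  by rewrite /= mulrzDr.
- by move=> /IH ->; rewrite -sumrN; apply: eq_bigr => i _; rewrite mulrNz.
- by move=> _; rewrite big1 // => i _; rewrite mulr0z.
Qed.
Lemma zexp_eq env a b :
  [&& zexp_wf (size env) a, zexp_wf (size env) b &
      all (fun i => zexp_coef a i == zexp_coef b i) (iota 0 (size env))] ->
  zexp_eval env a = zexp_eval env b.
Proof.
case/and3P => ha hb /allP h; rewrite !zexp_evalE //; apply: eq_bigr => i _.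
by rewrite (eqP (h i _)) // mem_iota /= add0n.
Qed.
End ZmodReflection.

(** Atoms are compared syntactically first and then by unification, so that convertible forms of one
    element count as a single atom. *)
Ltac zmod_same x y := match goal with
  | _ => let _ := match goal with _ => constr_eq x y end in constr:(true)
  | _ => let _ := match goal with _ => unify x y end in constr:(true)
  | _ => constr:(false) end.
Ltac zmod_mem x l := match l with
  | nil => constr:(false)
  | cons ?y ?l' => let b := zmod_same x y in
    match b with true => constr:(true) | false => zmod_mem x l' end end.
Ltac zmod_idx x l := match l with
  | cons ?y ?l' => let b := zmod_same x y in
    match b with true => constr:(O) | false => let n := zmod_idx x l' in constr:(S n) end end.
Ltac zmod_env V t env := match t with
  | ?a + ?b => let e := zmod_env V a env in zmod_env V b e
  | - ?a => zmod_env V a env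
  | 0 => env
  | _ => let b := zmod_mem t env in
    match b with true => env | false => constr:(@cons V t env) end end.
Ltac zmod_reify t env := match t with
  | ?a + ?b => let x := zmod_reify a env in let y := zmod_reify b env in constr:(ZA x y)
  | - ?a => let x := zmod_reify a env in constr:(ZN x)
  | 0 => constr:(Z0)
  | _ => let n := zmod_idx t env in constr:(ZV n) end.
Ltac zmod := match goal with |- @eq ?V ?a ?b =>
  let env := zmod_env V a (@nil V) in let env := zmod_env V b env in
  let x := zmod_reify a env in let y := zmod_reify b env in
  apply: (@zexp_eq _ env x y); vm_compute; reflexivity end.

(** * Linear maps, submodules, quotients and free modules *)

Section LinearMaps.
Variable R : comPzRingType.

Definition lin_of (M N : lmodType R) (f : M -> N) (h : linear f) : {linear M -> N} :=
  HB.pack f (GRing.isLinear.Build R M N _ f h).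

Lemma linear_scale (M : lmodType R) (r : R) : linear (fun x : M => r *: x).
Proof. by move=> a x y; rewrite scalerDr !scalerA mulrC. Qed.
Definition scale_lin (M : lmodType R) (r : R) : {linear M -> M} := lin_of (linear_scale (M := M) r).

Lemma linear_fst (M N : lmodType R) : linear (fun x : (M * N)%type => x.1). Proof. by []. Qed.
Lemma linear_snd (M N : lmodType R) : linear (fun x : (M * N)%type => x.2). Proof. by []. Qed.
Lemma linear_inl (M N : lmodType R) : linear (fun x : M => (x, 0) : (M * N)%type).
Proof. by move=> a x y; congr pair; rewrite /= scaler0 addr0. Qed.
Lemma linear_inr (M N : lmodType R) : linear (fun x : N => (0, x) : (M * N)%type).
Proof. by move=> a x y; congr pair; rewrite /= scaler0 addr0. Qed.
Definition fst_lin M N := lin_of (@linear_fst M N).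
Definition snd_lin M N := lin_of (@linear_snd M N).
Definition inl_lin M N := lin_of (@linear_inl M N).
Definition inr_lin M N := lin_of (@linear_inr M N).

Lemma pairE (M N : lmodType R) (x : (M * N)%type) : x = inl_lin M N x.1 + inr_lin M N x.2.
Proof. by case: x => a b; congr pair; rewrite /= ?addr0 ?add0r. Qed.

End LinearMaps.

Section Submodules.
Variable R : comPzRingType.

Record submod (M : lmodType R) := Submod {
  in_submod :> M -> Prop;
  submod0 : in_submod 0;
  submodD : forall x y, in_submod x -> in_submod y -> in_submod (x + y);
  submodZ : forall a x, in_submod x -> in_submod (a *: x) }.

Variables (M : lmodType R) (P : submod M).

Lemma submodN x : P x -> P (- x).
Proof. by rewrite -scaleN1r; apply: submodZ. Qed.
Lemma submodB x y : P x -> P y -> P (x - y).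
Proof. by move=> px py; apply/submodD/submodN. Qed.
Lemma submod_sum (I : Type) (r : seq I) (Q : pred I) (F : I -> M) :
  (forall i, Q i -> P (F i)) -> P (\sum_(i <- r | Q i) F i).
Proof. by move=> h; apply: big_ind => //; [apply: submod0|apply: submodD]. Qed.

Record sub_of : Type := SubOf { sub_val : M; sub_valP : P sub_val }.
HB.instance Definition _ := gen_eqMixin sub_of.
HB.instance Definition _ := gen_choiceMixin sub_of.

Lemma sub_val_inj : injective sub_val.
Proof. by case=> x px [y py] /= e; subst y; congr SubOf; apply: Prop_irrelevance. Qed.

Definition sub_zero := SubOf (submod0 P).
Definition sub_opp x := SubOf (submodN (sub_valP x)).
Definition sub_add x y := SubOf (submodD (sub_valP x) (sub_valP y)).
Definition sub_scale a x := SubOf (submodZ a (sub_valP x)).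
Fact sub_addA : associative sub_add.
Proof. by move=> x y z; apply: sub_val_inj; apply: addrA. Qed.
Fact sub_addC : commutative sub_add.
Proof. by move=> x y; apply: sub_val_inj; apply: addrC. Qed.
Fact sub_add0 : left_id sub_zero sub_add.
Proof. by move=> x; apply: sub_val_inj; apply: add0r. Qed.
Fact sub_addN : left_inverse sub_zero sub_opp sub_add.
Proof. by move=> x; apply: sub_val_inj; apply: addNr. Qed.
HB.instance Definition _ := GRing.isZmodule.Build sub_of sub_addA sub_addC sub_add0 sub_addN.
Fact sub_scaleA a b v : sub_scale a (sub_scale b v) = sub_scale (a * b) v.
Proof. by apply: sub_val_inj; apply: scalerA. Qed.
Fact sub_scale1 : left_id 1 sub_scale.
Proof. by move=> x; apply: sub_val_inj; apply: scale1r. Qed.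
Fact sub_scaleDr : right_distributive sub_scale +%R.
Proof. by move=> a x y; apply: sub_val_inj; apply: scalerDr. Qed.
Fact sub_scaleDl v : {morph sub_scale^~ v : a b / a + b}.
Proof. by move=> a b; apply: sub_val_inj; apply: scalerDl. Qed.
HB.instance Definition _ := GRing.Zmodule_isLmodule.Build R sub_of
  sub_scaleA sub_scale1 sub_scaleDr sub_scaleDl.

Fact sub_incl_linear : linear (fun x : sub_of => sub_val x).
Proof. by []. Qed.
Definition sub_incl : {linear sub_of -> M} := lin_of sub_incl_linear.

Lemma sub_incl_inj : injective sub_incl. Proof. exact: sub_val_inj. Qed.

Section Lift.
Variables (N : lmodType R) (f : {linear N -> M}) (h : forall x, P (f x)).
Fact sub_lift_linear : linear (fun x => SubOf (h x)).
Proof. by move=> a x y; apply: sub_val_inj; rewrite /= linearP. Qed.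
Definition sub_lift : {linear N -> sub_of} := lin_of sub_lift_linear.
End Lift.

Definition quo_rep (x : M) : M := xget x (fun y => P (y - x)).
Lemma quo_repP x : P (quo_rep x - x).
Proof. by apply: (@xgetPex _ x (fun y => P (y - x))); exists x; rewrite /= subrr; apply: submod0. Qed.
Lemma quo_rep_eq x y : P (x - y) -> quo_rep x = quo_rep y.
Proof.
move=> pxy; rewrite /quo_rep; have e : (fun z => P (z - x)) = (fun z => P (z - y)).
  apply/funext => z; apply/propext; split => /= h.
    by rewrite (_ : z - y = (z - x) + (x - y)); [apply: submodD | rewrite addrA subrK].
  rewrite (_ : z - x = (z - y) - (x - y)); first exact: submodB.
  by rewrite opprB addrA subrK.
(* The two choices have different defaults [x] and [y], so it remains to see that neither default is
   used. *)
rewrite -e; set A := (fun _ => _).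
have ha : A x by rewrite /A /= subrr; apply: submod0.
by rewrite /xget; case: pselect => [//|ne]; case: ne; exists x; apply/asboolP.
Qed.

(** The quotient module is encoded by the fixed points of [quo_rep], one in each coset. *)
Record quo : Type := Quo { quo_val : M; quo_valP : quo_rep quo_val = quo_val }.
HB.instance Definition _ := gen_eqMixin quo.
HB.instance Definition _ := gen_choiceMixin quo.

Lemma quo_piP x : quo_rep (quo_rep x) = quo_rep x.
Proof. by apply: quo_rep_eq; apply: quo_repP. Qed.
Definition quo_pi0 (x : M) : quo := Quo (quo_piP x).

Lemma quo_val_inj : injective quo_val.
Proof. by case=> x px [y py] /= e; subst y; congr Quo; apply: Prop_irrelevance. Qed.
Lemma quo_pi0P x y : quo_pi0 x = quo_pi0 y <-> P (x - y).
Proof.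
split=> [[e]|/quo_rep_eq e]; last exact: quo_val_inj.
rewrite (_ : x - y = (quo_rep y - y) - (quo_rep x - x)).
  by apply: submodB; apply: quo_repP.
by rewrite e opprB [RHS]addrC addrA subrK.
Qed.
Lemma quo_valK x : quo_pi0 (quo_val x) = x.
Proof. by apply: quo_val_inj; apply: quo_valP. Qed.

Definition quo_zero := quo_pi0 0.
Definition quo_opp x := quo_pi0 (- quo_val x).
Definition quo_add x y := quo_pi0 (quo_val x + quo_val y).
Definition quo_scale a x := quo_pi0 (a *: quo_val x).
Lemma quo_addE x y : quo_add (quo_pi0 x) (quo_pi0 y) = quo_pi0 (x + y).
Proof.
apply/quo_pi0P; rewrite opprD addrACA; apply: submodD; exact: quo_repP.
Qed.
Lemma quo_scaleE a x : quo_scale a (quo_pi0 x) = quo_pi0 (a *: x).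
Proof. by apply/quo_pi0P; rewrite -scalerBr; apply/submodZ/quo_repP. Qed.
Lemma quo_oppE x : quo_opp (quo_pi0 x) = quo_pi0 (- x).
Proof. by apply/quo_pi0P; rewrite -opprD; apply/submodN/quo_repP. Qed.
Fact quo_addA : associative quo_add.
Proof.
by move=> x y z; rewrite -(quo_valK x) -(quo_valK y) -(quo_valK z) !quo_addE addrA.
Qed.
Fact quo_addC : commutative quo_add.
Proof. by move=> x y; rewrite /quo_add addrC. Qed.
Fact quo_add0 : left_id quo_zero quo_add.
Proof. by move=> x; rewrite -(quo_valK x) quo_addE add0r. Qed.
Fact quo_addN : left_inverse quo_zero quo_opp quo_add.
Proof. by move=> x; rewrite -(quo_valK x) quo_oppE quo_addE addNr. Qed.
HB.instance Definition _ := GRing.isZmodule.Build quo quo_addA quo_addC quo_add0 quo_addN.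
Fact quo_scaleA a b v : quo_scale a (quo_scale b v) = quo_scale (a * b) v.
Proof. by rewrite -(quo_valK v) !quo_scaleE scalerA. Qed.
Fact quo_scale1 : left_id 1 quo_scale.
Proof. by move=> v; rewrite -(quo_valK v) !quo_scaleE scale1r. Qed.
Fact quo_scaleDr : right_distributive quo_scale +%R.
Proof.
move=> a x y; rewrite -(quo_valK x) -(quo_valK y) [_ + _]quo_addE !quo_scaleE.
by rewrite [RHS]quo_addE scalerDr.
Qed.
Fact quo_scaleDl v : {morph quo_scale^~ v : a b / a + b}.
Proof. by move=> a b; rewrite -(quo_valK v) !quo_scaleE [RHS]quo_addE scalerDl. Qed.
HB.instance Definition _ := GRing.Zmodule_isLmodule.Build R quo
  quo_scaleA quo_scale1 quo_scaleDr quo_scaleDl.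

Fact quo_pi_linear : linear quo_pi0.
Proof. by move=> a x y; rewrite [a *: quo_pi0 x]quo_scaleE [RHS]quo_addE. Qed.
Definition quo_pi : {linear M -> quo} := lin_of quo_pi_linear.
Lemma quo_piE x : quo_pi x = 0 <-> P x.
Proof. by rewrite -{2}[x]subr0; apply: quo_pi0P. Qed.
Lemma quo_pi_surj y : exists x, quo_pi x = y.
Proof. by exists (quo_val y); apply: quo_valK. Qed.

Section Map.
Variables (N : lmodType R) (f : {linear M -> N}) (h : forall x, P x -> f x = 0).
Fact quo_lift_linear : linear (fun x : quo => f (quo_val x)).
Proof.
have E y : f (quo_val (quo_pi y)) = f y.
  by apply/eqP; rewrite -subr_eq0 -(linearB f); apply/eqP/h; apply: quo_repP.
move=> a x y; rewrite -{1}(quo_valK x) -{1}(quo_valK y).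
by rewrite -[X in quo_val X](linearP quo_pi) E linearP.
Qed.
Definition quo_lift : {linear quo -> N} := lin_of quo_lift_linear.
Lemma quo_liftK x : quo_lift (quo_pi x) = f x.
Proof. by apply/eqP; rewrite -subr_eq0 -(linearB f); apply/eqP/h; apply: quo_repP. Qed.
End Map.
End Submodules.

Section SubmodOps.
Variable R : comPzRingType.
Definition ker_sub (M N : lmodType R) (f : {linear M -> N}) : submod M.
Proof.
exists (fun x => f x = 0) => [|x y|a x]; first exact: linear0.
  by rewrite linearD => -> ->; rewrite addr0.
by rewrite linearZ_LR => ->; rewrite scaler0.
Defined.
Definition im_sub (M N : lmodType R) (f : {linear M -> N}) : submod N.
Proof.
exists (fun x => exists y, f y = x).
- by exists 0; rewrite linear0.
- by move=> _ _ [a <-] [b <-]; exists (a + b); rewrite linearD.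
- by move=> a _ [b <-]; exists (a *: b); rewrite linearZ_LR.
Defined.
End SubmodOps.

Section FreeModules.
Variables (R : comPzRingType) (T : choiceType) (V : T -> Prop).

(** The free module on the elements of [T] that satisfy [V]. Cutting out the basis by a predicate
    keeps a single index type [rgen] for all degrees of the semifree resolution below. *)
Record fsm := Fsm {
  fs_fun :> T -> R;
  fs_suppP : exists s : seq T, forall t, fs_fun t != 0 -> t \in s /\ V t }.
HB.instance Definition _ := gen_eqMixin fsm.
HB.instance Definition _ := gen_choiceMixin fsm.

Lemma fsm_ext (a b : fsm) : (forall t, a t = b t) -> a = b.
Proof.
case: a b => [a ha] [b hb] /= e; have {e} e : a = b by apply/funext.
by subst b; congr Fsm; apply: Prop_irrelevance.
Qed.

Fact fsm_zeroP : exists s : seq T, forall t, (0 : R) != 0 -> t \in s /\ V t.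
Proof. by exists [::] => t; rewrite eqxx. Qed.
Definition fsm_zero := Fsm fsm_zeroP.
Fact fsm_oppP (a : fsm) : exists s : seq T, forall t, - a t != 0 -> t \in s /\ V t.
Proof. by case: (fs_suppP a) => s h; exists s => t; rewrite oppr_eq0; apply: h. Qed.
Definition fsm_opp a := Fsm (fsm_oppP a).
Fact fsm_addP (a b : fsm) : exists s : seq T, forall t, a t + b t != 0 -> t \in s /\ V t.
Proof.
case: (fs_suppP a) (fs_suppP b) => [s h] [s' h']; exists (s ++ s') => t ne.
rewrite mem_cat; have [a0|/h [-> ?]] := eqVneq (a t) 0; last by [].
have [b0|/h' [-> ?]] := eqVneq (b t) 0; last by rewrite orbT.
by move: ne; rewrite a0 b0 addr0 eqxx.
Qed.
Definition fsm_add a b := Fsm (fsm_addP a b).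
Fact fsm_scaleP r (a : fsm) : exists s : seq T, forall t, r * a t != 0 -> t \in s /\ V t.
Proof.
case: (fs_suppP a) => s h; exists s => t ne; apply: h.
by apply: contraNneq ne => ->; rewrite mulr0.
Qed.
Definition fsm_scale r a := Fsm (fsm_scaleP r a).
Fact fsm_addA : associative fsm_add.
Proof. by move=> x y z; apply: fsm_ext => t; apply: addrA. Qed.
Fact fsm_addC : commutative fsm_add.
Proof. by move=> x y; apply: fsm_ext => t; apply: addrC. Qed.
Fact fsm_add0 : left_id fsm_zero fsm_add.
Proof. by move=> x; apply: fsm_ext => t; apply: add0r. Qed.
Fact fsm_addN : left_inverse fsm_zero fsm_opp fsm_add.
Proof. by move=> x; apply: fsm_ext => t; apply: addNr. Qed.
HB.instance Definition _ := GRing.isZmodule.Build fsm fsm_addA fsm_addC fsm_add0 fsm_addN.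
Fact fsm_scaleA a b v : fsm_scale a (fsm_scale b v) = fsm_scale (a * b) v.
Proof. by apply: fsm_ext => t; apply: mulrA. Qed.
Fact fsm_scale1 : left_id 1 fsm_scale.
Proof. by move=> v; apply: fsm_ext => t; apply: mul1r. Qed.
Fact fsm_scaleDr : right_distributive fsm_scale +%R.
Proof. by move=> a u v; apply: fsm_ext => t; apply: mulrDr. Qed.
Fact fsm_scaleDl v : {morph fsm_scale^~ v : a b / a + b}.
Proof. by move=> a b; apply: fsm_ext => t; apply: mulrDl. Qed.
HB.instance Definition _ := GRing.Zmodule_isLmodule.Build R fsm
  fsm_scaleA fsm_scale1 fsm_scaleDr fsm_scaleDl.

(** Some list without repetition that contains the support. It may be larger than the support, hence
    the freedom of the list in [fs_extE]. *)
Definition fs_supp (c : fsm) : seq T := undup (projT1 (cid (fs_suppP c))).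
Lemma fs_supp_uniq (c : fsm) : uniq (fs_supp c). Proof. exact: undup_uniq. Qed.
Lemma mem_fs_supp (c : fsm) t : c t != 0 -> t \in fs_supp c.
Proof. by rewrite mem_undup => h; have [] := projT2 (cid (fs_suppP c)) t h. Qed.
Lemma fs_valid (c : fsm) t : c t != 0 -> V t.
Proof. by move=> h; have [] := projT2 (cid (fs_suppP c)) t h. Qed.

Section Ext.
Variables (M : lmodType R) (v : T -> M).
Definition fs_ext_fun (c : fsm) : M := \sum_(t <- fs_supp c) c t *: v t.

Lemma fs_extE (c : fsm) s : uniq s -> (forall t, c t != 0 -> t \in s) ->
  fs_ext_fun c = \sum_(t <- s) c t *: v t.
Proof.
move=> us hs.
have key (s1 : seq T) : uniq s1 -> (forall t, c t != 0 -> t \in s1) ->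
    \sum_(t <- s1) c t *: v t = \sum_(t <- [seq t <- s1 | c t != 0]) c t *: v t.
  move=> _ _; rewrite big_filter (bigID (fun t => c t != 0)) /= addrC big1 ?add0r //.
  by move=> t /negPn /eqP ->; rewrite scale0r.
rewrite /fs_ext_fun key ?fs_supp_uniq //; last exact: mem_fs_supp.
rewrite [RHS]key //; apply: perm_big; apply: uniq_perm.
- by rewrite filter_uniq ?fs_supp_uniq.
- by rewrite filter_uniq.
move=> t; rewrite !mem_filter; case: (boolP (c t != 0)) => //= h.
by rewrite hs // mem_fs_supp.
Qed.

Fact fs_ext_linear : linear fs_ext_fun.
Proof.
move=> a x y; set s := undup (fs_supp x ++ fs_supp y).
have us : uniq s by apply: undup_uniq.
have hx t : x t != 0 -> t \in s by move=> h; rewrite mem_undup mem_cat (mem_fs_supp h).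
have hy t : y t != 0 -> t \in s by move=> h; rewrite mem_undup mem_cat (mem_fs_supp h) orbT.
rewrite !(@fs_extE _ s) //.
  rewrite scaler_sumr -big_split; apply: eq_bigr => t _ /=.
  by rewrite scalerA -scalerDl.
move=> t; have [x0|/hx //] := eqVneq (x t) 0.
have [y0|/hy //] := eqVneq (y t) 0.
by change (a * x t + y t != 0 -> t \in s); rewrite x0 y0 mulr0 addr0 eqxx.
Qed.
Definition fs_ext : {linear fsm -> M} := lin_of fs_ext_linear.
End Ext.

Fact fs_deltaP t : V t -> exists s : seq T,
  forall t', ((t' == t)%:R : R) != 0 -> t' \in s /\ V t'.
Proof.
move=> vt; exists [:: t] => t'; case: (t' =P t) => [->|_]; rewrite ?eqxx //.
by rewrite mem_seq1 eqxx.
Qed.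
Definition fs_delta t (vt : V t) : fsm := Fsm (fs_deltaP vt).

Lemma fs_ext_delta (M : lmodType R) (v : T -> M) t (vt : V t) :
  fs_ext v (fs_delta vt) = v t.
Proof.
rewrite [LHS](@fs_extE _ _ _ [:: t]) //=; first by rewrite big_seq1 eqxx scale1r.
by move=> t' /=; rewrite mem_seq1; case: (t' =P t) => //; rewrite eqxx.
Qed.

Lemma fs_sumE (c : fsm) (s : seq T) (F : T -> fsm) t :
  (\sum_(i <- s) F i : fsm) t = \sum_(i <- s) F i t.
Proof. by elim: s => [|i s IH]; rewrite ?big_nil // !big_cons -IH. Qed.

Lemma fsm_ind (Q : submod fsm) : (forall t (vt : V t), Q (fs_delta vt)) -> forall c, Q c.
Proof.
move=> h c.
pose F t : fsm := if pselect (V t) is left vt then c t *: fs_delta vt else 0.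
have -> : c = \sum_(t <- fs_supp c) F t.
  apply: fsm_ext => t; rewrite fs_sumE //.
  have E i : F i t = c i * (t == i)%:R.
    rewrite /F; case: pselect => [vi|nv] //=.
    case: (t == i); last by rewrite mulr0.
    rewrite mulr1; apply/esym/eqP; apply: contraT => ne; by case: nv; apply: fs_valid ne.
  under eq_bigr do rewrite E.
  have [c0|ne] := eqVneq (c t) 0.
    rewrite c0 big1_seq // => i _; case: eqP => [<-|]; rewrite ?mulr0 //.
    by rewrite c0 mul0r.
  rewrite (bigD1_seq t) ?fs_supp_uniq ?mem_fs_supp //= eqxx mulr1 big1 ?addr0 //.
  by move=> i; rewrite eq_sym => /negPf ->; rewrite mulr0.
apply: submod_sum => t _; rewrite /F; case: pselect => [vt|_]; last exact: submod0.
exact/submodZ/h.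
Qed.

Lemma fsm_eq_lin (M : lmodType R) (f g : {linear fsm -> M}) :
  (forall t (vt : V t), f (fs_delta vt) = g (fs_delta vt)) -> forall c, f c = g c.
Proof.
move=> h c; have L : linear (fun x => f x - g x).
  by move=> a x y; rewrite (linearP f) (linearP g) scalerBr; zmod.
have := @fsm_ind (ker_sub (lin_of L)) _ c; rewrite /= => H.
by apply/eqP; rewrite -subr_eq0; apply/eqP/H => t vt; rewrite h subrr.
Qed.

Lemma fsm_projective : projective fsm.
Proof.
move=> M N g f sg.
have ch t : exists x, forall vt : V t, g x = f (fs_delta vt).
  case: (pselect (V t)) => [vt|nv]; last by exists 0.
  have [x ex] := sg (f (fs_delta vt)); exists x => vt'.
  by rewrite ex (Prop_irrelevance vt vt').
pose v t := projT1 (cid (ch t)).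
exists (fs_ext v).
have L : linear (fun c => g (fs_ext v c)) by move=> a x y; rewrite !linearP.
apply: (@fsm_eq_lin _ (lin_of L) f) => t vt /=.
by rewrite -[fs_ext_fun _ _]/(fs_ext v (fs_delta vt)) fs_ext_delta; apply: (projT2 (cid (ch t))).
Qed.
End FreeModules.

(** * Projective modules *)

Section Projectives.
Variable R : comPzRingType.

(** All elements of [P] serve as generators; the coordinates of [s x] form an infinite dual
    basis. *)
Lemma projective_split (P : lmodType R) : projective P ->
  exists s : {linear P -> fsm R (fun _ : P => True)},
    forall x, fs_ext (fun _ => True) (fun x : P => x) (s x) = x.
Proof.
move=> pP; apply: (pP _ _ (fs_ext (fun _ => True) _) idfun) => y.
by exists (fs_delta R (V := fun _ => True) (t := y) I); rewrite fs_ext_delta.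
Qed.

Lemma retract_projective (P Q : lmodType R) (i : {linear P -> Q}) (p : {linear Q -> P}) :
  (forall x, p (i x) = x) -> projective Q -> projective P.
Proof.
move=> pi pQ M N g f sg.
have L : linear (fun x => f (p x)) by move=> a x y; rewrite !linearP.
have [h hh] := pQ M N g (lin_of L) sg.
have L' : linear (fun x => h (i x)) by move=> a x y; rewrite !linearP.
by exists (lin_of L') => x; rewrite /= hh /= pi.
Qed.

Lemma prod_projective (P Q : lmodType R) : projective P -> projective Q ->
  projective (P * Q)%type.
Proof.
move=> pP pQ M N g f sg.
have L1 : linear (fun x => f (inl_lin P Q x)) by move=> a x y; rewrite !linearP.
have L2 : linear (fun x => f (inr_lin P Q x)) by move=> a x y; rewrite !linearP.
have [h1 e1] := pP M N g (lin_of L1) sg; have [h2 e2] := pQ M N g (lin_of L2) sg.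
have L : linear (fun x : (P * Q)%type => h1 x.1 + h2 x.2).
  by move=> a x y; rewrite /= !linearP scalerDr; zmod.
exists (lin_of L) => x; rewrite [in RHS](pairE x) (linearD f) -[lin_of L x]/(h1 x.1 + h2 x.2).
by rewrite (linearD g) e1 e2.
Qed.

Lemma row_projective n : projective 'rV[R]_n.
Proof.
move=> M N g f sg.
have [v hv] := choice (fun t : 'I_n => sg (f (delta_mx 0 t))).
have L : linear (fun x : 'rV[R]_n => \sum_t x 0 t *: v t).
  move=> a x y; rewrite scaler_sumr -big_split; apply: eq_bigr => t _ /=.
  by rewrite !mxE scalerDl scalerA.
exists (lin_of L) => x; rewrite /= linear_sum {2}[x]row_sum_delta linear_sum.
by apply: eq_bigr => t _; rewrite !linearZ_LR hv.
Qed.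

Fact row_lin_linear (M : lmodType R) n (v : 'I_n -> M) :
  linear (fun x : 'rV[R]_n => \sum_t x 0 t *: v t).
Proof.
move=> a x y; rewrite scaler_sumr -big_split; apply: eq_bigr => t _ /=.
by rewrite !mxE scalerDl scalerA.
Qed.
Definition row_lin (M : lmodType R) n (v : 'I_n -> M) : {linear 'rV[R]_n -> M} :=
  lin_of (row_lin_linear v).
Lemma row_linE (M : lmodType R) n (v : 'I_n -> M) x : row_lin v x = \sum_t x 0 t *: v t.
Proof. by []. Qed.
End Projectives.

(** * Noetherian rings, finite generation and Nakayama's lemma *)

Section Noetherian.
Variables (R : comPzRingType).
Implicit Types M : lmodType R.

(** Peeling off one generator at a time makes proofs about spans inductions on the list, without
    families of coefficients. *)
Fixpoint spanned M (s : seq M) (x : M) : Prop :=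
  match s with [::] => x = 0 | g :: s' => exists r, spanned s' (x - r *: g) end.

Lemma spanned0 M (s : seq M) : spanned s 0.
Proof. by elim: s => //= g s IH; exists 0; rewrite scale0r subr0. Qed.
Lemma spannedD M (s : seq M) x y : spanned s x -> spanned s y -> spanned s (x + y).
Proof.
elim: s x y => /= [x y -> ->|g s IH x y [r hx] [r' hy]]; first by rewrite addr0.
exists (r + r'); rewrite (_ : _ - _ = (x - r *: g) + (y - r' *: g)); first exact: IH.
by rewrite scalerDl; zmod.
Qed.
Lemma spannedZ M (s : seq M) a x : spanned s x -> spanned s (a *: x).
Proof.
elim: s x => /= [x ->|g s IH x [r hx]]; first by rewrite scaler0.
by exists (a * r); rewrite -scalerA -scalerBr; apply: IH.
Qed.
Definition span M (s : seq M) : submod M :=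
  Submod (spanned0 s) (@spannedD M s) (@spannedZ M s).
Lemma spanned_mem M (s : seq M) g : g \in s -> spanned s g.
Proof.
elim: s => //= h s IH; rewrite inE => /orP [/eqP ->|/IH hg].
  by exists 1; rewrite scale1r subrr; apply: spanned0.
by exists 0; rewrite scale0r subr0.
Qed.
Lemma spanned_sub M (s : seq M) (Q : submod M) x :
  (forall g, g \in s -> Q g) -> spanned s x -> Q x.
Proof.
elim: s x => /= [x _ ->|g s IH x h [r hx]]; first exact: submod0.
rewrite -(subrK (r *: g) x); apply: submodD.
  by apply: IH hx => k ks; apply: h; rewrite inE ks orbT.
by apply/submodZ/h; rewrite inE eqxx.
Qed.
Lemma spanned_sum M (s : seq M) x : spanned s x ->
  exists c : 'I_(size s) -> R, x = \sum_k c k *: s`_k.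
Proof.
elim: s x => /= [x ->|g s IH x [r /IH [c hc]]]; first by exists (fun=> 0); rewrite big_ord0.
exists (fun k => if unlift ord0 k is Some j then c j else r).
rewrite big_ord_recl unlift_none /= -(subrK (r *: g) x) hc addrC; congr (_ + _).
by apply: eq_bigr => i _; rewrite liftK.
Qed.

(** Finite generation of [Z] modulo [B] without forming the quotient; with cycles and boundaries it
    is finite generation of homology. *)
Definition fgr M (Z B : M -> Prop) := exists s : seq M, (forall g, g \in s -> Z g) /\
  forall z, Z z -> exists b, B b /\ spanned s (z - b).

Lemma fgrP M (Z B : submod M) :
  fgr Z B <-> exists (n : nat) (g : 'I_n -> M), (forall k, Z (g k)) /\
    forall z, Z z -> exists c : 'I_n -> R, B (z - \sum_(k < n) c k *: g k).
Proof.
split=> [[s [hs h]]|[n [g [hg h]]]].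
  exists (size s), (fun k => s`_k); split=> [k|z /h [b [hb]]].
    by apply/hs/mem_nth.
  by move=> /spanned_sum [c e]; exists c; rewrite -e subKr.
exists (codom g); split=> [x /codomP [k ->] //|z /h [c hc]].
exists (z - \sum_(k < n) c k *: g k); split=> //; rewrite subKr.
apply: (@submod_sum _ _ (span (codom g))) => k _; apply: spannedZ; apply: spanned_mem.
exact: codom_f.
Qed.

Lemma fgr_gen_ideal (hR : noetherian R) (I : R -> Prop) : is_ideal I ->
  exists s : seq R^o, (forall g, g \in s -> I g) /\ forall x, I x -> spanned s x.
Proof.
move=> hI; have [n [g [hg h]]] := hR I hI.
exists (codom g : seq R^o); split=> [x /codomP [k ->] //|x /h [c ->]].
apply: (@submod_sum _ _ (span (codom g : seq R^o))) => k _.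
by apply: spannedZ; apply: spanned_mem; apply: codom_f.
Qed.

(** Induction on the generators of [Z] modulo [B]. The elements of [P] that avoid the first
    generator [g] are handled by induction, and the coefficients at [g] that occur in [P] form a
    finitely generated ideal. *)
Lemma noetherian_fgr (hR : noetherian R) M (Z B P : submod M) :
  (forall x, B x -> P x) -> (forall x, P x -> Z x) -> fgr Z B -> fgr P B.
Proof.
move=> BP PZ [s [_ hs]]; have {}hs x (px : P x) := hs x (PZ x px).
elim: s P BP {PZ} hs => [|g s IH] P BP hs.
  exists [::]; split=> // z /hs [b [hb e]]; by exists b.
pose P'p x := P x /\ exists b, B b /\ spanned s (x - b).
have P'0 : P'p 0 by split; [apply: submod0|exists 0; rewrite subr0; split; [apply: submod0|apply: spanned0]].
have P'D x y : P'p x -> P'p y -> P'p (x + y).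
  move=> [px [b [hb ex]]] [py [b' [hb' ey]]]; split; first exact: submodD.
  exists (b + b'); split; first exact: submodD.
  by rewrite (_ : _ - _ = (x - b) + (y - b')); [apply: spannedD | zmod].
have P'Z a x : P'p x -> P'p (a *: x).
  move=> [px [b [hb ex]]]; split; first exact: submodZ.
  by exists (a *: b); split; [apply: submodZ|rewrite -scalerBr; apply: spannedZ].
pose P' := Submod P'0 P'D P'Z.
have [s1 [hs1 gen1]] : fgr P' B.
  apply: IH => [x bx|x [//]]; split; first exact: BP.
  by exists x; rewrite subrr; split=> //; apply: spanned0.
(* The ideal of coefficients at [g] of elements of [P], modulo [B] and the span of the other
   generators. *)
pose I r := exists p, P p /\ exists b, B b /\ spanned s (p - b - r *: g).
have hI : is_ideal I.
  split.
  - exists 0; split; first exact: submod0; exists 0; split; first exact: submod0.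
    by rewrite scale0r !subr0; apply: spanned0.
  - move=> x y [p [pp [b [hb e]]]] [p' [pp' [b' [hb' e']]]].
    exists (p + p'); split; first exact: submodD; exists (b + b'); split; first exact: submodD.
    rewrite (_ : _ - _ = (p - b - x *: g) + (p' - b' - y *: g)); first exact: spannedD.
    by rewrite scalerDl; zmod.
  - move=> a x [p [pp [b [hb e]]]]; exists (a *: p); split; first exact: submodZ.
    exists (a *: b); split; first exact: submodZ.
    by rewrite -scalerA -!scalerBr; apply: spannedZ.
have [n [r [hr genI]]] := hR I hI.
have [p hp] := choice hr.
exists (s1 ++ codom p); split=> [x|z pz].
  rewrite mem_cat => /orP [/hs1 [] //|/codomP [k ->]]; by case: (hp k).
have [b [hb [t ht]]] := hs z pz.
have [c hc] : exists c : 'I_n -> R, t = \sum_k c k * r k.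
  by apply: genI; exists z; split=> //; exists b.
pose w := \sum_k c k *: p k.
have pw : P w by apply: submod_sum => k _; apply: submodZ; case: (hp k).
have : P' (z - w).
  split; first exact: submodB.
  have [bb hbb] := choice (fun k => (hp k).2).
  exists (b - \sum_k c k *: bb k); split.
    apply: submodB => //; apply: submod_sum => k _; apply: submodZ; by case: (hbb k).
  rewrite (_ : _ - _ = (z - b - t *: g) - \sum_k c k *: (p k - bb k - r k *: g)).
    apply: (@submodB _ _ (span s)) => //; apply: (@submod_sum _ _ (span s)) => k _.
    by apply: spannedZ; case: (hbb k).
  have -> : \sum_k c k *: (p k - bb k - r k *: g) = w - \sum_k c k *: bb k - t *: g.
    rewrite hc scaler_suml -!sumrB; apply: eq_bigr => k _.
    by rewrite !scalerBr scalerA.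
  by zmod.
case/gen1 => b1 [hb1 sp]; exists b1; split=> //.
have mono s2 s3 (x : M) : {subset s2 <= s3} -> spanned s2 x -> spanned s3 x.
  move=> ss; apply: (@spanned_sub _ _ (span s3)) => u /ss; exact: spanned_mem.
rewrite (_ : _ - _ = (z - w - b1) + w); last by zmod.
apply: spannedD; first by apply: mono sp => u us; rewrite mem_cat us.
apply: (@submod_sum _ _ (span _)) => k _; apply: spannedZ; apply: spanned_mem.
by rewrite mem_cat codom_f orbT.
Qed.

Lemma noetherian_acc (hR : noetherian R) (I : nat -> R -> Prop) :
  (forall n, is_ideal (I n)) -> (forall n x, I n x -> I n.+1 x) ->
  exists n, forall k x, I k x -> I n x.
Proof.
move=> hI inc.
have mono m n x : (m <= n)%N -> I m x -> I n x.
  by move/subnKC <-; elim: (n - m)%N => [|k IH]; rewrite ?addn0 ?addnS // => /IH /inc.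
pose U x := exists n, I n x.
have hU : is_ideal U.
  split; first by exists 0%N; case: (hI 0%N).
    move=> x y [m hx] [n hy]; exists (maxn m n); case: (hI (maxn m n)) => _ D _.
    by apply: D; [apply: mono hx; apply: leq_maxl|apply: mono hy; apply: leq_maxr].
  by move=> a x [m hx]; exists m; case: (hI m) => _ _; apply.
have [n [g [hg gen]]] := hR U hU; have [N hN] := choice hg.
exists (\max_k N k) => k x hx; have [c ->] : exists c : 'I_n -> R, x = \sum_k c k * g k.
  by apply: gen; exists k.
case: (hI (\max_k N k)) => i0 iD iM; apply: big_ind => // j _; apply: iM.
by apply: mono (hN j); apply: leq_bigmax.
Qed.

(** Without a maximal member, choice yields a strictly increasing sequence of ideals in [F]. *)
Lemma noetherian_max (hR : noetherian R) (F : (R -> Prop) -> Prop) I0 : F I0 ->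
  (forall I, F I -> is_ideal I) ->
  exists I, F I /\ forall J, F J -> (forall x, I x -> J x) -> forall x, J x -> I x.
Proof.
move=> F0 hF; apply: contrapT => no.
pose Fs := {I | F I}.
have nxt (I : Fs) : exists J : Fs, (forall x, sval I x -> sval J x) /\ exists x, sval J x /\ ~ sval I x.
  apply: contrapT => ne; apply: no; exists (sval I); split; first exact: (svalP I).
  move=> J hJ IJ x Jx; apply: contrapT => nI; apply: ne.
  by exists (exist _ J hJ); split=> //; exists x.
have [f hf] := choice nxt.
pose I n := sval (iter n f (exist _ I0 F0)).
have [n hn] := @noetherian_acc hR I (fun n => hF _ (svalP (iter n f _)))
   (fun n => (hf (iter n f _)).1).
have [x [h1 h2]] := (hf (iter n f (exist _ I0 F0))).2.
by apply: h2; apply: (hn n.+1).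
Qed.

Lemma maximal_exists (hR : noetherian R) (I : R -> Prop) : is_ideal I -> ~ I 1 ->
  exists m, is_maximal m /\ forall x, I x -> m x.
Proof.
move=> hI nI.
have [m [[hm nm Im] mx]] := @noetherian_max hR
  (fun J => [/\ is_ideal J, ~ J 1 & forall x, I x -> J x]) I (And3 hI nI (fun=> id))
  (fun J h => let: And3 a _ _ := h in a).
exists m; split=> //; split=> // J hJ mJ.
case: (pselect (J 1)) => [|nJ]; [by right|left]; apply: mx => //; split=> // x /Im; exact: mJ.
Qed.

Fixpoint mspanned M (m : R -> Prop) (s : seq M) (x : M) : Prop :=
  match s with [::] => x = 0 | g :: s' => exists r, m r /\ mspanned m s' (x - r *: g) end.

Section Nakayama.
Variables (m : R -> Prop) (hm : is_ideal m) (M : lmodType R).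

Lemma mspanned0 (s : seq M) : mspanned m s 0.
Proof.
by case: hm => m0 _ _; elim: s => //= g s IH; exists 0; rewrite scale0r subr0.
Qed.
Lemma mspannedD (s : seq M) x y : mspanned m s x -> mspanned m s y -> mspanned m s (x + y).
Proof.
case: hm => _ mD _; elim: s x y => /= [x y -> ->|g s IH x y [r [mr hx]] [r' [mr' hy]]].
  by rewrite addr0.
exists (r + r'); split; first exact: mD.
rewrite (_ : _ - _ = (x - r *: g) + (y - r' *: g)); first exact: IH.
by rewrite scalerDl; zmod.
Qed.
Lemma mspannedZ (s : seq M) a x : mspanned m s x -> mspanned m s (a *: x).
Proof.
case: hm => _ _ mZ; elim: s x => /= [x ->|g s IH x [r [mr hx]]]; first by rewrite scaler0.
by exists (a * r); split; [apply: mZ|rewrite -scalerA -scalerBr; apply: IH].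
Qed.
Lemma mspanned_scale (s : seq M) r x : m r -> spanned s x -> mspanned m s (r *: x).
Proof.
case: hm => _ _ mZ mr; elim: s x => /= [x ->|g s IH x [t hx]]; first by rewrite scaler0.
by exists (r * t); split; [rewrite mulrC; apply: mZ|rewrite -scalerA -scalerBr; apply: IH].
Qed.

(** Nakayama without determinants: the relation of the first generator eliminates it from the other
    relations at the cost of a factor [1 - r] with [r] in [m], and the factors multiply to
    [1 - c]. *)
Lemma nakayama_seq (B : submod M) (s : seq M) :
  (forall g, g \in s -> exists b, B b /\ mspanned m s (g - b)) ->
  exists c, m c /\ forall g, g \in s -> B ((1 - c) *: g).
Proof.
have [m0 mD mZ] := hm.
elim: s => [|g s IH] h; first by exists 0.
have [b [hb [r [mr hg]]]] := h g (mem_head _ _).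
have {}IH : exists c, m c /\ forall g, g \in s -> B ((1 - c) *: g).
  apply: IH => k ks; have [|b' [hb' [r' [mr' hk]]]] := h k; first by rewrite inE ks orbT.
  exists ((1 - r) *: b' + r' *: b); split; first by apply: submodD; apply: submodZ.
  (* The relation of [k] is multiplied by [1 - r], and [(1 - r) *: g] is replaced by means of the
     relation of [g]; the summand [r *: k] restores [k]. *)
  have e : k - ((1 - r) *: b' + r' *: b) =
      (1 - r) *: (k - b' - r' *: g) + r' *: (g - b - r *: g) + r *: k.
    rewrite !scalerBr !scalerBl !scale1r !scalerA [r * r']mulrC; by zmod.
  rewrite e; apply: mspannedD; first by apply: mspannedD; apply: mspannedZ.
  by apply: mspanned_scale => //; apply: spanned_mem.
have [c [mc hc]] := IH.
exists (c + r - c * r); split.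
  by apply: (mD); [apply: (mD)|rewrite -mulNr; apply: mZ].
have E u : (1 - (c + r - c * r)) *: u = (1 - r) *: ((1 - c) *: u) :> M.
  by rewrite scalerA; congr (_ *: _); ring.
move=> k; rewrite inE => /orP [/eqP ->|/hc hk]; last by rewrite E; apply: submodZ.
rewrite E scalerA mulrC -scalerA.
have -> : (1 - r) *: g = b + (g - b - r *: g) by rewrite scalerBl scale1r; zmod.
rewrite scalerDr; apply: submodD; first exact: submodZ.
elim: (s) hc (_ - _) hg => [_ x /= ->|u s' IHs hc x [t [_ hx]]]; first by rewrite scaler0; apply: submod0.
rewrite -(subrK (t *: u) x) scalerDr; apply: submodD.
  by apply: IHs hx => v vs; apply: hc; rewrite inE vs orbT.
by rewrite scalerA mulrC -scalerA; apply/submodZ/hc; rewrite mem_head.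
Qed.

(** The form for an arbitrary ideal: in place of localizing, one element [1 - c] with [c] in [m]
    kills all of [Z] modulo [B]. *)
Lemma nakayama (Z B : submod M) : fgr Z B ->
  (forall z, Z z -> exists t : seq M, (forall g, g \in t -> Z g) /\
     exists b, B b /\ mspanned m t (z - b)) ->
  exists c, m c /\ forall z, Z z -> B ((1 - c) *: z).
Proof.
move=> [s [hs gen]] h.
have [|c [mc hc]] := @nakayama_seq B s.
  move=> g /hs /h [t [ht [b [hb e]]]].
  (* Each relation comes with its own list [t] of elements of [Z]; it is rewritten in the fixed
     generators [s]. *)
  suff: exists b', B b' /\ mspanned m s (g - b - b').
    move=> [b' [hb' e']]; exists (b + b'); split; first exact: submodD.
    by rewrite opprD addrA.
  elim: t ht (g - b) e => [_ x /= ->|u t IH ht x [r [mr e]]].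
    by exists 0; rewrite subr0; split; [apply: submod0|apply: mspanned0].
  have [|b1 [hb1 e1]] := IH _ _ e; first by move=> v vt; apply: ht; rewrite inE vt orbT.
  have [b2 [hb2 e2]] := gen u (ht u (mem_head _ _)).
  exists (b1 + r *: b2); split; first by apply: submodD => //; apply: submodZ.
  rewrite (_ : _ - _ = (x - r *: u - b1) + r *: (u - b2)); last by rewrite scalerBr; zmod.
  by apply: mspannedD => //; apply: mspanned_scale.
exists c; split=> // z /gen [b [hb e]].
rewrite -(subrK b z) scalerDr; apply: submodD; last exact: submodZ.
elim: (s) hc (z - b) e => [_ x /= ->|u s' IHs hc' x [t hx]]; first by rewrite scaler0; apply: submod0.
rewrite -(subrK (t *: u) x) scalerDr; apply: submodD.
  by apply: IHs hx => v vs; apply: hc'; rewrite inE vs orbT.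
by rewrite scalerA mulrC -scalerA; apply/submodZ/hc'; rewrite mem_head.
Qed.
End Nakayama.
End Noetherian.

(** * Tensor products of modules and their exactness *)

Section TensorModule.
Variables (R : comPzRingType) (M N : lmodType R).
Implicit Types x y : tens M N.

Definition tp (m : M) (n : N) : tens M N := tens_pi [:: (m, n)].

Lemma tens_piD (s t : seq (M * N)) : (tens_pi s + tens_pi t : tens M N) = tens_pi (s ++ t).
Proof. exact: tens_addE. Qed.

Lemma tens_pi_sum (s : seq (M * N)) : tens_pi s = \sum_(p <- s) tp p.1 p.2.
Proof.
elim: s => [|[m n] s IH]; first by rewrite big_nil.
by rewrite big_cons -IH tens_piD.
Qed.

Lemma tens_sum x : exists s : seq (M * N), x = \sum_(p <- s) tp p.1 p.2.
Proof. by exists (repr x); rewrite -tens_pi_sum tens_piK. Qed.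

Lemma tens_ind (Q : tens M N -> Prop) : Q 0 -> (forall x y, Q x -> Q y -> Q (x + y)) ->
  (forall m n, Q (tp m n)) -> forall x, Q x.
Proof.
move=> Q0 QD Qt x; have [s ->] := tens_sum x.
by elim: s => [|p s IH]; rewrite ?big_nil ?big_cons //; apply: QD.
Qed.

Lemma tpDl m m' n : tp (m + m') n = tp m n + tp m' n.
Proof. by rewrite tens_piD; apply/tens_piP; apply: tens_Dl. Qed.
Lemma tpDr m n n' : tp m (n + n') = tp m n + tp m n'.
Proof. by rewrite tens_piD; apply/tens_piP; apply: tens_Dr. Qed.
Lemma tp_bal r m n : tp (r *: m) n = tp m (r *: n).
Proof. by apply/tens_piP; apply: tens_bal. Qed.

Definition tens_scale (r : R) x : tens M N := tens_map (scale_lin M r) (idfun : {linear N -> N}) x.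
Lemma tens_scale_pi r s : tens_scale r (tens_pi s) = tens_pi [seq (r *: p.1, p.2) | p <- s].
Proof. exact: tens_mapE. Qed.
Fact tens_scaleDr : right_distributive tens_scale +%R.
Proof.
move=> a u v; rewrite -(tens_piK u) -(tens_piK v) tens_piD !tens_scale_pi.
by rewrite tens_piD map_cat.
Qed.
Lemma tens_scale_tp r m n : tens_scale r (tp m n) = tp (r *: m) n.
Proof. exact: tens_scale_pi. Qed.
Lemma tens_scale0 r : tens_scale r 0 = 0.
Proof. by apply: (@addrI _ (tens_scale r 0)); rewrite -tens_scaleDr !addr0. Qed.
Fact tens_scaleA a b v : tens_scale a (tens_scale b v) = tens_scale (a * b) v.
Proof.
elim/tens_ind: v => [|x y hx hy|m n]; first by rewrite !tens_scale0.
  by rewrite !tens_scaleDr hx hy.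
by rewrite !tens_scale_tp scalerA.
Qed.
Fact tens_scale1 : left_id 1 tens_scale.
Proof.
move=> v; elim/tens_ind: v => [|x y hx hy|m n]; first by rewrite !tens_scale0.
  by rewrite !tens_scaleDr hx hy.
by rewrite !tens_scale_tp scale1r.
Qed.
Fact tens_scaleDl v : {morph tens_scale^~ v : a b / a + b}.
Proof.
move=> a b; elim/tens_ind: v => [|x y hx hy|m n]; first by rewrite !tens_scale0 addr0.
  by rewrite !tens_scaleDr hx hy; zmod.
by rewrite !tens_scale_tp scalerDl tpDl.
Qed.
HB.instance Definition _ := GRing.Zmodule_isLmodule.Build R (tens M N)
  tens_scaleA tens_scale1 tens_scaleDr tens_scaleDl.

Lemma tpZl r m n : tp (r *: m) n = r *: tp m n.
Proof. by rewrite -tens_scale_tp. Qed.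
Lemma tpZr r m n : tp m (r *: n) = r *: tp m n.
Proof. by rewrite -tp_bal tpZl. Qed.
Lemma tp_linl n : linear (fun m => tp m n).
Proof. by move=> a x y; rewrite tpDl tpZl. Qed.
Lemma tp_linr m : linear (tp m).
Proof. by move=> a x y; rewrite tpDr tpZr. Qed.
Definition tpl n : {linear M -> tens M N} := lin_of (tp_linl n).
Definition tpr m : {linear N -> tens M N} := lin_of (tp_linr m).
Lemma tp0l n : tp 0 n = 0. Proof. exact: (linear0 (tpl n)). Qed.
Lemma tp0r m : tp m 0 = 0. Proof. exact: (linear0 (tpr m)). Qed.

Section Lift.
Variables (Q : lmodType R) (b : M -> N -> Q).
Hypotheses (bl : forall n, linear (b^~ n)) (br : forall m, linear (b m)).

Let bal r m n : b (r *: m) n = b m (r *: n).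
Proof.
have := linearZ_LR (lin_of (bl n)) r m; rewrite /= => ->.
by have := linearZ_LR (lin_of (br m)) r n; rewrite /= => ->.
Qed.

Lemma tens_eq_sum s t : tens_eq s t ->
  \sum_(p <- s) b p.1 p.2 = \sum_(p <- t) b p.1 p.2.
Proof.
elim=> {s t} [//|s t _ -> //|s t u _ -> _ -> //|s s' t t' _ e1 _ e2|s t|n|m m' n|m n n'|r m n].
- by rewrite !big_cat /= e1 e2.
- by rewrite !big_cat /= addrC.
- by rewrite big_seq1 big_nil /=; apply: (linear0 (lin_of (bl n))).
- by rewrite big_seq1 big_cons big_seq1 /=; apply: (linearD (lin_of (bl n))).
- by rewrite big_seq1 big_cons big_seq1 /=; apply: (linearD (lin_of (br m))).
- by rewrite !big_seq1 /= bal.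
Qed.

Definition tens_lift_fun x : Q := \sum_(p <- repr x) b p.1 p.2.
Lemma tens_lift_pi s : tens_lift_fun (tens_pi s) = \sum_(p <- s) b p.1 p.2.
Proof. by apply: tens_eq_sum; apply: tens_repr. Qed.
Lemma tens_lift_tp0 m n : tens_lift_fun (tp m n) = b m n.
Proof. by rewrite tens_lift_pi big_seq1. Qed.
Fact tens_lift_linear : linear tens_lift_fun.
Proof.
have D x y : tens_lift_fun (x + y) = tens_lift_fun x + tens_lift_fun y.
  by rewrite -(tens_piK x) -(tens_piK y) tens_piD !tens_lift_pi big_cat.
have Z a x : tens_lift_fun (a *: x) = a *: tens_lift_fun x.
  have L0 : tens_lift_fun 0 = 0 by rewrite [LHS]tens_lift_pi big_nil.
  elim/tens_ind: x => [|x y hx hy|m n]; first by rewrite scaler0 !L0 scaler0.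
    by rewrite scalerDr !D hx hy scalerDr.
  rewrite -tpZl !tens_lift_tp0; exact: (linearZ_LR (lin_of (bl n))).
by move=> a x y; rewrite D Z.
Qed.
Definition tens_lift : {linear tens M N -> Q} := lin_of tens_lift_linear.
Lemma tens_lift_tp m n : tens_lift (tp m n) = b m n.
Proof. exact: tens_lift_tp0. Qed.
End Lift.

Lemma tens_eq_lin (Q : lmodType R) (f g : {linear tens M N -> Q}) :
  (forall m n, f (tp m n) = g (tp m n)) -> forall x, f x = g x.
Proof.
move=> h; elim/tens_ind => [|x y hx hy|//]; first by rewrite !linear0.
by rewrite !linearD hx hy.
Qed.
End TensorModule.
Arguments tens_lift {R M N Q b} bl br.

Section TensorFunctor.
Variable R : comPzRingType.
Implicit Types M N P : lmodType R.

Lemma tens_map_tp M N M' N' (f : {linear M -> M'}) (g : {linear N -> N'}) m n :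
  tens_map f g (tp m n) = tp (f m) (g n).
Proof. exact: tens_mapE. Qed.
Fact tens_map_linear M N M' N' (f : {linear M -> M'}) (g : {linear N -> N'}) :
  linear (tens_map f g).
Proof.
have D x y : tens_map f g (x + y) = tens_map f g x + tens_map f g y.
  rewrite -(tens_piK x) -(tens_piK y) tens_piD !tens_mapE tens_piD.
  by rewrite /tens_map_seq map_cat.
have L0 : tens_map f g 0 = 0 by rewrite [LHS]tens_mapE.
move=> a x y; rewrite D; congr (_ + _).
elim/tens_ind: x => [|x x' hx hx'|m n]; first by rewrite scaler0 !L0 scaler0.
  by rewrite scalerDr !D hx hx' scalerDr.
by rewrite -tpZl !tens_map_tp -tpZl linearZ_LR.
Qed.
HB.instance Definition _ M N M' N' (f : {linear M -> M'}) (g : {linear N -> N'}) :=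
  GRing.isLinear.Build R (tens M N) (tens M' N') _ (tens_map f g) (tens_map_linear f g).

Definition tml M M' N (f : {linear M -> M'}) : {linear tens M N -> tens M' N} :=
  tens_map f (idfun : {linear N -> N}).
Definition tmr M N N' (g : {linear N -> N'}) : {linear tens M N -> tens M N'} :=
  tens_map (idfun : {linear M -> M}) g.
Lemma tml_tp M M' N (f : {linear M -> M'}) m n : tml N f (tp m n) = tp (f m) n.
Proof. exact: tens_map_tp. Qed.
Lemma tmr_tp M N N' (g : {linear N -> N'}) m n : tmr M g (tp m n) = tp m (g n).
Proof. exact: tens_map_tp. Qed.

Lemma tml_eq M M' N (f g : {linear M -> M'}) : (forall m, f m = g m) ->
  forall x, tml N f x = tml N g x.
Proof. by move=> h; apply: tens_eq_lin => m n; rewrite !tml_tp h. Qed.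
Lemma tml_comp M M' M'' N (f : {linear M -> M'}) (g : {linear M' -> M''}) x :
  tml N g (tml N f x) = tml N (g \o f) x.
Proof.
elim/tens_ind: x => [|x y hx hy|m n]; rewrite ?linear0 // ?linearD ?hx ?hy //.
by rewrite !tml_tp.
Qed.
Lemma tml_tmr M M' N N' (f : {linear M -> M'}) (g : {linear N -> N'}) x :
  tml N' f (tmr M g x) = tmr M' g (tml N f x).
Proof.
elim/tens_ind: x => [|x y hx hy|m n]; rewrite ?linear0 // ?linearD ?hx ?hy //.
by rewrite !(tml_tp, tmr_tp).
Qed.
Lemma tmr_comp M N N' N'' (f : {linear N -> N'}) (g : {linear N' -> N''}) x :
  tmr M g (tmr M f x) = tmr M (g \o f) x.
Proof.
elim/tens_ind: x => [|x y hx hy|m n]; rewrite ?linear0 // ?linearD ?hx ?hy //.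
by rewrite !tmr_tp.
Qed.
Lemma tml0 M M' N (f : {linear M -> M'}) x : (forall m, f m = 0) -> tml N f x = 0.
Proof.
move=> f0; elim/tens_ind: x => [|x y hx hy|m n]; rewrite ?linear0 // ?linearD ?hx ?hy ?addr0 //.
by rewrite tml_tp f0 tp0l.
Qed.
Lemma tmr0 M N N' (f : {linear N -> N'}) x : (forall m, f m = 0) -> tmr M f x = 0.
Proof.
move=> f0; elim/tens_ind: x => [|x y hx hy|m n]; rewrite ?linear0 // ?linearD ?hx ?hy ?addr0 //.
by rewrite tmr_tp f0 tp0r.
Qed.
Lemma tml_id M N (f : {linear M -> M}) x : (forall m, f m = m) -> tml N f x = x.
Proof.
move=> f0; elim/tens_ind: x => [|x y hx hy|m n]; rewrite ?linear0 // ?linearD ?hx ?hy ?addr0 //.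
by rewrite tml_tp f0.
Qed.

Section Exactness.
Variables (M N' N N'' : lmodType R) (f : {linear N' -> N}) (g : {linear N -> N''}).

Lemma tmr_surj : (forall y, exists x, g x = y) -> forall y, exists x, tmr M g x = y.
Proof.
move=> sg; elim/tens_ind => [|x y [u <-] [v <-]|m n].
- by exists 0; rewrite linear0.
- by exists (u + v); rewrite linearD.
- by have [z <-] := sg n; exists (tp m z); rewrite tmr_tp.
Qed.

(** Choosing preimages along [g] gives a map that is bilinear modulo the image of [tmr M f], hence a
    map from [M (x) N''] to the cokernel which recovers the class of [y] from [tmr M g y]. *)
Lemma tmr_exact : (forall y, exists x, g x = y) -> (forall y, g y = 0 -> exists x, f x = y) ->
  forall y, tmr M g y = 0 -> exists x, tmr M f x = y.
Proof.
move=> sg ex.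
have [s hs] := choice sg.
pose K := im_sub (tmr M f).
have wd m n n' : g n = g n' -> quo_pi K (tp m n) = quo_pi K (tp m n').
  move=> e; apply/eqP; rewrite -subr_eq0 -(linearB (quo_pi K)); apply/eqP/quo_piE.
  have [|x hx] := ex (n - n'); first by rewrite linearB e subrr.
  by exists (tp m x); rewrite tmr_tp hx; apply: (linearB (tpr N m)).
have bl n : linear (fun m => quo_pi K (tp m (s n))).
  by move=> a x y; rewrite tpDl tpZl linearP.
have br m : linear (fun n => quo_pi K (tp m (s n))).
  move=> a x y; rewrite -(linearP (quo_pi K)) -tpZr -tpDr; apply: wd.
  by rewrite linearP !hs.
have E : forall y, tens_lift bl br (tmr M g y) = quo_pi K y.
  have L : linear (fun y => tens_lift bl br (tmr M g y)) by move=> a x y; rewrite !linearP.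
  apply: (@tens_eq_lin _ _ _ _ (lin_of L)) => m n.
  by rewrite /= -[tens_map _ _ _]/(tmr M g (tp m n)) tmr_tp tens_lift_tp0 //; apply: wd; rewrite hs.
move=> y hy; have /(quo_piE K) // : quo_pi K y = 0 by rewrite -E hy linear0.
Qed.
End Exactness.

Lemma tml_exact M' M M'' N (f : {linear M' -> M}) (g : {linear M -> M''}) :
  (forall y, exists x, g x = y) -> (forall y, g y = 0 -> exists x, f x = y) ->
  forall y, tml N g y = 0 -> exists x, tml N f x = y.
Proof.
move=> sg ex.
have [s hs] := choice sg.
pose K := im_sub (tml N f).
have wd n m m' : g m = g m' -> quo_pi K (tp m n) = quo_pi K (tp m' n).
  move=> e; apply/eqP; rewrite -subr_eq0 -(linearB (quo_pi K)); apply/eqP/quo_piE.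
  have [|x hx] := ex (m - m'); first by rewrite linearB e subrr.
  by exists (tp x n); rewrite tml_tp hx; apply: (linearB (tpl M n)).
have bl n : linear (fun m => quo_pi K (tp (s m) n)).
  move=> a x y; rewrite -(linearP (quo_pi K)) -tpZl -tpDl; apply: wd.
  by rewrite linearP !hs.
have br m : linear (fun n => quo_pi K (tp (s m) n)).
  by move=> a x y; rewrite tpDr tpZr linearP.
have E : forall y, tens_lift bl br (tml N g y) = quo_pi K y.
  have L : linear (fun y => tens_lift bl br (tml N g y)) by move=> a x y; rewrite !linearP.
  apply: (@tens_eq_lin _ _ _ _ (lin_of L)) => m n.
  by rewrite /= -[tens_map _ _ _]/(tml N g (tp m n)) tml_tp tens_lift_tp0 //; apply: wd; rewrite hs.
move=> y hy; have /(quo_piE K) // : quo_pi K y = 0 by rewrite -E hy linear0.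
Qed.

Lemma tml_surj M M' N (g : {linear M -> M'}) :
  (forall y, exists x, g x = y) -> forall y, exists x, tml N g x = y.
Proof.
move=> sg; elim/tens_ind => [|x y [u <-] [v <-]|m n].
- by exists 0; rewrite linear0.
- by exists (u + v); rewrite linearD.
- by have [z <-] := sg m; exists (tp z n); rewrite tml_tp.
Qed.

(** Projective modules are flat. A dual basis of [P] gives coordinate maps [c t] from [P (x) Q] to
    [Q]; they commute with [f], and an element with vanishing coordinates is zero, being the sum of
    the [t (x) c t y]. *)
Lemma tmr_inj P N N' (f : {linear N -> N'}) : projective P -> injective f ->
  injective (tmr P f).
Proof.
move=> pP fI; have [s hs] := projective_split pP.
have bl (t : P) (Q : lmodType R) (n : Q) : linear (fun p => s p t *: n).
  by move=> a x y; rewrite linearP [X in X *: n]/(a * s x t + s y t) scalerDl scalerA.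
have br (t : P) (Q : lmodType R) p : linear (fun n : Q => s p t *: n).
  by move=> a x y; rewrite scalerDr !scalerA mulrC.
pose c (t : P) (Q : lmodType R) : {linear tens P Q -> Q} := tens_lift (bl t Q) (br t Q).
have cE t Q p n : c t Q (tp p n) = s p t *: n by apply: tens_lift_tp.
have cf t y : c t N' (tmr P f y) = f (c t N y).
  elim/tens_ind: y => [|x y hx hy|p n]; rewrite ?linear0 // ?linearD ?hx ?hy //.
  by rewrite tmr_tp !cE linearZ_LR.
have c0 y : (forall t, c t N y = 0) -> y = 0.
  have [l ->] := tens_sum y; pose S := undup (flatten [seq fs_supp (s p.1) | p <- l]).
  move=> h; transitivity (\sum_(t <- S) tp t (c t N (\sum_(p <- l) tp p.1 p.2))); last first.
    by rewrite big1 // => t _; rewrite h tp0r.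
  have E t : tp t (c t N (\sum_(p <- l) tp p.1 p.2)) = \sum_(p <- l) tp t (s p.1 t *: p.2).
    rewrite linear_sum -[tp t _]/(tpr N t _) linear_sum.
    by apply: eq_bigr => p _; rewrite cE.
  under [RHS]eq_bigr => t _ do rewrite E.
  rewrite exchange_big big_seq [RHS]big_seq; apply: eq_bigr => p pl /=.
  rewrite -{1}(hs p.1) [fs_ext _ _ _](@fs_extE _ _ _ _ _ _ S).
  - rewrite -[tp _ _]/(tpl P p.2 _) (linear_sum (tpl P p.2)); apply: eq_bigr => t _.
    by rewrite /= tpZl tpZr.
  - exact: undup_uniq.
  - move=> t ne; rewrite mem_undup; apply/flattenP; exists (fs_supp (s p.1)).
      by apply/mapP; exists p.
    exact: mem_fs_supp.
have tI y : tmr P f y = 0 -> y = 0.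
  by move=> h; apply: c0 => t; apply: fI; rewrite -cf h !linear0.
move=> x y e; apply/eqP; rewrite -subr_eq0; apply/eqP/tI.
by rewrite linearB e subrr.
Qed.

Lemma tens_prodE M M' N (x : tens (M * M')%type N) :
  x = tml N (inl_lin M M') (tml N (fst_lin M M') x) + tml N (inr_lin M M') (tml N (snd_lin M M') x).
Proof.
elim/tens_ind: x => [|x y hx hy|m n]; first by rewrite !linear0 addr0.
  by rewrite {1}hx {1}hy !linearD; zmod.
by rewrite !tml_tp -tpDl -pairE.
Qed.

Lemma tens1_lin M : forall r : R^o, linear (fun m : M => (r : R) *: m).
Proof. by move=> r a x y; rewrite scalerDr !scalerA mulrC. Qed.
Lemma tens1_lin' M : forall m : M, linear (fun r : R^o => (r : R) *: m).
Proof. by move=> m a x y; rewrite scalerDl scalerA. Qed.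
Definition tens1 M : {linear tens M R^o -> M} := tens_lift (@tens1_lin M) (@tens1_lin' M).
Lemma tens1_tp M m r : tens1 M (tp m r) = r *: m.
Proof. exact: tens_lift_tp. Qed.
End TensorFunctor.
Arguments tml {R M M' N} f.
Arguments tmr {R M N N'} g.

(** * Cycles, boundaries and mapping cones *)

Section Cycles.
Variables (R : comPzRingType).
Implicit Types X Y Z : complex R.

Lemma cycle_diff X (i : int) (z : X i) j : is_cycle z -> diff X i j z = 0.
Proof.
move=> hz; have [e|ne] := eqVneq i (j + 1); last exact: diff_shape.
by have -> : j = i - 1 by rewrite e addrK.
Qed.

Lemma boundary_diff X (i j : int) (y : X j) : is_boundary (diff X j i y).
Proof.
have [e|ne] := eqVneq j (i + 1); first by subst j; exists y.
by exists 0; rewrite linear0 (diff_shape y).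
Qed.

Lemma boundary_lift X (i j : int) (z : X i) : j = i + 1 -> is_boundary z ->
  exists y : X j, diff X j i y = z.
Proof. by move=> ->. Qed.

Lemma boundary_pred X (i : int) (z : X (i - 1)) : is_boundary z ->
  exists y : X i, diff X i (i - 1) y = z.
Proof. by apply: boundary_lift; rewrite subrK. Qed.

Lemma boundary_cycle X (i : int) (z : X i) : is_boundary z -> is_cycle z.
Proof. by case=> y <-; apply: diff_diff. Qed.

Definition cycles X (i : int) : submod (X i) := ker_sub (diff X i (i - 1)).
Definition boundaries X (i : int) : submod (X i) := im_sub (diff X (i + 1) i).

Lemma homology_fgP X i : homology_fg X i <-> fgr (@is_cycle R X i) (@is_boundary R X i).
Proof. by rewrite (fgrP (cycles X i) (boundaries X i)). Qed.

Lemma cmap_cycle X Y (f : chain_map X Y) i (z : X i) : is_cycle z -> is_cycle (f i z).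
Proof. by rewrite /is_cycle -cmap_diff => ->; rewrite linear0. Qed.
Lemma cmap_boundary X Y (f : chain_map X Y) i (z : X i) : is_boundary z -> is_boundary (f i z).
Proof. by case=> y <-; rewrite cmap_diff; apply: boundary_diff. Qed.

Lemma boundary0 X i : is_boundary (0 : X i). Proof. exact: (submod0 (boundaries X i)). Qed.
Lemma boundaryD X i (x y : X i) : is_boundary x -> is_boundary y -> is_boundary (x + y).
Proof. exact: (@submodD _ _ (boundaries X i)). Qed.
Lemma boundaryB X i (x y : X i) : is_boundary x -> is_boundary y -> is_boundary (x - y).
Proof. exact: (@submodB _ _ (boundaries X i)). Qed.
Lemma boundaryN X i (x : X i) : is_boundary x -> is_boundary (- x).
Proof. exact: (@submodN _ _ (boundaries X i)). Qed.
Lemma boundaryZ X i a (x : X i) : is_boundary x -> is_boundary (a *: x).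
Proof. exact: (@submodZ _ _ (boundaries X i)). Qed.
Lemma boundary_sub X i (x y : X i) : is_boundary (x - y) -> is_boundary y -> is_boundary x.
Proof. by move=> h hy; rewrite -(subrK y x); apply: boundaryD. Qed.
Lemma cycleD X i (x y : X i) : is_cycle x -> is_cycle y -> is_cycle (x + y).
Proof. exact: (@submodD _ _ (cycles X i)). Qed.
Lemma cycleB X i (x y : X i) : is_cycle x -> is_cycle y -> is_cycle (x - y).
Proof. exact: (@submodB _ _ (cycles X i)). Qed.
Lemma cycleZ X i a (x : X i) : is_cycle x -> is_cycle (a *: x).
Proof. exact: (@submodZ _ _ (cycles X i)). Qed.
Lemma cycle0 X i : is_cycle (0 : X i). Proof. exact: (submod0 (cycles X i)). Qed.

(** Injectivity and surjectivity are kept degree by degree, because partial resolutions induce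
    isomorphisms only in a range of degrees. *)
Definition hinj X Y (f : chain_map X Y) i := forall x : X i, is_cycle x -> is_boundary (f i x) -> is_boundary x.
Definition hsurj X Y (f : chain_map X Y) i := forall y : Y i, is_cycle y ->
  exists x : X i, is_cycle x /\ is_boundary (y - f i x).
Definition hiso X Y (f : chain_map X Y) i := hinj f i /\ hsurj f i.

Lemma bij_hiso X Y (f : chain_map X Y) : (forall i, injective (f i)) ->
  (forall i y, exists x, f i x = y) -> forall i, hiso f i.
Proof.
move=> fI fS i; split=> [x hx [y e]|y hy].
  have [z hz] := fS _ y; exists z; apply: fI; by rewrite cmap_diff hz.
have [x hx] := fS _ y; exists x; rewrite hx subrr; split; last exact: boundary0.
by apply: fI; rewrite cmap_diff hx hy linear0.
Qed.

Lemma hiso_comp X Y Z (g : chain_map Y Z) (f : chain_map X Y) i :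
  hiso f i -> hiso g i -> hiso (chain_comp g f) i.
Proof.
move=> [fi fs] [gi gs]; split=> [x hx h|z hz].
  by apply: fi => //; apply: gi => //; apply: cmap_cycle.
have [y [hy ey]] := gs z hz; have [x [hx ex]] := fs y hy; exists x; split=> //.
rewrite /= (_ : _ - _ = (z - g i y) + (g i y - g i (f i x))); last by zmod.
by apply: boundaryD => //; rewrite -(linearB (g i)); apply: cmap_boundary.
Qed.
Lemma hiso_compr X Y Z (g : chain_map Y Z) (f : chain_map X Y) i :
  hiso g i -> hiso (chain_comp g f) i -> hiso f i.
Proof.
move=> [gi gs] [ci cs]; split=> [x hx h|y hy].
  by apply: ci => //; apply: (cmap_boundary g).
have [x [hx ex]] := cs (g i y) (cmap_cycle g hy); exists x; split=> //.
apply: gi; first by apply: cycleB => //; apply: cmap_cycle.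
by rewrite (linearB (g i)).
Qed.
Lemma hiso_compl X Y Z (g : chain_map Y Z) (f : chain_map X Y) i :
  hiso f i -> hiso (chain_comp g f) i -> hiso g i.
Proof.
move=> [fi fs] [ci cs]; split=> [y hy h|z hz].
  have [x [hx ex]] := fs y hy; apply: boundary_sub (ex) _; apply: (cmap_boundary f).
  apply: ci => //; rewrite /= -[g i (f i x)](subKr (g i y)); apply: boundaryB => //.
  by rewrite -(linearB (g i)); apply: (cmap_boundary g).
have [x [hx ex]] := cs z hz; exists (f i x); split=> //; exact: cmap_cycle.
Qed.
Lemma hiso_zero X Y (f : chain_map X Y) i : hiso f i ->
  (homology_zero X i <-> homology_zero Y i).
Proof.
move=> [fi fs]; split=> h.
  move=> y hy; have [x [hx ex]] := fs y hy; apply: boundary_sub (ex) _.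
  by apply: cmap_boundary; apply: h.
by move=> x hx; apply: fi => //; apply: h; apply: cmap_cycle.
Qed.
Lemma hiso_id X i : hiso (chain_id X) i.
Proof. by split=> [x //|y hy]; exists y; rewrite /= subrr; split=> //; apply: boundary0. Qed.
Lemma hiso_fg X Y (f : chain_map X Y) i : hiso f i -> homology_fg X i -> homology_fg Y i.
Proof.
move=> [_ fs] [n [g [hg gen]]]; exists n, (fun k => f i (g k)); split=> [k|z hz].
  exact: cmap_cycle.
have [x [hx ex]] := fs z hz; have [c hc] := gen x hx; exists c.
rewrite (_ : _ - _ = (z - f i x) + f i (x - \sum_k c k *: g k)).
  by apply: boundaryD => //; apply: cmap_boundary.
rewrite (linearB (f i)) (linear_sum (f i)).
by under [in RHS]eq_bigr do rewrite (linearZ_LR (f i)); zmod.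
Qed.
Lemma hiso_fgr X Y (f : chain_map X Y) i : hiso f i -> homology_fg Y i -> homology_fg X i.
Proof.
move=> [fi fs] [n [g [hg gen]]].
have [g' hg'] := choice (fun k => fs (g k) (hg k)).
exists n, g'; split=> [k|z hz]; first by case: (hg' k).
have [c hc] := gen _ (cmap_cycle f hz); exists c; apply: fi.
  apply: cycleB => //; apply: (submod_sum (P := cycles X i)) => k _.
  by apply: submodZ; case: (hg' k).
have E : f i (z - \sum_k c k *: g' k) =
    (f i z - \sum_k c k *: g k) + \sum_k c k *: (g k - f i (g' k)).
  rewrite (linearB (f i)) (linear_sum (f i)).
  under [in LHS]eq_bigr do rewrite (linearZ_LR (f i)).
  under [X in _ = _ + X]eq_bigr do rewrite scalerBr.
  by rewrite sumrB; zmod.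
rewrite E; apply: boundaryD => //; apply: (submod_sum (P := boundaries Y i)) => k _.
by apply: submodZ; case: (hg' k).
Qed.

Lemma cscale_subproof X (r : R) i j (x : X i) :
  scale_lin (X j) r (diff X i j x) = diff X i j (scale_lin (X i) r x).
Proof. by rewrite /= linearZ_LR. Qed.
Definition cscale X (r : R) : chain_map X X := ChainMap (cscale_subproof r).

Lemma czero_subproof X Y i j (x : X i) : (0 : Y j) = diff Y i j 0.
Proof. by rewrite linear0. Qed.
Definition czero X Y : chain_map X Y := @ChainMap _ X Y (fun i => \0) (@czero_subproof X Y).

Lemma linear_sub (M N : lmodType R) (f g : {linear M -> N}) : linear (fun x => f x - g x).
Proof. by move=> a x y; rewrite (linearP f) (linearP g) scalerBr; zmod. Qed.
Lemma linear_add (M N : lmodType R) (f g : {linear M -> N}) : linear (fun x => f x + g x).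
Proof. by move=> a x y; rewrite (linearP f) (linearP g) scalerDr; zmod. Qed.
Lemma linear_comp (M N P : lmodType R) (g : {linear N -> P}) (f : {linear M -> N}) :
  linear (fun x => g (f x)).
Proof. by move=> a x y; rewrite (linearP f) (linearP g). Qed.
Lemma linear_scalef (M N : lmodType R) (r : R) (f : {linear M -> N}) : linear (fun x => r *: f x).
Proof. by move=> a x y; rewrite (linearP f) scalerDr !scalerA mulrC. Qed.

End Cycles.

Section Diag.
Variables (R : comPzRingType) (X Y : complex R) (f : chain_map X Y).

Lemma diag_funE i (x : X i) : diag_fun f i x = f i x.
Proof. by rewrite /diag_fun; case: (i =P i) => // e; rewrite (eq_axiomK e). Qed.
Lemma diag_fun_ne i j (x : X i) : i != j -> diag_fun f j x = 0.
Proof. by rewrite /diag_fun; case: (i =P j). Qed.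
Definition diag_lin i j : {linear X i -> Y j} := lin_of (@diag_linear _ _ _ f i j).
Lemma diag_linE i j x : diag_lin i j x = diag_fun f j x. Proof. by []. Qed.
Lemma diag_fun0 i j : diag_fun f j (0 : X i) = 0. Proof. exact: (linear0 (diag_lin i j)). Qed.
Lemma diff_diag i j k (x : X i) :
  diff Y j k (diag_fun f j x) = diag_fun f k (diff X i (j - 1) x).
Proof.
have [e|ne] := eqVneq i j; last first.
  by rewrite diag_fun_ne // linear0 diff_shape ?subrK // diag_fun0.
subst j; rewrite diag_funE -cmap_diff.
have [e|ne] := eqVneq (i - 1) k; first by subst k; rewrite diag_funE.
rewrite diag_fun_ne // diff_shape ?linear0 //.
by apply: contraNneq ne => ->; rewrite addrK.
Qed.
End Diag.

Section Cone.
Variables (R : comPzRingType) (X Y : complex R) (f : chain_map X Y).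

Definition cone_obj (i : int) : lmodType R := (X (i - 1) * Y i)%type.
(** [diag_fun f j] is [f] from degree [i - 1] to degree [j], and zero unless the two agree; thus the
    cone is formed without transport along equalities of degrees. *)
Definition cone_fun (i j : int) (z : cone_obj i) : cone_obj j :=
  (- diff X (i - 1) (j - 1) z.1, diag_fun f j z.1 + diff Y i j z.2).
Fact cone_fun_linear i j : linear (@cone_fun i j).
Proof.
move=> a x y; congr pair; rewrite /=.
  by rewrite (linearP (diff X _ _)) opprD scalerN.
rewrite (linearP (diff Y _ _)) -diag_linE (linearP (diag_lin f _ _)) /= scalerDr; zmod.
Qed.
Fact cone_shape i j (z : cone_obj i) : i != j + 1 -> lin_of (@cone_fun_linear i j) z = 0.
Proof.
move=> ne; congr pair; rewrite /= diff_shape ?oppr0 //.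
  by apply: contraNneq ne => /(congr1 (+%R^~ 1)); rewrite !subrK => ->.
by rewrite addr0 diag_fun_ne //; apply: contraNneq ne => <-; rewrite subrK.
Qed.
Fact cone_dd i j k (z : cone_obj i) :
  lin_of (@cone_fun_linear j k) (lin_of (@cone_fun_linear i j) z) = 0.
Proof.
congr pair; rewrite /=; first by rewrite linearN diff_diff oppr0 oppr0.
rewrite linearD diff_diff addr0 diff_diag -!diag_linE linearN; by rewrite addNr.
Qed.
Definition cone : complex R := Complex cone_shape cone_dd.

Lemma cone_diff i j (z : cone i) : diff cone i j z = cone_fun j z. Proof. by []. Qed.

Lemma cone_cycleP i (z : cone i) :
  is_cycle z <-> is_cycle z.1 /\ f (i - 1) z.1 + diff Y i (i - 1) z.2 = 0.
Proof.
rewrite {1}/is_cycle cone_diff /cone_fun diag_funE; split=> [[/eqP]|[e1 e2]].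
  by rewrite oppr_eq0 => /eqP.
by rewrite (_ : diff X _ _ _ = 0) ?e2 ?oppr0.
Qed.

(** Trades the component in [X (i + 1 - 1)] for one in [X i]. *)
Lemma cone_boundaryP i (z : cone i) :
  is_boundary z <-> exists (x : X i) (y : Y (i + 1)),
    z = (- diff X i (i - 1) x, f i x + diff Y (i + 1) i y).
Proof.
split=> [[[x y]]|[x [y ->]]].
  rewrite cone_diff /cone_fun /= => <-.
  have e : i + 1 - 1 = i by rewrite addrK.
  by move: x; rewrite e => x; exists x, y; rewrite diag_funE.
have e : i + 1 - 1 = i by rewrite addrK.
have [x' hx'] : exists x' : X (i + 1 - 1), (- diff X (i + 1 - 1) (i - 1) x', diag_fun f i x') =
    (- diff X i (i - 1) x, f i x).
  by rewrite e; exists x; rewrite diag_funE.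
case: hx' => e1 e2; exists (x', y); by rewrite cone_diff /cone_fun /= e1 e2.
Qed.

(** The long exact sequence of the cone at a single degree. *)
Lemma cone_zeroP i : homology_zero cone i <-> hinj f (i - 1) /\ hsurj f i.
Proof.
split=> [h|[fi fs] z /cone_cycleP [hz1 hz2]].
  split=> [x hx /boundary_pred [y' hy']|y hy].
    have /h /cone_boundaryP [x' [_ [E _]]] : is_cycle ((x, - y') : cone i).
      by apply/cone_cycleP; rewrite /= linearN hy' subrr.
    rewrite E; apply: boundaryN; exact: boundary_diff.
  have /h /cone_boundaryP [x [y' [/eqP E1 E2]]] : is_cycle ((0, y) : cone i).
    apply/cone_cycleP; rewrite /= linear0 add0r; split=> //; exact: cycle0.
  exists x; split; first by move: E1; rewrite eq_sym oppr_eq0 => /eqP.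
  by rewrite E2 addrC addKr; apply: boundary_diff.
have hx : is_boundary z.1.
  apply: fi => //; move/eqP: hz2; rewrite addr_eq0 => /eqP ->.
  by apply: boundaryN; apply: boundary_diff.
have [x ex] := boundary_pred hx.
have [x' [hx' [y' ey']]] : exists x', is_cycle x' /\ is_boundary (z.2 + f i x - f i x').
  apply: fs; rewrite /is_cycle linearD -cmap_diff ex; apply: etrans hz2; exact: addrC.
apply/cone_boundaryP; exists (x' - x), y'.
rewrite [z]surjective_pairing linearB hx' ex sub0r opprK; congr pair.
by rewrite ey' linearB; zmod.
Qed.

Lemma cone_acyclicP : acyclic cone <-> quasi_iso f.
Proof.
split=> [h i|h i]; last by apply/cone_zeroP; split; [case: (h (i - 1))|case: (h i)].
have /cone_zeroP [_ ?] := h i; have /cone_zeroP [] := h (i + 1).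
by rewrite addrK.
Qed.

(** The homology of the cone is an extension of the kernel of [f] on [H_(i-1)] by a quotient of
    [H_i Y]. The kernel is finitely generated since [R] is Noetherian; its generators [x] are
    completed to cycles [(x, l x)]. *)
Lemma cone_fg (hR : noetherian R) i :
  homology_fg X (i - 1) -> homology_fg Y i -> homology_fg cone i.
Proof.
move/homology_fgP => hX /homology_fgP [t [ht gent]]; apply/homology_fgP.
pose Pp (x : X (i - 1)) := is_cycle x /\ is_boundary (f (i - 1) x).
have P0 : Pp 0 by split; rewrite ?linear0; [apply: cycle0|apply: boundary0].
have PD x y : Pp x -> Pp y -> Pp (x + y).
  by move=> [? ?] [? ?]; split; rewrite ?linearD; [apply: cycleD|apply: boundaryD].
have PZ a x : Pp x -> Pp (a *: x).
  by move=> [? ?]; split; rewrite ?linearZ_LR; [apply: cycleZ|apply: boundaryZ].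
have [s [hs gens]] : fgr (Submod P0 PD PZ) (boundaries X (i - 1)).
  apply: (noetherian_fgr hR (Z := cycles X (i - 1))) => //; last by move=> x [].
  move=> x hx; split; [exact: boundary_cycle|exact: cmap_boundary].
have lift x : exists y : Y i, Pp x -> f (i - 1) x + diff Y i (i - 1) y = 0.
  case: (pselect (Pp x)) => [[_ /boundary_pred [y e]]|np]; last by exists 0.
  by exists (- y) => _; rewrite linearN e subrr.
have [l hl] := choice lift.
exists ([seq (x, l x) : cone i | x <- s] ++ [seq (0, y) : cone i | y <- t]); split=> [g|z].
  rewrite mem_cat => /orP [/mapP [x xs ->]|/mapP [y yt ->]]; apply/cone_cycleP => /=.
    by have [? ?] := hs x xs; split=> //; apply: hl.
  rewrite linear0 add0r; split; [exact: cycle0|exact: ht].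
set G := _ ++ _ => /cone_cycleP [hz1 hz2].
have [b [hb sp]] : exists b, is_boundary b /\ spanned s (z.1 - b).
  apply: gens; split=> //; move/eqP: hz2; rewrite addr_eq0 => /eqP ->.
  by apply: boundaryN; apply: boundary_diff.
have [x0 hx0] := boundary_pred hb.
have [w [sw ew]] : exists w : cone i, spanned G w /\ w.1 = z.1 - b /\ is_cycle w.
  have sub : forall g, g \in s -> spanned G ((g, l g) : cone i) /\ is_cycle ((g, l g) : cone i).
    move=> g gs; split; first by apply: spanned_mem; rewrite mem_cat map_f.
    by apply/cone_cycleP; have [? ?] := hs g gs; split=> //; apply: hl.
  elim: (s) sub (z.1 - b) sp => [_ x /= ->|g s' IH sub x [r hx]].
    by exists 0; split; [apply: spanned0|split=> //; apply: cycle0].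
  have [|w [sw [ew cw]]] := IH _ _ hx; first by move=> v vs; apply: sub; rewrite inE vs orbT.
  have [sg cg] := sub g (mem_head _ _).
  exists (w + r *: ((g, l g) : cone i)); split; first by apply: spannedD => //; apply: spannedZ.
  by split; [rewrite /= ew subrK|apply: cycleD => //; apply: cycleZ].
have [ew1 /cone_cycleP [_ ew2]] := ew.
pose u : Y i := z.2 - w.2 + f i x0.
have cu : is_cycle u.
  have -> : is_cycle u = (diff Y i (i - 1) u = 0) by [].
  rewrite /u linearD linearB -cmap_diff hx0.
  have E1 : diff Y i (i - 1) z.2 = - f (i - 1) z.1 by apply/eqP; rewrite -addr_eq0; apply/eqP; apply: etrans hz2; apply: addrC.
  have E2 : diff Y i (i - 1) w.2 = - f (i - 1) w.1 by apply/eqP; rewrite -addr_eq0; apply/eqP; apply: etrans ew2; apply: addrC.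
  by rewrite E1 E2 ew1 linearB; zmod.
have [b' [hb' sp']] := gent u cu.
exists ((b, b' - f i x0) : cone i); split.
  case: hb' => y' ey'; apply/cone_boundaryP; exists (- x0), y'.
  by rewrite !linearN hx0 opprK ey'; congr pair; zmod.
rewrite (_ : _ - _ = w + ((0, u - b') : cone i)).
  apply: spannedD => //.
  have sub y : y \in t -> spanned G ((0, y) : cone i).
    by move=> yt; apply: spanned_mem; rewrite mem_cat map_f ?orbT.
  elim: (t) sub (u - b') sp' => [_ y /= ->|g t' IH sub y [r hy]]; first exact: spanned0.
  have -> : (0, y) = ((0, y - r *: g) : cone i) + r *: ((0, g) : cone i).
    by congr pair; rewrite /= ?scaler0 ?addr0 ?subrK.
  apply: spannedD; first by apply: IH hy => v vt; apply: sub; rewrite inE vt orbT.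
  by apply/spannedZ/sub/mem_head.
rewrite [z in LHS]surjective_pairing [w]surjective_pairing; congr pair; rewrite /= ?ew1 ?addr0 //.
by rewrite /u; zmod.
Qed.
End Cone.

Section ShortExact.
Variables (R : comPzRingType) (A B C : complex R) (f : chain_map A B) (g : chain_map B C).
Hypotheses (fI : forall i, injective (f i)) (gS : forall i y, exists x, g i x = y)
  (gf : forall i x, g i (f i x) = 0) (ex : forall i y, g i y = 0 -> exists x, f i x = y).

Lemma ses_right i : homology_zero B i -> homology_zero A (i - 1) -> homology_zero C i.
Proof.
move=> hB hA c hc; have [b hb] := gS c.
have [a ha] : exists a, f (i - 1) a = diff B i (i - 1) b.
  by apply: ex; rewrite cmap_diff hb hc.
have /hA ea' : is_cycle a by apply: fI; rewrite cmap_diff ha diff_diff linear0.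
have [a'' ha''] := boundary_pred ea'.
have /hB hb' : is_cycle (b - f i a'').
  by rewrite /is_cycle linearB -cmap_diff ha'' ha subrr.
have -> : c = g i (b - f i a'') by rewrite linearB gf hb subr0.
exact: cmap_boundary.
Qed.

End ShortExact.

(** * Homotopies and complexes of homomorphisms *)

Section HomologyEquality.
Variable R : comPzRingType.
Implicit Types X Y Z : complex R.

(** Equality on homology. The effect of a homotopy on [pre] and [bid] is stated in this form, weaker
    than homotopy, which already transports quasi-isomorphisms. *)
Definition heqv X Y (f g : chain_map X Y) := forall i (x : X i), is_cycle x -> is_boundary (f i x - g i x).

Lemma heqv_hiso X Y (f g : chain_map X Y) i : heqv f g -> hiso f i -> hiso g i.
Proof.
move=> h [fi fs]; split=> [x hx hb|y hy].
  by apply: fi => //; rewrite -(subrK (g i x) (f i x)); apply: boundaryD => //; apply: h.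
have [x [hx e]] := fs y hy; exists x; split=> //.
rewrite (_ : _ - _ = (y - f i x) + (f i x - g i x)); last by zmod.
by apply: boundaryD => //; apply: h.
Qed.
Lemma heqv_sym X Y (f g : chain_map X Y) : heqv f g -> heqv g f.
Proof. by move=> h i x hx; rewrite -opprB; apply/boundaryN/h. Qed.
Lemma heqv_quasi_iso X Y (f g : chain_map X Y) : heqv f g -> quasi_iso f -> quasi_iso g.
Proof. by move=> h fq i; apply: heqv_hiso h (fq i). Qed.
Lemma heqv_inv_quasi_iso X Y (f : chain_map X Y) (g : chain_map Y X) :
  heqv (chain_comp g f) (chain_id X) -> heqv (chain_comp f g) (chain_id Y) -> quasi_iso f.
Proof.
move=> gf fg i; split=> [x hx hb|y hy].
  have := gf i x hx; rewrite /= => h.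
  by rewrite -[x](subKr (g i (f i x))); apply: boundaryB => //; apply: (cmap_boundary g).
exists (g i y); split; first exact: cmap_cycle.
by rewrite -opprB; apply/boundaryN/(fg i y hy).
Qed.
End HomologyEquality.

Section HomComplexes.
Variable R : comPzRingType.
Implicit Types X Y Z : complex R.

Definition hom_lin X Y n (f : hom_deg X Y n) i j : {linear X i -> Y j} := lin_of (@hom_linear _ _ _ _ f i j).
Lemma hom_lin0 X Y n (f : hom_deg X Y n) i j : f i j 0 = 0.
Proof. exact: (linear0 (hom_lin f i j)). Qed.
Lemma hom_linD X Y n (f : hom_deg X Y n) i j x y : f i j (x + y) = f i j x + f i j y.
Proof. exact: (linearD (hom_lin f i j)). Qed.
Lemma hom_linB X Y n (f : hom_deg X Y n) i j x y : f i j (x - y) = f i j x - f i j y.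
Proof. exact: (linearB (hom_lin f i j)). Qed.
Lemma hom_linN X Y n (f : hom_deg X Y n) i j x : f i j (- x) = - f i j x.
Proof. exact: (linearN (hom_lin f i j)). Qed.
Lemma homBE X Y n (f g : hom_deg X Y n) i j x : (f - g) i j x = f i j x - g i j x.
Proof. by []. Qed.

Lemma hom_diffE X Y (n m : int) (f : hom_deg X Y n) (i j k l : int) (x : X i) :
  n = m + 1 -> k = j + 1 -> l = i - 1 ->
  hom_diff m f i j x = diff Y k j (f i k x) - hsign R n *: f l j (diff X i l x).
Proof. by move=> nm -> ->; rewrite /= /hom_diff_fun ifT //; apply/eqP. Qed.
Lemma hom_diff_ne X Y (n m : int) (f : hom_deg X Y n) (i j : int) (x : X i) :
  n != m + 1 -> hom_diff m f i j x = 0.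
Proof. by move=> /negPf nm; rewrite /= /hom_diff_fun nm. Qed.

Lemma hom_cycleP X Y n (f : hom_complex X Y n) : is_cycle f <->
  forall i j (x : X i), diff Y (j + 1) j (hom_fun f i (j + 1) x) =
    hsign R n *: hom_fun f (i - 1) j (diff X i (i - 1) x).
Proof.
have E i j x := @hom_diffE X Y n (n - 1) f i j (j + 1) (i - 1) x (esym (subrK 1 n)) erefl erefl.
split=> [h i j x|h].
  apply/eqP; rewrite -subr_eq0; apply/eqP; rewrite -E.
  exact: (congr1 (fun g : hom_deg X Y (n - 1) => g i j x) h).
by apply: hom_ext => i j x; apply: etrans (E i j x) _; rewrite h subrr.
Qed.

Lemma hom_boundaryP X Y n (f : hom_complex X Y n) : is_boundary f <->
  exists h : hom_deg X Y (n + 1), forall i j (x : X i), hom_fun f i j x =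
    diff Y (j + 1) j (h i (j + 1) x) + hsign R n *: h (i - 1) j (diff X i (i - 1) x).
Proof.
have E (h : hom_deg X Y (n + 1)) i j x :=
   @hom_diffE X Y (n + 1) n h i j (j + 1) (i - 1) x erefl erefl erefl.
split=> [[h e]|[h e]]; exists h.
  by move=> i j x; rewrite -e; apply: etrans (E h i j x) _; rewrite hsignS scaleNr opprK.
by apply: hom_ext => i j x; apply: etrans (E h i j x) _; rewrite hsignS scaleNr opprK e.
Qed.

Lemma hom_cycle_at X Y n (f : hom_complex X Y n) : is_cycle f -> forall i j k l (x : X i),
  k = j + 1 -> l = i - 1 ->
  diff Y k j (hom_fun f i k x) = hsign R n *: hom_fun f l j (diff X i l x).
Proof. by move=> /hom_cycleP h i j k l x -> ->. Qed.

Section Post.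
Variables (X Y Y' : complex R) (g : chain_map Y Y').
Fact post_lin n (f : hom_deg X Y n) i j : linear (fun x => g j (f i j x)).
Proof. by move=> a x y; rewrite hom_linear linearP. Qed.
Fact post_shape n (f : hom_deg X Y n) i j x : j != i + n -> g j (f i j x) = 0.
Proof. by move=> /hom_shape ->; rewrite linear0. Qed.
Definition post_fun n (f : hom_complex X Y n) : hom_complex X Y' n :=
  HomDeg (post_lin f) (@post_shape n f).
Fact post_linear n : linear (@post_fun n).
Proof. by move=> a u v; apply: hom_ext => i j x; exact: (linearP (g j)). Qed.
Fact post_diff n m (f : hom_complex X Y n) :
  lin_of (@post_linear m) (diff (hom_complex X Y) n m f)
  = diff (hom_complex X Y') n m (lin_of (@post_linear n) f).
Proof.
apply: hom_ext => i j x; rewrite /= /hom_diff_fun; case: ifP => _; last by rewrite linear0.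
by rewrite linearB linearZ_LR cmap_diff.
Qed.
Definition post : chain_map (hom_complex X Y) (hom_complex X Y') := ChainMap post_diff.
Lemma postE n (f : hom_complex X Y n) i j x : hom_fun (post n f) i j x = g j (hom_fun f i j x).
Proof. by []. Qed.
End Post.

Section Pre.
Variables (X X' Y : complex R) (g : chain_map X' X).
Fact pre_lin n (f : hom_deg X Y n) i j : linear (fun x => f i j (g i x)).
Proof. by move=> a x y; rewrite linearP hom_linear. Qed.
Fact pre_shape n (f : hom_deg X Y n) i j x : j != i + n -> f i j (g i x) = 0.
Proof. by move=> /hom_shape ->. Qed.
Definition pre_fun n (f : hom_complex X Y n) : hom_complex X' Y n :=
  HomDeg (pre_lin f) (@pre_shape n f).
Fact pre_linear n : linear (@pre_fun n).
Proof. by move=> a u v; apply: hom_ext. Qed.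
Fact pre_diff n m (f : hom_complex X Y n) :
  lin_of (@pre_linear m) (diff (hom_complex X Y) n m f)
  = diff (hom_complex X' Y) n m (lin_of (@pre_linear n) f).
Proof.
apply: hom_ext => i j x; rewrite /= /hom_diff_fun; case: ifP => _ //.
congr (_ - _ *: _).
change (hom_fun f (i - 1) j (diff X i (i - 1) (g i x)) = hom_fun f (i - 1) j (g (i - 1) (diff X' i (i - 1) x))).
by rewrite cmap_diff.
Qed.
Definition pre : chain_map (hom_complex X Y) (hom_complex X' Y) := ChainMap pre_diff.
Lemma preE n (f : hom_complex X Y n) i j x : hom_fun (pre n f) i j x = hom_fun f i j (g i x).
Proof. by []. Qed.
End Pre.

Definition cyc X Y (f : chain_map X Y) : hom_complex X Y 0 := diag f.
Lemma cycE X Y (f : chain_map X Y) i x : hom_fun (cyc f) i i x = f i x.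
Proof. exact: diag_funE. Qed.
Lemma cyc_cycle X Y (f : chain_map X Y) : is_cycle (cyc f).
Proof. exact: diag_cycle. Qed.
Lemma hom0_ext X Y (f g : hom_complex X Y 0) :
  (forall i x, hom_fun f i i x = hom_fun g i i x) -> f = g.
Proof.
move=> h; apply: hom_ext => i j x; have [<-//|ne] := eqVneq i j.
by rewrite !hom_shape // addr0 eq_sym.
Qed.
Lemma post_cyc X Y Z (g : chain_map Y Z) (f : chain_map X Y) :
  post X g 0 (cyc f) = cyc (chain_comp g f).
Proof. by apply: hom0_ext => i x; rewrite postE !cycE. Qed.
Lemma pre_cyc X Y Z (g : chain_map Y Z) (f : chain_map X Y) :
  pre Z f 0 (cyc g) = cyc (chain_comp g f).
Proof. by apply: hom0_ext => i x; rewrite preE !cycE. Qed.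

Section OfCycle.
Variables (X Y : complex R) (u : hom_complex X Y 0) (hu : is_cycle u).
Fact of_cycle_diff i j (x : X i) :
  hom_lin u j j (diff X i j x) = diff Y i j (hom_lin u i i x).
Proof.
have [e|ne] := eqVneq i (j + 1); last by rewrite !diff_shape ?linear0.
have := hom_cycle_at hu (i := i) (j := j) (k := i) (l := j) x e.
by rewrite /hsign expr0 scale1r /= => ->; rewrite // e addrK.
Qed.
Definition of_cycle : chain_map X Y := ChainMap of_cycle_diff.
Lemma of_cycleK : cyc of_cycle = u.
Proof. by apply: hom0_ext => i x; rewrite cycE. Qed.
End OfCycle.

(** Makes homotopy a statement about [H_0] of the complex of homomorphisms, so that lifting along a
    quasi-isomorphism is surjectivity on [H_0] and cancelling it is injectivity. *)
Lemma homotopicP X Y (f g : chain_map X Y) : homotopic f g <-> is_boundary (cyc f - cyc g).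
Proof.
split=> [[h e]|/hom_boundaryP [h e]]; last first.
  exists (fun i j => hom_lin h i j) => i x; have := e i i x.
  by rewrite /hsign expr0 scale1r homBE !cycE.
(* A homotopy in the sense of [homotopic] may have arbitrary components in other degrees; only those
   of degree one are kept. *)
pose hf i j (x : X i) : Y j := if j == i + 1 then h i j x else 0.
have hl i j : linear (@hf i j).
  by move=> a x y; rewrite /hf; case: ifP => _; rewrite ?linearP ?scaler0 ?addr0.
have hs i j x : j != i + (0 + 1) -> @hf i j x = 0.
  by rewrite add0r /hf => /negPf ->.
apply/hom_boundaryP; exists (HomDeg hl hs) => i j x.
rewrite /hsign expr0 scale1r homBE.
change (cyc f i j x - cyc g i j x = diff Y (j + 1) j (hf i (j + 1) x) +
   hf (i - 1) j (diff X i (i - 1) x)).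
have [<-|ne] := eqVneq i j; first by rewrite !cycE e /hf eqxx subrK eqxx.
have ne' : (j == i) = false by apply/eqP => E; rewrite E eqxx in ne.
have z (w : hom_complex X Y 0) : hom_fun w i j x = 0 by apply: hom_shape; rewrite addr0 ne'.
by rewrite /hf subrK (inj_eq (addIr 1)) ne' !z subrr linear0 addr0.
Qed.

Lemma homotopic_eq X Y (f g : chain_map X Y) : (forall i x, f i x = g i x) -> homotopic f g.
Proof.
move=> h; apply/homotopicP; have -> : cyc f = cyc g by apply: hom0_ext => i x; rewrite !cycE h.
by rewrite subrr; apply: boundary0.
Qed.
Lemma homotopic_sym X Y (f g : chain_map X Y) : homotopic f g -> homotopic g f.
Proof. by move=> /homotopicP h; apply/homotopicP; rewrite -opprB; apply: boundaryN. Qed.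
Lemma homotopic_trans X Y (f g h : chain_map X Y) :
  homotopic f g -> homotopic g h -> homotopic f h.
Proof.
move=> /homotopicP fg /homotopicP gh; apply/homotopicP.
by rewrite (_ : _ - _ = (cyc f - cyc g) + (cyc g - cyc h)); [apply: boundaryD|zmod].
Qed.
Lemma homotopic_post X Y Z (f g : chain_map X Y) (k : chain_map Y Z) :
  homotopic f g -> homotopic (chain_comp k f) (chain_comp k g).
Proof.
move=> /homotopicP fg; apply/homotopicP; rewrite -!post_cyc -linearB.
exact: cmap_boundary.
Qed.
Lemma homotopic_pre X Y Z (f g : chain_map Y Z) (k : chain_map X Y) :
  homotopic f g -> homotopic (chain_comp f k) (chain_comp g k).
Proof.
move=> /homotopicP fg; apply/homotopicP; rewrite -!pre_cyc -linearB.
exact: cmap_boundary.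
Qed.

Lemma homotopic_heqv X Y (f g : chain_map X Y) : homotopic f g -> heqv f g.
Proof.
move=> [h e] i x hx; rewrite e hx linear0 addr0; exact: boundary_diff.
Qed.

Definition comp_homotopy X X' Y n (u : hom_deg X Y n) (h : forall i j, {linear X' i -> X j}) :
  hom_deg X' Y (n + 1).
Proof.
exists (fun i j x => u (i + 1) j (h i (i + 1) x)).
  by move=> i j a x y; rewrite linearP hom_linear.
by move=> i j x ne; rewrite hom_shape //; apply: contraNneq ne => ->; apply/eqP; ring.
Defined.

Lemma pre_homotopic X X' Y (f g : chain_map X' X) : homotopic f g -> heqv (pre Y f) (pre Y g).
Proof.
move=> [h e] n u hu; apply/hom_boundaryP.
(* Moving the differential past the cycle [u] costs the sign of [n], which this scalar cancels. *)
exists (hsign R n *: comp_homotopy u h) => i j x.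
rewrite homBE !preE -hom_linB e hom_linD !homZE /=.
rewrite linearZ_LR (hom_cycle_at hu (l := i)) ?addrK //.
rewrite !scalerA -hsignD.
have -> : hsign R (n + n) = 1 by rewrite hsignD hsign_sq.
rewrite !scale1r; congr (_ + _). 
Qed.

Definition heq X Y (f : chain_map X Y) := exists g : chain_map Y X,
  homotopic (chain_comp g f) (chain_id X) /\ homotopic (chain_comp f g) (chain_id Y).

Lemma heq_quasi_iso X Y (f : chain_map X Y) : heq f -> quasi_iso f.
Proof. by case=> g [h1 h2]; apply: (@heqv_inv_quasi_iso _ _ _ _ g); apply: homotopic_heqv. Qed.

Lemma pre_comp X X' X'' Y (f : chain_map X' X) (g : chain_map X'' X') n u :
  pre Y g n (pre Y f n u) = pre Y (chain_comp f g) n u.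
Proof. exact: hom_ext. Qed.
Lemma pre_id X Y n u : pre Y (chain_id X) n u = u. Proof. exact: hom_ext. Qed.

Lemma pre_heq X X' Y (f : chain_map X' X) : heq f -> quasi_iso (pre Y f).
Proof.
case=> g [h1 h2]; apply: (@heqv_inv_quasi_iso _ _ _ _ (pre Y g)) => n u hu.
  by have := pre_homotopic (Y := Y) h2 hu; rewrite pre_id -pre_comp.
by have := pre_homotopic (Y := Y) h1 hu; rewrite pre_id -pre_comp.
Qed.

Section HomCone.
Variables (P Y Z : complex R) (f : chain_map Y Z).
(** [g] is only required to act by [f] on values: besides [post P f] it will be multiplication by a
    scalar on [hom_complex], for Koszul complexes. *)
Variable g : chain_map (hom_complex P Y) (hom_complex P Z).
Hypothesis gE : forall n (u : hom_complex P Y n) i j x,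
  hom_fun (g n u) i j x = f j (hom_fun u i j x).

Fact hcone_lin n (z : cone g n) i j :
  linear (fun x => (hom_fun z.1 i (j - 1) x, hom_fun z.2 i j x) : cone f j).
Proof. by move=> a x y; congr pair; rewrite /= hom_linear. Qed.
Fact hcone_shape n (z : cone g n) i j x : j != i + n ->
  (hom_fun z.1 i (j - 1) x, hom_fun z.2 i j x) = 0 :> cone f j.
Proof.
move=> ne; congr pair; rewrite hom_shape //.
by rewrite addrA; apply: contraNneq ne => /addIr ->.
Qed.
Definition hcone_fun n (z : cone g n) : hom_complex P (cone f) n :=
  HomDeg (hcone_lin z) (@hcone_shape n z).
Fact hcone_linear n : linear (@hcone_fun n).
Proof. by move=> a u v; apply: hom_ext. Qed.

Fact hcone_diff n m (z : cone g n) :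
  lin_of (@hcone_linear m) (diff (cone g) n m z) =
  diff (hom_complex P (cone f)) n m (lin_of (@hcone_linear n) z).
Proof.
have [e|ne] := eqVneq n (m + 1); last by rewrite !diff_shape ?linear0.
have D1 k (u : hom_complex P Y k) i j x : k = m ->
    hom_fun (diag_fun g m u) i j x = f j (hom_fun u i j x).
  by move=> E; subst k; rewrite diag_funE gE.
have D2 k (u : hom_complex P Y k) i j l x : l = j ->
    diag_fun f j (hom_fun u i l x) = f j (hom_fun u i j x).
  by move=> E; subst l; rewrite diag_funE.
apply: hom_ext => i j x.
apply/esym; apply: etrans (@hom_diffE _ _ n m (hcone_fun z) i j (j + 1) (i - 1) x e erefl erefl) _.
congr pair; rewrite [LHS]/=.
  apply/esym.
  change (- hom_diff (m - 1) z.1 i (j - 1) x = - diff Y (j + 1 - 1) (j - 1) (hom_fun z.1 i (j + 1 - 1) x) -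
     hsign R n *: hom_fun z.1 (i - 1) (j - 1) (diff P i (i - 1) x)).
  rewrite (@hom_diffE _ _ (n - 1) (m - 1) z.1 i (j - 1) (j + 1 - 1) (i - 1)) //; try (rewrite ?e; ring).
  have -> : hsign R n = - hsign R (n - 1) by rewrite -hsignS subrK.
  by rewrite scaleNr; zmod.
apply/esym.
change (hom_fun (diag_fun g m z.1) i j x + hom_diff m z.2 i j x =
  diag_fun f j (hom_fun z.1 i (j + 1 - 1) x) + diff Z (j + 1) j (hom_fun z.2 i (j + 1) x)
  - hsign R n *: hom_fun z.2 (i - 1) j (diff P i (i - 1) x)).
rewrite D1 ?e ?addrK // D2 ?addrK //.
rewrite (@hom_diffE _ _ n m z.2 i j (j + 1) (i - 1)) //; by zmod.
Qed.
Definition hcone : chain_map (cone g) (hom_complex P (cone f)) := ChainMap hcone_diff.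

Lemma hcone_hiso i : hiso hcone i.
Proof.
apply: bij_hiso => n.
  move=> z z' /(congr1 (fun h : hom_deg _ _ _ => hom_fun h)) E.
  have {}E i' j x := congr1 (fun h => h i' j x) E.
  rewrite [z]surjective_pairing [z']surjective_pairing; congr pair; apply: hom_ext => k j x.
    by have := congr1 fst (E k (j + 1) x); rewrite /= addrK.
  exact: (congr1 snd (E k j x)).
move=> F.
have ul k j : linear (fun x => diag_fun (chain_id Y) j (hom_fun F k (j + 1) x).1).
  by move=> a x y; rewrite hom_linear; apply: (linearP (diag_lin (chain_id Y) _ _)).
have us k j x : j != k + (n - 1) -> diag_fun (chain_id Y) j (hom_fun F k (j + 1) x).1 = 0.
  move=> ne; rewrite hom_shape; first exact: diag_fun0.
  by apply: contraNneq ne => E; apply/eqP; rewrite addrA -E addrK.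
have vl k j : linear (fun x => (hom_fun F k j x).2).
  by move=> a x y; rewrite hom_linear.
have vs k j x : j != k + n -> (hom_fun F k j x).2 = 0.
  by move=> ne; rewrite hom_shape.
exists (HomDeg ul us, HomDeg vl vs); apply: hom_ext => k j x.
rewrite /= [RHS]surjective_pairing; congr pair.
have E l : l = j -> diag_fun (chain_id Y) (j - 1) (hom_fun F k l x).1 = (hom_fun F k j x).1.
  by move=> e; subst l; rewrite diag_funE.
by rewrite E // subrK.
Qed.
End HomCone.

(** The cone of [post P f] is [Hom (P, cone f)] by [hcone], and [cone f] is acyclic. *)
Lemma semiproj_post P Y Z (f : chain_map Y Z) : semiprojective P -> quasi_iso f -> quasi_iso (post P f).
Proof.
move=> [_ hP] /cone_acyclicP /hP h; apply/cone_acyclicP => i.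
apply: (hiso_zero (hcone_hiso (f := f) (g := post P f) (fun n u k j x => erefl) i)).2; exact: h.
Qed.

Lemma semiproj_lift P Y Z (q : chain_map Y Z) (f : chain_map P Z) :
  semiprojective P -> quasi_iso q -> exists g : chain_map P Y, homotopic (chain_comp q g) f.
Proof.
move=> hP hq; have [_ s] := semiproj_post hP hq 0.
have [u [hu e]] := s (cyc f) (cyc_cycle f); exists (of_cycle hu).
apply: homotopic_sym; apply/homotopicP; by rewrite -post_cyc of_cycleK.
Qed.
Lemma semiproj_cancel P Y Z (q : chain_map Y Z) (f g : chain_map P Y) :
  semiprojective P -> quasi_iso q -> homotopic (chain_comp q f) (chain_comp q g) -> homotopic f g.
Proof.
move=> hP hq /homotopicP h; have [i _] := semiproj_post hP hq 0.
apply/homotopicP; apply: i; first by apply: cycleB; apply: cyc_cycle.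
by rewrite linearB !post_cyc.
Qed.
Lemma comp_assoc_homotopic X Y Z T (f : chain_map X Y) (g : chain_map Y Z) (h : chain_map Z T) :
  homotopic (chain_comp h (chain_comp g f)) (chain_comp (chain_comp h g) f).
Proof. exact: homotopic_eq. Qed.
Lemma semiproj_quasi_heq P Q (f : chain_map P Q) :
  semiprojective P -> semiprojective Q -> quasi_iso f -> heq f.
Proof.
move=> hP hQ hf; have [g hg] := semiproj_lift (chain_id Q) hQ hf; exists g; split=> //.
apply: (semiproj_cancel hP hf).
apply: homotopic_trans (comp_assoc_homotopic _ _ _) _.
apply: homotopic_trans (homotopic_pre f hg) _; exact: homotopic_eq.
Qed.
End HomComplexes.

(** * Existence of semiprojective resolutions *)

Section SemifreeResolution.
Variables (R : comPzRingType) (X : complex R).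

(* Generators of a semifree resolution: one for each cycle of [X], and one for
   each pair of a chain [z] of generators and an element [y] of degree [i], whose
   boundary is [z] and whose image in [X] is [y]. Only the valid ones are used. *)
Inductive rgen := rcyc (i : int) (x : X i) | ratt (z : seq (R * rgen)) (i : int) (y : X i).

Section Induction.
Variable P : rgen -> Prop.
Hypothesis (Pc : forall i x, P (@rcyc i x)).
Fixpoint all_snd (z : seq (R * rgen)) : Prop :=
  match z with [::] => True | p :: z' => P p.2 /\ all_snd z' end.
Hypothesis (Pa : forall z i y, all_snd z -> P (@ratt z i y)).
Fixpoint rgen_ind_snd g : P g := match g with
  | rcyc i x => Pc x
  | ratt z i y => Pa y ((fix F z : all_snd z := match z with
      [::] => I | p :: z' => conj (rgen_ind_snd p.2) (F z') end) z) end.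
End Induction.

HB.instance Definition _ := gen_eqMixin rgen.
HB.instance Definition _ := gen_choiceMixin rgen.

Lemma all_sndP (P : rgen -> Prop) z : all_snd P z <-> forall p, p \in z -> P p.2.
Proof.
elim: z => [|q z IH] /=; split=> //.
  by move=> [h1 /IH h2] p; rewrite inE => /orP [/eqP ->|/h2].
by move=> h; split; [apply: h; rewrite mem_head|apply/IH => p pz; apply: h; rewrite inE pz orbT].
Qed.

Definition rdeg g : int := match g with rcyc i _ => i | ratt _ i _ => i end.
Definition rbd g : seq (R * rgen) := match g with rcyc _ _ => [::] | ratt z _ _ => z end.
Definition rev_at g (j : int) : X j := match g with
  | rcyc i x => diag_fun (chain_id X) j x | ratt _ i y => diag_fun (chain_id X) j y end.

Definition allgen (_ : rgen) := True.
Notation F := (fsm R allgen).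
Definition gdelta (g : rgen) : F := @fs_delta R _ allgen g I.
Definition glin (z : seq (R * rgen)) : F := \sum_(p <- z) p.1 *: gdelta p.2.
(** [gD] and [gev] are defined on the free module on all generators, valid or not and of all degrees
    at once, because the validity of a generator is expressed through them. *)
Definition gD : {linear F -> F} := fs_ext allgen (fun g => glin (rbd g)).
Definition gev j : {linear F -> X j} := fs_ext allgen (fun g => rev_at g j).

Fixpoint rvalid g : Prop := match g with
  | rcyc i x => is_cycle x
  | ratt z i y => [/\ (fix V z : Prop := match z with [::] => True
          | p :: z' => (rvalid p.2 /\ rdeg p.2 + 1 = i) /\ V z' end) z,
      gD (glin z) = 0 & forall j, i = j + 1 -> gev j (glin z) = diff X i j y] end.

Lemma rvalid_ratt z i y : rvalid (@ratt z i y) <->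
  [/\ forall p, p \in z -> rvalid p.2 /\ rdeg p.2 + 1 = i, gD (glin z) = 0 &
      forall j, i = j + 1 -> gev j (glin z) = diff X i j y].
Proof. by split=> -[/(all_sndP (fun g => rvalid g /\ rdeg g + 1 = i)) h1 h2 h3]. Qed.

Definition gvalid (i : int) g := rvalid g /\ rdeg g = i.
Definition rP (i : int) : lmodType R := fsm R (gvalid i).
Definition rdl i g : rP i :=
  if pselect (gvalid i g) is left v then fs_delta R v else 0.
(** An injection into [F], where identities can be checked without proofs of validity. *)
Definition rincl i : {linear rP i -> F} := fs_ext (gvalid i) gdelta.

Lemma rdlE i g (v : gvalid i g) : rdl i g = fs_delta R v.
Proof. by rewrite /rdl; case: pselect => // v'; rewrite (Prop_irrelevance v v'). Qed.

Lemma rincl_delta i g (v : gvalid i g) : rincl i (fs_delta R v) = gdelta g.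
Proof. exact: fs_ext_delta. Qed.

Lemma rinclE i (c : rP i) t : (rincl i c : F) t = (c : fsm _ _) t.
Proof.
have L1 : linear (fun c : rP i => ((rincl i c : F) t : R^o)).
  by move=> a x y; rewrite linearP.
have L2 : linear (fun c : rP i => ((c : fsm _ _) t : R^o)) by [].
apply: (@fsm_eq_lin _ _ _ _ (lin_of L1) (lin_of L2)) => g v.
by rewrite /= -[fs_ext_fun _ _]/(rincl i (fs_delta R v)) rincl_delta.
Qed.
Lemma rincl_inj i : injective (rincl i).
Proof. by move=> c c' e; apply: fsm_ext => t; rewrite -!rinclE e. Qed.

Definition rlin i (z : seq (R * rgen)) : rP i := \sum_(p <- z) p.1 *: rdl i p.2.
Lemma rincl_rlin i z : (forall p, p \in z -> gvalid i p.2) -> rincl i (rlin i z) = glin z.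
Proof.
move=> h; rewrite linear_sum /glin big_seq [RHS]big_seq; apply: eq_bigr => p /h v.
by rewrite linearZ_LR (rdlE v) rincl_delta.
Qed.

Definition rdiff i j : {linear rP i -> rP j} :=
  fs_ext (gvalid i) (fun g => if i == j + 1 then rlin j (rbd g) else 0).

Lemma bd_valid i j g : gvalid i g -> i = j + 1 -> forall p, p \in rbd g -> gvalid j p.2.
Proof.
case: g => // z i' y [/rvalid_ratt [h _ _] /= e] ij p /h [v d]; split=> //.
by apply: (addIr 1); rewrite d e.
Qed.

Lemma rincl_diff i j c : i = j + 1 -> rincl j (rdiff i j c) = gD (rincl i c).
Proof.
move=> ij; apply: (@fsm_eq_lin _ _ _ _ (lin_of (linear_comp (rincl j) (rdiff i j)))
  (lin_of (linear_comp gD (rincl i)))) => g v.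
rewrite /= -[fs_ext_fun _ (fs_delta R v)]/(rdiff i j (fs_delta R v)).
rewrite -[fs_ext_fun _ (fs_delta R v)]/(rincl i (fs_delta R v)) rincl_delta.
rewrite [rdiff _ _ _]fs_ext_delta ij eqxx.
rewrite -[fs_ext_fun _ (rlin _ _)]/(rincl j _) rincl_rlin; last exact: bd_valid ij.
by rewrite -[fs_ext_fun _ _]/(gD (gdelta g)) [RHS]fs_ext_delta.
Qed.

Fact rdiff_shape i j (c : rP i) : i != j + 1 -> rdiff i j c = 0.
Proof.
move=> /negPf ne; apply: (@fsm_eq_lin _ _ _ _ (rdiff i j) \0) => g v.
by rewrite fs_ext_delta ne.
Qed.

Lemma gD_bd i g : gvalid i g -> gD (glin (rbd g)) = 0.
Proof.
case: g => [i' x _|z i' y [/rvalid_ratt [_ h _] _] //].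
by rewrite /glin big_nil linear0.
Qed.

Fact rdiff_diff i j k (c : rP i) : rdiff j k (rdiff i j c) = 0.
Proof.
have [jk|ne] := eqVneq j (k + 1); last by rewrite rdiff_shape.
have [ij|ne] := eqVneq i (j + 1); last by rewrite [rdiff i j c]rdiff_shape ?linear0.
apply: (@fsm_eq_lin _ _ _ _ (lin_of (linear_comp (rdiff j k) (rdiff i j))) \0) => g v.
apply: (@rincl_inj k).
change (rincl k (rdiff j k (rdiff i j (fs_delta R v))) = rincl k 0); rewrite linear0.
rewrite !rincl_diff // rincl_delta [gD (gdelta g)]fs_ext_delta; exact: gD_bd v.
Qed.

Definition rcomplex : complex R := @Complex R rP rdiff rdiff_shape rdiff_diff.

Definition rev_lin i : {linear rcomplex i -> X i} := fs_ext (gvalid i) (fun g => rev_at g i).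
Lemma rev_lin_gev i j (c : rP i) : j = i -> gev j (rincl i c) = fs_ext (gvalid i) (fun g => rev_at g j) c.
Proof.
move=> ->; apply: (@fsm_eq_lin _ _ _ _ (lin_of (linear_comp (gev i) (rincl i))) (rev_lin i)) => g v.
change (gev i (rincl i (fs_delta R v)) = rev_lin i (fs_delta R v)); rewrite rincl_delta.
by rewrite [RHS]fs_ext_delta [LHS]fs_ext_delta.
Qed.
Lemma rev_lin_gev1 i (c : rP i) : rev_lin i c = gev i (rincl i c).
Proof. by rewrite rev_lin_gev. Qed.

Fact rev_diff i j (c : rcomplex i) : rev_lin j (diff rcomplex i j c) = diff X i j (rev_lin i c).
Proof.
have [ij|ne] := eqVneq i (j + 1); last by rewrite !diff_shape ?linear0.
apply: (@fsm_eq_lin _ _ _ _ (lin_of (linear_comp (rev_lin j) (rdiff i j)))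
  (lin_of (linear_comp (diff X i j) (rev_lin i)))) => g v.
change (rev_lin j (rdiff i j (fs_delta R v)) = diff X i j (rev_lin i (fs_delta R v))).
rewrite rev_lin_gev1 rincl_diff // rincl_delta [gD (gdelta g)]fs_ext_delta.
rewrite [rev_lin i _]fs_ext_delta; case: g v => [i' x [hx /= e]|z i' y [/rvalid_ratt [_ _ h] /= e]].
  subst i'; rewrite /glin big_nil diag_funE (cycle_diff _ hx); exact: (linear0 (gev j)).
by subst i'; rewrite diag_funE; apply: h.
Qed.
Definition rmap : chain_map rcomplex X := ChainMap rev_diff.

(** Every cycle of [X] is the image of a generator [rcyc]. A cycle [c] whose image bounds [y'] is
    the boundary of the generator [ratt z y'], where [z] lists the terms of [c]. The type [rgen]
    contains all stages of the usual iterated construction at once. *)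
Lemma rmap_quasi_iso : quasi_iso rmap.
Proof.
move=> i; split=> [c hc [y' hy']|y hy]; last first.
  have v : gvalid i (rcyc y) by split.
  exists (fs_delta R v : rcomplex i); split.
    have e : i = i - 1 + 1 by rewrite subrK.
    by rewrite /is_cycle; apply: etrans (fs_ext_delta _ _) _; rewrite -e eqxx /= /rlin big_nil.
  rewrite [rmap i _]fs_ext_delta /= diag_funE subrr; exact: boundary0.
pose z := [seq ((c : fsm _ _) t, t) | t <- fs_supp c & (c : fsm _ _) t != 0].
have zv p : p \in z -> gvalid i p.2.
  by move=> /mapP [t]; rewrite mem_filter => /andP [ne _] ->; apply: fs_valid ne.
have zE : glin z = rincl i c.
  rewrite /glin /z big_map big_filter.
  transitivity (\sum_(t <- fs_supp c) (c : fsm _ _) t *: gdelta t); last by [].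
  rewrite [RHS](bigID (fun t => (c : fsm _ _) t != 0)) /= [X in _ = _ + X]big1 ?addr0 //.
  by move=> t /negPn /eqP ->; rewrite scale0r.
have v : gvalid (i + 1) (ratt z y').
  split=> //; apply/rvalid_ratt; split.
  - by move=> p /zv [h1 h2]; rewrite h2.
  - rewrite zE -(@rincl_diff i (i - 1)) ?subrK //.
    by rewrite [rdiff _ _ _]hc linear0.
  - move=> j /addIr <-; by rewrite zE -rev_lin_gev1 hy'.
exists (fs_delta R v : rcomplex (i + 1)); apply: etrans (fs_ext_delta _ _) _.
by rewrite eqxx /=; apply: (@rincl_inj i); rewrite rincl_rlin.
Qed.

Section Lifting.
Variables (A : complex R) (hA : acyclic A) (n : int) (f : hom_complex rcomplex A n)
  (hf : is_cycle f).

(** A chosen primitive of [t], with default zero and spread over all degrees [j], so that the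
    recursion [rhty] requires no proof of validity. *)
Definition lift_bd (k : int) (t : A k) (j : int) : A j :=
  if pselect (exists a : A (k + 1), diff A (k + 1) k a = t) is left e
  then diag_fun (chain_id A) j (projT1 (cid e)) else 0.

Lemma lift_bdP k (t : A k) j : is_boundary t -> j = k + 1 -> diff A j k (lift_bd t j) = t.
Proof.
move=> h ->; rewrite /lift_bd; case: pselect => [e|[]//].
by rewrite diag_funE; apply: (projT2 (cid e)).
Qed.

(** The null-homotopy on generators, by recursion on their nesting: a primitive of the value of [f]
    corrected by the homotopy on the boundary. For valid generators the corrected value is a cycle,
    as [rhtyP] shows. *)
Fixpoint rhty g : forall j, A j := match g with
  | rcyc i x => lift_bd (hom_fun f i (i + n) (rdl i (rcyc x)))
  | ratt z i y => lift_bd (hom_fun f i (i + n) (rdl i (ratt z y))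
      - hsign R n *: (fix S z := match z with [::] => 0
          | p :: z' => p.1 *: rhty p.2 (i + n) + S z' end) z) end.

Definition ghty k : {linear F -> A k} := fs_ext allgen (fun g => rhty g k).

Lemma ghty_glin k z : ghty k (glin z) = \sum_(p <- z) p.1 *: rhty p.2 k.
Proof.
rewrite linear_sum; apply: eq_bigr => p _; rewrite linearZ_LR; congr (_ *: _).
exact: fs_ext_delta.
Qed.

Lemma rhtyE g : rhty g = lift_bd (hom_fun f (rdeg g) (rdeg g + n) (rdl (rdeg g) g)
  - hsign R n *: ghty (rdeg g + n) (glin (rbd g))).
Proof.
have g0 k : ghty k (glin [::]) = 0 by rewrite /glin big_nil linear0.
case: g => [i x|z i y].
  by rewrite g0 scaler0 subr0.
rewrite ghty_glin; congr (lift_bd (_ - _ *: _)) => /=.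
by elim: z => [|p z IH]; rewrite ?big_nil ?big_cons //= IH.
Qed.

Lemma rhtyP g : rvalid g -> forall i k l, rdeg g = i -> k = i + n -> l = k + 1 ->
  diff A l k (rhty g l) =
  hom_fun f i k (rdl i g) - hsign R n *: ghty k (glin (rbd g)).
Proof.
elim/rgen_ind_snd: g => [i x|z i y /all_sndP IH] vg i' k l <- -> -> {i' k l}.
  rewrite rhtyE lift_bdP //; apply: hA; rewrite [rdeg _]/= [rbd _]/=.
  apply: cycleB; last by rewrite (_ : ghty _ _ = 0) ?scaler0; [apply: cycle0|rewrite /glin big_nil linear0].
  rewrite /is_cycle (hom_cycle_at hf (l := i - 1)) ?subrK //.
  have v : gvalid i (rcyc x) by split.
  rewrite (rdlE v) [diff rcomplex _ _ _]fs_ext_delta subrK eqxx /rlin big_nil.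
  by rewrite hom_lin0 scaler0.
rewrite rhtyE lift_bdP //; apply: hA; rewrite [rdeg _]/= [rbd _]/=.
have v : gvalid i (ratt z y) by split.
rewrite /is_cycle linearB linearZ_LR (hom_cycle_at hf (l := i - 1)) ?subrK //.
rewrite -scalerBr (rdlE v) [diff rcomplex _ _ _]fs_ext_delta subrK eqxx [rbd _]/=.
have /rvalid_ratt [h1 h2 _] := vg.
(* The induction hypothesis is applied to each term of [z]. The last summand is the homotopy on the
   boundary of [z], which is zero for a valid generator. *)
have -> : diff A (i + n) (i + n - 1) (ghty (i + n) (glin z)) =
    hom_fun f (i - 1) (i + n - 1) (rlin (i - 1) z)
    - hsign R n *: ghty (i + n - 1) (gD (glin z)).
  have E2 k : ghty k (gD (glin z)) = \sum_(p <- z) p.1 *: ghty k (glin (rbd p.2)).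
    rewrite (linear_sum gD) linear_sum; apply: eq_bigr => p _.
    by rewrite !linearZ_LR [gD _]fs_ext_delta.
  have E3 j : hom_fun f (i - 1) j (rlin (i - 1) z) =
      \sum_(p <- z) p.1 *: hom_fun f (i - 1) j (rdl (i - 1) p.2).
    rewrite -[hom_fun f _ _ _]/(hom_lin f _ _ (rlin (i - 1) z)) linear_sum.
    by apply: eq_bigr => p _; rewrite linearZ_LR.
  rewrite ghty_glin E2 E3 linear_sum scaler_sumr -sumrB.
  rewrite big_seq [RHS]big_seq; apply: eq_bigr => p pz.
  have [vp dp] := h1 p pz.
  rewrite linearZ_LR scalerA mulrC -scalerA -scalerBr; congr (_ *: _).
  apply: (IH p pz vp); first by apply: (addIr 1); rewrite dp subrK.
    by ring.
  by rewrite subrK.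
by rewrite h2 linear0 scaler0 subr0 subrr scaler0.
Qed.

Lemma rlifting : is_boundary f.
Proof.
pose hf' i j (x : rcomplex i) : A j :=
  if j == i + (n + 1) then fs_ext (gvalid i) (fun g => rhty g j) x else 0.
have hl i j : linear (@hf' i j).
  by move=> a x y; rewrite /hf'; case: ifP => _; rewrite ?linearP ?scaler0 ?addr0.
have hs i j x : j != i + (n + 1) -> @hf' i j x = 0 by rewrite /hf' => /negPf ->.
apply/hom_boundaryP; exists (HomDeg hl hs) => i j.
apply: (@fsm_eq_lin _ _ _ _ (hom_lin f i j)
  (lin_of (linear_add (lin_of (linear_comp (diff A (j + 1) j) (lin_of (hl i (j + 1)))))
     (lin_of (linear_scalef (hsign R n) (lin_of (linear_comp (lin_of (hl (i - 1) j)) (diff rcomplex i (i - 1))))))))) => g v.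
rewrite /= /hf'.
have [E|ne] := eqVneq j (i + n); last first.
  have -> : (j + 1 == i + (n + 1)) = false by apply/eqP => E; case/eqP: ne; apply: (addIr 1); rewrite E; ring.
  have -> : (j == i - 1 + (n + 1)) = false.
    by apply/eqP => E; case/eqP: ne; rewrite E; ring.
  by rewrite hom_shape // linear0 scaler0 addr0.
subst j; have -> : (i + n + 1 == i + (n + 1)) by rewrite addrA.
have -> : (i + n == i - 1 + (n + 1)) by apply/eqP; ring.
change (hom_fun f i (i + n) (fs_delta R v) = diff A (i + n + 1) (i + n)
   (fs_ext (gvalid i) (fun g => rhty g (i + n + 1)) (fs_delta R v)) +
   hsign R n *: fs_ext (gvalid (i - 1)) (fun g => rhty g (i + n)) (rdiff i (i - 1) (fs_delta R v))).
rewrite fs_ext_delta.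
rewrite [rdiff _ _ _]fs_ext_delta subrK eqxx.
have [vg dg] := v.
rewrite (@rhtyP g vg i (i + n) (i + n + 1)) // (rdlE v).
suff -> : fs_ext (gvalid (i - 1)) (fun g => rhty g (i + n)) (rlin (i - 1) (rbd g)) = ghty (i + n) (glin (rbd g)).
  by rewrite subrK.
rewrite linear_sum ghty_glin big_seq [RHS]big_seq; apply: eq_bigr => p pz.
have vp : gvalid (i - 1) p.2 by apply: bd_valid v _ _ pz; rewrite subrK.
by rewrite linearZ_LR (rdlE vp) fs_ext_delta.
Qed.
End Lifting.

Lemma rcomplex_semiprojective : semiprojective rcomplex.
Proof.
split=> [i|A hA n f hf]; first exact: fsm_projective.
exact: (rlifting hA hf).
Qed.
End SemifreeResolution.

(** * Isomorphisms in the derived category *)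

Section ResolutionFacts.
Variable R : comPzRingType.
Implicit Types X Y : complex R.

Lemma is_resolution_res X : is_resolution (resolution X).
Proof.
rewrite /resolution; case: pselect => [e|[]]; first exact: (projT2 (cid e)).
exists (ComplexOver (rmap X)); split; [exact: rcomplex_semiprojective|exact: rmap_quasi_iso].
Qed.
Lemma res_semiprojective X : semiprojective (res X).
Proof. by case: (is_resolution_res X). Qed.
Lemma res_map_quasi_iso X : quasi_iso (res_map X).
Proof. by case: (is_resolution_res X). Qed.

Lemma quasi_iso_comp X Y Z (g : chain_map Y Z) (f : chain_map X Y) :
  quasi_iso f -> quasi_iso g -> quasi_iso (chain_comp g f).
Proof. by move=> hf hg i; apply: hiso_comp (hf i) (hg i). Qed.
Lemma quasi_iso_compr X Y Z (g : chain_map Y Z) (f : chain_map X Y) :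
  quasi_iso g -> quasi_iso (chain_comp g f) -> quasi_iso f.
Proof. by move=> hg h i; apply: hiso_compr (hg i) (h i). Qed.
Lemma quasi_iso_compl X Y Z (g : chain_map Y Z) (f : chain_map X Y) :
  quasi_iso f -> quasi_iso (chain_comp g f) -> quasi_iso g.
Proof. by move=> hf h i; apply: hiso_compl (hf i) (h i). Qed.

Lemma dmor_isoE X Y (u : dmor X Y) : dmor_iso u <-> quasi_iso u.
Proof.
split=> [[g [h1 h2]]|h]; first by apply: heq_quasi_iso; exists g.
exact: (semiproj_quasi_heq (res_semiprojective X) (res_semiprojective Y) h).
Qed.

(** From here on, isomorphisms of the derived category are handled as quasi-isomorphisms between
    convenient models. *)
Lemma disoE X Y (f : chain_map X Y) : diso f <-> quasi_iso f.
Proof.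
have hX := res_map_quasi_iso X; have hY := res_map_quasi_iso Y.
split=> [[u [hu /dmor_isoE qu]]|qf].
  apply: quasi_iso_compl hX _; apply: heqv_quasi_iso (homotopic_heqv hu) _.
  exact: quasi_iso_comp.
have [u hu] := semiproj_lift (chain_comp f (res_map X)) (res_semiprojective X) hY.
exists u; split=> //; apply/dmor_isoE; apply: quasi_iso_compr hY _.
apply: heqv_quasi_iso (heqv_sym (homotopic_heqv hu)) _; exact: quasi_iso_comp.
Qed.
End ResolutionFacts.

(** * Finitely generated projective modules *)

Section ProjectiveLift.
Variable R : comPzRingType.

Lemma projective_lift (P M N : lmodType R) (g : {linear M -> N}) (u : {linear P -> N}) :
  projective P -> (forall x, exists y, g y = u x) ->
  exists h : {linear P -> M}, forall x, g (h x) = u x.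
Proof.
move=> hP h.
have gi y : im_sub g (g y) by exists y.
have sg (y : sub_of (im_sub g)) : exists x, sub_lift gi x = y.
  by case: y => y [x e]; exists x; apply: sub_val_inj.
have [k hk] := hP _ _ (sub_lift gi) (sub_lift (P := im_sub g) (f := u) h) sg.
by exists k => x; have /(congr1 (@sub_val _ _ _)) := hk x.
Qed.

(** A finite dual basis. Unlike a basis of row vectors, it passes directly to products, hence to
    Koszul complexes, and to base change. *)
Definition fgp (M : lmodType R) := exists n (e : 'I_n -> M) (c : 'I_n -> {linear M -> R^o}),
  forall x, x = \sum_t c t x *: e t.

Lemma fgp_projective (M : lmodType R) : fgp M -> projective M.
Proof.
case=> n [e [c h]] M1 N g f sg.
have [v hv] := choice (fun t => sg (f (e t))).
have L : linear (fun x => \sum_t (c t x : R) *: v t).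
  move=> a x y; rewrite scaler_sumr -big_split; apply: eq_bigr => t _ /=.
  by rewrite (linearP (c t)) scalerDl scalerA.
exists (lin_of L) => x; rewrite /= linear_sum {2}[x]h linear_sum.
by apply: eq_bigr => t _; rewrite !linearZ_LR hv.
Qed.

Lemma fgp_row n : fgp 'rV[R]_n.
Proof.
have L t : linear (fun x : 'rV[R]_n => (x 0 t : R^o)) by move=> a x y; rewrite !mxE.
exists n, (fun t => delta_mx 0 t), (fun t => lin_of (L t)) => x.
exact: row_sum_delta.
Qed.

Lemma fgp_regular : fgp R^o.
Proof.
exists 1, (fun _ => 1 : R^o), (fun _ => idfun) => x.
by rewrite big_ord1; apply/esym/mulr1.
Qed.

Lemma fgp_prod (M N : lmodType R) : fgp M -> fgp N -> fgp (M * N)%type.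
Proof.
move=> [m [e [c h]]] [n [e' [c' h']]].
pose ee (t : 'I_(m + n)) : (M * N)%type := match split t with
  | inl i => (e i, 0) | inr j => (0, e' j) end.
pose cc (t : 'I_(m + n)) : {linear (M * N)%type -> R^o} := match split t with
  | inl i => lin_of (linear_comp (c i) (fst_lin M N))
  | inr j => lin_of (linear_comp (c' j) (snd_lin M N)) end.
exists (m + n)%N, ee, cc => x; rewrite big_split_ord /=.
rewrite [LHS]pairE; congr (_ + _).
  rewrite {1}(h x.1) linear_sum; apply: eq_bigr => i _.
  by rewrite /ee /cc (unsplitK (inl i)) linearZ_LR.
rewrite {1}(h' x.2) linear_sum; apply: eq_bigr => j _.
by rewrite /ee /cc (unsplitK (inr j)) linearZ_LR.
Qed.

Lemma fgp_zero (M : lmodType R) : (forall x : M, x = 0) -> fgp M.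
Proof.
move=> h; exists 0%N, (fun _ => 0), (fun _ => \0) => x; by rewrite big_ord0 [x]h.
Qed.
End ProjectiveLift.

(** * Truncations, partial contractions and complexes bounded below *)

Section QuotientComplex.
Variables (R : comPzRingType) (Y : complex R) (U : forall i, submod (Y i)).
Hypothesis hU : forall i j y, U i y -> U j (diff Y i j y).

Definition cquo_diff i j : {linear quo (U i) -> quo (U j)} :=
  quo_lift (P := U i) (f := lin_of (linear_comp (quo_pi (U j)) (diff Y i j)))
    (fun y hy => (quo_piE (U j) _).2 (hU j hy)).
Lemma cquo_diff_pi i j y : cquo_diff i j (quo_pi (U i) y) = quo_pi (U j) (diff Y i j y).
Proof. exact: quo_liftK. Qed.
Fact cquo_shape i j x : i != j + 1 -> cquo_diff i j x = 0.
Proof.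
by move=> ne; have [y <-] := quo_pi_surj x; rewrite cquo_diff_pi diff_shape // linear0.
Qed.
Fact cquo_dd i j k x : cquo_diff j k (cquo_diff i j x) = 0.
Proof.
by have [y <-] := quo_pi_surj x; rewrite !cquo_diff_pi diff_diff linear0.
Qed.
Definition cquo : complex R := Complex cquo_shape cquo_dd.
Fact cquo_map_diff i j y : quo_pi (U j) (diff Y i j y) = diff cquo i j (quo_pi (U i) y).
Proof. by rewrite -cquo_diff_pi. Qed.
Definition cquo_map : chain_map Y cquo := @ChainMap R Y cquo (fun i => quo_pi (U i)) cquo_map_diff.
End QuotientComplex.

Section Truncation.
Variables (R : comPzRingType) (Y : complex R) (P : forall i, submod (Y i)) (a : int).
(* The subcomplex that is everything above degree [a], the submodule [P a] in
   degree [a] and zero below. *)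
Definition trunc_sub i : submod (Y i).
Proof.
exists (fun y : Y i => y = 0 \/ (a < i) \/ (i = a /\ P i y)).
- by left.
- move=> x y [->|[hx|[e hx]]] [->|[hy|[e' hy]]]; rewrite ?add0r ?addr0; try by [left|right; left].
  + by right; right.
  + by right; right.
  + by right; right; split=> //; apply: submodD.
- move=> c x [->|[hx|[e hx]]]; first by left; rewrite scaler0.
    by right; left.
  by right; right; split=> //; apply: submodZ.
Defined.
Lemma trunc_below i y : i < a -> trunc_sub i y -> y = 0.
Proof.
move=> ia [//|[h|[e _]]]; first by have := lt_trans ia h; rewrite ltxx.
by move: (ia); rewrite {1}e ltxx.
Qed.
Hypothesis hP1 : (forall j y, P a y -> diff Y a j y = 0).
Hypothesis hP2 : (forall i y, P a (diff Y i a y)).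
Lemma trunc_closed i j y : trunc_sub i y -> trunc_sub j (diff Y i j y).
Proof.
have [e|ne] := eqVneq i (j + 1); last by rewrite diff_shape //; left.
move=> [->|[h|[ia hy]]]; first by left; rewrite linear0.
- have [ja|ja] := eqVneq j a; first by right; right; split=> //; rewrite ja; apply: hP2.
  right; left; lia.
- left; have H k (z : Y k) : k = a -> P k z -> diff Y k j z = 0.
    by move=> E; move: z; rewrite E => z; apply: hP1.
  exact: H.
Qed.
End Truncation.

Section PartialContraction.
Variable R : comPzRingType.

Lemma tau_acyclic (Y : complex R) a (hU : forall i j y,
    trunc_sub (cycles Y) a i y -> trunc_sub (cycles Y) a j (diff Y i j y)) :
  (forall i, i < a -> homology_zero Y i) -> acyclic (cquo hU).
Proof.
move=> hY i z; have [y <-] := quo_pi_surj z.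
rewrite {1}/is_cycle [diff _ _ _ _]cquo_diff_pi => /quo_piE hy.
case: (ltrgtP i a) => ia.
- have /hY [//|y' ey'] : is_cycle y by apply: trunc_below hy; lia.
  exists (quo_pi (trunc_sub (cycles Y) a (i + 1)) y').
  by rewrite [diff _ _ _ _]cquo_diff_pi ey'.
- suff -> : quo_pi (trunc_sub (cycles Y) a i) y = 0 by apply: boundary0.
  by apply/quo_piE; right; left.
- suff -> : quo_pi (trunc_sub (cycles Y) a i) y = 0 by apply: boundary0.
  apply/quo_piE; right; right; split=> //; apply: trunc_below hy; lia.
Qed.

(** Dividing [Y] by its part above degree [a] and its cycles in degree [a] leaves an acyclic
    complex, to which [f] is null-homotopic. The homotopy lifts to [Y] since each [W i] is
    projective, and below [a] nothing has been divided out. *)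
Lemma partial_contraction (W Y : complex R) (f : chain_map W Y) (a : int) :
  semiprojective W -> (forall i, i < a -> homology_zero Y i) ->
  exists h : forall i j, {linear W i -> Y j}, forall i, i < a -> forall x,
    f i x = diff Y (i + 1) i (h i (i + 1) x) + h (i - 1) i (diff W i (i - 1) x).
Proof.
move=> [pW hW] hY.
have hU := @trunc_closed R Y (cycles Y) a (fun j y => @cycle_diff R Y a y j)
  (fun i y => @diff_diff R Y i a (a - 1) y).
have := hW _ (tau_acyclic (hU := hU) hY) 0 _ (cyc_cycle (chain_comp (cquo_map hU) f)).
move=> b; have /homotopicP [h hh] : is_boundary (cyc (chain_comp (cquo_map hU) f) - cyc (czero W (cquo hU))).
  by rewrite (_ : cyc (czero _ _) = 0) ?subr0 //; apply: hom0_ext => i x; rewrite cycE.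
have lft i j : exists k : {linear W i -> Y j}, forall x, quo_pi (trunc_sub (cycles Y) a j) (k x) = h i j x.
  exact: (pW i _ _ (quo_pi _) (h i j) (@quo_pi_surj _ _ _)).
pose k i j := projT1 (cid (lft i j)); have hk i j := projT2 (cid (lft i j)).
exists k => i ia x.
apply/eqP; rewrite -subr_eq0; apply/eqP.
apply: (@trunc_below R Y (cycles Y) a i _ ia); apply/quo_piE.
rewrite linearB linearD hk -(cquo_diff_pi hU) hk.
by have := hh i x; rewrite /= subr0 => ->; rewrite subrr.
Qed.
End PartialContraction.

Section BoundedBelow.
Variables (R : comPzRingType) (L B : complex R) (a n : int).
Hypothesis (La : forall i, i < a -> forall x : L i, x = 0) (Lp : forall i, projective (L i)).
Hypothesis hB : forall k, (forall x : L k, x = 0) \/ homology_zero B (k + n).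
Variables (f : hom_complex L B n) (hf : is_cycle f).

Let good (K : int) (h : forall i j, {linear L i -> B j}) := forall i, i < K -> forall x,
  hom_fun f i (i + n) x = diff B (i + n + 1) (i + n) (h i (i + n + 1) x) +
    hsign R n *: h (i - 1) (i + n) (diff L i (i - 1) x).

Let step K h : good K h -> exists h' : forall i j, {linear L i -> B j},
  good (K + 1) h' /\ forall i j x, i < K -> h' i j x = h i j x.
Proof.
move=> gh.
pose u : {linear L K -> B (K + n)} := lin_of (linear_sub (hom_lin f K (K + n))
  (lin_of (linear_scalef (hsign R n) (lin_of (linear_comp (h (K - 1) (K + n)) (diff L K (K - 1))))))).
have uE x : u x = hom_fun f K (K + n) x - hsign R n *: h (K - 1) (K + n) (diff L K (K - 1) x) by [].
have [w hw] : exists w : {linear L K -> B (K + n + 1)}, forall x, diff B _ (K + n) (w x) = u x.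
  apply: projective_lift => // x; have [x0|hz] := hB K.
    by exists 0; rewrite [x]x0 !linear0.
  apply: hz; rewrite /is_cycle uE linearB linearZ_LR (hom_cycle_at hf (l := K - 1)) ?subrK //.
  have E : K + n - 1 = K - 1 + n by ring.
  rewrite E (gh (K - 1)); last by lia.
  rewrite diff_diff linear0 scaler0 addr0.
  by have -> : K - 1 + n + 1 = K + n by [ring]; rewrite subrr.
have hl i j : linear (fun x => (if i < K then h i j x else 0) +
     diag_fun (chain_id B) j (w (diag_fun (chain_id L) K x))).
  move=> c x y; rewrite -!diag_linE !linearP /=; case: ifP => _; rewrite ?linearP scalerDr.
    by zmod.
  by rewrite scaler0 !add0r.
exists (fun i j => lin_of (hl i j)); split=> [i iK x|i j x iK]; last first.
  by rewrite /= iK (@diag_fun_ne _ _ _ _ i) ?linear0 ?diag_fun0 ?addr0 //; apply/eqP; lia.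
rewrite /=.
have -> : i - 1 < K by lia.
rewrite (@diag_fun_ne _ _ _ _ (i - 1)) ?linear0 ?diag_fun0 ?addr0; last by apply/eqP; lia.
have [E|ne] := eqVneq i K.
  subst i; rewrite ltxx add0r !diag_funE /= hw uE; by rewrite subrK.
have iK' : i < K by lia.
by rewrite iK' (@diag_fun_ne _ _ _ _ i) ?linear0 ?diag_fun0 ?addr0 //; apply: gh.
Qed.

(** The homotopy is extended degree by degree, starting below [a] where [L] is zero. The alternative
    in [hB] covers acyclic targets as well as targets whose homology vanishes only in the degrees
    that [L] reaches. *)
Lemma bounded_below_boundary : is_boundary f.
Proof.
pose T := forall i j, {linear L i -> B j}.
have ch (t : nat) (h : T) : exists h' : T, good (a + t%:Z) h -> good (a + t.+1%:Z) h' /\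
    forall i j x, i < a + t%:Z -> h' i j x = h i j x.
  case: (pselect (good (a + t%:Z) h)) => [g|ng]; last by exists h.
  by have [h' [g' e]] := step g; exists h' => _; split=> //; rewrite -addn1 PoszD addrA.
have [nx hnx] := choice (fun th : nat * T => ch th.1 th.2).
pose H := fix H (t : nat) : T := if t is t'.+1 then nx (t', H t') else fun i j => \0.
have gH t : good (a + t%:Z) (H t).
  elim: t => [|t IH]; last by case: (hnx (t, H t) IH).
  move=> i; rewrite addr0 => ia x; rewrite (La ia x) hom_lin0 !linear0 ?scaler0 ?addr0 //.
have st t s i j x : i < a + t%:Z -> H (t + s)%N i j x = H t i j x.
  move=> it; elim: s => [|s IH]; first by rewrite addn0.
  rewrite addnS -IH; case: (hnx ((t + s)%N, H (t + s)%N) (gH _)) => _; apply.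
  by rewrite PoszD; lia.
(* A stage that has passed degree [i]; by [st] later stages agree with it there, so the limit of the
   homotopies can be read off at this index. *)
pose k i := `|i - a|.+1.
have ik i : i < a + (k i)%:Z by rewrite /k; lia.
pose hh i j (x : L i) : B j := if j == i + (n + 1) then H (k i) i j x else 0.
have hl i j : linear (@hh i j).
  by move=> c x y; rewrite /hh; case: ifP => _; rewrite ?linearP ?scaler0 ?addr0.
have hs i j x : j != i + (n + 1) -> @hh i j x = 0 by rewrite /hh => /negPf ->.
apply/hom_boundaryP; exists (HomDeg hl hs) => i j x; rewrite /= /hh.
have [E|ne] := eqVneq j (i + n); last first.
  have -> : (j + 1 == i + (n + 1)) = false.
    by apply/eqP => E; case/eqP: ne; apply: (addIr 1); rewrite E; ring.
  have -> : (j == i - 1 + (n + 1)) = false.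
    by apply/eqP => E; case/eqP: ne; rewrite E; ring.
  by rewrite hom_shape // linear0 scaler0 addr0.
subst j; have -> : (i + n + 1 == i + (n + 1)) by rewrite addrA.
have -> : (i + n == i - 1 + (n + 1)) by apply/eqP; ring.
have [ia|ai] := ltP i a.
  by rewrite (La ia x) hom_lin0 !linear0 ?scaler0 ?addr0.
rewrite (gH (k i)); last exact: ik.
congr (_ + _ *: _).
have [e0|e1] := eqVneq i a; last first.
  have -> : k i = addn (k (i - 1)) 1 by rewrite /k; lia.
  by rewrite st //; apply: ik.
have La' y : y = 0 :> L (i - 1) by apply: La; lia.
by rewrite [diff _ _ _ _]La' !linear0.
Qed.
End BoundedBelow.

Lemma bounded_below_semiprojective (R : comPzRingType) (L : complex R) (a : int) :
  (forall i, i < a -> forall x : L i, x = 0) -> (forall i, projective (L i)) -> semiprojective L.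
Proof.
move=> La Lp; split=> // A hA n f hf.
by apply: (bounded_below_boundary La Lp _ hf) => k; right; apply: hA.
Qed.

(** * Free resolutions of complexes with finitely generated homology *)

Section FreeApproximation.
Variables (R : comPzRingType) (hR : noetherian R) (X : complex R) (hX : degreewise_finite X) (a : int).

(* One degree of the resolution: the number of its basis vectors, that of the
   previous degree, the matrix of the differential and the images in [X]. *)
Record fr_state := FrState {
  fr_n : nat; fr_m : nat; fr_D : nat -> nat -> R; fr_F : forall i, nat -> X i }.

Definition fr_nil := FrState 0 0 (fun _ _ => 0) (fun _ _ => 0).

(** Injectivity on homology in degree [i] and surjectivity in degree [i + 1] both constrain the new
    basis in degree [i + 1], so they are arranged in one step. *)
Definition fr_spec (i : int) (s s' : fr_state) := [/\ fr_m s' = fr_n s,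
  forall p r, (p < fr_n s')%N -> (r < fr_m s)%N ->
    \sum_(q < fr_n s) fr_D s' p q * fr_D s q r = 0,
  forall p, (p < fr_n s')%N ->
    diff X (i + 1) i (fr_F s' (i + 1) p) = \sum_(q < fr_n s) fr_D s' p q *: fr_F s i q,
  forall v : 'rV[R]_(fr_n s), (forall r, (r < fr_m s)%N -> \sum_q v 0 q * fr_D s q r = 0) ->
    is_boundary (\sum_q v 0 q *: fr_F s i q) ->
    exists w : 'rV[R]_(fr_n s'), forall q : 'I_(fr_n s), v 0 q = \sum_p w 0 p * fr_D s' p q &
  forall z : X (i + 1), is_cycle z -> exists w : 'rV[R]_(fr_n s'),
    (forall q, (q < fr_n s)%N -> \sum_p w 0 p * fr_D s' p q = 0) /\
    is_boundary (z - \sum_p w 0 p *: fr_F s' (i + 1) p)].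

(** The new basis has two blocks. The first maps to generators [t] of the module of cycles in degree
    [i] whose image in [X] bounds, and is sent to chosen primitives [y]; the second has zero
    differential and is sent to generators [u] of [H_(i+1) X]. *)
Lemma fr_next (i : int) s : exists s', fr_spec i s s'.
Proof.
set n := fr_n s.
pose Dv (v : 'rV[R]_n) r := \sum_q v 0 q * fr_D s q r.
pose Fv (v : 'rV[R]_n) : X i := \sum_q v 0 q *: fr_F s i q.
have FvL : linear Fv.
  move=> c x y; rewrite /Fv scaler_sumr -big_split; apply: eq_bigr => q _ /=.
  by rewrite !mxE scalerDl scalerA.
pose Kp v := (forall r, (r < fr_m s)%N -> Dv v r = 0) /\ is_boundary (Fv v).
have Fv0 : Fv 0 = 0 := linear0 (lin_of FvL).
have FvD x y : Fv (x + y) = Fv x + Fv y := linearD (lin_of FvL) x y.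
have FvZ c x : Fv (c *: x) = c *: Fv x := linearZ_LR (lin_of FvL) c x.
have K0 : Kp 0.
  split; last by rewrite Fv0; apply: boundary0.
  by move=> r _; apply: big1 => q _; rewrite mxE mul0r.
have KD x y : Kp x -> Kp y -> Kp (x + y).
  move=> [h1 h2] [h3 h4]; split; last by rewrite FvD; apply: boundaryD.
  move=> r hr; rewrite -[0]addr0 -{1}(h1 r hr) -(h3 r hr) -big_split; apply: eq_bigr => q _.
  by rewrite mxE mulrDl.
have KZ c x : Kp x -> Kp (c *: x).
  move=> [h1 h2]; split; last by rewrite FvZ; apply: boundaryZ.
  move=> r hr; rewrite -[0](mulr0 c) -(h1 r hr) mulr_sumr; apply: eq_bigr => q _.
  by rewrite mxE mulrA.
pose K := Submod K0 KD KZ.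
have allD : forall x y : 'rV[R]_n, True -> True -> True by [].
pose ALL := @Submod R 'rV[R]_n (fun _ => True) I (fun _ _ _ _ => I) (fun _ _ _ => I).
have zD (x y : 'rV[R]_n) : x = 0 -> y = 0 -> x + y = 0 by move=> -> ->; rewrite addr0.
have zZ c (x : 'rV[R]_n) : x = 0 -> c *: x = 0 by move=> ->; rewrite scaler0.
pose NUL := @Submod R 'rV[R]_n (fun x => x = 0) erefl zD zZ.
have fgK : fgr K NUL.
  apply: (noetherian_fgr hR (Z := ALL)) => // [x ->|]; first exact: K0.
  apply/fgrP; exists n, (fun t => delta_mx 0 t); split=> // z _; exists (fun t => z 0 t).
  by rewrite /= -row_sum_delta subrr.
have [m1 [t [ht gent]]] := (fgrP K NUL).1 fgK.
have ch k : exists y : X (i + 1), diff X (i + 1) i y = Fv (t k) by case: (ht k).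
have [y hy] := choice ch.
have [m2 [u [hu genu]]] := hX (i + 1).
pose Dm : 'M[R]_(m1 + m2, n) := \matrix_(p, q) match split p with inl k => t k 0 q | inr _ => 0 end.
pose Fm (p : 'I_(m1 + m2)) : X (i + 1) := match split p with inl k => y k | inr k => u k end.
(* Entries and images are extended by zero to all of [nat], so that the type of a state does not
   depend on ranks. *)
pose Dn p q : R := if insub p is Some p' then if insub q is Some q' then Dm p' q' else 0 else 0.
pose Fn j p : X j := if insub p is Some p' then diag_fun (chain_id X) j (Fm p') else 0.
have DnE (p : 'I_(m1 + m2)) (q : 'I_n) : Dn p q = Dm p q by rewrite /Dn !valK.
have FnE (p : 'I_(m1 + m2)) : Fn (i + 1) p = Fm p by rewrite /Fn valK diag_funE.
have Dl (k : 'I_m1) q : Dm (lshift m2 k) q = t k 0 q by rewrite mxE (unsplitK (inl k)).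
have Dr (k : 'I_m2) q : Dm (rshift m1 k) q = 0 by rewrite mxE (unsplitK (inr k)).
have Fl (k : 'I_m1) : Fm (lshift m2 k) = y k by rewrite /Fm (unsplitK (inl k)).
have Fr (k : 'I_m2) : Fm (rshift m1 k) = u k by rewrite /Fm (unsplitK (inr k)).
clearbody Dn Fn; exists (FrState (m1 + m2) n Dn Fn); split=> //=.
- move=> p r hp hr; rewrite -[p]/(val (Ordinal hp)).
  under eq_bigr => q _ do rewrite DnE.
  move: (Ordinal hp) => o; rewrite -(splitK o); case: (split o) => k /=.
    under eq_bigr => q _ do rewrite Dl.
    by have [h _] := ht k; apply: h.
  by rewrite big1 // => q _; rewrite Dr mul0r.
- move=> p hp; rewrite -[p]/(val (Ordinal hp)) FnE.
  under eq_bigr => q _ do rewrite DnE.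
  move: (Ordinal hp) => o; rewrite -(splitK o); case: (split o) => k /=.
    rewrite Fl hy; apply: eq_bigr => q _; by rewrite Dl.
  rewrite Fr big1 => [|q _]; last by rewrite Dr scale0r.
  have h := hu k; exact: cycle_diff.
- move=> v h1 h2; have /gent [c /eqP] : K v by split.
  rewrite subr_eq0 => /eqP hc; exists (row_mx (\row_k c k) 0) => q.
  rewrite big_split_ord /= [X in _ + X]big1 ?addr0; last first.
    by move=> k _; rewrite row_mxEr mxE mul0r.
  rewrite {1}hc summxE; apply: eq_bigr => k _.
  by have /= -> := DnE (lshift m2 k) q; rewrite row_mxEl Dl !mxE.
- move=> z /genu [c hc]; exists (row_mx 0 (\row_k c k)); split=> [q hq|].
    rewrite big1 // => p _; have /= -> := DnE p (Ordinal hq); rewrite -(splitK p).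
    by case: (split p) => k /=; rewrite ?Dr ?mulr0 // row_mxEl mxE mul0r.
  suff -> : \sum_p (row_mx 0 (\row_k c k) : 'rV[R]_(m1 + m2)) 0 p *: Fn (i + 1) p = \sum_k c k *: u k by [].
  rewrite big_split_ord /= big1 ?add0r => [|k _]; last by rewrite row_mxEl mxE scale0r.
  by apply: eq_bigr => k _; have /= -> := FnE (rshift m1 k); rewrite row_mxEr mxE Fr.
Qed.

Definition fr_step (i : int) s := projT1 (cid (fr_next i s)).
Lemma fr_stepP i s : fr_spec i s (fr_step i s). Proof. exact: projT2 (cid (fr_next i s)). Qed.

(** The state of degree [a - 1] is the zero module, so the first step already gives surjectivity on
    homology in degree [a]. *)
Fixpoint fr_seq (k : nat) := if k is k'.+1 then fr_step (a - 1 + k'%:Z) (fr_seq k') else fr_nil.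
Definition fr_at (i : int) := if i - (a - 1) is Posz k then fr_seq k else fr_nil.

Lemma fr_at_below i : i < a -> fr_at i = fr_nil.
Proof.
rewrite /fr_at => ia; case e: (i - (a - 1)) => [[|k]|k] //; by lia.
Qed.
Lemma fr_atS i : a - 1 <= i -> fr_at (i + 1) = fr_step i (fr_at i).
Proof.
move=> ia; rewrite /fr_at; case e: (i - (a - 1)) => [k|k]; last by lia.
have -> : i + 1 - (a - 1) = Posz k.+1 by lia.
by rewrite /=; congr fr_step; lia.
Qed.
Lemma fr_at_spec i : a - 1 <= i -> fr_spec i (fr_at i) (fr_at (i + 1)).
Proof. by move=> ia; rewrite fr_atS //; apply: fr_stepP. Qed.
Lemma fr_at_m i j : i = j + 1 -> fr_m (fr_at i) = fr_n (fr_at j).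
Proof.
move=> ->; have [ja|aj] := ltP j (a - 1); last by case: (fr_at_spec aj).
by rewrite !fr_at_below //; lia.
Qed.

Definition fr_obj (i : int) : lmodType R := 'rV[R]_(fr_n (fr_at i)).
Definition fr_mx i j : 'M[R]_(fr_n (fr_at i), fr_n (fr_at j)) :=
  if i == j + 1 then \matrix_(p, q) fr_D (fr_at i) p q else 0.
Lemma fr_mxE i j p q : i = j + 1 -> fr_mx i j p q = fr_D (fr_at i) p q.
Proof. by move=> /eqP ij; rewrite /fr_mx ij mxE. Qed.
Fact fr_diff_linear i j : linear (fun v : fr_obj i => v *m fr_mx i j : fr_obj j).
Proof. by move=> c x y; rewrite mulmxDl -scalemxAl. Qed.
Definition fr_diff i j : {linear fr_obj i -> fr_obj j} := lin_of (@fr_diff_linear i j).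
Fact fr_shape i j v : i != j + 1 -> fr_diff i j v = 0.
Proof. by move=> /negPf ne; rewrite /= /fr_mx ne mulmx0. Qed.

Lemma fr_mx0 i (v : fr_obj i) : i < a -> v = 0.
Proof.
move=> ia; apply/rowP => q; have := ltn_ord q; by rewrite {2}fr_at_below.
Qed.
Fact fr_dd i j k v : fr_diff j k (fr_diff i j v) = 0.
Proof.
have [jk|ne] := eqVneq j (k + 1); last by rewrite fr_shape.
have [ij|ne] := eqVneq i (j + 1); last by rewrite [fr_diff i j v]fr_shape ?linear0.
have [ja|aj] := ltP j a; first by rewrite (fr_mx0 (fr_diff i j v)) // linear0.
rewrite /= -mulmxA; suff -> : fr_mx i j *m fr_mx j k = 0 by rewrite mulmx0.
subst i; apply/matrixP => p r; rewrite !mxE.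
have jp : a - 1 <= j by lia.
have [_ h _ _ _] := fr_at_spec jp.
have hr : (r < fr_m (fr_at j))%N by rewrite (fr_at_m jk).
rewrite -[RHS](h p r _ hr) //.
by apply: eq_bigr => q _; rewrite !fr_mxE.
Qed.
Definition fr_complex : complex R := Complex fr_shape fr_dd.

Definition fr_map_lin i : {linear fr_complex i -> X i} :=
  row_lin (fun q : 'I_(fr_n (fr_at i)) => fr_F (fr_at i) i q).

Fact fr_map_diff i j v : fr_map_lin j (diff fr_complex i j v) = diff X i j (fr_map_lin i v).
Proof.
have [ij|ne] := eqVneq i (j + 1); last by rewrite !diff_shape ?linear0.
have [ja|aj] := ltP j (a - 1).
  by rewrite [v]fr_mx0 ?linear0 //; lia.
have [_ _ h _ _] := fr_at_spec aj.
subst i; rewrite !row_linE linear_sum.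
under [RHS]eq_bigr => p _ do rewrite linearZ_LR h // scaler_sumr.
rewrite exchange_big /=; apply: eq_bigr => q _.
rewrite mxE scaler_suml; apply: eq_bigr => p _.
by rewrite fr_mxE // scalerA.
Qed.
Definition fr_map : chain_map fr_complex X := ChainMap fr_map_diff.

Lemma fr_hiso i : a <= i -> hiso fr_map i.
Proof.
move=> ai; split=> [v hv hb|z hz].
  have ai' : a - 1 <= i by lia.
  have [_ _ _ h _] := fr_at_spec ai'.
  have [|//|w hw] := h v.
    move=> r hr; have e : i = i - 1 + 1 by rewrite subrK.
    rewrite (fr_at_m e) in hr.
    have /rowP /(_ (Ordinal hr)) : (v *m fr_mx i (i - 1)) = 0 := hv.
    rewrite !mxE => E; rewrite -[RHS]E; apply: eq_bigr => q _.
    by rewrite fr_mxE.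
  exists w; apply/rowP => q; rewrite mxE hw; apply: eq_bigr => p _.
  by rewrite fr_mxE.
have ai' : a - 1 <= i - 1 by lia.
have [_ _ _ _] := fr_at_spec ai'; rewrite subrK => h.
have [w [hw1 hw2]] := h z hz; exists w; split=> //.
apply/rowP => q; rewrite !mxE -[RHS](hw1 q) //; apply: eq_bigr => p _.
by rewrite fr_mxE ?subrK.
Qed.
End FreeApproximation.

Definition finite_free_below (R : comPzRingType) (L : complex R) (a : int) :=
  (forall i, fgp (L i)) /\ (forall i, i < a -> forall x : L i, x = 0).

Lemma free_approximation (R : comPzRingType) (X : complex R) (a : int) :
  noetherian R -> degreewise_finite X -> exists (L : complex R) (f : chain_map L X),
    finite_free_below L a /\ forall i, a <= i -> hiso f i.
Proof.
move=> hR hX; exists (fr_complex hR hX a), (fr_map hR hX a); split; last exact: fr_hiso.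
split=> [i|i ia x]; [exact: fgp_row|exact: fr_mx0].
Qed.

Lemma finite_free_semiprojective (R : comPzRingType) (L : complex R) (a : int) :
  finite_free_below L a -> semiprojective L.
Proof.
move=> [h1 h2]; apply: (bounded_below_semiprojective h2) => i; exact/fgp_projective.
Qed.

Lemma free_resolution (R : comPzRingType) (X : complex R) (a : int) :
  noetherian R -> degreewise_finite X -> (forall i, i < a -> homology_zero X i) ->
  exists (L : complex R) (f : chain_map L X), finite_free_below L a /\ quasi_iso f.
Proof.
move=> hR hX h0; have [L [f [hL hf]]] := free_approximation a hR hX.
exists L, f; split=> // i; have [ia|/hf //] := ltP i a.
split=> [x _ _|y hy]; first by rewrite (hL.2 i ia x); apply: boundary0.
exists 0; rewrite linear0 subr0; split; [exact: cycle0|exact: h0 hy].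
Qed.

(** * Tensor product of a complex with a module *)

Section TensorComplex.
Variable R : comPzRingType.
Implicit Types (X Y Z : complex R) (N : lmodType R).

Definition tc_obj X N (i : int) : lmodType R := tens (X i) N.
Definition tc_diff X N i j : {linear tc_obj X N i -> tc_obj X N j} := tml (diff X i j).
Fact tc_shape X N i j (x : tc_obj X N i) : i != j + 1 -> tc_diff X N i j x = 0.
Proof. by move=> ne; apply: tml0 => m; apply: diff_shape. Qed.
Fact tc_dd X N i j k (x : tc_obj X N i) : tc_diff X N j k (tc_diff X N i j x) = 0.
Proof. by rewrite /tc_diff tml_comp; apply: tml0 => m; apply: diff_diff. Qed.
Definition tc X N : complex R := Complex (@tc_shape X N) (@tc_dd X N).

Lemma tc_diff_tp X N i j (x : X i) (n : N) : diff (tc X N) i j (tp x n) = tp (diff X i j x) n.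
Proof. exact: tml_tp. Qed.

Lemma tc_diff_tml X Y N i k l (h : {linear X i -> Y k}) (x : X i) (n : N) :
  diff (tc Y N) k l (tml h (tp x n)) = tp (diff Y k l (h x)) n.
Proof. by rewrite tml_tp; apply: tml_tp. Qed.
Lemma tml_tc_diff X Y N i k l (h : {linear X k -> Y l}) (x : X i) (n : N) :
  tml h (diff (tc X N) i k (tp x n)) = tp (h (diff X i k x)) n.
Proof. by rewrite [diff _ _ _ _]tml_tp; apply: tml_tp. Qed.

Fact tcl_subproof X Y (f : chain_map X Y) N i j (x : tc X N i) :
  tml (f j) (diff (tc X N) i j x) = diff (tc Y N) i j (tml (f i) x).
Proof.
apply: etrans (tml_comp (diff X i j) (f j) x) _.
apply: etrans _ (esym (tml_comp (f i) (diff Y i j) x)).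
by apply: tml_eq => m; rewrite /= cmap_diff.
Qed.
Definition tcl X Y (f : chain_map X Y) N : chain_map (tc X N) (tc Y N) :=
  @ChainMap R (tc X N) (tc Y N) (fun i => tml (f i)) (@tcl_subproof X Y f N).
Lemma tcl_tp X Y (f : chain_map X Y) N i (x : X i) (n : N) : tcl f N i (tp x n) = tp (f i x) n.
Proof. exact: tml_tp. Qed.

Fact tcr_subproof X N N' (g : {linear N -> N'}) i j (x : tc X N i) :
  tmr g (diff (tc X N) i j x) = diff (tc X N') i j (tmr g x).
Proof. by apply/esym/tml_tmr. Qed.
Definition tcr X N N' (g : {linear N -> N'}) : chain_map (tc X N) (tc X N') :=
  @ChainMap R (tc X N) (tc X N') (fun i => tmr g) (@tcr_subproof X N N' g).
Lemma tcr_tp X N N' (g : {linear N -> N'}) i (x : X i) (n : N) : tcr X g i (tp x n) = tp x (g n).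
Proof. exact: tmr_tp. Qed.

Lemma tcl_homotopic X Y (f g : chain_map X Y) N : homotopic f g -> homotopic (tcl f N) (tcl g N).
Proof.
move=> [h e]; exists (fun i j => tml (h i j)) => i x; elim/tens_ind: x => [|x y hx hy|x n].
- by rewrite !linear0; zmod.
- rewrite (linearD (tcl f N i)) (linearD (tcl g N i)) opprD addrACA hx hy !linearD; zmod.
rewrite !tcl_tp tc_diff_tml tml_tc_diff -tpDl -e; exact: esym (linearB (tpl (Y i) n) _ _).
Qed.
Lemma tcl_comp X Y Z (g : chain_map Y Z) (f : chain_map X Y) N i x :
  tcl g N i (tcl f N i x) = tcl (chain_comp g f) N i x.
Proof. exact: tml_comp. Qed.
Lemma tcl_quasi_iso X Y (f : chain_map X Y) N :
  semiprojective X -> semiprojective Y -> quasi_iso f -> quasi_iso (tcl f N).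
Proof.
move=> hX hY hf; have [g [h1 h2]] := semiproj_quasi_heq hX hY hf.
apply: heq_quasi_iso; exists (tcl g N); split.
  apply: homotopic_trans (homotopic_trans (tcl_homotopic N h1) _).
    by apply: homotopic_eq => i x /=; apply: tcl_comp.
  by apply: homotopic_eq => i x /=; apply: tml_id.
apply: homotopic_trans (homotopic_trans (tcl_homotopic N h2) _).
  by apply: homotopic_eq => i x /=; apply: tcl_comp.
by apply: homotopic_eq => i x /=; apply: tml_id.
Qed.

Fact tc1_subproof X i j (x : tc X R^o i) :
  @tens1 R (X j) (diff (tc X R^o) i j x) = diff X i j (@tens1 R (X i) x).
Proof.
elim/tens_ind: x => [|x y hx hy|x n]; first by rewrite !linear0.
  by rewrite !linearD hx hy.
by rewrite tc_diff_tp !tens1_tp linearZ_LR.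
Qed.
Definition tc1 X : chain_map (tc X R^o) X := ChainMap (@tc1_subproof X).

(** A partial contraction of the identity of [X] remains one after tensoring with [N]. *)
Lemma tc_zero X N a : semiprojective X -> (forall i, i < a -> homology_zero X i) ->
  forall i, i < a -> homology_zero (tc X N) i.
Proof.
move=> hX h0 i ia z hz; have [h hh] := partial_contraction (chain_id X) hX h0.
exists (tml (h i (i + 1)) z).
suff E : z = diff (tc X N) (i + 1) i (tml (h i (i + 1)) z) + tml (h (i - 1) i) (diff (tc X N) i (i - 1) z).
  by move: E; rewrite (hz : diff _ _ _ z = 0) linear0 addr0 => <-.
elim/tens_ind: (z) => [|x y hx hy|x n]; first by rewrite !linear0 addr0.
  by rewrite !linearD addrACA -hx -hy.
by rewrite tc_diff_tml tml_tc_diff -tpDl -hh.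
Qed.
End TensorComplex.

(** * Koszul complexes *)

Section Koszul.
Variable R : comPzRingType.
Implicit Types X Y W V : complex R.

Definition kos W (x : R) : complex R := cone (cscale W x).

Definition kos_map X Y (f : chain_map X Y) x i (z : kos X x i) : kos Y x i := (f (i - 1) z.1, f i z.2).
Fact kos_map_linear X Y (f : chain_map X Y) x i : linear (@kos_map X Y f x i).
Proof. by move=> c u v; rewrite /kos_map !linearP. Qed.
Fact kos_map_diff X Y (f : chain_map X Y) x i j (z : kos X x i) :
  lin_of (@kos_map_linear X Y f x j) (diff (kos X x) i j z) =
  diff (kos Y x) i j (lin_of (@kos_map_linear X Y f x i) z).
Proof.
congr pair; rewrite [LHS]/= [RHS]/=; first by rewrite linearN cmap_diff.
rewrite linearD cmap_diff; congr (_ + _).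
have [e|ne] := eqVneq (i - 1) j; last by rewrite !diag_fun_ne ?linear0.
by subst j; rewrite !diag_funE /= linearZ_LR.
Qed.
Definition kosm X Y (f : chain_map X Y) x : chain_map (kos X x) (kos Y x) :=
  ChainMap (@kos_map_diff X Y f x).

(** The five lemma in elements: homology of the Koszul complex in degree [i] is built from homology
    in degrees [i] and [i - 1]. *)
Lemma kosm_hiso X Y (f : chain_map X Y) x i : hiso f (i - 1) -> hiso f i -> hiso (kosm f x) i.
Proof.
move=> [I1 S1] [I2 S2].
have dD := linearD (diff X i (i - 1)); have dB := linearB (diff X i (i - 1)).
have dZ := linearZ_LR (diff X i (i - 1)).
have eD := linearD (diff Y i (i - 1)); have eB := linearB (diff Y i (i - 1)).
have eZ := linearZ_LR (diff Y i (i - 1)).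
have fB := linearB (f i); have fZ := linearZ_LR (f i); have fD := linearD (f i).
split=> [z /cone_cycleP [hz1 hz2] /cone_boundaryP [a' [b' [E1 E2]]]|z /cone_cycleP [hz1 hz2]].
  have {}hz2 : x *: z.1 + diff X i (i - 1) z.2 = 0 := hz2.
  have {}E1 : f (i - 1) z.1 = - diff Y i (i - 1) a' := E1.
  have {}E2 : f i z.2 = x *: a' + diff Y (i + 1) i b' := E2.
  have [a1 ha1] : exists a1, diff X i (i - 1) a1 = - z.1.
    apply: boundary_pred; apply: boundaryN; apply: I1 => //; rewrite E1.
    by apply: boundaryN; apply: boundary_diff.
  (* The primitive [a1] of [- z.1] need not map to [a']. The difference of [f i a1] and [a'] is a
     cycle, and surjectivity in degree [i] supplies the correction [c]. *)
  have [c [hc [e he]]] : exists c, is_cycle c /\ is_boundary (f i a1 - a' - f i c).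
    apply: S2; rewrite /is_cycle eB -cmap_diff ha1 linearN E1; zmod.
  have hc0 : diff X i (i - 1) c = 0 := hc.
  have /I2 [|b1 hb1] : is_cycle (z.2 - x *: a1 + x *: c).
  - rewrite /is_cycle dD dB !dZ ha1 hc0 scaler0 scalerN -[RHS]hz2; zmod.
  - rewrite fD fB !fZ E2.
    rewrite (_ : _ + _ = diff Y (i + 1) i b' - x *: (f i a1 - a' - f i c)).
      by rewrite -he; apply: boundaryB; [|apply: boundaryZ]; apply: boundary_diff.
    by rewrite !scalerBr; zmod.
  apply/cone_boundaryP; exists (a1 - c), b1.
  rewrite [z]surjective_pairing; congr pair; first by rewrite dB ha1 hc0; zmod.
  by rewrite hb1 /= scalerBr; zmod.
have {}hz2 : x *: z.1 + diff Y i (i - 1) z.2 = 0 := hz2.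
have hz2' : diff Y i (i - 1) z.2 = - (x *: z.1).
  by apply/eqP; rewrite -addr_eq0; apply/eqP; rewrite -[RHS]hz2; zmod.
have [a0 [ha0 ha0']] := S1 z.1 hz1; have [e he] := boundary_pred ha0'.
have [b0 hb0] : exists b0, diff X i (i - 1) b0 = - (x *: a0).
  apply: boundary_pred; apply: boundaryN; apply: I1; first exact: cycleZ.
  rewrite linearZ_LR (_ : x *: _ = - diff Y i (i - 1) (z.2 + x *: e)).
    by apply: boundaryN; apply: boundary_diff.
  by rewrite eD eZ he scalerBr hz2'; zmod.
have [b1 [hb1 [g hg]]] : exists b1, is_cycle b1 /\ is_boundary (z.2 + x *: e - f i b0 - f i b1).
  apply: S2; rewrite /is_cycle eB eD eZ he -cmap_diff hb0 linearN linearZ_LR scalerBr hz2'; zmod.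
have hb10 : diff X i (i - 1) b1 = 0 := hb1.
exists ((a0, b0 + b1) : kos X x i); split.
  by apply/cone_cycleP; split=> //=; rewrite dD hb0 hb10; zmod.
apply/cone_boundaryP; exists (- e), g.
rewrite [z in LHS]surjective_pairing linearN he hg; congr pair; first by rewrite /=; zmod.
by rewrite /= fD scalerN; zmod.
Qed.

Fixpoint kosl W (xs : seq R) : complex R := if xs is x :: xs' then kos (kosl W xs') x else W.
Fixpoint koslm X Y (f : chain_map X Y) xs : chain_map (kosl X xs) (kosl Y xs) :=
  match xs with [::] => f | x :: xs' => kosm (koslm f xs') x end.

Lemma kos_projective W x : (forall i, projective (W i)) -> forall i, projective (kos W x i).
Proof. by move=> h i; apply: prod_projective. Qed.
Lemma kosl_projective W xs : (forall i, projective (W i)) -> forall i, projective (kosl W xs i).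
Proof. by move=> h; elim: xs => //= x xs IH; apply: kos_projective. Qed.
Lemma kosl_fg (hR : noetherian R) W xs : degreewise_finite W -> degreewise_finite (kosl W xs).
Proof. by move=> h; elim: xs => //= x xs IH i; apply: cone_fg. Qed.

Definition cnull W (x : R) := homotopic (cscale W x) (czero W W).

(** The null-homotopy of multiplication by [x] is [(z1, z2) |-> (z2, 0)]. *)
Lemma kos_null W x : cnull (kos W x) x.
Proof.
pose h i j (z : kos W x i) : kos W x j := (diag_fun (chain_id W) (j - 1) z.2, 0).
have hl i j : linear (@h i j).
  move=> c u v; congr pair; last by rewrite /= scaler0 addr0.
  exact: (linearP (diag_lin (chain_id W) i (j - 1))).
exists (fun i j => lin_of (hl i j)) => i z.
have D k l (w : W k) : l = k -> diag_fun (cscale W x) k (diag_fun (chain_id W) l w) = x *: w.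
  by move=> E; subst l; rewrite !diag_funE.
have D2 k l (w : W k) : l = k -> diff W l (i - 1) (diag_fun (chain_id W) l w) = diff W k (i - 1) w.
  by move=> E; subst l; rewrite diag_funE.
rewrite /= subr0 /cone_fun /h /=; congr pair; rewrite /=.
  rewrite D2 ?addrK // !diag_funE /=; zmod.
by rewrite D ?addrK // linear0 !addr0.
Qed.

Lemma kos_null_mono W x y : cnull W y -> cnull (kos W x) y.
Proof.
move=> [h e].
pose H i j (z : kos W x i) : kos W x j := (- h (i - 1) (j - 1) z.1, h i j z.2).
have hl i j : linear (@H i j).
  move=> c u v; rewrite /H; congr pair; rewrite /= ?(linearP (h _ _)) //.
  by rewrite opprD scalerN.
exists (fun i j => lin_of (hl i j)) => i z.
have e1 : y *: z.1 = _ := etrans (esym (subr0 _)) (e (i - 1) z.1).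
have e2 : y *: z.2 = _ := etrans (esym (subr0 _)) (e i z.2).
rewrite /= subr0 /cone_fun /H /=; congr pair; rewrite /= ?linearN ?opprK.
  rewrite e1; congr (_ + _).
  have F k (w : W (i - 1)) : k = i -> diff W k (i - 1) (h (i - 1) k w) = diff W i (i - 1) (h (i - 1) i w).
    by move=> E; subst k.
  by rewrite !F ?addrK ?subrK.
rewrite e2 linearD diag_funE /= linearZ_LR.
have -> : diag_fun (cscale W x) i (- h (i - 1) (i + 1 - 1) z.1) = - (x *: h (i - 1) i z.1).
  have G k : k = i -> diag_fun (cscale W x) i (- h (i - 1) k z.1) = - (x *: h (i - 1) i z.1).
    by move=> E; subst k; rewrite diag_funE /= scalerN.
  by rewrite G ?addrK.
by zmod.
Qed.
Lemma kosl_null W xs x : x \in xs -> cnull (kosl W xs) x.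
Proof.
elim: xs => //= y xs IH; rewrite inE => /orP [/eqP ->|/IH]; first exact: kos_null.
exact: kos_null_mono.
Qed.
Lemma cnull_boundary W x N i (z : tc W N i) : cnull W x -> is_cycle z -> is_boundary (x *: z).
Proof.
move=> h hz; have := homotopic_heqv (tcl_homotopic N h) hz.
have -> : tcl (czero W W) N i z = 0 by apply: tml0.
rewrite subr0; suff -> : tcl (cscale W x) N i z = x *: z by [].
elim/tens_ind: (z) => [|u v hu hv|u n]; first by rewrite linear0 scaler0.
  by rewrite linearD hu hv scalerDr.
by rewrite tcl_tp /= tpZl.
Qed.
Lemma cnull_boundary0 W x i (z : W i) : cnull W x -> is_cycle z -> is_boundary (x *: z).
Proof. by move=> h hz; have := homotopic_heqv h hz; rewrite /= subr0. Qed.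
End Koszul.

(** * Maps that are null-homotopic modulo an ideal *)

Section MaximalNull.
Variables (R : comPzRingType) (m : R -> Prop).

(** This is [m M] when [m] is an ideal. *)
Definition mtimes (M : lmodType R) : submod M.
Proof.
exists (fun u => exists t : seq (R * M), (forall p, p \in t -> m p.1) /\ u = \sum_(p <- t) p.1 *: p.2).
- by exists [::]; rewrite big_nil.
- move=> x y [t [ht ->]] [t' [ht' ->]]; exists (t ++ t'); rewrite big_cat; split=> // p.
  by rewrite mem_cat => /orP [/ht|/ht'].
- move=> c x [t [ht ->]]; exists [seq (p.1, c *: p.2) | p <- t]; split.
    by move=> p /mapP [q qt ->]; exact: (ht q qt).
  by rewrite big_map scaler_sumr; apply: eq_bigr => p _ /=; rewrite !scalerA mulrC.
Defined.
Lemma mtimesZ (M : lmodType R) r (u : M) : m r -> mtimes M (r *: u).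
Proof.
move=> mr; exists [:: (r, u)]; rewrite big_seq1; split=> // p; by rewrite mem_seq1 => /eqP ->.
Qed.
Lemma mtimes_lin (M N : lmodType R) (f : {linear M -> N}) u : mtimes M u -> mtimes N (f u).
Proof.
move=> [t [ht ->]]; rewrite linear_sum big_seq; apply: submod_sum => p pt.
by rewrite linearZ_LR; apply/mtimesZ/ht.
Qed.

(** The homotopy consists of maps over [R] and only its defect lies in [m W], so it can be carried
    through Koszul complexes and tensor products. [J] is the range of degrees where it is
    required. *)
Definition mnull (J : int -> Prop) (W' W : complex R) (f : chain_map W' W) :=
  exists h : forall i j, {linear W' i -> W j}, forall i, J i -> forall w : W' i,
    mtimes (W i) (f i w - (diff W (i + 1) i (h i (i + 1) w) + h (i - 1) i (diff W' i (i - 1) w))).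

(** [J] is closed under predecessors because degree [i] of a Koszul complex contains degree [i - 1]
    of the original one, on which the homotopy changes sign. *)
Lemma mnull_kosm J W' W (f : chain_map W' W) x : (forall i, J i -> J (i - 1)) ->
  mnull J f -> mnull J (kosm f x).
Proof.
move=> Jd [h e].
pose H i j (z : kos W' x i) : kos W x j := (- h (i - 1) (j - 1) z.1, h i j z.2).
have hl i j : linear (@H i j).
  move=> c u v; rewrite /H; congr pair; rewrite /= ?(linearP (h _ _)) //.
  by rewrite opprD scalerN.
exists (fun i j => lin_of (hl i j)) => i iJ z.
have e1 := e _ (Jd i iJ) z.1; have e2 := e i iJ z.2.
have E1 : diff W (i + 1 - 1) (i - 1) (h (i - 1) (i + 1 - 1) z.1) =
    diff W (i - 1 + 1) (i - 1) (h (i - 1) (i - 1 + 1) z.1) by rewrite addrK subrK.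
have E2 : diag_fun (cscale W x) i (h (i - 1) (i + 1 - 1) z.1) = x *: h (i - 1) i z.1.
  have G k : k = i -> diag_fun (cscale W x) i (h (i - 1) k z.1) = x *: h (i - 1) i z.1.
    by move=> E; subst k; rewrite diag_funE.
  by rewrite G ?addrK.
have -> : kosm f x i z - (diff (kos W x) (i + 1) i (lin_of (hl i (i + 1)) z) +
     lin_of (hl (i - 1) i) (diff (kos W' x) i (i - 1) z)) =
   inl_lin (W (i - 1)) (W i) (f (i - 1) z.1 - (diff W (i - 1 + 1) (i - 1) (h (i - 1) (i - 1 + 1) z.1) +
      h (i - 1 - 1) (i - 1) (diff W' (i - 1) (i - 1 - 1) z.1))) +
   inr_lin (W (i - 1)) (W i) (f i z.2 - (diff W (i + 1) i (h i (i + 1) z.2) + h (i - 1) i (diff W' i (i - 1) z.2))).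
  congr pair.
    change (f (i - 1) z.1 - (- diff W (i + 1 - 1) (i - 1) (- h (i - 1) (i + 1 - 1) z.1) +
      (- h (i - 1 - 1) (i - 1) (- diff W' (i - 1) (i - 1 - 1) z.1))) =
      (f (i - 1) z.1 - (diff W (i - 1 + 1) (i - 1) (h (i - 1) (i - 1 + 1) z.1) +
      h (i - 1 - 1) (i - 1) (diff W' (i - 1) (i - 1 - 1) z.1))) + 0).
    by rewrite (linearN (diff W _ _)) (linearN (h _ _)) !opprK E1 addr0.
  change (f i z.2 - ((diag_fun (cscale W x) i (- h (i - 1) (i + 1 - 1) z.1) + diff W (i + 1) i (h i (i + 1) z.2))
     + h (i - 1) i (diag_fun (cscale W' x) (i - 1) z.1 + diff W' i (i - 1) z.2)) =
    0 + (f i z.2 - (diff W (i + 1) i (h i (i + 1) z.2) + h (i - 1) i (diff W' i (i - 1) z.2)))).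
  rewrite -diag_linE (linearN (diag_lin (cscale W x) _ _)) diag_linE E2 diag_funE (linearD (h _ _)).
  by rewrite [cscale W' x _ _]/(x *: z.1) (linearZ_LR (h _ _)); zmod.
by apply: submodD; apply: mtimes_lin.
Qed.
Lemma mnull_koslm J W' W (f : chain_map W' W) xs : (forall i, J i -> J (i - 1)) ->
  mnull J f -> mnull J (koslm f xs).
Proof. by move=> Jd h; elim: xs => //= x xs IH; apply: mnull_kosm. Qed.

Lemma mnull_tc J W' W (f : chain_map W' W) (N : lmodType R) i (z : tc W' N i) :
  mnull J f -> (forall r, m r -> forall n : N, r *: n = 0) -> J i ->
  is_cycle z -> is_boundary (tcl f N i z).
Proof.
move=> [h e] kN iJ hz; exists (tml (h i (i + 1)) z).
suff E : tcl f N i z = diff (tc W N) (i + 1) i (tml (h i (i + 1)) z) +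
    tml (h (i - 1) i) (diff (tc W' N) i (i - 1) z) by rewrite E hz linear0 addr0.
elim/tens_ind: (z) => [|x y hx hy|x n]; first by rewrite !linear0 addr0.
  by rewrite !linearD hx hy; zmod.
rewrite tcl_tp tc_diff_tml tml_tc_diff -tpDl; apply/eqP; rewrite -subr_eq0; apply/eqP.
apply: etrans (esym (linearB (tpl (W i) n) _ _)) _.
have [t [ht ->]] := e i iJ x; rewrite linear_sum big_seq big1 // => p pt.
by rewrite /= tp_bal (kN _ (ht p pt)) tp0r.
Qed.
End MaximalNull.

(** * From coefficients killed by an ideal to arbitrary coefficients *)

Section TLemma.
Variable R : comPzRingType.

Definition tzero (V' V : complex R) (f : chain_map V' V) (N : lmodType R) i :=
  forall z : tc V' N i, is_cycle z -> is_boundary (tcl f N i z).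

(** As [f] vanishes on [N / x N], the cycle [f z] is homologous to one with coefficients in [x N]. A
    lift [rho] of the latter to coefficients [N] has its differential in [ker x], where [g]
    vanishes, so [g rho] can be corrected to a cycle [w]. Then [g (f z)] is [x *: w] up to a
    boundary, and [x] is null on [V]. Projectivity of [V'] keeps the two inclusions of coefficients
    injective. *)
Lemma tzero_step (V'' V' V : complex R) (f : chain_map V'' V') (g : chain_map V' V)
  (N : lmodType R) (x : R) i :
  (forall i, projective (V' i)) -> cnull V x ->
  tzero f (quo (im_sub (scale_lin N x))) i ->
  tzero g (sub_of (ker_sub (scale_lin N x))) (i - 1) ->
  tzero (chain_comp g f) N i.
Proof.
move=> pV' nx hq hs z hz.
set s := scale_lin N x; set A := ker_sub s; set I := im_sub s.
have pI n : I (s n) by exists n.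
pose iota := sub_incl I; pose p : {linear N -> sub_of I} := sub_lift pI.
pose kap := sub_incl A; pose pi := quo_pi I.
have pS y : exists n, p n = y by case: y => y [n e]; exists n; apply: sub_val_inj.
have [q hq'] := hq (tcr V'' pi i z) (cmap_cycle (tcr V'' pi) hz).
have [q' eq'] : exists q', tcr V' pi (i + 1) q' = q := tmr_surj (@quo_pi_surj _ _ I) q.
have tcc (X Y : complex R) (k : chain_map X Y) (M M' : lmodType R) (u : {linear M -> M'}) j y :
    tcl k M' j (tcr X u j y) = tcr Y u j (tcl k M j y) by apply: tml_tmr.
have tI (X : complex R) (M M' : lmodType R) (u : {linear M -> M'}) j :
    projective (X j) -> injective u -> injective (tcr X u j) by apply: tmr_inj.
have [sg hsg] : exists sg, tcr V' iota i sg = tcl f N i z - diff (tc V' N) (i + 1) i q'.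
  apply: (tmr_exact (M := V' i) (f := iota) (g := pi)); first exact: quo_pi_surj.
    by move=> y /quo_piE hy; exists (SubOf hy).
  change (tcr V' pi i (tcl f N i z - diff (tc V' N) (i + 1) i q') = 0).
  by rewrite linearB cmap_diff eq' hq' -tcc subrr.
have [rho hrho] : exists rho, tcr V' p i rho = sg := tmr_surj (M := V' i) pS sg.
have csg : is_cycle sg.
  apply: (tI V' _ _ iota _ (pV' _) (@sub_incl_inj _ _ _)).
  rewrite cmap_diff hsg linearB diff_diff subr0 linear0.
  by rewrite -cmap_diff (hz : diff _ _ _ z = 0) linear0.
have [al hal] : exists al, tcr V' kap (i - 1) al = diff (tc V' N) i (i - 1) rho.
  apply: (tmr_exact (M := V' (i - 1)) (f := kap) (g := p)) => //.
    move=> y /(congr1 (@sub_val _ _ _)) hy; by exists (@SubOf _ _ A y hy).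
  change (tcr V' p (i - 1) (diff (tc V' N) i (i - 1) rho) = 0).
  by rewrite cmap_diff hrho.
have cal : is_cycle al.
  apply: (tI V' _ _ kap _ (pV' _) (@sub_incl_inj _ _ _)).
  by rewrite cmap_diff hal diff_diff linear0.
have [be hbe] := boundary_pred (hs al cal).
pose w := tcl g N i rho - tcr V kap i be.
have cw : is_cycle w.
  by rewrite /is_cycle /w linearB -!cmap_diff -hal hbe tcc subrr.
have bw := cnull_boundary nx cw.
have xk : x *: tcr V kap i be = 0.
  elim/tens_ind: (be : tens (V i) (sub_of A)) => [|u v hu hv|u n].
  - by rewrite linear0 scaler0.
  - by rewrite linearD scalerDr hu hv addr0.
  rewrite tcr_tp -tpZr; case: n => n hn; by rewrite -[x *: _]/(s n) (hn : s n = 0) tp0r.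
have ip y : tcr V iota i (tcr V p i y) = x *: y.
  elim/tens_ind: (y : tens (V i) N) => [|u v hu hv|u n]; first by rewrite !linear0 ?scaler0.
    by rewrite scalerDr -hu -hv !linearD.
  by rewrite !tcr_tp -tpZr.
have -> : tcl (chain_comp g f) N i z = tcl g N i (diff (tc V' N) (i + 1) i q') + x *: w.
  rewrite -tcl_comp -(subrK (diff (tc V' N) (i + 1) i q') (tcl f N i z)) -hsg linearD addrC.
  congr (_ + _); rewrite scalerBr xk subr0 -ip -hrho.
  by rewrite -!tcc.
apply: boundaryD => //; apply: cmap_boundary; exact: boundary_diff.
Qed.

(** [tzero_step] removes a generator from [xs] by composing two consecutive maps, so each induction
    step thins the system to its even indices. [Q] is a property that survives composition; it will
    be an isomorphism on homology in some range. *)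
Lemma tlemma (J : int -> Prop) (Q : forall A B : complex R, chain_map A B -> Prop)
  (hQ : forall A B C (g : chain_map B C) (f : chain_map A B), Q _ _ f -> Q _ _ g -> Q _ _ (chain_comp g f))
  (Jd : forall i, J i -> J (i - 1)) (xs : seq R) (V : nat -> complex R)
  (th : forall j, chain_map (V j.+1) (V j)) :
  (forall j i, projective (V j i)) -> (forall j x, x \in xs -> cnull (V j) x) ->
  (forall j, Q _ _ (th j)) ->
  (forall N : lmodType R, (forall x, x \in xs -> forall n : N, x *: n = 0) ->
     forall j i, J i -> tzero (th j) N i) ->
  exists k (c : chain_map (V k) (V 0%N)), Q _ _ c /\ forall i, J i -> tzero c R^o i.
Proof.
elim: xs V th => [|x xs IH] V th pV nV qV hN.
  by exists 1, (th 0%N); split=> [|i iJ]; [apply: qV|apply: hN].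
pose V' j := V j.*2.
pose th' j : chain_map (V' j.+1) (V' j) := chain_comp (th j.*2) (th j.*2.+1).
have [||||k [c [qc hc]]] := IH V' th' _ _ _ _.
- by move=> j i; apply: (pV j.*2).
- by move=> j y hy; apply: (nV j.*2); rewrite inE hy orbT.
- by move=> j; apply: hQ; apply: qV.
- move=> N kN j i iJ; apply: (tzero_step (x := x)) => //; first by apply: (nV j.*2); rewrite mem_head.
    apply: hN => // y; rewrite inE => /orP [/eqP ->|hy] n.
      have [n' <-] := quo_pi_surj n; rewrite -linearZ_LR; apply/quo_piE; by exists n'.
    have [n' <-] := quo_pi_surj n; by rewrite -linearZ_LR kN // linear0.
  apply: hN; last exact: Jd.
  move=> y; rewrite inE => /orP [/eqP ->|hy] [n hn]; apply: sub_val_inj => //=.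
  exact: kN.
by exists k.*2, c.
Qed.

Lemma tzero_homology (V' V : complex R) (c : chain_map V' V) i :
  hiso c i -> tzero c R^o i -> homology_zero V i.
Proof.
move=> [ci cs] hc z hz; have [x [hx ex]] := cs z hz; apply: boundary_sub (ex) _.
have ct : is_cycle (tp x (1 : R^o) : tc V' R^o i).
  by rewrite /is_cycle tc_diff_tp (hx : diff _ _ _ _ = 0) tp0l.
have := cmap_boundary (tc1 V) (hc _ ct).
by rewrite tcl_tp (_ : tc1 V i _ = c i x) //; apply: etrans (tens1_tp _ (1 : R^o)) (scale1r _).
Qed.
End TLemma.

(** * Descent of vanishing homology *)

Section ResidueFunctional.
Variables (R S : comPzRingType) (phi : {rmorphism R -> S}) (m : R -> Prop) (q : S -> Prop).
Hypotheses (hm : is_maximal m) (hq : is_prime q) (mq : forall r, m r <-> q (phi r)).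

Let good (V : S -> Prop) := [/\ forall s, q s -> V s, forall s t, V s -> V t -> V (s + t),
  forall r s, V s -> V (phi r * s) & ~ V 1].

Let q_good : good q.
Proof.
have [[q0 qD qM] q1 _] := hq; split=> //; by move=> r s; apply: (qM).
Qed.

Let max_good : exists V, good V /\ forall V', good V' -> (forall s, V s -> V' s) -> forall s, V' s -> V s.
Proof.
(* The union of the empty chain is empty and does not contain [q]; therefore [q] is added in the
   predicate. *)
pose P : set (set S) := fun U => good (fun s => U s \/ q s).
have [F FP tF|U [PU maxU]] := @Zorn_bigcup S P.
  have [qq qD qM q1] := q_good.
  split=> [s qs|s t|r s|]; first by right.
  - move=> [[U FU Us]|qs] [[U' FU' U't]|qt].
    + have [UU'|U'U] := tF _ _ FU FU'.
        have [_ D _ _] := FP _ FU'.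
        by case: (D s t (or_introl (UU' _ Us)) (or_introl U't)) => h; [left; exists U'|right].
      have [_ D _ _] := FP _ FU.
      by case: (D s t (or_introl Us) (or_introl (U'U _ U't))) => h; [left; exists U|right].
    + have [_ D _ _] := FP _ FU.
      by case: (D s t (or_introl Us) (or_intror qt)) => h; [left; exists U|right].
    + have [_ D _ _] := FP _ FU'.
      by case: (D s t (or_intror qs) (or_introl U't)) => h; [left; exists U'|right].
    + by right; apply: qD.
  - move=> [[U FU Us]|qs]; last by right; apply: (qM).
    have [_ _ M _] := FP _ FU; by case: (M r s (or_introl Us)) => h; [left; exists U|right].
  - move=> [[U FU U1]|] //; by have [_ _ _ []] := FP _ FU; left.
exists (fun s => U s \/ q s); split=> // V' gV' UV' s V's; apply: contrapT => nU.
have [qV' _ _ _] := gV'.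
apply: (maxU V'); last first.
  rewrite /P; suff -> : (fun s => V' s \/ q s) = V' by [].
  by apply/funext => t; apply/propext; split=> [[|/qV']|]; [| |left].
split=> [t Ut|h]; first by apply: UV'; left.
by apply: nU; left; apply: (h).
Qed.

(** [R / m] is a field inside [S / q], so the line spanned by [1] has a complement; a submodule [V]
    containing [q] and maximal without [1] is one. The function [rho] chooses lifts to [R] of
    [S -> S / V = R / m], hence is linear only modulo [m]. *)
Lemma residue_functional : exists rho : S -> R,
  [/\ forall s t, m (rho (s + t) - rho s - rho t), forall r s, m (rho (phi r * s) - r * rho s) & m (rho 1 - 1)].
Proof.
have [V [[qV VD VM V1] maxV]] := max_good.
have [[m0 mD mM] m1 mmax] := hm.
have VN s : V s -> V (- s) by move=> /(VM (-1)); rewrite rmorphN1 mulN1r.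
have inv r : ~ m r -> exists r' c, m c /\ r' * r = 1 - c.
  move=> nr; pose J x := exists a c, m c /\ x = c + a * r.
  have iJ : is_ideal J.
    split; first by exists 0, 0; rewrite mul0r addr0.
      move=> x y [a [c [mc ->]]] [b [d [md ->]]]; exists (a + b), (c + d); split; first exact: mD.
      by ring.
    move=> b x [a [c [mc ->]]]; exists (b * a), (b * c); split; first exact: mM.
    by ring.
  have [x mx||[a [c [mc e]]]] := mmax J iJ; first by exists 0, x; rewrite mul0r addr0.
    by move=> h; case: nr; apply: (h); exists 1, 0; split=> //; ring.
  by exists a, c; split=> //; rewrite e; ring.
have Vm r : V (phi r) -> m r.
  move=> h; apply: contrapT => /inv [r' [c [mc e]]]; apply: V1.
  have := VD _ _ (VM r' _ h) (qV _ ((mq c).1 mc)).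
  by rewrite -rmorphM e rmorphB rmorph1 subrK.
have ex s : exists r, V (s - phi r).
  have [Vs|nV] := pselect (V s); first by exists 0; rewrite rmorph0 subr0.
  (* By maximality of [V], an element [s] outside [V] forces [1] into [V + phi(R) s]. The
     coefficient of [s] is outside [m], and its inverse modulo [m] is the desired residue. *)
  pose V' t := exists v r, V v /\ t = v + phi r * s.
  have [v [r [hv e]]] : V' 1.
    apply: contrapT => n1; apply: nV; apply: (maxV V').
    - split=> //.
      + by move=> t qt; exists t, 0; rewrite rmorph0 mul0r addr0; split=> //; apply: (qV).
      + move=> t u [v [r [hv ->]]] [v' [r' [hv' ->]]]; exists (v + v'), (r + r').
        by split; [apply: (VD)|rewrite rmorphD; ring].
      + move=> r t [v [r' [hv ->]]]; exists (phi r * v), (r * r').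
        by split; [apply: (VM)|rewrite rmorphM; ring].
    - by move=> t Vt; exists t, 0; rewrite rmorph0 mul0r addr0.
    - exists 0, 1; rewrite rmorph1 mul1r add0r; split=> //.
      by have := VM 0 _ (qV _ ((mq 0).1 m0)); rewrite rmorph0 mul0r.
  have nr : ~ m r.
    move=> mr; apply: V1; rewrite e; apply: (VD) => //; apply: (qV).
    have [[_ _ qM] _ _] := hq; rewrite mulrC; apply: (qM); exact/mq.
  have [r' [c [mc e']]] := inv r nr; exists r'.
  have qcs : q (phi c * s) by have [[_ _ qM] _ _] := hq; rewrite mulrC; apply: (qM); apply/mq.
  rewrite (_ : s - phi r' = phi c * s + phi (- r') * v); first by apply: (VD); [apply: (qV)|apply: (VM)].
  have -> : phi r' = phi r' * (v + phi r * s) by rewrite -e mulr1.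
  rewrite mulrDr mulrA -rmorphM e' rmorphB rmorph1 rmorphN; ring.
have [rho hrho] := choice ex.
exists rho; split=> [s t|r s|]; apply: Vm.
- rewrite !rmorphB (_ : _ - _ - _ = - (s + t - phi (rho (s + t))) + (s - phi (rho s)) + (t - phi (rho t))).
    by apply: (VD) => //; apply: (VD) => //; apply: (VN).
  by ring.
- rewrite rmorphB rmorphM (_ : _ - _ = - (phi r * s - phi (rho (phi r * s))) + phi r * (s - phi (rho s))).
    by apply: (VD); [apply: (VN)|apply: (VM)].
  by ring.
- rewrite rmorphB rmorph1 -opprB; exact: VN.
Qed.
End ResidueFunctional.

Section Descent.
Variables (R S : comPzRingType) (phi : {rmorphism R -> S}).
Local Notation Sm := (ringmod phi).
Definition one_mod : Sm := (1 : S).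

Lemma unit_map_subproof (W : complex R) i j (x : W i) :
  tpl (W j) one_mod (diff W i j x) = diff (tc W Sm) i j (tpl (W i) one_mod x).
Proof. by apply/esym; apply: tml_tp. Qed.
Definition unit_map (W : complex R) : chain_map W (tc W Sm) :=
  @ChainMap R W (tc W Sm) (fun i => tpl (W i) one_mod) (@unit_map_subproof W).

Section Reduction.
Variables (m : R -> Prop) (q : S -> Prop).
Hypotheses (hm : is_maximal m) (hq : is_prime q) (mq : forall r, m r <-> q (phi r)).

(** The residue functional tensored with [M]. The second clause is naturality in [M], phrased
    through representatives [u] so that the induced map on [M / m M] need not be named. *)
Lemma residue_map : exists sg : forall M : lmodType R, {linear tens M Sm -> quo (mtimes m M)},
  (forall M u, sg M (tp u one_mod) = quo_pi (mtimes m M) u) /\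
  forall (M M' : lmodType R) (f : {linear M -> M'}) y u,
    sg M y = quo_pi (mtimes m M) u -> sg M' (tml f y) = quo_pi (mtimes m M') (f u).
Proof.
have [rho [hD hM h1]] := residue_functional hm hq mq.
have cong (M : lmodType R) a b (u : M) : m (a - b) ->
    quo_pi (mtimes m M) (a *: u) = quo_pi (mtimes m M) (b *: u).
  by move=> h; apply/quo_pi0P; rewrite -scalerBl; apply: mtimesZ.
have bl (M : lmodType R) (s : Sm) : linear (fun u : M => quo_pi (mtimes m M) (rho s *: u)).
  by move=> a x y; rewrite -(linearP (quo_pi _)) scalerDr !scalerA mulrC.
have br (M : lmodType R) (u : M) : linear (fun s : Sm => quo_pi (mtimes m M) (rho s *: u)).
  move=> a s t; rewrite -(linearP (quo_pi _)) scalerA -scalerDl; apply: cong.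
  have [[_ mD _] _ _] := hm.
  rewrite (_ : _ - _ = (rho (phi a * s + t) - rho (phi a * s) - rho t) + (rho (phi a * s) - a * rho s)).
    exact: mD.
  by rewrite [a *: s + t]/(phi a * s + t); ring.
pose sg M := tens_lift (bl M) (br M).
have sgE M u s : sg M (tp u s) = quo_pi (mtimes m M) (rho s *: u) by apply: tens_lift_tp.
exists sg; split=> [M u|M M' f y u e]; first by rewrite sgE (cong _ _ 1) ?scale1r.
have fm x : mtimes m M x -> quo_pi (mtimes m M') (f x) = 0.
  by move=> h; apply/quo_piE; apply: mtimes_lin.
pose fb := quo_lift (P := mtimes m M) (f := lin_of (linear_comp (quo_pi (mtimes m M')) f)) fm.
have fbE x : fb (quo_pi _ x) = quo_pi _ (f x) := quo_liftK _ _.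
rewrite -fbE -e.
apply: (@tens_eq_lin _ _ _ _ (lin_of (linear_comp (sg M') (tml f))) (lin_of (linear_comp fb (sg M)))) => v s.
change (sg M' (tml f (tp v s)) = fb (sg M (tp v s))).
by rewrite tml_tp !sgE fbE (linearZ_LR f).
Qed.

Lemma mnull_base_change (J : int -> Prop) (W' W : complex R) (f : chain_map W' W)
  (h : forall i j, {linear W' i -> tc W Sm j}) :
  (forall i, projective (W' i)) ->
  (forall i, J i -> forall w, unit_map W i (f i w) =
     diff (tc W Sm) (i + 1) i (h i (i + 1) w) + h (i - 1) i (diff W' i (i - 1) w)) ->
  mnull m J f.
Proof.
move=> pW e; have [sg [sg1 sgf]] := residue_map.
have lft i j : exists k : {linear W' i -> W j}, forall w, quo_pi (mtimes m (W j)) (k w) = sg (W j) (h i j w).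
  exact: (pW i _ _ (quo_pi _) (lin_of (linear_comp (sg (W j)) (h i j))) (@quo_pi_surj _ _ _)).
pose k i j := projT1 (cid (lft i j)); have hk i j := projT2 (cid (lft i j)).
exists k => i iJ w; apply/quo_piE; rewrite linearB linearD.
have -> : quo_pi (mtimes m (W i)) (diff W (i + 1) i (k i (i + 1) w)) =
    sg (W i) (diff (tc W Sm) (i + 1) i (h i (i + 1) w)) by rewrite -(sgf _ _ _ _ _ (esym (hk i (i + 1) w))).
by rewrite hk -sg1 -linearD -e // subrr.
Qed.
End Reduction.

Hypotheses (hR : noetherian R) (hmax : forall m : R -> Prop, is_maximal m ->
     exists q : S -> Prop, is_prime q /\ (forall r, m r <-> q (phi r))).

Lemma maximal_generators (m : R -> Prop) : is_maximal m ->
  exists xs : seq R, (forall x, x \in xs -> m x) /\ forall r, m r -> spanned (xs : seq R^o) r.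
Proof. by move=> [hm _ _]; have [s [h1 h2]] := fgr_gen_ideal hR hm; exists s. Qed.

Lemma kill_gen (m : R -> Prop) (xs : seq R) (N : lmodType R) :
  (forall r, m r -> spanned (xs : seq R^o) r) ->
  (forall x, x \in xs -> forall n : N, x *: n = 0) -> forall r, m r -> forall n : N, r *: n = 0.
Proof.
move=> gen k r /gen sp n.
pose P := ker_sub (lin_of (fun (a : R) (x y : R^o) => (etrans (scalerDl _ _ _)
  (congr1 (+%R^~ _) (esym (scalerA a x n))) : (a * x + y) *: n = a *: (x *: n) + y *: n))).
exact: (@spanned_sub _ _ _ P r (fun g gs => k g gs n) sp).
Qed.

Lemma local_global_zero (W : complex R) i :
  (forall m, is_maximal m -> exists c, m c /\ forall z : W i, is_cycle z -> is_boundary ((1 - c) *: z)) ->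
  homology_zero W i.
Proof.
move=> h z hz; apply: contrapT => nb.
pose I r := is_boundary (r *: z).
have iI : is_ideal I.
  split; first by rewrite /I scale0r; apply: boundary0.
    by move=> x y; rewrite /I scalerDl; apply: boundaryD.
  by move=> a x; rewrite /I -scalerA; apply: boundaryZ.
have [m [hm Im]] : exists m, is_maximal m /\ forall x, I x -> m x.
  by apply: maximal_exists => //; rewrite /I scale1r.
have [c [mc hc]] := h m hm; have [[_ mD _] m1 _] := hm.
apply: m1; rewrite -(subrK c 1); apply: mD => //; apply: Im; exact: hc.
Qed.

(** [H_i V] modulo [x] embeds into [H_i] of the Koszul complex by [z |-> (0, z)]. Hence
    [(1 - c) *: z] is [x *: a] up to a boundary with [a] a cycle, and Nakayama applies, once for
    each element of [xs]. *)
Lemma kosl_nakayama (m : R -> Prop) (W : complex R) xs i : is_maximal m ->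
  degreewise_finite W -> (forall x, x \in xs -> m x) ->
  (exists c, m c /\ forall z : kosl W xs i, is_cycle z -> is_boundary ((1 - c) *: z)) ->
  exists c, m c /\ forall z : W i, is_cycle z -> is_boundary ((1 - c) *: z).
Proof.
move=> [hm m1 _] fW; elim: xs => //= x xs IH hx [c [mc hc]].
apply: IH; first by move=> y ys; apply: hx; rewrite inE ys orbT.
set V := kosl W xs in hc *.
have fV : degreewise_finite V by apply: kosl_fg.
apply: (nakayama hm (Z := cycles V i) (B := boundaries V i)); first exact/homology_fgP.
move=> z hz.
have := hc ((0, z) : kos V x i); case=> [|]; first by apply/cone_cycleP; rewrite linear0 add0r; split=> //; apply: cycle0.
move=> [a' b'] /[dup] e /(congr1 snd) /= e2.
have /cone_boundaryP [a [b E]] : is_boundary ((1 - c) *: ((0, z) : kos V x i)) by exists (a', b').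
have ha : is_cycle a.
  have /eqP := congr1 fst E; rewrite /= scaler0 eq_sym oppr_eq0 => /eqP //.
have {}E : (1 - c) *: z = x *: a + diff V (i + 1) i b := congr1 snd E.
exists [:: z; a]; split; first by move=> g; rewrite !inE => /orP [/eqP ->|/eqP ->].
exists (diff V (i + 1) i b); split; first exact: boundary_diff.
exists c; split=> //; exists x; split; first by apply: hx; rewrite mem_head.
rewrite /= (_ : z - _ - _ - _ = ((1 - c) *: z) - (x *: a + diff V (i + 1) i b)); first by rewrite E subrr.
by rewrite scalerBl scale1r; zmod.
Qed.

Theorem descent (W : complex R) (a : int) : semiprojective W -> degreewise_finite W ->
  (forall i, i < a -> homology_zero (tc W Sm) i) -> forall i, i < a -> homology_zero W i.
Proof.
move=> sW fW h0 i ia; apply: local_global_zero => m hm.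
have [q [hq mq]] := hmax hm.
have [xs [xm gen]] := maximal_generators hm.
have [h eh] := partial_contraction (unit_map W) sW h0.
pose J (i : int) := is_true (i < a).
have Jd j : J j -> J (j - 1) by rewrite /J; lia.
have mn : mnull m J (chain_id W) by apply: (mnull_base_change hm hq mq (h := h)) => //; case: sW.
have kN (N : lmodType R) : (forall x, x \in xs -> forall n : N, x *: n = 0) ->
    forall (j : nat) i, J i -> tzero (koslm (chain_id W) xs) N i.
  move=> kN _ j Jj z hz; apply: (mnull_tc (mnull_koslm xs Jd mn) _ Jj hz).
  exact: kill_gen gen kN.
have Qid (j : nat) : forall i, hiso (koslm (chain_id W) xs) i.
  elim: (xs) => [|x ys IH] i0; first exact: hiso_id.
  exact: kosm_hiso.
(* The system is constant, with the endomorphism of [W // xs] induced by the identity, which is null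
   modulo [m] in the degrees [J]. The resulting composite is an isomorphism on homology and vanishes
   there. *)
have [k [c [qc hc]]] := @tlemma R J (fun A B f => forall i, hiso f i)
  (fun A B C g f hf hg j => hiso_comp (hf j) (hg j)) Jd xs
  (fun _ => kosl W xs) (fun _ => koslm (chain_id W) xs) (fun _ => kosl_projective (let: conj p _ := sW in p))
  (fun _ x => @kosl_null _ W xs x) Qid kN.
apply: (kosl_nakayama (xs := xs)) => //; exists 0; split; first by case: hm => -[].
move=> z hz; rewrite subr0 scale1r; exact: (tzero_homology (qc i) (hc i ia)).
Qed.
End Descent.

Section FlatDimension.
Variables (R S : comPzRingType) (phi : {rmorphism R -> S}).

(** Dimension shifting along the cokernels [M j] of the flat resolution:
    [0 -> M (j+1) -> F j -> M j -> 0] for [j > 0] and [0 -> M 1 -> F 0 -> S -> 0], starting at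
    [M (n+1) = 0]. The index of [Q] counts the sequences passed, for bounds that worsen at each of
    them. *)
Lemma flat_dimension_induction (Q : nat -> lmodType R -> Prop) :
  finite_flat_dim phi -> (forall N k, flat N -> Q k N) ->
  (forall (N' N N'' : lmodType R) (f : {linear N' -> N}) (g : {linear N -> N''}) k,
     injective f -> (forall y, exists x, g x = y) -> (forall x, g (f x) = 0) ->
     (forall y, g y = 0 -> exists x, f x = y) -> flat N -> Q k N' -> Q k.+1 N'') ->
  exists k, Q k (ringmod phi).
Proof.
move=> [F [n [e [Ff F0 eq]]]] Q0 QS.
pose M (j : nat) : lmodType R := quo (boundaries F j%:Z).
have dB j y : boundaries F j.+1%:Z y -> diff F j.+1%:Z j%:Z y = 0.
  by move=> h; have := boundary_cycle h; rewrite /is_cycle; have -> : j.+1%:Z - 1 = j%:Z by lia.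
pose f j : {linear M j.+1 -> F j%:Z} := quo_lift (@dB j).
have fE j y : f j (quo_pi _ y) = diff F j.+1%:Z j%:Z y := quo_liftK _ _.
have hz j : homology_zero F j.+1%:Z.
  move=> x hx; apply: (eq j.+1%:Z).1 => //.
  have -> : e j.+1%:Z x = 0 by apply/rowP => -[]. 
  exact: boundary0.
have fI j : injective (f j).
  move=> x y; have [x' <-] := quo_pi_surj x; have [y' <-] := quo_pi_surj y.
  rewrite !fE => h; apply/quo_pi0P; apply: hz.
  by rewrite /is_cycle linearB (_ : j.+1%:Z - 1 = j%:Z) ?h ?subrr //; lia.
have zflat (N : lmodType R) : (forall x : N, x = 0) -> flat N.
  move=> z A B g _ x y _.
  have t0 w : w = 0 :> tens A N.
    by elim/tens_ind: w => [//|u v -> ->|u v]; rewrite ?addr0 // [v]z tp0r.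
  by rewrite [x]t0 [y]t0.
have QM k : (k <= n)%N -> Q k (M (n - k).+1).
  elim: k => [|k IH] kn.
    apply/Q0/zflat => x; have [y <-] := quo_pi_surj x.
    rewrite [y]F0 ?linear0 //; lia.
  have E : (n - k)%N = (n - k.+1).+1 by lia.
  apply: (QS _ _ _ (f (n - k.+1).+1) (quo_pi (boundaries F (n - k.+1).+1%:Z)) k) => //.
  - exact: quo_pi_surj.
  - move=> x; have [y <-] := quo_pi_surj x; rewrite fE; apply/quo_piE; exact: boundary_diff.
  - move=> y /quo_piE hy; have E2 : (n - k.+1).+2%:Z = (n - k.+1).+1%:Z + 1 by lia.
    have [w hw] := boundary_lift E2 hy.
    by exists (quo_pi _ w); rewrite fE.
  - by rewrite -E; apply: IH; lia.
exists n.+1; apply: (QS _ _ _ (f 0%N) (e 0) n) => //.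
- move=> y; have [|x [_ [w hw]]] := (eq 0).2 y; first by [].
  by exists x; apply/esym/eqP; rewrite -subr_eq0 -hw.
- by move=> x; have [y <-] := quo_pi_surj x; rewrite fE cmap_diff.
- move=> y hy; have hb : is_boundary y.
    by apply: (eq 0).1; [apply: F0|rewrite hy; apply: boundary0].
  have [w hw] := boundary_lift (esym (add0r (1 : int))) hb.
  by exists (quo_pi _ w); rewrite fE.
- by have := QM n (leqnn n); rewrite subnn.
Qed.
End FlatDimension.

(** * Base change and restriction of scalars *)

Section BaseChangeModule.
Variables (R S : comPzRingType) (phi : {rmorphism R -> S}).
Local Notation Sm := (ringmod phi).
Implicit Types M : lmodType R.
Implicit Types N : lmodType S.

Definition bt M (m : M) (s : S) : base_change phi M := tp m (s : Sm).

Lemma bc_ind M (Q : base_change phi M -> Prop) : Q 0 -> (forall x y, Q x -> Q y -> Q (x + y)) ->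
  (forall m s, Q (bt m s)) -> forall x, Q x.
Proof. exact: (@tens_ind _ M Sm Q). Qed.
Lemma btZ M (m : M) (s t : S) : s *: bt m t = bt m (s * t).
Proof. by rewrite [LHS]bc_scaleE. Qed.
Lemma bt1Z M (m : M) (s : S) : bt m s = s *: bt m 1. Proof. by rewrite btZ mulr1. Qed.
Lemma bc_mapE M M' (f : {linear M -> M'}) m s : bc_map phi f (bt m s) = bt (f m) s.
Proof. exact: tens_map_tp. Qed.
Lemma bt_balanced M (m : M) (r : R) (s : S) : bt (r *: m) s = bt m (phi r * s).
Proof. exact: tp_bal. Qed.

Lemma bunit_linear M : linear (fun m : M => (bt m 1 : restr phi (base_change phi M))).
Proof.
move=> r m m'; rewrite [RHS]/(phi r *: bt m 1 + bt m' 1) btZ -bt_balanced.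
exact: (tpDl (r *: m) m' (1 : Sm)).
Qed.
Definition bunit M : {linear M -> restr phi (base_change phi M)} := lin_of (@bunit_linear M).

Section Extension.
Variables (M : lmodType R) (N : lmodType S) (u : {linear M -> restr phi N}).
Lemma bext_linl (s : Sm) : linear (fun m : M => ((s : S) *: (u m : N) : restr phi N)).
Proof.
have E (r : R) (a b : N) : s *: (phi r *: a + b) = phi r *: (s *: a) + s *: b.
  by rewrite scalerDr !scalerA mulrC.
by move=> r m m'; rewrite linearP; apply: E.
Qed.
Lemma bext_linr (m : M) : linear (fun s : Sm => ((s : S) *: (u m : N) : restr phi N)).
Proof.
have E (r : R) (s t : S) (a : N) : (phi r * s + t) *: a = phi r *: (s *: a) + t *: a.
  by rewrite scalerDl scalerA.
by move=> r s t; apply: E.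
Qed.
Definition bext_R : {linear tens M Sm -> restr phi N} := tens_lift bext_linl bext_linr.
Definition bext_fun (x : base_change phi M) : N := bext_R x.
Lemma bext_fun_bt m s : bext_fun (bt m s) = s *: (u m : N).
Proof. exact: (tens_lift_tp bext_linl bext_linr m s). Qed.
Lemma bext_funD x y : bext_fun (x + y) = bext_fun x + bext_fun y.
Proof. exact: (linearD bext_R). Qed.
Lemma bext_linear : linear bext_fun.
Proof.
move=> a x y; rewrite bext_funD; congr (_ + _).
elim/bc_ind: x => [|v w hv hw|m s]; first by rewrite scaler0 [bext_fun 0](linear0 bext_R) scaler0.
  by rewrite scalerDr !bext_funD hv hw scalerDr.
by rewrite btZ !bext_fun_bt scalerA.
Qed.
(** The map adjoint to [u] under extension and restriction of scalars. *)
Definition bext : {linear base_change phi M -> N} := lin_of bext_linear.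
Lemma bext_bt m s : bext (bt m s) = s *: (u m : N). Proof. exact: bext_fun_bt. Qed.
End Extension.

Lemma bc_eq_lin M N (f g : {linear base_change phi M -> N}) :
  (forall m, f (bt m 1) = g (bt m 1)) -> forall x, f x = g x.
Proof.
move=> h; elim/bc_ind => [|x y hx hy|m s]; first by rewrite !linear0.
  by rewrite !linearD hx hy.
by rewrite bt1Z (linearZ_LR f) (linearZ_LR g) h.
Qed.

Lemma restr_map_linear N N' (f : {linear N -> N'}) : linear (f : restr phi N -> restr phi N').
Proof. move=> r x y; exact: (linearP f (phi r) x y). Qed.
Definition restr_map N N' (f : {linear N -> N'}) : {linear restr phi N -> restr phi N'} := lin_of (restr_map_linear f).

Lemma base_change_projective M : projective M -> projective (base_change phi M).
Proof.
move=> hM A B g f gs.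
have [h hh] := hM _ _ (restr_map g) (lin_of (linear_comp (restr_map f) (bunit M))) gs.
exists (bext h); apply: (@bc_eq_lin _ _ (lin_of (linear_comp g (bext h))) f) => m.
have E : bext h (bt m 1) = h m by apply: etrans (bext_bt h m 1) (scale1r _).
by apply: etrans (congr1 g E) _; apply: hh.
Qed.

Lemma base_change_fgp M : fgp M -> fgp (base_change phi M).
Proof.
move=> [n [e [c ce]]].
have pl (k : 'I_n) : linear (fun m : M => (phi (c k m) : restr phi S^o)).
  by move=> r x y; rewrite linearP rmorphD rmorphM.
exists n, (fun k => bt (e k) 1), (fun k => bext (lin_of (pl k))) => x.
elim/bc_ind: x => [|x y hx hy|m s].
- by rewrite big1 // => k _; rewrite linear0 scale0r.
- by rewrite {1}hx {1}hy -big_split; apply: eq_bigr => k _; rewrite linearD scalerDl.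
rewrite {1}(ce m) [LHS](linear_sum (tpl M (s : Sm))); apply: eq_bigr => k _.
rewrite bext_bt btZ mulr1; apply: etrans (bt_balanced _ _ _) _; congr (bt _ _).
exact: mulrC.
Qed.
End BaseChangeModule.

Section Restriction.
Variables (R S : comPzRingType) (phi : {rmorphism R -> S}).
Local Notation Sm := (ringmod phi).
Implicit Types (A B : complex S) (P X Y : complex R).

Definition rc A : complex R := @Complex R (fun i => restr phi (A i)) (fun i j => restr_map phi (diff A i j))
  (fun i j x => @diff_shape S A i j x) (fun i j k x => @diff_diff S A i j k x).
Definition rcm A B (f : chain_map A B) : chain_map (rc A) (rc B) :=
  @ChainMap R (rc A) (rc B) (fun i => restr_map phi (f i)) (fun i j x => @cmap_diff S A B f i j x).
Lemma rcm_quasi_iso A B (f : chain_map A B) : quasi_iso (rcm f) <-> quasi_iso f. Proof. by []. Qed.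

Fact tcbc_linear P i : linear (fun x : tens (P i) Sm => (x : restr phi (base_change phi (P i)))).
Proof.
have E r (x : tens (P i) Sm) : r *: x = phi r *: (x : base_change phi (P i)).
  elim/tens_ind: x => [|x x' hx hx'|p s].
  - have Z : phi r *: (0 : base_change phi (P i)) = 0 := scaler0 _ _.
    rewrite scaler0; symmetry; exact Z.
  - have Z (y y' : base_change phi (P i)) : phi r *: (y + y') = phi r *: y + phi r *: y' := scalerDr _ _ _.
    rewrite scalerDr hx hx'; symmetry; exact (Z x x').
  have Z : bt phi (r *: p) s = phi r *: bt phi p s by rewrite bt_balanced btZ.
  rewrite -tpZl; exact Z.
by move=> r x y; rewrite E.
Qed.
(** The identity on elements: it only exchanges the [R]-structure of the tensor product for the
    restriction of its [S]-structure. *)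
Definition tcbc P : chain_map (tc P Sm) (rc (bc_complex phi P)) :=
  @ChainMap R (tc P Sm) (rc (bc_complex phi P)) (fun i => lin_of (@tcbc_linear P i)) (fun i j x => erefl).
Lemma tcbc_hiso P i : hiso (tcbc P) i.
Proof. by move: i; apply: bij_hiso => i => [x y //|y]; exists y. Qed.

Fact cext_subproof P A (u : chain_map P (rc A)) i j (x : bc_complex phi P i) :
  bext (u j) (diff (bc_complex phi P) i j x) = diff A i j (bext (u i) x).
Proof.
move: x; apply: (@bc_eq_lin _ _ _ _ _ (lin_of (linear_comp (bext (u j)) (diff (bc_complex phi P) i j)))
  (lin_of (linear_comp (diff A i j) (bext (u i))))) => p.
change (bext (u j) (bc_map phi (diff P i j) (bt phi p 1)) = diff A i j (bext (u i) (bt phi p 1))).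
by rewrite bc_mapE !bext_bt !scale1r cmap_diff.
Qed.
Definition cext P A (u : chain_map P (rc A)) : chain_map (bc_complex phi P) A :=
  @ChainMap S (bc_complex phi P) A (fun i => bext (u i)) (cext_subproof u).
Lemma cext_bt P A (u : chain_map P (rc A)) i p s : cext u i (bt phi p s) = s *: (u i p : A i).
Proof. exact: bext_bt. Qed.

Lemma cext_homotopic P A (u v : chain_map P (rc A)) : homotopic u v -> homotopic (cext u) (cext v).
Proof.
move=> [h e]; exists (fun i j => bext (h i j)) => i.
have L : linear (fun x => diff A (i + 1) i (bext (h i (i + 1)) x) +
     bext (h (i - 1) i) (diff (bc_complex phi P) i (i - 1) x)).
  exact: (linear_add (lin_of (linear_comp (diff A (i + 1) i) (bext (h i (i + 1)))))
    (lin_of (linear_comp (bext (h (i - 1) i)) (diff (bc_complex phi P) i (i - 1))))).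
apply: (@bc_eq_lin _ _ _ _ _ (lin_of (linear_sub (cext u i) (cext v i))) (lin_of L)) => p.
change (bext (u i) (bt phi p 1) - bext (v i) (bt phi p 1) = diff A (i + 1) i (bext (h i (i + 1)) (bt phi p 1)) +
     bext (h (i - 1) i) (bc_map phi (diff P i (i - 1)) (bt phi p 1))).
rewrite bc_mapE !bext_bt !scale1r; exact: e.
Qed.

Lemma hsign_rmorph n : phi (hsign R n) = hsign S n.
Proof. exact: rmorph_sign. Qed.

Section Adjunction.
Variables (P : complex R) (A : complex S).
Local Notation bP := (bc_complex phi P).
Definition adj_hom n (f : hom_deg bP A n) : hom_deg P (rc A) n :=
  @HomDeg R P (rc A) n (fun i j p => f i j (bt phi p 1))
   (fun i j => linear_comp (restr_map phi (hom_lin f i j)) (bunit phi (P i)))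
   (fun i j p => @hom_shape S bP A n f i j (bt phi p 1)).
Fact adj_linear n : linear (@adj_hom n : rc (hom_complex bP A) n -> hom_complex P (rc A) n).
Proof. by move=> r f g; apply: hom_ext. Qed.
Fact adj_diff n m (f : rc (hom_complex bP A) n) :
  adj_hom (diff (hom_complex bP A) n m f) = diff (hom_complex P (rc A)) n m (adj_hom f).
Proof.
apply: hom_ext => i j p.
have [nm|ne] := eqVneq n (m + 1); last first.
  by apply: etrans (hom_diff_ne f j (bt phi p 1) ne) (esym (hom_diff_ne (adj_hom f) j p ne)).
apply: etrans (hom_diffE f (bt phi p 1) nm erefl erefl) _.
apply: etrans _ (esym (hom_diffE (adj_hom f) p nm erefl erefl)).
congr (_ - _).
rewrite -[RHS]/(phi (hsign R n) *: f (i - 1) j (bt phi (diff P i (i - 1) p) 1)) hsign_rmorph.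
congr (_ *: f _ _ _); exact: (bc_mapE phi (diff P i (i - 1)) p 1).
Qed.
Definition adj : chain_map (rc (hom_complex bP A)) (hom_complex P (rc A)) :=
  @ChainMap R (rc (hom_complex bP A)) (hom_complex P (rc A)) (fun n => lin_of (@adj_linear n)) adj_diff.

Lemma adj_hiso n : hiso adj n.
Proof.
move: n; apply: bij_hiso => n.
  move=> f g /= e; apply: hom_ext => i j; apply: (@bc_eq_lin _ _ _ _ _ (hom_lin f i j) (hom_lin g i j)) => p.
  exact: (congr1 (fun h : hom_deg P (rc A) n => h i j p) e).
move=> g; have sh i j (x : bP i) : j != i + n -> bext (hom_lin g i j) x = 0.
  move=> ne; move: x; apply: (@bc_eq_lin _ _ _ _ _ _ (\0 : {linear _ -> _})) => p.
  by rewrite bext_bt /= (hom_shape g p ne) scaler0.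
exists (@HomDeg S bP A n (fun i j => bext (hom_lin g i j)) (fun i j => linearP (bext (hom_lin g i j))) sh).
apply: hom_ext => i j p.
have E : bext (hom_lin g i j) (bt phi p 1) = (g i j p : A j) by rewrite bext_bt; apply: (@scale1r S (A j)).
exact E.
Qed.
End Adjunction.

(** By adjunction [Hom_S (P (x) S, A)] is [Hom_R (P, A)], which is acyclic with [A]. *)
Lemma bc_semiprojective P : semiprojective P -> semiprojective (bc_complex phi P).
Proof.
move=> [pP hP]; split=> [i|A hA i]; first exact: base_change_projective.
by apply: ((hiso_zero (adj_hiso P A i)).2); apply: hP.
Qed.

Fact bcm_subproof X Y (f : chain_map X Y) i j (x : bc_complex phi X i) :
  bc_map phi (f j) (diff (bc_complex phi X) i j x) = diff (bc_complex phi Y) i j (bc_map phi (f i) x).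
Proof. exact: (@cmap_diff R _ _ (tcl f Sm) i j x). Qed.
Definition bcm X Y (f : chain_map X Y) : chain_map (bc_complex phi X) (bc_complex phi Y) :=
  @ChainMap S (bc_complex phi X) (bc_complex phi Y) (fun i => bc_map phi (f i)) (bcm_subproof f).
Lemma bcm_bt X Y (f : chain_map X Y) i x s : bcm f i (bt phi x s) = bt phi (f i x) s.
Proof. exact: bc_mapE. Qed.
Lemma bcm_quasi_iso X Y (f : chain_map X Y) :
  semiprojective X -> semiprojective Y -> quasi_iso f -> quasi_iso (bcm f).
Proof. by move=> hX hY hf; apply: (tcl_quasi_iso Sm hX hY hf). Qed.

Lemma bc_diff_bt X i j x s : diff (bc_complex phi X) i j (bt phi x s) = bt phi (diff X i j x) s.
Proof. exact: bc_mapE. Qed.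

Section HomBaseChange.
Variables (X Y : complex R).
Local Notation bX := (bc_complex phi X).
Local Notation bY := (bc_complex phi Y).
Fact bch_shape n (u : hom_deg X Y n) i j (x : bX i) : j != i + n -> bc_map phi (hom_lin u i j) x = 0.
Proof. by move=> ne; apply: bc_map0 => m; apply: (hom_shape u m ne). Qed.
Definition bch_hom n (u : hom_complex X Y n) : hom_complex bX bY n :=
  @HomDeg S bX bY n (fun i j => bc_map phi (hom_lin u i j)) (fun i j => linearP (bc_map phi (hom_lin u i j)))
   (@bch_shape n u).
Lemma bch_bt n u i j x s : hom_fun (@bch_hom n u) i j (bt phi x s) = bt phi (hom_fun u i j x) s.
Proof. exact: bc_mapE. Qed.
Lemma bch_ext n (f g : hom_complex bX bY n) :
  (forall i j x, hom_fun f i j (bt phi x 1) = hom_fun g i j (bt phi x 1)) -> f = g.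
Proof.
move=> h; apply: hom_ext => i j; apply: (@bc_eq_lin _ _ _ _ _ (hom_lin f i j) (hom_lin g i j)) => x.
exact: h.
Qed.
Fact bch_linear n : linear (@bch_hom n : hom_complex X Y n -> rc (hom_complex bX bY) n).
Proof.
move=> r u v; apply: bch_ext => i j x; rewrite bch_bt.
change (bt phi (r *: hom_fun u i j x + hom_fun v i j x) 1 =
   phi r *: hom_fun (bch_hom u) i j (bt phi x 1) + hom_fun (bch_hom v) i j (bt phi x 1)).
rewrite !bch_bt; exact: (linearP (bunit phi (Y j))).
Qed.
Fact bch_diff n m (u : hom_complex X Y n) :
  bch_hom (diff (hom_complex X Y) n m u) = diff (hom_complex bX bY) n m (bch_hom u).
Proof.
apply: bch_ext => i j x; rewrite bch_bt.
have [nm|ne] := eqVneq n (m + 1); last first.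
  rewrite (hom_diff_ne u j x ne) (hom_diff_ne (bch_hom u) j _ ne); exact: (linear0 (bunit phi (Y j))).
rewrite (hom_diffE u x nm erefl erefl) (hom_diffE (bch_hom u) _ nm erefl erefl).
have E1 := bch_bt u (j + 1) x 1; have E2 := bch_bt u j (diff X i (i - 1) x) 1.
have E3 := bc_diff_bt (i - 1) x 1.
transitivity (diff bY (j + 1) j (bt phi (hom_fun u i (j + 1) x) 1) -
  hsign S n *: bt phi (hom_fun u (i - 1) j (diff X i (i - 1) x)) 1); last first.
  by congr (_ - _ *: _); [rewrite -E1|rewrite -E2 -E3].
rewrite bc_diff_bt -hsign_rmorph btZ mulr1.
have -> z : bt phi z (phi (hsign R n)) = bt phi (hsign R n *: z) 1 by rewrite bt_balanced mulr1.
exact: (linearB (bunit phi (Y j))).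
Qed.
Definition bch : chain_map (hom_complex X Y) (rc (hom_complex bX bY)) :=
  @ChainMap R (hom_complex X Y) (rc (hom_complex bX bY)) (fun n => lin_of (@bch_linear n)) bch_diff.
End HomBaseChange.
End Restriction.

(** * Tensor evaluation *)

Section UpperTruncation.
Variables (R : comPzRingType) (B : complex R) (b : int).
Fact btrunc_closed i j y : trunc_sub (boundaries B) b i y -> trunc_sub (boundaries B) b j (diff B i j y).
Proof.
apply: trunc_closed => [k z /boundary_cycle hz|k z]; [exact: cycle_diff|exact: boundary_diff].
Qed.
(** Turns vanishing of homology above [b] into vanishing of the complex. Homomorphisms of a given
    degree from a complex that starts in degree [a] then have finitely many components. *)
Definition btrunc : complex R := cquo (fun i j y => @btrunc_closed i j y).
Definition btrunc_map : chain_map B btrunc := cquo_map (fun i j y => @btrunc_closed i j y).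
Lemma btrunc_above i (x : btrunc i) : b < i -> x = 0.
Proof. by move=> ib; have [y <-] := quo_pi_surj x; apply/quo_piE; right; left. Qed.
Lemma btrunc_quasi_iso : (forall i, b < i -> homology_zero B i) -> quasi_iso btrunc_map.
Proof.
move=> h0 i; split=> [x hx [w]|y hy].
  have [w' <-] := quo_pi_surj w; rewrite [diff _ _ _ _]cquo_diff_pi => /quo_pi0P.
  move=> /(submodN) ; rewrite opprB => hw.
  have [e|ne] := eqVneq (diff B (i + 1) i w') x; first by rewrite -e; apply: boundary_diff.
  case: hw => [/eqP|[ib|[ib hb]]]; first by rewrite subr_eq0 eq_sym (negPf ne).
    exact: h0.
  by apply: boundary_sub hb _; apply: boundary_diff.
have [ib|ib] := ltP b i.
  by exists 0; split; [apply: cycle0|rewrite (linear0 (btrunc_map i)) subr0 (btrunc_above y ib); apply: boundary0].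
have [x ex] := quo_pi_surj y; exists x; split; last by rewrite -ex subrr; apply: boundary0.
move: hy; rewrite -ex => hy; have /quo_piE h := etrans (esym (cquo_diff_pi _ (i - 1) x)) hy.
by apply: trunc_below h; lia.
Qed.
Lemma btrunc_fg i : fg_module (B i) -> fg_module (btrunc i).
Proof.
move=> [n [g hg]]; exists n, (fun k => quo_pi _ (g k)) => x.
have [y <-] := quo_pi_surj x; have [c ->] := hg y; exists c.
by rewrite (linear_sum (quo_pi _)); apply: eq_bigr => k _; rewrite (linearZ_LR (quo_pi _)).
Qed.
End UpperTruncation.

Section HomTensor.
Variable R : comPzRingType.
Implicit Types (L B G : complex R) (N : lmodType R).

Section Map.
Variables (L B : complex R) (N : lmodType R).
Definition ht_hom (n : N) d (h : hom_complex L B d) : hom_complex L (tc B N) d :=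
  @HomDeg R L (tc B N) d (fun i j x => tpl (B j) n (hom_fun h i j x))
    (fun i j => linear_comp (tpl (B j) n) (hom_lin h i j))
    (fun i j x ne => etrans (congr1 (tpl (B j) n) (hom_shape h x ne)) (linear0 (tpl (B j) n))).
Fact ht_linl d (n : N) : linear (fun h => @ht_hom n d h).
Proof. move=> r h h'; apply: hom_ext => i j x; exact: (linearP (tpl (B j) n)). Qed.
Fact ht_linr d (h : hom_complex L B d) : linear (fun n => @ht_hom n d h).
Proof. move=> r n n'; apply: hom_ext => i j x; exact: (linearP (tpr N (hom_fun h i j x))). Qed.
Definition ht_lin d : {linear tens (hom_complex L B d) N -> hom_complex L (tc B N) d} :=
  tens_lift (@ht_linl d) (@ht_linr d).
Lemma ht_tp d (h : hom_complex L B d) n i j x : hom_fun (ht_lin d (tp h n)) i j x = tp (hom_fun h i j x) n.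
Proof. by rewrite /ht_lin tens_lift_tp. Qed.
Fact ht_diff d e (z : tc (hom_complex L B) N d) :
  ht_lin e (diff (tc (hom_complex L B) N) d e z) = diff (hom_complex L (tc B N)) d e (ht_lin d z).
Proof.
move: z; apply: (tens_eq_lin (f := lin_of (linear_comp (ht_lin e) (diff (tc (hom_complex L B) N) d e)))
  (g := lin_of (linear_comp (diff (hom_complex L (tc B N)) d e) (ht_lin d)))) => h n.
change (ht_lin e (diff (tc (hom_complex L B) N) d e (tp h n)) =
  diff (hom_complex L (tc B N)) d e (ht_lin d (tp h n))).
rewrite tc_diff_tp; apply: hom_ext => i j x; rewrite ht_tp.
have [nm|ne] := eqVneq d (e + 1); last first.
  by rewrite (hom_diff_ne h j x ne) (hom_diff_ne (ht_lin d (tp h n)) j x ne) tp0l.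
rewrite (hom_diffE h x nm erefl erefl) (hom_diffE (ht_lin d (tp h n)) x nm erefl erefl) !ht_tp.
rewrite tc_diff_tp; apply: etrans (linearB (tpl _ n) _ _) _; congr (_ - _); exact: (linearZ_LR (tpl _ n)).
Qed.
(** The tensor evaluation map, sending [h (x) n] to [x |-> h x (x) n]. *)
Definition ht : chain_map (tc (hom_complex L B) N) (hom_complex L (tc B N)) :=
  @ChainMap R (tc (hom_complex L B) N) (hom_complex L (tc B N)) ht_lin ht_diff.
End Map.

Lemma ht_natural_coef L B N N' (g : {linear N -> N'}) d z :
  post L (tcr B g) d (ht L B N d z) = ht L B N' d (tcr (hom_complex L B) g d z).
Proof.
move: z; apply: (tens_eq_lin (f := lin_of (linear_comp (post L (tcr B g) d) (ht L B N d)))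
  (g := lin_of (linear_comp (ht L B N' d) (tcr (hom_complex L B) g d)))) => h n.
change (post L (tcr B g) d (ht_lin L B N d (tp h n)) = ht_lin L B N' d (tcr (hom_complex L B) g d (tp h n))).
by rewrite tcr_tp; apply: hom_ext => i j x; rewrite postE !ht_tp tcr_tp.
Qed.
Lemma ht_natural L B B' N (f : chain_map B B') d z :
  post L (tcl f N) d (ht L B N d z) = ht L B' N d (tcl (post L f) N d z).
Proof.
move: z; apply: (tens_eq_lin (f := lin_of (linear_comp (post L (tcl f N) d) (ht L B N d)))
  (g := lin_of (linear_comp (ht L B' N d) (tcl (post L f) N d)))) => h n.
change (post L (tcl f N) d (ht_lin L B N d (tp h n)) = ht_lin L B' N d (tcl (post L f) N d (tp h n))).
by rewrite tcl_tp; apply: hom_ext => i j x; rewrite postE !ht_tp tcl_tp postE.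
Qed.

Section Elementary.
Variables (L B : complex R) (n i : int) (c : {linear L i -> R^o}).
(** The analogue of a matrix unit: [x |-> c x *: y], supported in degree [i]. *)
Definition elem_fun (y : B (i + n)) (k l : int) (x : L k) : B l :=
  (c (diag_fun (chain_id L) i x) : R) *: diag_fun (chain_id B) l y.
Fact elem_fun_linear y k l : linear (@elem_fun y k l).
Proof.
move=> r x x'; rewrite /elem_fun [diag_fun _ _ (_ + _)](linearP (diag_lin (chain_id L) k i)).
by rewrite (linearP c) scalerDl scalerA.
Qed.
Fact elem_fun_shape y k l (x : L k) : l != k + n -> elem_fun y l x = 0.
Proof.
move=> ne; rewrite /elem_fun; have [e|ne'] := eqVneq k i; last first.
  by rewrite diag_fun_ne // linear0 scale0r.
by subst k; rewrite (@diag_fun_ne _ _ _ _ (i + n) l) ?scaler0 // eq_sym.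
Qed.
Definition elem_hom y : hom_complex L B n := HomDeg (elem_fun_linear y) (@elem_fun_shape y).
Fact elem_linear : linear elem_hom.
Proof.
move=> r y y'; apply: hom_ext => k l x.
change (elem_fun (r *: y + y') l x = r *: elem_fun y l x + elem_fun y' l x).
rewrite /elem_fun [diag_fun _ _ (_ + _)](linearP (diag_lin (chain_id B) (i + n) l)).
by rewrite scalerDr !scalerA mulrC.
Qed.
Definition elem : {linear B (i + n) -> hom_complex L B n} := lin_of elem_linear.
Lemma elem_at y x : hom_fun (elem y) i (i + n) x = (c x : R) *: y.
Proof. by rewrite /= /elem_fun !diag_funE. Qed.
Lemma elem_ne y k l (x : L k) : k != i -> hom_fun (elem y) k l x = 0.
Proof. by move=> ne; rewrite /= /elem_fun diag_fun_ne // linear0 scale0r. Qed.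
End Elementary.

Section BoundedTarget.
Variables (L B : complex R) (a b : int).
Hypotheses (hL : finite_free_below L a) (hB : forall i : int, b < i -> forall y : B i, y = 0).

(** The target [C] is quantified after the dual bases, since the same ones must decompose
    homomorphisms into [B] and into [tc B N]. *)
Lemma elementary_basis n : exists (K : nat) (T : 'I_K -> nat)
    (e : forall k : 'I_K, 'I_(T k) -> L (a + k%:Z)) (c : forall k : 'I_K, 'I_(T k) -> {linear L (a + k%:Z) -> R^o}),
  forall C : complex R, (forall i : int, b < i -> forall y : C i, y = 0) -> forall h : hom_complex L C n,
  h = \sum_k \sum_t elem C n (c k t) (hom_fun h (a + k%:Z) (a + k%:Z + n) (e k t)).
Proof.
(* Only degrees from [a] to [b - n] contribute. If there are none, the absolute value just provides
   spare indices with zero terms. *)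
pose K := absz (b - n - a + 1).
pose T (k : 'I_K) := projT1 (cid (hL.1 (a + k%:Z))).
pose e (k : 'I_K) := projT1 (cid (projT2 (cid (hL.1 (a + k%:Z))))).
pose c (k : 'I_K) := projT1 (cid (projT2 (cid (projT2 (cid (hL.1 (a + k%:Z))))))).
have db (k : 'I_K) x : x = \sum_t c k t x *: e k t := projT2 (cid (projT2 (cid (projT2 (cid (hL.1 (a + k%:Z)))))) ) x.
exists K, T, e, c => C hC h; apply: hom_ext => i j x.
have [E|ne] := eqVneq j (i + n); last by rewrite !(hom_shape _ x ne).
subst j.
have ev (z : hom_complex L C n) : hom_fun z i (i + n) x = lin_of (fun r (f g : hom_complex L C n) =>
  erefl (hom_fun (r *: f + g) i (i + n) x)) z by [].
rewrite [in RHS]ev linear_sum.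
have [ia|ia] := ltP i a.
  rewrite (hL.2 i ia x) hom_lin0 big1 // => k _; rewrite linear_sum big1 // => t _.
  exact: hom_lin0.
have [ib|ib] := ltP b (i + n); first by rewrite !(hC _ ib (_ _ _)) [LHS](hC _ ib).
have kK : (absz (i - a) < K)%N by rewrite /K; lia.
have ei : i = a + (Ordinal kK : 'I_K)%:Z by rewrite /=; lia.
move: (Ordinal kK : 'I_K) ei => k0 ei; subst i.
rewrite (bigD1 k0) // [\sum_(k < K | k != k0) _]big1; last first.
  move=> k nk; rewrite linear_sum big1 // => t _; apply: elem_ne.
  by apply: contraNneq nk => /addrI/eqP; rewrite eqz_nat => /eqP/val_inj ->.
rewrite linear_sum {1}[x](db k0) -[LHS]/(hom_lin h (a + k0%:Z) (a + k0%:Z + n) _) linear_sum.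
apply: etrans _ (esym (addr0 _)).
by apply: eq_bigr => t _; rewrite linearZ_LR; apply/esym/elem_at.
Qed.

Lemma ht_hiso N n : hiso (ht L B N) n.
Proof.
move: n; apply: bij_hiso => n.
all: have [K [T [e [c dec]]]] := elementary_basis n.
  pose Th (F : hom_complex L (tc B N) n) : tc (hom_complex L B) N n :=
    \sum_k \sum_t tml (elem B n (c k t)) (hom_fun F (a + k%:Z) (a + k%:Z + n) (e k t)).
  have ThD F F' : Th (F + F') = Th F + Th F'.
    rewrite /Th -big_split; apply: eq_bigr => k _; rewrite -big_split; apply: eq_bigr => t _.
    exact: (linearD (tml (elem B n (c k t)))).
  have ThK z : Th (ht L B N n z) = z.
    elim/tens_ind: z => [|x y hx hy|h p].
    - rewrite linear0 /Th big1 // => k _; rewrite big1 // => t _; exact: linear0.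
    - by rewrite (linearD (ht L B N n)) ThD hx hy.
    rewrite /Th {2}(dec B hB h) -[RHS]/(tpl _ p _) linear_sum; apply: eq_bigr => k _.
    rewrite linear_sum; apply: eq_bigr => t _.
    by rewrite [hom_fun _ _ _ _]ht_tp tml_tp.
  exact: can_inj ThK.
move=> F; rewrite (dec (tc B N) _ F); last first.
  move=> i ib; elim/tens_ind => [//|u v -> ->|u v]; first by rewrite addr0.
  by rewrite [u](hB ib) tp0l.
pose I := im_sub (ht L B N n); rewrite -[exists x, _]/(I _).
apply: submod_sum => k _; apply: submod_sum => t _.
elim/tens_ind: (hom_fun F _ _ _) => [|u v hu hv|y p]; first by rewrite linear0; apply: submod0.
  by rewrite linearD; apply: submodD.
exists (tp (elem B n (c k t) y) p); apply: hom_ext => i j x; rewrite [LHS]ht_tp.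
rewrite /= /elem_fun; have [E|ne] := eqVneq (a + k%:Z + n) j.
  by subst j; rewrite !diag_funE tpZl.
by rewrite !(diag_fun_ne _ _ ne) !scaler0 tp0l.
Qed.

Lemma hom_fg (hR : noetherian R) n : (forall i, fg_module (B i)) -> homology_fg (hom_complex L B) n.
Proof.
move=> fB; apply/homology_fgP.
have [K [T [e [c dec]]]] := elementary_basis n.
pose full : submod (hom_complex L B n) := @Submod R _ (fun _ => True) I (fun _ _ _ _ => I) (fun _ _ _ => I).
apply: (noetherian_fgr hR (Z := full) (B := boundaries _ n) (P := cycles _ n)) => //.
  by move=> x; apply: boundary_cycle.
pose d k := cid (fB (a + (k : 'I_K)%:Z + n)).
pose D k := projT1 (d k); pose g k : 'I_(D k) -> B (a + (k : 'I_K)%:Z + n) := projT1 (cid (projT2 (d k))).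
have hg k y : exists r : 'I_(D k) -> R, y = \sum_j r j *: g k j := projT2 (cid (projT2 (d k))) y.
pose s : seq (hom_complex L B n) := flatten [seq flatten [seq [seq elem B n (c k t) (g k j) | j <- enum 'I_(D k)]
  | t <- enum 'I_(T k)] | k <- enum 'I_K].
pose Sp : submod (hom_complex L B n) := Submod (spanned0 s) (@spannedD _ _ s) (@spannedZ _ _ s).
exists s; split=> // h _; exists 0; split; first exact: submod0.
rewrite subr0 (dec B hB h); apply: (submod_sum (P := Sp)) => k _; apply: (submod_sum (P := Sp)) => t _.
have [r ->] := hg k (hom_fun h (a + k%:Z) (a + k%:Z + n) (e k t)).
rewrite linear_sum; apply: (submod_sum (P := Sp)) => j _; rewrite linearZ_LR.
apply: spannedZ; apply: spanned_mem; apply/flattenP.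
exists (flatten [seq [seq elem B n (c k t') (g k j') | j' <- enum 'I_(D k)] | t' <- enum 'I_(T k)]).
  by apply: map_f; rewrite mem_enum.
apply/flattenP; exists [seq elem B n (c k t) (g k j') | j' <- enum 'I_(D k)].
  by apply: map_f; rewrite mem_enum.
by apply: map_f; rewrite mem_enum.
Qed.
End BoundedTarget.
End HomTensor.

Section FlatTensor.
Variable R : comPzRingType.
Implicit Types X Y : complex R.

Lemma quasi_iso_eq X Y (f g : chain_map X Y) : (forall i x, f i x = g i x) -> quasi_iso f -> quasi_iso g.
Proof. by move=> h; apply: heqv_quasi_iso => i x _; rewrite h subrr; apply: boundary0. Qed.

(** Flatness enters once, for the inclusion of the image of the differential; the rest is right
    exactness. *)
Lemma flat_tc_zero N X i : flat N -> homology_zero X i -> homology_zero (tc X N) i.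
Proof.
move=> fN h0 z hz.
pose Z := ker_sub (diff X i (i - 1)); pose I := im_sub (diff X i (i - 1)).
have dI x : I (diff X i (i - 1) x) by exists x.
pose p : {linear X i -> sub_of I} := sub_lift (P := I) (f := diff X i (i - 1)) dI.
have ps (y : sub_of I) : exists x, p x = y by case: y => y [x e]; exists x; apply: sub_val_inj.
have pz : tml p z = 0 :> tens _ N.
  apply: (fN _ _ (sub_incl I) (@sub_incl_inj _ _ I)).
  rewrite -[LHS]/(tml (sub_incl I) (tml p z)) tml_comp.
  have -> : tens_map (sub_incl I) (idfun : {linear N -> N}) 0 = 0 := linear0 (tml (sub_incl I)).
  by rewrite -[RHS]hz; apply: tml_eq.
have [y ey] := tml_exact ps (fun y (e : p y = 0) => ex_intro (fun x => sub_incl Z x = y)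
   (@SubOf _ _ Z y (congr1 (@sub_val _ _ I) e)) erefl) pz.
have dZ x : Z (diff X (i + 1) i x) by apply: diff_diff.
pose q : {linear X (i + 1) -> sub_of Z} := sub_lift (P := Z) (f := diff X (i + 1) i) dZ.
have qs (s : sub_of Z) : exists x, q x = s.
  by case: s => v hv; have [x e] := h0 v hv; exists x; apply: sub_val_inj.
have [w ew] := tml_surj (N := N) qs y.
by exists w; rewrite -ey -ew tml_comp; apply: tml_eq.
Qed.

Section TensorCone.
Variables (X Y : complex R) (f : chain_map X Y) (N : lmodType R).
Definition tcone_fun i (z : cone (tcl f N) i) : tc (cone f) N i :=
  tml (inr_lin (X (i - 1)) (Y i)) z.2 + tml (inl_lin (X (i - 1)) (Y i)) z.1.
Fact tcone_linear i : linear (@tcone_fun i).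
Proof.
move=> a x y; rewrite /tcone_fun /= (linearP (tml (inr_lin _ _))) (linearP (tml (inl_lin _ _))).
by rewrite scalerDr; zmod.
Qed.
Fact tcone_diff i j (z : cone (tcl f N) i) :
  tcone_fun (diff (cone (tcl f N)) i j z) = diff (tc (cone f) N) i j (tcone_fun z).
Proof.
rewrite /tcone_fun linearD; case: z => u v.
rewrite -[diff (cone (tcl f N)) i j (u, v)]/(- diff (tc X N) (i - 1) (j - 1) u,
   diag_fun (tcl f N) j u + diff (tc Y N) i j v).
rewrite [in LHS]/= linearD linearN.
have -> : diff (tc (cone f) N) i j (tml (inr_lin (X (i - 1)) (Y i)) v) =
    tml (inr_lin (X (j - 1)) (Y j)) (diff (tc Y N) i j v).
  rewrite [diff _ _ _ _]tml_comp [RHS]tml_comp; apply: tml_eq => y.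
  by congr pair; rewrite /= ?linear0 ?oppr0 // diag_fun0 add0r.
have -> : diff (tc (cone f) N) i j (tml (inl_lin (X (i - 1)) (Y i)) u) =
    tml (inr_lin (X (j - 1)) (Y j)) (diag_fun (tcl f N) j u) -
    tml (inl_lin (X (j - 1)) (Y j)) (diff (tc X N) (i - 1) (j - 1) u).
  have L : diag_fun (tcl f N) j u = tml (diag_lin f (i - 1) j) u.
    have [e|ne] := eqVneq (i - 1) j; last first.
      by rewrite diag_fun_ne // tml0 // => x; apply: diag_fun_ne.
    subst j; rewrite diag_funE; apply: tml_eq => x; exact: esym (diag_funE f x).
  rewrite L; move: u {L}.
  apply: (tens_eq_lin (f := lin_of (linear_comp (diff (tc (cone f) N) i j) (tml (inl_lin (X (i - 1)) (Y i)))))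
    (g := lin_of (linear_sub (lin_of (linear_comp (tml (inr_lin (X (j - 1)) (Y j))) (tml (diag_lin f (i - 1) j))))
      (lin_of (linear_comp (tml (inl_lin (X (j - 1)) (Y j))) (diff (tc X N) (i - 1) (j - 1))))))) => x n.
  change (diff (tc (cone f) N) i j (tml (inl_lin (X (i - 1)) (Y i)) (tp x n)) =
    tml (inr_lin (X (j - 1)) (Y j)) (tml (diag_lin f (i - 1) j) (tp x n)) -
    tml (inl_lin (X (j - 1)) (Y j)) (diff (tc X N) (i - 1) (j - 1) (tp x n))).
  rewrite tml_tp !tc_diff_tp !tml_tp.
  rewrite -tpDl; congr (tp _ n).
  by congr pair; rewrite /= ?linear0 ?subr0 ?addr0 ?add0r.
by zmod.
Qed.
Definition tcone : chain_map (cone (tcl f N)) (tc (cone f) N) :=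
  @ChainMap R (cone (tcl f N)) (tc (cone f) N) (fun i => lin_of (@tcone_linear i)) tcone_diff.
Lemma tcone_hiso i : hiso tcone i.
Proof.
move: i; apply: bij_hiso => i.
  apply: (can_inj (g := fun z => (tml (fst_lin (X (i - 1)) (Y i)) z, tml (snd_lin (X (i - 1)) (Y i)) z))).
  case=> u v; rewrite [LHS]/= /tcone_fun.
  rewrite (linearD (tml (fst_lin _ _))) (linearD (tml (snd_lin _ _))).
  congr pair; rewrite !tml_comp.
    by rewrite tml0 // tml_id // add0r.
  by rewrite tml_id // tml0 // addr0.
move=> z; exists (tml (fst_lin (X (i - 1)) (Y i)) z, tml (snd_lin (X (i - 1)) (Y i)) z).
by rewrite [RHS]tens_prodE; apply: (@addrC (tc (cone f) N i)).
Qed.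
End TensorCone.

Lemma tcl_cone_zero X Y (f : chain_map X Y) N i :
  homology_zero (cone (tcl f N)) i <-> homology_zero (tc (cone f) N) i.
Proof.
split; first exact: (hiso_zero (tcone_hiso f N i)).1.
exact: (hiso_zero (tcone_hiso f N i)).2.
Qed.

Lemma flat_tcl_quasi_iso N X Y (f : chain_map X Y) : flat N -> quasi_iso f -> quasi_iso (tcl f N).
Proof.
move=> fN /cone_acyclicP hf; apply/cone_acyclicP => i; apply/tcl_cone_zero; exact: flat_tc_zero.
Qed.

Section ConeMap.
Variables (X Y X' Y' : complex R) (f : chain_map X Y) (f' : chain_map X' Y')
  (a : chain_map X X') (b : chain_map Y Y').
Hypothesis e : forall i x, b i (f i x) = f' i (a i x).
Definition cone_map_fun i (z : cone f i) : cone f' i := (a (i - 1) z.1, b i z.2).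
Fact cone_map_linear i : linear (@cone_map_fun i).
Proof. by move=> c u v; rewrite /cone_map_fun (linearP (a _)) (linearP (b _)). Qed.
Fact cone_map_diff i j (z : cone f i) :
  lin_of (@cone_map_linear j) (diff (cone f) i j z) = diff (cone f') i j (lin_of (@cone_map_linear i) z).
Proof.
congr pair; rewrite [LHS]/= [RHS]/=; first by rewrite linearN cmap_diff.
rewrite linearD cmap_diff; congr (_ + _).
have [E|ne] := eqVneq (i - 1) j; last by rewrite !diag_fun_ne ?linear0.
by subst j; rewrite !diag_funE /= e.
Qed.
Definition cone_map : chain_map (cone f) (cone f') := ChainMap cone_map_diff.
End ConeMap.

(** The cone is an extension of the shift of [X] by [Y]. A cycle [u] is contracted on [Y] by some
    [v]; what remains is a cycle [w] of degree [n + 1] on [X], contracted by some [t], and [v] and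
    [t] together contract [u]. *)
Lemma cone_semiprojective X Y (be : chain_map X Y) :
  semiprojective X -> semiprojective Y -> semiprojective (cone be).
Proof.
move=> [pX hX] [pY hY]; split=> [i|A hA n u hu]; first exact: prod_projective.
pose incl_f i : {linear Y i -> cone be i} := inr_lin (X (i - 1)) (Y i).
have incl_d i j (y : Y i) : incl_f j (diff Y i j y) = diff (cone be) i j (incl_f i y).
  by congr pair; rewrite /= ?linear0 ?oppr0 // diag_fun0 add0r.
pose incl : chain_map Y (cone be) := ChainMap incl_d.
have /hom_boundaryP [v hv] := hY A hA n _ (cmap_cycle (pre A incl) hu).
have {}hv i j (y : Y i) : hom_fun u i j (0, y) = diff A (j + 1) j (v i (j + 1) y) + hsign R n *: v (i - 1) j (diff Y i (i - 1) y) := hv i j y.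
have udec i j (x : X (i - 1)) (y : Y i) : hom_fun u i j (x, y) = hom_fun u i j (x, 0) + hom_fun u i j (0, y).
  by rewrite -hom_linD; congr (hom_fun u i j); congr pair; rewrite /= ?addr0 ?add0r.
pose wf i j (x : X i) : A j := hom_fun u (i + 1) j (diag_fun (chain_id X) (i + 1 - 1) x, 0) - hsign R n *: v i j (be i x).
have wl i j : linear (@wf i j).
  move=> a x x'; rewrite /wf [diag_fun _ _ (_ + _)](linearP (diag_lin (chain_id X) i (i + 1 - 1))) (linearP (be i)) hom_linear.
  have -> : (a *: diag_lin (chain_id X) i (i + 1 - 1) x + diag_lin (chain_id X) i (i + 1 - 1) x', 0) =
     a *: ((diag_fun (chain_id X) (i + 1 - 1) x, 0) : cone be (i + 1)) + ((diag_fun (chain_id X) (i + 1 - 1) x', 0) : cone be (i + 1)).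
    by congr pair; rewrite /= scaler0 addr0.
  by rewrite hom_linear !scalerDr scalerN !scalerA mulrC; zmod.
have ws i j x : j != i + (n + 1) -> @wf i j x = 0.
  by move=> ne; rewrite /wf !hom_shape ?scaler0 ?subr0 //; apply: contraNneq ne => ->; apply/eqP; ring.
pose w : hom_complex X A (n + 1) := HomDeg wl ws.
have wE i j (x : X (i - 1)) : hom_fun u i j (x, 0) = hom_fun w (i - 1) j x + hsign R n *: v (i - 1) j (be (i - 1) x).
  rewrite /= /wf subrK.
  have H k : k = i -> hom_fun u k j (diag_fun (chain_id X) (k - 1) x, 0) = hom_fun u i j (x, 0).
    by move=> e; subst k; rewrite diag_funE.
  by rewrite H // subrK.
have hw : is_cycle w.
  apply/hom_cycleP => i j x; rewrite hsignS scaleNr.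
  have E : diff (cone be) (i + 1) i (diag_fun (chain_id X) (i + 1 - 1) x, 0) = (- diff X i (i - 1) x, be i x).
    rewrite cone_diff /cone_fun /= linear0 addr0.
    have H m : m = i -> (- diff X m (i - 1) (diag_fun (chain_id X) m x), diag_fun be i (diag_fun (chain_id X) m x)) =
        (- diff X i (i - 1) x, be i x) by move=> em; subst m; rewrite !diag_funE.
    by apply: H; rewrite addrK.
  change (diff A (j + 1) j (hom_fun u (i + 1) (j + 1) (diag_fun (chain_id X) (i + 1 - 1) x, 0) -
     hsign R n *: v i (j + 1) (be i x)) = - (hsign R n *: hom_fun w (i - 1) j (diff X i (i - 1) x))).
  rewrite linearB linearZ_LR (hom_cycle_at hu (l := i)) ?addrK // E udec.
  have -> : hom_fun u i j (- diff X i (i - 1) x, 0) = - hom_fun u i j (diff X i (i - 1) x, 0).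
    by rewrite -hom_linN; congr (hom_fun u i j); congr pair; rewrite /= oppr0.
  rewrite wE hv -!cmap_diff.
  have G (M : lmodType R) (r : R) (a b d : M) : r *: (- (a + b) + (d + b)) - r *: d = - (r *: a).
    by rewrite !scalerDr scalerN scalerDr; zmod.
  exact: G.
have /hom_boundaryP [t ht] := hX A hA (n + 1) w hw.
pose hf i j (z : cone be i) : A j := v i j z.2 + t (i - 1) j z.1.
have hl i j : linear (@hf i j) by move=> a x y; rewrite /hf /= !hom_linear scalerDr; zmod.
have hs i j z : j != i + (n + 1) -> @hf i j z = 0.
  by move=> ne; rewrite /hf !hom_shape ?addr0 //; apply: contraNneq ne => ->; apply/eqP; ring.
apply/hom_boundaryP; exists (HomDeg hl hs) => i j [x y].
rewrite udec wE ht hv cone_diff /cone_fun /= /hf /= diag_funE hom_linD hom_linN linearD hsignS scaleNr.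
by rewrite !scalerDr scalerN; zmod.
Qed.
End FlatTensor.

Lemma hom_lift (R : comPzRingType) (P A B : complex R) (f : chain_map A B) n (h : hom_complex P B n) :
  (forall i, projective (P i)) -> (forall i j x, exists a, f j a = hom_fun h i j x) ->
  exists k : hom_complex P A n, post P f n k = h.
Proof.
move=> pP ex.
have lft i j : exists k : {linear P i -> A j}, forall x, f j (k x) = hom_lin h i j x.
  by apply: projective_lift => // x; apply: ex.
pose k i j := projT1 (cid (lft i j)); have hk i j x : f j (k i j x) = hom_fun h i j x := projT2 (cid (lft i j)) x.
pose kf i j (x : P i) : A j := if j == i + n then k i j x else 0.
have kl i j : linear (@kf i j) by move=> a x y; rewrite /kf; case: ifP => _; rewrite ?linearP ?scaler0 ?addr0.
have ks i j x : j != i + n -> @kf i j x = 0 by rewrite /kf => /negPf ->.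
exists (HomDeg kl ks : hom_complex P A n); apply: hom_ext => i j x; rewrite postE /= /kf.
by have [e|ne] := eqVneq j (i + n); rewrite ?hk // linear0 hom_shape.
Qed.

Section TensorEvaluation.
Variables (R S : comPzRingType) (phi : {rmorphism R -> S}).
Hypothesis hphi : finite_flat_dim phi.
Local Notation Sm := (ringmod phi).

(** The bound grows by one with each syzygy, by the connecting map; this is recorded by the counter
    [k]. *)
Lemma base_change_bounded_above (B : complex R) b : (forall i, projective (B i)) ->
  (forall i, b < i -> homology_zero B i) -> exists b', forall i, b' < i -> homology_zero (bc_complex phi B) i.
Proof.
move=> pB h0.
pose Q (k : nat) (N : lmodType R) := forall i, b + k%:Z < i -> homology_zero (tc B N) i.
have base N k : flat N -> Q k N.
  by move=> fN i ik; apply: flat_tc_zero => //; apply: h0; lia.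
have [|k hk] := flat_dimension_induction hphi (Q := Q) base; last by exists (b + k%:Z) => i /hk.
move=> N' N N'' f g k fI gs gf ex fN hN i ik.
apply: (@ses_right _ _ _ _ (tcr B f) (tcr B g)).
- by move=> j; apply: tmr_inj.
- by move=> j; apply: tmr_surj.
- by move=> j x; rewrite /= -[LHS]/(tmr g (tmr f x)) tmr_comp tmr0.
- by move=> j; apply: tmr_exact.
- by apply: flat_tc_zero => //; apply: h0; lia.
- by apply: hN; lia.
Qed.

Variables (L B G : complex R) (a b : int) (ga : chain_map G (hom_complex L B)).
Hypotheses (hL : finite_free_below L a) (pB : forall i, projective (B i))
  (hB : forall i, b < i -> homology_zero B i) (sG : semiprojective G) (qga : quasi_iso ga).

(** Tensor evaluation on derived level: [Hom (L, B)] need not be semiprojective, so it is replaced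
    by [G] before tensoring. *)
Definition te N := chain_comp (ht L B N) (tcl ga N).

(** For flat [N] the target [B] may be replaced by its truncation, and there evaluation is bijective
    by the finite dual bases. *)
Lemma te_flat N : flat N -> quasi_iso (te N).
Proof.
have sL := finite_free_semiprojective hL => fN.
pose f := btrunc_map B b; have qf : quasi_iso f by apply: btrunc_quasi_iso.
have q1 : quasi_iso (chain_comp (post L f) ga) by apply: quasi_iso_comp => //; apply: semiproj_post.
have q2 := flat_tcl_quasi_iso fN q1.
have q3 : quasi_iso (ht L (btrunc B b) N) by move=> n; apply: (ht_hiso (b := b) hL) => i ib y; apply: btrunc_above ib.
have q4 : quasi_iso (post L (tcl f N)) by apply: semiproj_post => //; apply: flat_tcl_quasi_iso.
apply: (quasi_iso_compr q4); apply: quasi_iso_eq (quasi_iso_comp q2 q3) => n z.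
have H1 := congr1 (ht L (btrunc B b) N n) (esym (tcl_comp (post L f) ga z)).
have H2 := esym (ht_natural f (tcl ga N n z)).
exact (etrans H1 H2).
Qed.

Lemma te_natural (M M' : lmodType R) (u : {linear M -> M'}) n z : post L (tcr B u) n (te M n z) = te M' n (tcr G u n z).
Proof.
apply: etrans (ht_natural_coef u (tcl ga M n z)) _; congr (ht L B M' n _).
by apply: esym; apply: tml_tmr.
Qed.

(** In the coefficients, the cones of [te] form short exact sequences: [G] and [B] are degreewise
    projective and so tensor exactly, and [L] is degreewise projective and so lifts
    homomorphisms. *)
Lemma te_quasi_iso : quasi_iso (te Sm).
Proof.
have [pL _] := finite_free_semiprojective hL; have [pG _] := sG.
have [|k //] := flat_dimension_induction hphi (Q := fun _ N => quasi_iso (te N)) (fun N _ => @te_flat N).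
move=> N' N N'' f g _ fI gs gf ex fN /cone_acyclicP hN.
have /cone_acyclicP hN' := te_flat fN.
apply/cone_acyclicP => i.
apply: (@ses_right _ _ _ _ (cone_map (te_natural f)) (cone_map (te_natural g))) => //.
- move=> j [x y] [x' y'] [e1 e2]; congr pair; first by apply: (tmr_inj (pG _) fI).
  apply: hom_ext => k l z.
  have E : tmr f (hom_fun y k l z) = tmr f (hom_fun y' k l z) := congr1 (fun h => h k l z) e2.
  exact: (tmr_inj (@pB l) fI E).
- move=> j [x y]; have [x' ex'] := tmr_surj (M := G (j - 1)) gs x.
  have [|y' ey'] := @hom_lift _ L _ _ (tcr B g) j y pL; first by move=> k l z; apply: tmr_surj.
  by exists (x', y'); congr pair.
- move=> j [x y]; congr pair; first by rewrite /= -[LHS]/(tmr g (tmr f x)) tmr_comp tmr0.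
  by apply: hom_ext => k l z; rewrite /= -[LHS]/(tmr g (tmr f _)) tmr_comp tmr0.
- move=> j [x y] [e1 e2]; have [x' ex'] := tmr_exact gs ex e1.
  have [|y' ey'] := @hom_lift _ L _ _ (tcr B f) j y pL; last by exists (x', y'); congr pair.
  move=> k l z; apply: (tmr_exact gs ex).
  exact: (congr1 (fun h => h k l z) e2).
Qed.
End TensorEvaluation.

(** * Transfer of quasi-isomorphisms and vanishing along the base change *)

Section Transfer.
Variables (R S : comPzRingType) (phi : {rmorphism R -> S}).
Hypotheses (hR : noetherian R) (hphi : finite_flat_dim phi)
  (hmax : forall m : R -> Prop, is_maximal m ->
     exists q : S -> Prop, is_prime q /\ (forall r, m r <-> q (phi r))).
Local Notation Sm := (ringmod phi).

Lemma descent_zero (W : complex R) (a : int) : semiprojective W -> degreewise_finite W ->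
  (forall i, i < a -> homology_zero (bc_complex phi W) i) <-> (forall i, i < a -> homology_zero W i).
Proof.
move=> sW fW; split=> h; first exact: (@descent R S phi hR hmax W a sW fW h).
exact: (@tc_zero R W Sm a sW h).
Qed.

(** The cone of [f] is again semiprojective with finitely generated homology, so descent of
    vanishing applies to it. *)
Lemma descent_quasi_iso (W W' : complex R) (f : chain_map W W') :
  semiprojective W -> semiprojective W' -> degreewise_finite W -> degreewise_finite W' ->
  quasi_iso (bcm phi f) <-> quasi_iso f.
Proof.
move=> sW sW' fW fW'; split; last exact: bcm_quasi_iso.
move=> h; apply/cone_acyclicP => i.
have sC := cone_semiprojective f sW sW'.
have fC : degreewise_finite (cone f) by move=> j; apply: cone_fg.
apply: ((@descent_zero _ (i + 1) sC fC).1 _ i); last by lia.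
move=> j _; apply/(tcl_cone_zero f Sm j); move: j; apply/cone_acyclicP; exact: h.
Qed.

Lemma fgp_fg (M : lmodType R) : fgp M -> fg_module M.
Proof. by move=> [n [e [c h]]]; exists n, e => x; exists (fun k => c k x). Qed.

Lemma finite_free_hom_fg (L B : complex R) a c b : finite_free_below L a -> finite_free_below B c ->
  (forall i, b < i -> homology_zero B i) -> degreewise_finite (hom_complex L B).
Proof.
move=> hL hB h0 n.
have q : quasi_iso (post L (btrunc_map B b)).
  by apply: semiproj_post; [exact: finite_free_semiprojective hL|apply: btrunc_quasi_iso].
apply: (hiso_fgr (q n)); apply: (hom_fg (b := b) hL) => //; first by move=> i ib y; apply: btrunc_above ib.
by move=> i; apply/btrunc_fg/fgp_fg; apply: hB.1.
Qed.

(** The map over [S] that extends [ga]. Base changes of the homothety and biduality morphisms are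
    both of this form, by [kappa_chi] and [kappa_bid]. *)
Definition kappa (L B G : complex R) (ga : chain_map G (hom_complex L B)) :
  chain_map (bc_complex phi G) (hom_complex (bc_complex phi L) (bc_complex phi B)) :=
  cext (chain_comp (bch phi L B) ga).

Lemma kappa_bt (L B G : complex R) (ga : chain_map G (hom_complex L B)) n g s i j p t :
  hom_fun (kappa ga n (bt phi g s)) i j (bt phi p t) = bt phi (hom_fun (ga n g) i j p) (s * t).
Proof.
have E : kappa ga n (bt phi g s) = s *: bch_hom phi (ga n g) := cext_bt _ g s.
have E2 : s *: hom_fun (bch_hom phi (ga n g)) i j (bt phi p t) = bt phi (hom_fun (ga n g) i j p) (s * t).
  by rewrite bch_bt; apply: btZ.
by rewrite E; apply: E2.
Qed.

Lemma kappa_comp (L B G W : complex R) (ga : chain_map G (hom_complex L B)) (be : chain_map W G) i x :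
  kappa (chain_comp ga be) i x = kappa ga i (bcm phi be i x).
Proof.
move: x; apply: (@bc_eq_lin _ _ _ _ _ (kappa (chain_comp ga be) i) (lin_of (linear_comp (kappa ga i) (bcm phi be i)))) => w.
apply: bch_ext => j k x; rewrite kappa_bt.
change (bt phi (hom_fun (ga i (be i w)) j k x) (1 * 1) =
  hom_fun (kappa ga i (bcm phi be i (bt phi w 1))) j k (bt phi x 1)).
by rewrite bcm_bt kappa_bt.
Qed.

Lemma kappa_homotopic (L B G : complex R) (ga ga' : chain_map G (hom_complex L B)) :
  homotopic ga ga' -> homotopic (kappa ga) (kappa ga').
Proof. by move=> h; apply: cext_homotopic; apply: homotopic_post. Qed.

(** Under [Hom_S (L (x) S, B (x) S) = Hom_R (L, B (x) S)], the map [kappa ga] becomes tensor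
    evaluation. *)
Lemma kappa_te (L B G : complex R) (ga : chain_map G (hom_complex L B)) :
  semiprojective L -> quasi_iso (kappa ga) <-> quasi_iso (te ga Sm).
Proof.
move=> sL.
have q2 : quasi_iso (post L (tcbc phi B)) by apply: semiproj_post => // i; apply: tcbc_hiso.
have q3 : quasi_iso (tcbc phi G) by move=> i; apply: tcbc_hiso.
have q4 : quasi_iso (adj phi L (bc_complex phi B)) by move=> i; apply: adj_hiso.
have E n z : chain_comp (post L (tcbc phi B)) (te ga Sm) n z =
    chain_comp (adj phi L (bc_complex phi B)) (chain_comp (rcm phi (kappa ga)) (tcbc phi G)) n z.
  apply: hom_ext => i j p.
  pose ev (C : complex R) : {linear hom_complex L C n -> C j} := lin_of (fun r (f g : hom_complex L C n) =>
    erefl (hom_fun (r *: f + g) i j p)).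
  move: z; apply: (tens_eq_lin
    (f := lin_of (linear_comp (ev _) (lin_of (linear_comp (post L (tcbc phi B) n) (te ga Sm n)))))
    (g := lin_of (linear_comp (ev _) (lin_of (linear_comp (adj phi L (bc_complex phi B) n) (lin_of (linear_comp (rcm phi (kappa ga) n) (tcbc phi G n)))))))) => g s.
  have E1 : hom_fun (te ga Sm n (tp g s)) i j p = tp (hom_fun (ga n g) i j p) s.
    by rewrite -(ht_tp (ga n g) s j p); congr (hom_fun (ht_lin L B Sm n _) i j p); apply: tcl_tp.
  have E2 := kappa_bt ga g s j p 1; rewrite mulr1 in E2.
  exact: etrans E1 (esym E2).
split=> h.
  apply: (quasi_iso_compr q2); apply: quasi_iso_eq (fun n z => esym (E n z)) _.
  exact: quasi_iso_comp (quasi_iso_comp q3 ((rcm_quasi_iso phi _).2 h)) q4.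
apply/(rcm_quasi_iso phi); apply: (quasi_iso_compl q3); apply: (quasi_iso_compr q4).
exact: quasi_iso_eq E (quasi_iso_comp h q2).
Qed.

Section HomTransfer.
Variables (L B : complex R) (a c b : int).
Hypotheses (hL : finite_free_below L a) (hB : finite_free_below B c)
  (h0 : forall i, b < i -> homology_zero B i).

Lemma kappa_quasi_iso (G : complex R) (ga : chain_map G (hom_complex L B)) :
  semiprojective G -> quasi_iso ga -> quasi_iso (kappa ga).
Proof.
move=> sG qg; have [pB _] := finite_free_semiprojective hB.
exact: (kappa_te ga (finite_free_semiprojective hL)).2 (te_quasi_iso hphi hL pB h0 sG qg).
Qed.

(** Up to homotopy [u] factors as [ga] after some [be], where [ga] resolves [Hom (L, B)], and
    [kappa u] as [kappa ga] after the base change of [be]. Since [kappa ga] is a quasi-isomorphism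
    by tensor evaluation, the claim is descent for [be]. *)
Lemma transfer_quasi_iso (W : complex R) (u : chain_map W (hom_complex L B)) :
  semiprojective W -> degreewise_finite W -> quasi_iso (kappa u) <-> quasi_iso u.
Proof.
move=> sW fW; pose ga := res_map (hom_complex L B).
have sG := res_semiprojective (hom_complex L B); have qg : quasi_iso ga by apply: res_map_quasi_iso.
have [be hbe] := semiproj_lift u sW qg.
have fG : degreewise_finite (res (hom_complex L B)).
  by move=> i; apply: (hiso_fgr (qg i)); apply: finite_free_hom_fg hL hB h0 i.
have qk := kappa_quasi_iso sG qg.
have hk := kappa_homotopic hbe.
split=> h.
  have h1 := heqv_quasi_iso (heqv_sym (homotopic_heqv hk)) h.
  have h2 : quasi_iso (bcm phi be).
    by apply: (quasi_iso_compr qk); apply: quasi_iso_eq h1 => i x; apply: kappa_comp.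
  have h3 := (descent_quasi_iso be sW sG fW fG).1 h2.
  exact: heqv_quasi_iso (homotopic_heqv hbe) (quasi_iso_comp h3 qg).
have h1 := heqv_quasi_iso (heqv_sym (homotopic_heqv hbe)) h.
have h2 := bcm_quasi_iso phi sW sG (quasi_iso_compr qg h1).
apply: heqv_quasi_iso (homotopic_heqv hk) _.
by apply: quasi_iso_eq (quasi_iso_comp h2 qk) => i x; apply/esym/kappa_comp.
Qed.

Lemma transfer_zero (d : int) :
  (forall i, i < d -> homology_zero (hom_complex (bc_complex phi L) (bc_complex phi B)) i) <->
  (forall i, i < d -> homology_zero (hom_complex L B) i).
Proof.
pose ga := res_map (hom_complex L B).
have sG := res_semiprojective (hom_complex L B); have qg : quasi_iso ga by apply: res_map_quasi_iso.
have qk := kappa_quasi_iso sG qg.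
have fG : degreewise_finite (res (hom_complex L B)).
  by move=> i; apply: (hiso_fgr (qg i)); apply: finite_free_hom_fg hL hB h0 i.
have D := descent_zero d sG fG.
split=> h i id.
  by apply: (hiso_zero (qg i)).1; apply: D.1 i id => j jd; apply: (hiso_zero (qk j)).2; apply: h.
by apply: (hiso_zero (qk i)).1; apply: D.2 i id => j jd; apply: (hiso_zero (qg j)).2; apply: h.
Qed.
End HomTransfer.

Lemma base_change_finite_free (L : complex R) a : finite_free_below L a -> finite_free_below (bc_complex phi L) a.
Proof.
move=> [h1 h2]; split=> [i|i ia x]; first exact: base_change_fgp.
elim/bc_ind: (x : base_change phi (L i)) => [//|u v -> ->|m s]; first exact: addr0.
rewrite (h2 i ia m); exact: tp0l.
Qed.

Lemma Ltensor_resolution (C Q : complex R) (q : chain_map Q C) : semiprojective Q -> quasi_iso q ->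
  exists qh : chain_map (bc_complex phi Q) (Ltensor phi C), quasi_iso qh.
Proof.
move=> sQ qq; have qC := res_map_quasi_iso C; have [la hla] := semiproj_lift q sQ qC.
exists (bcm phi la); apply: (bcm_quasi_iso phi (f := la) sQ (res_semiprojective C)).
by apply: (quasi_iso_compr qC); apply: heqv_quasi_iso (heqv_sym (homotopic_heqv hla)) qq.
Qed.

Lemma Ltensor_zero (C : complex R) a : degreewise_finite C ->
  (forall i, i < a -> homology_zero (Ltensor phi C) i) <-> (forall i, i < a -> homology_zero C i).
Proof.
move=> fC; have qC := res_map_quasi_iso C.
have D := @descent_zero (res C) a (res_semiprojective C) (fun i => hiso_fgr (qC i) (fC i)).
split=> h; last by apply: D.2 => i ia; apply: (hiso_zero (qC i)).2; apply: h.
by move=> i ia; apply: (hiso_zero (qC i)).1; apply: D.1 i ia.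
Qed.
End Transfer.

(** * Bounds on homology and the infimum *)

Section Boundedness.
Variable R : comPzRingType.
Implicit Types X Y : complex R.

Definition zero_below X (a : int) := forall i : int, i < a -> homology_zero X i.
Definition zero_above X (b : int) := forall i : int, b < i -> homology_zero X i.

Lemma homologically_boundedP X : homologically_bounded X <->
  (exists a, zero_below X a) /\ exists b, zero_above X b.
Proof.
split=> [[s hs]|[[a ha] [b hb]]].
  have [N hN] : exists N : nat, forall i, i \in s -> (absz i <= N)%N.
    elim: (s) => [|j s' [N IH]]; first by exists 0%N.
    exists (absz j + N)%N => i; rewrite inE => /orP [/eqP ->|/IH h]; first exact: leq_addr.
    exact: leq_trans h (leq_addl _ _).
  split; [exists (- N%:Z)|exists N%:Z]; move=> i ic; apply: hs; apply/negP => /hN; lia.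
exists [seq a + k%:Z | k <- iota 0 (absz (b - a + 1))] => i ni.
have [ia|ia] := ltP i a; first exact: ha.
have [ib|ib] := ltP b i; first exact: hb.
case/negP: ni; apply/mapP; exists (absz (i - a)); last by lia.
by rewrite mem_iota; lia.
Qed.

Definition spread X i (z : X i) (j : int) : X j := diag_fun (chain_id X) j z.
Lemma spread_id X i (z : X i) : spread z i = z. Proof. exact: diag_funE. Qed.
Lemma spread_ne X i j (z : X i) : i != j -> spread z j = 0. Proof. exact: diag_fun_ne. Qed.
Lemma spread_total X i (z : X i) : is_cycle z -> total_cycle (spread z).
Proof.
move=> hz; split.
  by exists [:: i] => j; rewrite inE eq_sym => ne; apply: spread_ne.
move=> j; have [e|ne] := eqVneq i j; first by subst j; rewrite spread_id.
by rewrite spread_ne //; apply: cycle0.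
Qed.

(** Finitely many families of finite support live in finitely many degrees, which yields the bounds.
    Later arguments obtain the three conditions separately. *)
Lemma homologically_finiteP X : homologically_finite X <->
  [/\ degreewise_finite X, exists a, zero_below X a & exists b, zero_above X b].
Proof.
split=> [[n [g [tg hg]]]|[fX [a ha] [b hb]]].
  have fX : degreewise_finite X.
    move=> i; exists n, (fun k => g k i); split; first by move=> k; have [_] := tg k; apply.
    by move=> z hz; have [c hc] := hg _ (spread_total hz); exists c; rewrite -{1}(spread_id z); apply: hc.
  have [s hs] : exists s : seq int, forall k i, i \notin s -> g k i = 0.
    have [s hs] := choice (fun k => (tg k).1).
    exists (flatten [seq s k | k <- enum 'I_n]) => k i ni; apply: hs; apply: contraNN ni => h.
    by apply/flattenP; exists (s k) => //; apply: map_f; rewrite mem_enum.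
  have hbd : homologically_bounded X.
    exists s => i ni z hz; have [c hc] := hg _ (spread_total hz).
    have := hc i; rewrite spread_id big1 ?subr0 // => k _; by rewrite hs // scaler0.
  by have [h1 h2] := (homologically_boundedP X).1 hbd.
pose K := absz (b - a + 1).
pose d (k : 'I_K) := cid (fX (a + k%:Z)).
pose T k := projT1 (d k); pose g k : 'I_(T k) -> X (a + (k : 'I_K)%:Z) := projT1 (cid (projT2 (d k))).
have [hc hg] : (forall k t, is_cycle (g k t)) /\ forall k (z : X (a + (k : 'I_K)%:Z)), is_cycle z -> exists c : 'I_(T k) -> R, is_boundary (z - \sum_t c t *: g k t).
  by split=> k; have [h1 h2] := projT2 (cid (projT2 (d k))).
pose I := {k : 'I_K & 'I_(T k)}.
exists #|{: I}|, (fun j => spread (g (tag (enum_val j)) (tagged (enum_val j)))); split.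
  by move=> k; apply: spread_total; apply: hc.
move=> z [_ cz].
pose c k := projT1 (cid (hg k _ (cz (a + (k : 'I_K)%:Z)))).
have hcc k : is_boundary (z (a + (k : 'I_K)%:Z) - \sum_t c k t *: g k t) := projT2 (cid (hg k _ (cz (a + k%:Z)))).
exists (fun j => c (tag (enum_val j)) (tagged (enum_val j))) => i.
have -> : \sum_(j < #|{: I}|) c (tag (enum_val j)) (tagged (enum_val j)) *: spread (g (tag (enum_val j)) (tagged (enum_val j))) i =
    \sum_k \sum_t c k t *: spread (g k t) i.
  rewrite (sig_big_dep xpredT (fun _ => xpredT) (fun k t => c k t *: spread (g k t) i)) /=.
  by rewrite -(big_enum_val (A := {: I}) (fun p : I => c (tag p) (tagged p) *: spread (g (tag p) (tagged p)) i)).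
have cb : is_cycle (z i - \sum_k \sum_t c k t *: spread (g k t) i).
  apply: cycleB => //; apply: (submod_sum (P := cycles X i)) => k _; apply: (submod_sum (P := cycles X i)) => t _.
  by apply: cycleZ; apply: (spread_total (hc k t)).2.
have [ia|ia] := ltP i a; first exact: ha.
have [ib|ib] := ltP b i; first exact: hb.
have kK : (absz (i - a) < K)%N by rewrite /K; lia.
have ei : i = a + (Ordinal kK : 'I_K)%:Z by rewrite /=; lia.
move: (Ordinal kK : 'I_K) ei {cb} => k0 ei; subst i.
rewrite (bigD1 k0) //= [\sum_(k < K | k != k0) _]big1 ?addr0.
  rewrite (eq_bigr (fun t => c k0 t *: g k0 t)); first exact: hcc.
  by move=> t _; rewrite spread_id.
move=> k nk; rewrite big1 // => t _; rewrite spread_ne ?scaler0 //.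
by apply: contraNneq nk => /addrI/eqP; rewrite eqz_nat => /eqP/val_inj ->.
Qed.

End Boundedness.

(** An infimum depends on its set only through the lower bounds and through emptiness, and the set
    is empty exactly when [+oo] is a lower bound. All of this is read off from [zero_below]. *)
Lemma hinf_eq (R S : comPzRingType) (X : complex R) (Y : complex S) :
  (forall a, zero_below X a <-> zero_below Y a) -> hinf X = hinf Y.
Proof.
pose A (T : comPzRingType) (Z : complex T) : set (\bar int) :=
  [set (i%:E)%E | i in [set i : int | ~ homology_zero Z i]]%classic.
have lb (T : comPzRingType) (Z : complex T) x : lbound (A T Z) x <->
    match x with EFin a => zero_below Z a | EPInf => forall a, zero_below Z a | ENInf => True end.
  case: x => [a||]; split=> //.
  - move=> h i ia; apply: contrapT => ni; have hA : A T Z (i%:E)%E by exists i.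
    by have := h _ hA; rewrite lee_fin; lia.
  - move=> h _ [i ni <-]; rewrite lee_fin leNgt; apply/negP => ia; exact: ni (h i ia).
  - move=> h a i ia; apply: contrapT => ni; have hA : A T Z (i%:E)%E by exists i.
    by have := h _ hA.
  - by move=> h _ [i ni <-]; case: ni; apply: (h (i + 1)); lia.
  - by move=> _ y _; apply: leNye.
move=> h.
have E : lbound (A R X) = lbound (A S Y).
  by apply/seteqP; split=> x /lb hx; apply/lb; case: x hx => // [a /h //|hx a]; apply/h; apply: hx.
have E0 : (A R X == set0) = (A S Y == set0).
  have e0 (T : comPzRingType) (Z : complex T) : A T Z = set0 <-> lbound (A T Z) +oo%E.
    split=> [e y|/lb hz]; first by rewrite e.
    by apply/seteqP; split=> // y [i ni _]; case: ni; apply: (hz (i + 1)); lia.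
  by apply/eqP/eqP => /e0; [rewrite E|rewrite -E] => /e0.
by rewrite /hinf /infimum -/(A R X) -/(A S Y) E0 /infimums E.
Qed.

(** * Biduality and homothety morphisms *)

Section BidualityMaps.
Variable R : comPzRingType.
Implicit Types P E C X Y : complex R.

Section Bid.
Variables (P E C : complex R) (ga : chain_map E (hom_complex P C)).
Fact bid_fun_linear n (p : P n) i j : linear (fun e : E i => hsign R (n * i) *: hom_fun (ga i e) n j p).
Proof.
move=> a e e'; rewrite (linearP (ga i)).
change (hsign R (n * i) *: (a *: hom_fun (ga i e) n j p + hom_fun (ga i e') n j p) =
  a *: (hsign R (n * i) *: hom_fun (ga i e) n j p) + hsign R (n * i) *: hom_fun (ga i e') n j p).
by rewrite scalerDr !scalerA mulrC.
Qed.
Fact bid_fun_shape n (p : P n) i j (e : E i) : j != i + n -> hsign R (n * i) *: hom_fun (ga i e) n j p = 0.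
Proof. by move=> ne; rewrite hom_shape ?scaler0 // addrC. Qed.
Definition bid_hom n (p : P n) : hom_complex E C n := HomDeg (bid_fun_linear p) (@bid_fun_shape n p).
Fact bid_linear n : linear (@bid_hom n).
Proof.
move=> a p q; apply: hom_ext => i j u.
change (hsign R (n * i) *: hom_fun (ga i u) n j (a *: p + q) =
  a *: (hsign R (n * i) *: hom_fun (ga i u) n j p) + hsign R (n * i) *: hom_fun (ga i u) n j q).
by rewrite hom_linear scalerDr !scalerA mulrC.
Qed.
Fact bid_diff (n m : int) (p : P n) : bid_hom (diff P n m p) = diff (hom_complex E C) n m (bid_hom p).
Proof.
apply: hom_ext => i j u; rewrite /= /hom_diff_fun /=.
case: (n =P m + 1) => [nm|/eqP ne]; last by rewrite diff_shape // hom_lin0 scaler0.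
have {nm} e : n - 1 = m by rewrite nm addrK.
case: m / e; rewrite cmap_diff /= /hom_diff_fun subrK eqxx linearZ_LR.
rewrite scalerA -hsignD scalerBr scalerA -hsignD.
have -> : n + n * (i - 1) = n * i by ring.
rewrite subKr; congr (_ *: _).
have -> : n * i = (n - 1) * i + i by ring.
by rewrite !hsignD -mulrA hsign_sq mulr1.
Qed.
(** Biduality for freely chosen models, [ga] standing for a resolution of [Hom (P, C)]. The chosen
    resolutions give [biduality], and finite projective models can be used for base change. *)
Definition bid : chain_map P (hom_complex E C) :=
  @ChainMap R P (hom_complex E C) (fun n => lin_of (@bid_linear n)) bid_diff.
Lemma bidE n p i j e : hom_fun (bid n p) i j e = hsign R (n * i) *: hom_fun (ga i e) n j p.
Proof. by []. Qed.
End Bid.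

Lemma bid_homotopic P E C (ga ga' : chain_map E (hom_complex P C)) : homotopic ga ga' -> heqv (bid ga) (bid ga').
Proof.
move=> [h e] n p hp; apply/hom_boundaryP.
pose hf i j (u : E i) : C j := hsign R (n * i) *: hom_fun (h i (i + 1) u) n j p.
have hl i j : linear (@hf i j).
  move=> a u v; rewrite /hf (linearP (h i (i + 1))).
  change (hsign R (n * i) *: (a *: hom_fun (h i (i + 1) u) n j p + hom_fun (h i (i + 1) v) n j p) =
    a *: (hsign R (n * i) *: hom_fun (h i (i + 1) u) n j p) + hsign R (n * i) *: hom_fun (h i (i + 1) v) n j p).
  by rewrite scalerDr !scalerA mulrC.
have hs i j u : j != i + (n + 1) -> @hf i j u = 0.
  by move=> ne; rewrite /hf hom_shape ?scaler0 //; apply: contraNneq ne => ->; apply/eqP; ring.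
exists (HomDeg hl hs) => i j u; rewrite homBE !bidE -scalerBr -homBE e.
rewrite [hom_fun (_ + _) n j p]/(hom_fun (diff (hom_complex P C) (i + 1) i (h i (i + 1) u)) n j p + hom_fun (h (i - 1) i (diff E i (i - 1) u)) n j p).
have -> : hom_fun (diff (hom_complex P C) (i + 1) i (h i (i + 1) u)) n j p = diff C (j + 1) j (hom_fun (h i (i + 1) u) n (j + 1) p).
  apply: etrans (hom_diffE (h i (i + 1) u) p erefl erefl erefl) _.
  by rewrite (hp : diff P n (n - 1) p = 0) hom_lin0 scaler0 subr0.
rewrite scalerDr /= /hf (linearZ_LR (diff C (j + 1) j)) scalerA -hsignD; congr (_ + _).
have -> : n + n * (i - 1) = n * i by ring.
congr (_ *: _); have H k : k = i -> hom_fun (h (i - 1) k (diff E i (i - 1) u)) n j p = hom_fun (h (i - 1) i (diff E i (i - 1) u)) n j p.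
  by move=> ->.
by rewrite H ?subrK.
Qed.

(** Independence of the models. The comparison [f : E' -> E] is compatible with [ga] and [ga'] only
    up to homotopy, hence the detour through [bid_homotopic]. *)
Lemma bid_invariant P P' E E' C C' (la : chain_map P' P) (c : chain_map C' C)
  (ga : chain_map E (hom_complex P C)) (ga' : chain_map E' (hom_complex P' C')) :
  semiprojective P -> semiprojective P' -> semiprojective E -> semiprojective E' ->
  quasi_iso la -> quasi_iso c -> quasi_iso ga -> quasi_iso ga' ->
  quasi_iso (bid ga) <-> quasi_iso (bid ga').
Proof.
move=> sP sP' sE sE' ql qc qg qg'.
have qpre : quasi_iso (pre C la) by apply: pre_heq; apply: semiproj_quasi_heq.
have q1 : quasi_iso (chain_comp (pre C la) ga) by apply: quasi_iso_comp.
have q2 : quasi_iso (chain_comp (post P' c) ga') by apply: quasi_iso_comp => //; apply: semiproj_post.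
have [f hf] := semiproj_lift (chain_comp (post P' c) ga') sE' q1.
have qf : quasi_iso f by apply: (quasi_iso_compr q1); apply: heqv_quasi_iso (heqv_sym (homotopic_heqv hf)) q2.
have qpf : quasi_iso (pre C f) by apply: pre_heq; apply: semiproj_quasi_heq.
have qpc : quasi_iso (post E' c) by apply: semiproj_post.
have hb := bid_homotopic hf.
have e1 i x : bid (chain_comp (chain_comp (pre C la) ga) f) i x =
    chain_comp (pre C f) (chain_comp (bid ga) la) i x by apply: hom_ext.
have e2 i x : bid (chain_comp (post P' c) ga') i x = chain_comp (post E' c) (bid ga') i x.
  by apply: hom_ext => j k u; rewrite bidE [RHS]postE bidE [RHS]linearZ_LR.
split=> h.
  apply: (quasi_iso_compr qpc); apply: quasi_iso_eq e2 _; apply: heqv_quasi_iso hb _.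
  apply: quasi_iso_eq (fun i x => esym (e1 i x)) _.
  exact: quasi_iso_comp (quasi_iso_comp ql h) qpf.
apply: (quasi_iso_compl ql); apply: (quasi_iso_compr qpf); apply: quasi_iso_eq e1 _.
apply: heqv_quasi_iso (heqv_sym hb) _; apply: quasi_iso_eq (fun i x => esym (e2 i x)) _.
exact: quasi_iso_comp h qpc.
Qed.

Section Resolved.
Variables (X C L Q G : complex R) (l : chain_map L X) (q : chain_map Q C) (ga : chain_map G (hom_complex L Q)).
Hypotheses (sL : semiprojective L) (ql : quasi_iso l) (qq : quasi_iso q).

Let res_lift : exists la : chain_map L (res X), quasi_iso la.
Proof.
have qX := res_map_quasi_iso X; have [la hla] := semiproj_lift l sL qX; exists la.
by apply: (quasi_iso_compr qX); apply: heqv_quasi_iso (heqv_sym (homotopic_heqv hla)) ql.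
Qed.

Lemma RHom_zero i : homology_zero (RHom X C) i <-> homology_zero (hom_complex L Q) i.
Proof.
have [la qla] := res_lift.
have q1 : quasi_iso (pre C la) by apply: pre_heq; apply: semiproj_quasi_heq => //; apply: res_semiprojective.
have q2 : quasi_iso (post L q) by apply: semiproj_post.
split=> h; first by apply/(hiso_zero (q2 i)); apply/(hiso_zero (q1 i)).
by apply/(hiso_zero (q1 i)); apply/(hiso_zero (q2 i)).
Qed.

Lemma biduality_bid : semiprojective G -> quasi_iso ga -> diso (biduality C X) <-> quasi_iso (bid ga).
Proof.
move=> sG qg; have [la qla] := res_lift; set D := RHom X C.
have := bid_invariant (res_semiprojective X) sL (res_semiprojective D) sG qla qq (res_map_quasi_iso D) qg.
have e i x : bid (res_map D : chain_map (res D) (hom_complex (res X) C)) i x = biduality C X i x by apply: hom_ext.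
by move=> H; split=> [/disoE h|h]; [apply/H; apply: quasi_iso_eq (fun i x => esym (e i x)) h|
  apply/disoE; apply: quasi_iso_eq e _; apply/H].
Qed.
End Resolved.

Definition chi_fun P (r : R^o) : hom_complex P P 0 := (r : R) *: cyc (chain_id P).
Fact chi_linear P : linear (@chi_fun P).
Proof. by move=> a x y; rewrite /chi_fun scalerDl scalerA. Qed.
Fact chi_cycle P r : is_cycle (lin_of (@chi_linear P) r).
Proof. by apply: cycleZ; apply: cyc_cycle. Qed.
(** The homothety morphism with both arguments of the homomorphism complex given by one and the same
    model. *)
Definition chi P : chain_map (stalk R^o) (hom_complex P P) := stalk_map (@chi_cycle P).

Lemma stalk_nz (M : lmodType R) (i : int) : i != 0 -> forall x : stalk M i, x = 0.
Proof. by case: i => [[|k]|k] // _ x; apply/rowP => -[]. Qed.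

Lemma homothety_chi Q C (q : chain_map Q C) : semiprojective Q -> quasi_iso q ->
  diso (homothety C) <-> quasi_iso (chi Q).
Proof.
move=> sQ qq; have qC := res_map_quasi_iso C; have sC := res_semiprojective C.
have [la hla] := semiproj_lift q sQ qC; pose c := chain_comp (res_map C) la.
have qc : quasi_iso c := heqv_quasi_iso (heqv_sym (homotopic_heqv hla)) qq.
have qla : quasi_iso la := quasi_iso_compr qC qc.
have q1 : quasi_iso (pre C la) by apply: pre_heq; apply: semiproj_quasi_heq.
have q2 : quasi_iso (post Q c) by apply: semiproj_post.
have e i x : chain_comp (pre C la) (homothety C) i x = chain_comp (post Q c) (chi Q) i x.
  have [ei|ne] := eqVneq i 0; last by rewrite (stalk_nz ne x) !linear0.
  subst i; apply: hom0_ext => i p.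
  change ((x : R) *: diag_fun (res_map C) i (la i p) = c i ((x : R) *: diag_fun (chain_id Q) i p)).
  by rewrite !diag_funE linearZ_LR.
split=> [/disoE h|h].
  apply: (quasi_iso_compr q2); apply: quasi_iso_eq e _; exact: quasi_iso_comp.
apply/disoE; apply: (quasi_iso_compr q1); apply: quasi_iso_eq (fun i x => esym (e i x)) _; exact: quasi_iso_comp.
Qed.

Lemma stalk_finite_free : finite_free_below (stalk R^o) 0.
Proof.
split=> [i|i i0 x]; last by apply: stalk_nz; lia.
have [->|ne] := eqVneq i 0; first exact: fgp_regular.
by apply: fgp_zero; apply: stalk_nz.
Qed.

Lemma finite_free_fg (hR : noetherian R) (L : complex R) a : finite_free_below L a -> degreewise_finite L.
Proof.
move=> [h1 _] i; apply/homology_fgP; have [n [e [c ec]]] := h1 i.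
pose full : submod (L i) := @Submod R _ (fun _ => True) I (fun _ _ _ _ => I) (fun _ _ _ => I).
apply: (noetherian_fgr hR (Z := full) (B := boundaries L i) (P := cycles L i)) => //.
  by move=> x; apply: boundary_cycle.
exists [seq e k | k <- enum 'I_n]; split=> // x _; exists 0; split; first exact: submod0.
rewrite subr0 (ec x); pose Sp : submod (L i) := Submod (spanned0 [seq e k | k <- enum 'I_n]) (@spannedD _ _ _) (@spannedZ _ _ _).
apply: (submod_sum (P := Sp)) => k _; apply: spannedZ; apply: spanned_mem; apply: map_f; exact: mem_enum.
Qed.

Lemma hom_zero_above (L Q : complex R) a b : finite_free_below L a -> zero_above Q b -> zero_above (hom_complex L Q) (b - a).
Proof.
move=> hL hQ n bn f hf.
apply: (bounded_below_boundary hL.2 (fun i => (finite_free_semiprojective hL).1 i) _ hf) => k.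
have [ka|ka] := ltP k a; first by left; apply: hL.2.
by right; apply: hQ; lia.
Qed.
End BidualityMaps.

(** * Base change of homothety and biduality *)

Section AscentDescent.
Variables (R S : comPzRingType) (phi : {rmorphism R -> S}).
Hypotheses (hR : noetherian R) (hS : noetherian S) (hphi : finite_flat_dim phi)
  (hmax : forall m : R -> Prop, is_maximal m ->
     exists q : S -> Prop, is_prime q /\ (forall r, m r <-> q (phi r))).
Local Notation Sm := (ringmod phi).
Local Notation bc := (bc_complex phi).

Lemma kappa_bid (L Q G : complex R) (ga : chain_map G (hom_complex L Q)) i x :
  kappa phi (bid ga) i x = bid (kappa phi ga) i x.
Proof.
move: x; apply: (@bc_eq_lin _ _ _ _ _ (kappa phi (bid ga) i) (bid (kappa phi ga) i)) => p.
apply: bch_ext => j k g; rewrite kappa_bt.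
change (bt phi (hsign R (i * j) *: hom_fun (ga j g) i k p) (1 * 1) =
  hsign S (i * j) *: hom_fun (kappa phi ga j (bt phi g 1)) i k (bt phi p 1)).
rewrite kappa_bt bt_balanced !mulr1 (hsign_rmorph phi).
exact: bt1Z.
Qed.

Fact stalk_unit_linear : linear (fun r : R^o => (phi r : restr phi S^o)).
Proof. by move=> r x y; rewrite rmorphD rmorphM. Qed.
Definition stalk_unit : chain_map (stalk R^o) (rc phi (stalk S^o)) :=
  @stalk_map R R^o (rc phi (stalk S^o)) (lin_of stalk_unit_linear) (fun _ => erefl).
Definition stalk_bc : chain_map (bc (stalk R^o)) (stalk S^o) := cext stalk_unit.
Lemma stalk_bc_quasi_iso : quasi_iso stalk_bc.
Proof.
move=> i; have [->|ne] := eqVneq i 0; last first.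
  have z (x : bc (stalk R^o) i) : x = 0.
    elim/bc_ind: (x : base_change phi (stalk R^o i)) => [//|u v -> ->|m s]; first exact: addr0.
    rewrite (stalk_nz ne m); exact: tp0l.
  split=> [x _ _|y _]; first by rewrite (z x); apply: boundary0.
  by exists 0; split; [apply: cycle0|rewrite (stalk_nz ne y) linear0 subr0; apply: boundary0].
have K (x : base_change phi (R^o)) : bt phi (1 : R^o) (stalk_bc 0 x : S) = x.
  elim/bc_ind: x => [|u v hu hv|m s].
  - rewrite linear0; exact: (tp0r Sm (1 : R^o)).
  - rewrite linearD -{2}hu -{2}hv; exact: (tpDr (1 : R^o)).
  have -> : stalk_bc 0 (bt phi m s) = s * phi m := cext_bt (i := 0) stalk_unit m s.
  rewrite mulrC -bt_balanced; congr bt; exact: mulr1.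
split=> [x hx [y ey]|y hy].
  have z0 : stalk_bc 0 x = 0 by rewrite -ey.
  rewrite -(K x) z0; suff -> : bt phi (1 : R^o) 0 = 0 by apply: boundary0.
  exact: (tp0r Sm (1 : R^o)).
exists (bt phi (1 : R^o) y); split; last first.
  have -> : stalk_bc 0 (bt phi (1 : R^o) y) = y * phi 1 := cext_bt (i := 0) stalk_unit (1 : R^o) y.
  by rewrite rmorph1 mulr1 subrr; apply: boundary0.
exact: (bc_map0 _ (f := diff (stalk R^o) 0 (0 - 1))).
Qed.

Lemma kappa_chi (Q : complex R) i x : kappa phi (chi Q) i x = chain_comp (chi (bc Q)) stalk_bc i x.
Proof.
move: x; apply: (@bc_eq_lin _ _ _ _ _ (kappa phi (chi Q) i) (chain_comp (chi (bc Q)) stalk_bc i)) => r.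
have [ei|ne] := eqVneq i 0; last first.
  by rewrite (stalk_nz ne r) (tp0l _ (1 : Sm) : bt phi 0 1 = 0) !linear0.
subst i; apply: bch_ext => j k p; rewrite kappa_bt mulr1.
have E : stalk_bc 0 (bt phi r 1) = 1 * phi r := cext_bt (i := 0) stalk_unit r 1.
change (bt phi ((r : R) *: diag_fun (chain_id Q) k p) 1 = hom_fun (chi (bc Q) 0 (stalk_bc 0 (bt phi r 1))) j k (bt phi p 1)).
rewrite E mul1r bt_balanced mulr1.
change (bt phi (diag_fun (chain_id Q) k p) (phi r) = phi r *: diag_fun (chain_id (bc Q)) k (bt phi p 1)).
have [ejk|ne] := eqVneq j k; last by rewrite !diag_fun_ne // scaler0; apply: (tp0l).
by subst k; rewrite !diag_funE /= btZ mulr1.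
Qed.

Lemma chi_transfer (Q : complex R) a b : finite_free_below Q a -> zero_above Q b ->
  quasi_iso (chi (bc Q)) <-> quasi_iso (chi Q).
Proof.
move=> hQ zQ; have ff := stalk_finite_free R.
have T := transfer_quasi_iso hR hphi hmax hQ hQ zQ (chi Q) (finite_free_semiprojective ff) (finite_free_fg hR ff).
split=> h.
  apply/T; apply: quasi_iso_eq (fun i x => esym (@kappa_chi Q i x)) _; exact: quasi_iso_comp stalk_bc_quasi_iso h.
apply: (quasi_iso_compl stalk_bc_quasi_iso); apply: quasi_iso_eq (@kappa_chi Q) _; exact/T.
Qed.

Lemma Ltensor_finite (C : complex R) : degreewise_finite C -> (exists a, zero_below C a) ->
  degreewise_finite (Ltensor phi C).
Proof.
move=> fC [a ha]; have [Q [q [hQ qq]]] := free_resolution hR fC ha.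
have [qh qqh] := Ltensor_resolution phi (finite_free_semiprojective hQ) qq.
move=> i; apply: (hiso_fg (qqh i)); exact: (finite_free_fg hS (base_change_finite_free phi hQ)).
Qed.

Lemma Ltensor_above (C : complex R) : (exists b, zero_above C b) -> exists b, zero_above (Ltensor phi C) b.
Proof.
move=> [b hb]; have qC := res_map_quasi_iso C.
apply: (base_change_bounded_above hphi (b := b)); first by case: (res_semiprojective C).
by move=> i ib; apply/(hiso_zero (qC i)); apply: hb.
Qed.

Lemma Ltensor_homologically_finite (C : complex R) :
  homologically_finite C -> homologically_finite (Ltensor phi C).
Proof.
move=> /homologically_finiteP [fC [a ha] hb]; apply/homologically_finiteP; split.
- by apply: Ltensor_finite => //; exists a.
- by exists a; apply/(Ltensor_zero hR hmax a fC).
- exact: Ltensor_above.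
Qed.

(** The case where [C] is known to be homologically finite. Without this, the upper bound that
    descent requires is supplied by [bounded_above]. *)
Lemma semidualizing_bounded (C : complex R) : homologically_finite C ->
  semidualizing (Ltensor phi C) <-> semidualizing C.
Proof.
move=> hC; have /homologically_finiteP [fC [a ha] [b hb]] := hC.
have [Q [q [hQ qq]]] := free_resolution hR fC ha; have sQ := finite_free_semiprojective hQ.
have [qh qqh] := Ltensor_resolution phi sQ qq.
have H1 := homothety_chi sQ qq; have H2 := homothety_chi (bc_semiprojective phi sQ) qqh.
have zQ : zero_above Q b by move=> i ib; apply/(hiso_zero (qq i)); apply: hb.
have T := chi_transfer hQ zQ.
split=> [[_ /H2/T/H1 h]|[_ /H1/T/H2 h]]; split=> //; exact: Ltensor_homologically_finite.
Qed.

Section Reflexivity.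
Variables (C X : complex R).
Hypotheses (hC : homologically_finite C) (fX : degreewise_finite X).

(** [X] is only assumed bounded below, and its upper bound is part of reflexivity. It follows from
    biduality, which identifies [X] with [Hom (G, Q)] for a resolution [G] that is bounded below. *)
Lemma reflexive_transfer a : zero_below X a ->
  (forall d, zero_below (RHom X C) d <-> zero_below (RHom (Ltensor phi X) (Ltensor phi C)) d) /\
  (C_reflexive (Ltensor phi C) (Ltensor phi X) <-> C_reflexive C X).
Proof.
move=> zX; have /homologically_finiteP [fC [c hc] [b hb]] := hC.
have [Q [q [hQ qq]]] := free_resolution hR fC hc; have sQ := finite_free_semiprojective hQ.
have [L [l [hL ql]]] := free_resolution hR fX zX; have sL := finite_free_semiprojective hL.
have [qh qqh] := Ltensor_resolution phi sQ qq; have [lh qlh] := Ltensor_resolution phi sL ql.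
have sbL := bc_semiprojective phi sL.
have zQ : zero_above Q b by move=> i ib; apply/(hiso_zero (qq i)); apply: hb.
have RZ i := RHom_zero sL ql qq i; have SZ i := RHom_zero sbL qlh qqh i.
have TZ d := transfer_zero hR hphi hmax hL hQ zQ d.
have DZ d : zero_below (RHom X C) d <-> zero_below (RHom (Ltensor phi X) (Ltensor phi C)) d.
  split=> h i id.
    by apply/SZ; apply: (TZ d).2 i id => j jd; apply/RZ; apply: h.
  by apply/RZ; apply: (TZ d).1 i id => j jd; apply/SZ; apply: h.
split=> //.
have aR : exists e, zero_above (RHom X C) e.
  by exists (b - a) => i ib; apply/RZ; apply: (hom_zero_above hL zQ).
have aS : exists e, zero_above (RHom (Ltensor phi X) (Ltensor phi C)) e.
  have [b' zbQ] := base_change_bounded_above hphi (fun i => (finite_free_semiprojective hQ).1 i) zQ.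
  exists (b' - a) => i ib; apply/SZ; apply: (hom_zero_above (base_change_finite_free phi hL) zbQ) ib.
have main d : zero_below (RHom X C) d ->
   (diso (biduality (Ltensor phi C) (Ltensor phi X)) <-> diso (biduality C X)) /\
   (diso (biduality C X) -> exists e, zero_above X e).
  move=> zD.
  have zV : zero_below (hom_complex L Q) d by move=> i id; apply/RZ; apply: zD.
  have [G [ga [hG qg]]] := free_resolution hR (finite_free_hom_fg hR hL hQ zQ) zV.
  have sG := finite_free_semiprojective hG.
  have qk := kappa_quasi_iso hphi hL hQ zQ sG qg.
  have H1 := biduality_bid sL ql qq sG qg.
  have H2 := biduality_bid sbL qlh qqh (bc_semiprojective phi sG) qk.
  have T := transfer_quasi_iso hR hphi hmax hG hQ zQ (bid ga) sL (finite_free_fg hR hL).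
  split.
    split=> [/H2 h|/H1 h]; [apply/H1/T|apply/H2].
      by apply: quasi_iso_eq h => i x; apply/esym/kappa_bid.
    by move/T: h; apply: quasi_iso_eq => i x; apply: kappa_bid.
  (* The homology of [Q] ends in degree [b] and [G] begins in degree [d]. *)
  move=> /H1 h; exists (b - d) => i ib; apply/(hiso_zero (ql i)); apply/(hiso_zero (h i)).
  exact: (hom_zero_above hG zQ).
split=> [[fXh /homologically_boundedP [[d zd] _] dXh]|[fX' /homologically_boundedP [[d zd] _] dX]].
  have zD : zero_below (RHom X C) d by apply/DZ.
  have [m1 m2] := main d zD; have dX := m1.1 dXh.
  split=> //; last by apply/homologically_boundedP; split=> //; exists d.
  by apply/homologically_finiteP; split=> //; [exists a|apply: m2].
split; first exact: Ltensor_homologically_finite.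
  by apply/homologically_boundedP; split=> //; exists d; apply/DZ.
exact: (main d zd).1.2.
Qed.

Lemma reflexive_base_change : C_reflexive (Ltensor phi C) (Ltensor phi X) <-> C_reflexive C X.
Proof.
have H a : zero_below X a -> _ := fun zX => (@reflexive_transfer a zX).2.
split=> [h|h].
  have [/homologically_finiteP [_ [a ha] _] _ _] := h.
  by apply/(H a) => //; apply/(Ltensor_zero hR hmax a fX).
by have [/homologically_finiteP [_ [a ha] _] _ _] := h; apply/(H a).
Qed.

Lemma Gdim_base_change : Gdim C X = Gdim (Ltensor phi C) (Ltensor phi X).
Proof.
rewrite /Gdim; have E : `[< C_reflexive (Ltensor phi C) (Ltensor phi X) >] = `[< C_reflexive C X >].
  by apply/asboolP/asboolP => /reflexive_base_change.
rewrite E; case: asboolP => // -[/homologically_finiteP [_ [a ha] _] _ _].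
have [DZ _] := reflexive_transfer ha; have /homologically_finiteP [fC _ _] := hC.
rewrite (hinf_eq DZ) (@hinf_eq _ _ C (Ltensor phi C)) // => d.
by split=> h; apply/(Ltensor_zero hR hmax d fC).
Qed.
End Reflexivity.
End AscentDescent.

(** * Descent of isomorphisms *)

Section PicardAlgebra.
Variables (R S : comPzRingType) (phi : {rmorphism R -> S}).
Hypotheses (hR : noetherian R) (hmax : forall m : R -> Prop, is_maximal m ->
     exists q : S -> Prop, is_prime q /\ (forall r, m r <-> q (phi r))) (hpic : pic_injective phi).

Lemma regular_pic : pic (R^o : lmodType R).
Proof.
split.
- exists 1%N, (fun _ => 1 : R^o) => x; exists (fun _ => x).
  by rewrite big_ord1; apply: esym (mulr1 (x : R)).
- exact: (fgp_projective (fgp_regular R)).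
move=> p [_ p1 _]; exists (1 : R^o); split=> [x|r [s [ps e]]].
  by exists (x : R), 1; split=> //; apply: mulrC.
by exists s; split=> //; rewrite -[LHS]mulr1.
Qed.

(** In the application, [w i j] and [r j i] are the scalars by which the two composites of [al i]
    and [al' j] act. [wA] and [rB] express associativity, and [sw] and [sr] say that the
    combinations with coefficients [s] and [t] are inverse over [S]. *)
Variables (m n : nat) (w : 'I_m -> 'I_n -> R) (r : 'I_n -> 'I_m -> R) (s : 'I_m -> S) (t : 'I_n -> S).
Hypotheses (wA : forall i j k l, w i j * w k l = r j k * w i l)
  (rB : forall j i l k, r j i * r l k = w i l * r j k)
  (sw : \sum_i \sum_j s i * t j * phi (w i j) = 1) (sr : \sum_i \sum_j s i * t j * phi (r j i) = 1).

(** If the [r j i] lay in a maximal ideal, then [sr] would put [1] into a prime of [S] that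
    contracts to it. *)
Lemma unit_combination : exists x : 'I_n -> 'I_m -> R, \sum_j \sum_i x j i * r j i = 1.
Proof.
pose I y := exists x : 'I_n -> 'I_m -> R, y = \sum_j \sum_i x j i * r j i.
suff [x ->] : I 1 by exists x.
apply: contrapT => nI; have iI : is_ideal I.
  split.
  - by exists (fun _ _ => 0); rewrite big1 // => j _; rewrite big1 // => i _; rewrite mul0r.
  - move=> _ _ [x ->] [y ->]; exists (fun j i => x j i + y j i); rewrite -big_split; apply: eq_bigr => j _.
    by rewrite -big_split; apply: eq_bigr => i _; rewrite mulrDl.
  - move=> a _ [x ->]; exists (fun j i => a * x j i); rewrite mulr_sumr; apply: eq_bigr => j _.
    by rewrite mulr_sumr; apply: eq_bigr => i _; rewrite mulrA.
have [mm [hm Im]] := maximal_exists hR iI nI; have [q [[[q0 qD qM] q1 _] mq]] := hmax hm.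
apply: q1; rewrite -sr; apply: big_ind => // i _; apply: big_ind => // j _; apply: (qM).
apply/mq; apply: Im; exists (fun j' i' => (j' == j)%:R * (i' == i)%:R).
rewrite (bigD1 j) //= (bigD1 i) //= !eqxx !mul1r big1 ?addr0 => [|i' ne]; last by rewrite (negPf ne) mulr0 mul0r.
by rewrite big1 ?addr0 // => j' ne; rewrite big1 // => i' _; rewrite (negPf ne) !mul0r.
Qed.

(** With [1] written as a combination of the [r j i] with coefficients [x], the matrix [e = x w]
    satisfies [e i j * e a k = q j a * e i k], where [q] has trace 1. So [e] is idempotent of rank
    one, and its row space [L] is the invertible module. Freeness of [L] over [R] is deduced from
    freeness over [S], and a basis vector yields the coefficients. *)
Lemma picard_descent : exists (b : 'I_m -> R) (y : 'I_n -> R),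
  \sum_i \sum_j b i * y j * r j i = 1 /\ \sum_i \sum_j b i * y j * w i j = 1.
Proof.
have [x hx] := unit_combination.
pose e l j := \sum_i x l i * w i j; pose q j l := \sum_i x l i * r j i.
have q1 : \sum_j q j j = 1 := hx.
(* For [j = a] this gives idempotency after summation, because the trace of [q] is 1. *)
have ee i j a k : e i j * e a k = q j a * e i k.
  rewrite {1}/e mulr_suml /q mulr_suml.
  apply: etrans (_ : \sum_l \sum_p x i l * (x a p * (w l j * w p k)) = _).
    by apply: eq_bigr => l _; rewrite /e !mulr_sumr; apply: eq_bigr => p _; ring.
  rewrite exchange_big; apply: eq_bigr => p _; rewrite /e mulr_sumr; apply: eq_bigr => l _.
  by rewrite wA; ring.
have qq j a k l : q j a * q k l = e a k * q j l.
  rewrite {1}/q mulr_suml {1}/e mulr_suml; apply: eq_bigr => i _; rewrite /q !mulr_sumr.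
  by apply: eq_bigr => p _; have := rB j i k p => E; ring: E.
have ew l j i k : e l j * w i k = r j i * e l k.
  rewrite /e mulr_suml mulr_sumr; apply: eq_bigr => p _.
  by have := wA p j i k => E; ring: E.
pose Lp (v : 'rV[R]_n) := forall k, v 0 k = \sum_l v 0 l * e l k.
have L0 : Lp 0 by move=> k; rewrite mxE big1 // => l _; rewrite mxE mul0r.
have LD u v : Lp u -> Lp v -> Lp (u + v).
  by move=> hu hv k; rewrite mxE hu hv -big_split; apply: eq_bigr => l _; rewrite mxE mulrDl.
have LZ a v : Lp v -> Lp (a *: v).
  by move=> hv k; rewrite mxE hv mulr_sumr; apply: eq_bigr => l _; rewrite mxE mulrA.
pose P := Submod L0 LD LZ; pose L : lmodType R := sub_of P.
pose row (f : 'I_n -> R) : 'rV[R]_n := \row_k f k.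
have Ee i : Lp (row (e i)).
  move=> k; rewrite mxE; apply/esym; apply: etrans (_ : \sum_l q l l * e i k = _).
    by apply: eq_bigr => l _; rewrite mxE ee.
  by rewrite -mulr_suml q1 mul1r.
pose eL i : L := @SubOf R 'rV[R]_n P (row (e i)) (Ee i).
pose pE (v : 'rV[R]_n) : 'rV[R]_n := row (fun k => \sum_l v 0 l * e l k).
have pEl : linear pE.
  move=> a u v; apply/rowP => k; rewrite !mxE mulr_sumr -big_split; apply: eq_bigr => l _.
  by rewrite !mxE mulrDl mulrA.
have pEE v : pE v = \sum_l v 0 l *: row (e l).
  by apply/rowP => k; rewrite summxE mxE; apply: eq_bigr => l _; rewrite !mxE.
have pEP v : P (lin_of pEl v).
  by rewrite /= pEE; apply: (submod_sum (P := P)) => l _; apply: (LZ).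
have pK (z : L) : sub_lift (P := P) (f := lin_of pEl) pEP (sub_incl P z) = z.
  apply: sub_val_inj; case: z => v hv; apply/rowP => k; rewrite /= mxE; exact: esym (hv k).
have coef (z : L) k : (sub_val z) 0 k = \sum_l (sub_val z) 0 l * e l k := sub_valP z k.
have zq (z : L) j k : q j j * (sub_val z) 0 k = (sub_val z) 0 j * e j k.
  rewrite (coef z k) (coef z j) mulr_sumr mulr_suml; apply: eq_bigr => l _.
  by have := ee l j j k => E; ring: E.
have picL : pic L.
  split.
  - exists n, (fun l => eL l) => z; exists (fun l => (sub_val z) 0 l).
    apply: sub_val_inj; apply/rowP => k; rewrite coef.
    have -> : sub_val (\sum_l (sub_val z) 0 l *: eL l) = \sum_l (sub_val z) 0 l *: row (e l).
      exact: (linear_sum (sub_incl P)).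
    by rewrite summxE; apply: eq_bigr => l _; rewrite !mxE.
  - exact: (@retract_projective R L 'rV[R]_n (sub_incl P) (sub_lift (P := P) (f := lin_of pEl) pEP) pK (@row_projective R n)).
  move=> p pp; have [[p0 pD pM] p1 pP] := pp.
  have [j pj] : exists j, ~ p (q j j).
    apply: contrapT => nj; apply: p1; rewrite -q1; apply: big_ind => // j _.
    by apply: contrapT => h; apply: nj; exists j.
  exists (eL j); split=> [z|c [d [pd hd]]].
    exists ((sub_val z) 0 j), (q j j); split=> //; apply: sub_val_inj; apply/rowP => k.
    by rewrite !mxE zq.
  exists (d * q j j); split; first by move=> /pP [].
  have z k : d * c * e j k = 0.
    by have /(congr1 (fun z : L => (sub_val z) 0 k)) := hd; rewrite /= !mxE.
  rewrite (_ : d * q j j * c = \sum_k d * c * e j k * q j k); first by rewrite big1 // => k _; rewrite z mul0r.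
  transitivity (\sum_k d * c * (q j j * q k k)); first by rewrite -mulr_sumr -mulr_sumr q1; ring.
  by apply: eq_bigr => k _; rewrite qq; ring.
have Ws i : Lp (row (w i)).
  move=> k; rewrite mxE; apply/esym; apply: etrans (_ : \sum_l q l l * w i k = _); last first.
    by rewrite -mulr_suml q1 mul1r.
  apply: eq_bigr => l _; rewrite mxE /e /q mulr_sumr mulr_suml; apply: eq_bigr => p _.
  by have := wA i l p k => E; ring: E.
pose wL i : L := @SubOf R 'rV[R]_n P (row (w i)) (Ws i).
(* Over [S], the map [z |-> sum z j * t j] and multiplication by [B], the sum of the [wL i (x) s i],
   are inverse to each other by [sr] and [sw]. *)
have isoL : mod_iso (base_change phi L) (base_change phi R^o).
  have Fl : linear (fun z : L => (bt phi (1 : R^o) (\sum_j phi ((sub_val z) 0 j) * t j) : restr phi (base_change phi R^o))).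
    move=> a u v.
    have D (c d : S) : bt phi (1 : R^o) (phi a * c + d) = phi a *: bt phi (1 : R^o) c + bt phi (1 : R^o) d.
      by rewrite btZ; apply: (tpDr (1 : R^o)).
    apply: etrans (D _ _); congr bt; rewrite mulr_sumr -big_split; apply: eq_bigr => j _.
    by rewrite /= !mxE rmorphD rmorphM mulrDl mulrA.
  pose B : base_change phi L := \sum_i bt phi (wL i) (s i).
  have Gl : linear (fun c : R^o => (phi c *: B : restr phi (base_change phi L))).
    have D c d f : (phi (c * d + f)) *: B = phi c *: (phi d *: B) + phi f *: B.
      by rewrite scalerA -scalerDl rmorphD rmorphM.
    by move=> c d f; apply: D.
  exists (bext (lin_of Fl)), (bext (lin_of Gl)).
    apply: (@bc_eq_lin _ _ _ _ _ (lin_of (linear_comp (bext (lin_of Gl)) (bext (lin_of Fl)))) idfun) => z.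
    change (bext (lin_of Gl) (bext (lin_of Fl) (bt phi z 1)) = bt phi z 1).
    have -> : bext (lin_of Fl) (bt phi z 1) = bt phi (1 : R^o) (\sum_j phi ((sub_val z) 0 j) * t j).
      by rewrite bext_bt; apply: scale1r.
    set c := \sum_j _; have -> : bext (lin_of Gl) (bt phi (1 : R^o) c) = c *: B.
      by rewrite bext_bt /= rmorph1; congr (_ *: _); apply: scale1r.
    have sd (f : S) i : f *: bt phi (wL i) (s i) = bt phi (wL i) (f * s i) by apply: btZ.
    have zw i j : (sub_val z) 0 j *: (wL i) = r j i *: z.
      apply: sub_val_inj; apply/rowP => k; rewrite /= !mxE (coef z j) (coef z k) mulr_suml mulr_sumr.
      by apply: eq_bigr => l _; have := ew l j i k => E; ring: E.
    transitivity (\sum_i \sum_j bt phi z (s i * t j * phi (r j i))).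
      rewrite /B scaler_sumr; apply: eq_bigr => i _; rewrite sd /c mulr_suml.
      rewrite [LHS](linear_sum (tpr _ (wL i))); apply: eq_bigr => j _.
      have -> : phi ((sub_val z) 0 j) * t j * s i = phi ((sub_val z) 0 j) * (s i * t j) by ring.
      apply: etrans (esym (bt_balanced _ _ _ _)) _; rewrite zw; apply: etrans (bt_balanced _ _ _ _) _.
      by congr bt; ring.
    rewrite -[in RHS]sr [RHS](linear_sum (tpr _ z)); apply: eq_bigr => i _.
    exact: esym (linear_sum (tpr _ z) _ _ _).
  apply: (@bc_eq_lin _ _ _ _ _ (lin_of (linear_comp (bext (lin_of Fl)) (bext (lin_of Gl)))) idfun) => c.
  change (bext (lin_of Fl) (bext (lin_of Gl) (bt phi c 1)) = bt phi c 1).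
  have -> : bext (lin_of Gl) (bt phi c 1) = phi c *: B by rewrite bext_bt; apply: scale1r.
  rewrite (linearZ_LR (bext (lin_of Fl))) /B (linear_sum (bext (lin_of Fl))).
  have -> : \sum_i bext (lin_of Fl) (bt phi (wL i) (s i)) = bt phi (1 : R^o) 1.
    rewrite -[in RHS]sw [RHS](linear_sum (tpr _ (1 : R^o))); apply: eq_bigr => i _.
    have E : bext (lin_of Fl) (bt phi (wL i) (s i)) =
        s i *: bt phi (1 : R^o) (\sum_j phi ((sub_val (wL i)) 0 j) * t j) := bext_bt _ _ _.
    rewrite E; have E2 f g : f *: bt phi (1 : R^o) g = bt phi (1 : R^o) (f * g) by apply: btZ.
    rewrite E2; congr bt; rewrite mulr_sumr; apply: eq_bigr => j _.
    by rewrite /= mxE; ring.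
  by rewrite btZ -bt_balanced; congr bt; apply: mulr1.
(* Injectivity on Picard groups makes [L] free. With a basis vector [v] and the coordinates [y] of
   the rows of [e], the matrix becomes [e j k = y j * v k]. *)
have [f [g fg gf]] := hpic picL regular_pic isoL.
pose v0 : L := g (1 : R^o); pose v k := (sub_val v0) 0 k.
have gen (z : L) : z = (f z : R) *: v0.
  by apply: (can_inj fg); rewrite linearZ_LR /v0 gf; apply: esym (mulr1 _).
have fre c : (forall k, c * v k = 0) -> c = 0.
  move=> h; have /(congr1 f) : c *: v0 = 0 by apply: sub_val_inj; apply/rowP => k; rewrite /= !mxE h.
  by rewrite linearZ_LR /v0 gf linear0 => <-; apply: esym (mulr1 _).
pose y j : R := f (eL j).
have ey j k : e j k = y j * v k.
  by have /(congr1 (fun z : L => (sub_val z) 0 k)) := gen (eL j); rewrite /= !mxE.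
have rho : \sum_j y j * v j = 1.
  apply/eqP; rewrite -subr_eq0; apply/eqP; apply: fre => k.
  rewrite mulrBl mul1r [v k in X in _ - X](coef v0) mulr_suml -sumrB big1 // => j _.
  by rewrite ey /v; ring.
have qy j l : q j l = y l * v j.
  have H a : q j l * y a = y a * y l * v j.
    apply/eqP; rewrite -subr_eq0; apply/eqP; apply: fre => k.
    have E := ee a j l k; rewrite !ey in E.
    by rewrite mulrBl -[q j l * y a * v k]mulrA -E; ring.
  rewrite -[LHS]mulr1 -[RHS]mulr1 -rho !mulr_sumr; apply: eq_bigr => a _.
  by rewrite mulrA H; ring.
(* The coefficients [b] are the row [v] times the matrix [x]. The two sums then become the square of
   [sum y j * v j] and that sum itself, which is 1 by [rho]. *)
exists (fun i => \sum_j v j * x j i), y; split.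
  transitivity (\sum_j \sum_l v l * y j * q j l).
    rewrite exchange_big; apply: eq_bigr => j _; rewrite /q.
    under [RHS]eq_bigr do rewrite mulr_sumr.
    rewrite exchange_big; apply: eq_bigr => i _; rewrite !mulr_suml; apply: eq_bigr => l _; ring.
  rewrite -[RHS]mulr1 -{1}rho -rho mulr_suml; apply: eq_bigr => j _; rewrite mulr_sumr; apply: eq_bigr => l _.
  by rewrite qy; ring.
transitivity (\sum_j y j * v j) => //.
have cv j : v j = \sum_l v l * e l j := coef v0 j.
rewrite exchange_big; apply: eq_bigr => j _; rewrite [in RHS]cv mulr_sumr.
transitivity (\sum_l \sum_i v l * y j * (x l i * w i j)).
  rewrite exchange_big; apply: eq_bigr => i _; rewrite !mulr_suml; apply: eq_bigr => l _; ring.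
by apply: eq_bigr => l _; rewrite -mulr_sumr -/(e l j); ring.
Qed.
End PicardAlgebra.

(** * Composition of homomorphisms of degree 0 up to homotopy *)

Section Composition.
Variable R : comPzRingType.
Implicit Types X Y Z : complex R.

Fact comp_lin X Y Z (f : hom_complex Y Z 0) (g : hom_complex X Y 0) i j :
  linear (fun x => hom_fun f i j (hom_fun g i i x)).
Proof. by move=> a x y; rewrite !hom_linear. Qed.
Fact comp_shape X Y Z (f : hom_complex Y Z 0) (g : hom_complex X Y 0) i j x :
  j != i + 0 -> hom_fun f i j (hom_fun g i i x) = 0.
Proof. exact: hom_shape. Qed.
Definition comp X Y Z (f : hom_complex Y Z 0) (g : hom_complex X Y 0) : hom_complex X Z 0 :=
  HomDeg (comp_lin f g) (@comp_shape _ _ _ f g).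
Fact comp_linearl X Y Z (g : hom_complex X Y 0) : linear (fun f : hom_complex Y Z 0 => comp f g).
Proof. by move=> a f f'; apply: hom_ext. Qed.
Fact comp_linearr X Y Z (f : hom_complex Y Z 0) : linear (fun g : hom_complex X Y 0 => comp f g).
Proof.
move=> a g g'; apply: hom_ext => i j x.
exact: (@hom_linear _ _ _ _ f i j a (hom_fun g i i x) (hom_fun g' i i x)).
Qed.
Lemma compBl X Y Z (f f' : hom_complex Y Z 0) (g : hom_complex X Y 0) : comp (f - f') g = comp f g - comp f' g.
Proof. exact: (linearB (lin_of (comp_linearl (Z := Z) g))). Qed.
Lemma compBr X Y Z (f : hom_complex Y Z 0) (g g' : hom_complex X Y 0) : comp f (g - g') = comp f g - comp f g'.
Proof. exact: (linearB (lin_of (comp_linearr (X := X) f))). Qed.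
Lemma compZl X Y Z a (f : hom_complex Y Z 0) (g : hom_complex X Y 0) : comp (a *: f) g = a *: comp f g.
Proof. exact: (linearZ_LR (lin_of (comp_linearl (Z := Z) g))). Qed.
Lemma compZr X Y Z a (f : hom_complex Y Z 0) (g : hom_complex X Y 0) : comp f (a *: g) = a *: comp f g.
Proof. exact: (linearZ_LR (lin_of (comp_linearr (X := X) f))). Qed.
Lemma comp_suml X Y Z n (f : 'I_n -> hom_complex Y Z 0) (g : hom_complex X Y 0) :
  comp (\sum_i f i) g = \sum_i comp (f i) g.
Proof. exact: (linear_sum (lin_of (comp_linearl (Z := Z) g))). Qed.
Lemma comp_sumr X Y Z n (f : hom_complex Y Z 0) (g : 'I_n -> hom_complex X Y 0) :
  comp f (\sum_i g i) = \sum_i comp f (g i).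
Proof. exact: (linear_sum (lin_of (comp_linearr (X := X) f))). Qed.
Definition one X : hom_complex X X 0 := cyc (chain_id X).
Lemma compA X Y Z T (f : hom_complex Z T 0) (g : hom_complex Y Z 0) (h : hom_complex X Y 0) :
  comp (comp f g) h = comp f (comp g h).
Proof. exact: hom_ext. Qed.
Lemma comp1 X Y (f : hom_complex X Y 0) : comp (one Y) f = f.
Proof. by apply: hom0_ext => i x; rewrite -[LHS]/(hom_fun (cyc (chain_id Y)) i i (hom_fun f i i x)) cycE. Qed.
Lemma comp_post X Y Z (f : hom_complex Y Z 0) (hf : is_cycle f) (g : hom_complex X Y 0) :
  comp f g = post X (of_cycle hf) 0 g.
Proof. exact: hom0_ext. Qed.
Lemma comp_pre X Y Z (f : hom_complex Y Z 0) (g : hom_complex X Y 0) (hg : is_cycle g) :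
  comp f g = pre Z (of_cycle hg) 0 f.
Proof. exact: hom0_ext. Qed.
Lemma comp_cycle X Y Z (f : hom_complex Y Z 0) (g : hom_complex X Y 0) :
  is_cycle f -> is_cycle g -> is_cycle (comp f g).
Proof. by move=> hf hg; rewrite (comp_post hf); apply: cmap_cycle. Qed.
Lemma comp_cyc X Y Z (f : chain_map Y Z) (g : chain_map X Y) : comp (cyc f) (cyc g) = cyc (chain_comp f g).
Proof. by apply: hom0_ext => i x; rewrite /= !diag_funE. Qed.

Definition eqv X Y (f g : hom_complex X Y 0) := is_boundary (f - g).
Lemma eqv_refl X Y (f : hom_complex X Y 0) : eqv f f.
Proof. by rewrite /eqv subrr; apply: boundary0. Qed.
Lemma eqv_sym X Y (f g : hom_complex X Y 0) : eqv f g -> eqv g f.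
Proof. by move=> /boundaryN; rewrite opprB. Qed.
Lemma eqv_trans X Y (f g h : hom_complex X Y 0) : eqv f g -> eqv g h -> eqv f h.
Proof. by move=> h1 h2; have := boundaryD h1 h2; rewrite /eqv; congr is_boundary; zmod. Qed.
Lemma eqv_scale X Y a (f g : hom_complex X Y 0) : eqv f g -> eqv (a *: f) (a *: g).
Proof. by move=> h; rewrite /eqv -scalerBr; apply: boundaryZ. Qed.
Lemma eqv_sum X Y n (f g : 'I_n -> hom_complex X Y 0) : (forall i, eqv (f i) (g i)) ->
  eqv (\sum_i f i) (\sum_i g i).
Proof. by move=> h; rewrite /eqv -sumrB; apply: (submod_sum (P := boundaries (hom_complex X Y) 0)) => i _; apply: h. Qed.
Lemma eqv_comp X Y Z (f f' : hom_complex Y Z 0) (g g' : hom_complex X Y 0) :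
  is_cycle f -> is_cycle g' -> eqv f f' -> eqv g g' -> eqv (comp f g) (comp f' g').
Proof.
move=> hf hg ef eg; rewrite /eqv.
have -> : comp f g - comp f' g' = comp f (g - g') + comp (f - f') g'.
  by rewrite compBl compBr; zmod.
by apply: boundaryD; [rewrite (comp_post hf)|rewrite (comp_pre _ hg)]; apply: cmap_boundary.
Qed.
Lemma one_cycle X : is_cycle (one X). Proof. exact: cyc_cycle. Qed.

Lemma scalar_ex X (f : hom_complex X X 0) : quasi_iso (chi X) -> is_cycle f -> exists r : R, eqv f (r *: one X).
Proof. by move=> q hf; have [r [_ hr]] := (q 0).2 f hf; exists r. Qed.
Lemma scalar_inj X (r r' : R) : quasi_iso (chi X) -> eqv (r *: one X) (r' *: one X) -> r = r'.
Proof.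
move=> q h; apply/eqP; rewrite -subr_eq0; apply/eqP.
have hb : is_boundary (chi X 0 (r - r' : R^o)).
  have -> : chi X 0 (r - r' : R^o) = r *: one X - r' *: one X := scalerBl _ _ _.
  exact: h.
by have [y <-] := (q 0).1 (r - r' : R^o) erefl hb.
Qed.

(** Two bracketings of [f g f' g'] are compared; the inner products are scalars up to homotopy, and
    scalars are detected by the homothety of [Y]. *)
Lemma scalar_assoc X Y (f f' : hom_complex X Y 0) (g g' : hom_complex Y X 0) (a b c d : R) :
  quasi_iso (chi Y) -> is_cycle f -> is_cycle f' -> is_cycle g -> is_cycle g' ->
  eqv (comp f g) (a *: one Y) -> eqv (comp f' g') (b *: one Y) -> eqv (comp g f') (c *: one X) ->
  eqv (comp f g') (d *: one Y) -> a * b = c * d.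
Proof.
move=> q hf hf' hg hg' ea eb ec ed; apply: (scalar_inj q).
have scl (Z T : complex R) (x : R) (h : hom_complex Z T 0) : comp (x *: one T) h = x *: h.
  by rewrite compZl comp1.
apply: eqv_trans (_ : eqv _ (comp (comp f g) (comp f' g'))) _.
  apply: eqv_sym; apply: eqv_trans (eqv_comp (comp_cycle hf hg) _ ea eb) _; first by apply/cycleZ/one_cycle.
  by rewrite scl scalerA; apply: eqv_refl.
rewrite compA -(compA g f' g').
apply: eqv_trans (eqv_comp hf _ (eqv_refl f) (eqv_comp (comp_cycle hg hf') hg' ec (eqv_refl g'))) _.
  by apply: comp_cycle => //; apply/cycleZ/one_cycle.
rewrite scl -scalerA compZr; exact: eqv_scale.
Qed.

Lemma comp_sum X Y Z m n (f : 'I_m -> hom_complex Y Z 0) (g : 'I_n -> hom_complex X Y 0) (a : 'I_m -> R) (b : 'I_n -> R) :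
  comp (\sum_j a j *: f j) (\sum_i b i *: g i) = \sum_i \sum_j (b i * a j) *: comp (f j) (g i).
Proof.
rewrite comp_sumr; apply: eq_bigr => i _; rewrite compZr comp_suml scaler_sumr.
by apply: eq_bigr => j _; rewrite compZl scalerA.
Qed.
End Composition.

(** * Homomorphisms between base changes *)

Section PicardDescent.
Variables (R S : comPzRingType) (phi : {rmorphism R -> S}).
Hypotheses (hR : noetherian R) (hS : noetherian S) (hphi : finite_flat_dim phi)
  (hmax : forall m : R -> Prop, is_maximal m ->
     exists q : S -> Prop, is_prime q /\ (forall r, m r <-> q (phi r))).
Local Notation bc := (bc_complex phi).

Lemma bch_comp X Y Z (f : hom_complex Y Z 0) (g : hom_complex X Y 0) :
  bch_hom phi (comp f g) = comp (bch_hom phi f) (bch_hom phi g).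
Proof.
apply: bch_ext => i j x; rewrite bch_bt.
rewrite -[RHS]/(hom_fun (bch_hom phi f) i j (hom_fun (bch_hom phi g) i i (bt phi x 1))).
exact: esym (etrans (congr1 (hom_fun (bch_hom phi f) i j) (bch_bt phi g i x 1)) (bch_bt phi f j (hom_fun g i i x) 1)).
Qed.
Lemma bch_one X : bch_hom phi (one X) = one (bc X).
Proof.
apply: bch_ext => i j x; rewrite bch_bt /=.
have [e|ne] := eqVneq i j; last by rewrite !diag_fun_ne //; apply: tp0l.
by subst j; rewrite !diag_funE.
Qed.

(** Vanishing below degree 0 contracts [G] there, so [psi = 1 - h d] projects [G 0] onto its cycles.
    After base change [psi] still fixes the cycle that represents [F], so [F] becomes a combination
    of base changes of cycles of the form [psi g]. *)
Lemma hom_decomposition (P P' : complex R) a c b (F : hom_complex (bc P) (bc P') 0) :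
  finite_free_below P a -> finite_free_below P' c -> zero_above P' b -> zero_below (hom_complex P P') 0 ->
  is_cycle F -> exists n (s : 'I_n -> S) (al : 'I_n -> hom_complex P P' 0),
    (forall i, is_cycle (al i)) /\ eqv F (\sum_i s i *: (bch_hom phi (al i) : hom_complex (bc P) (bc P') 0)).
Proof.
move=> hP hP' zP' z0 hF; pose ga := res_map (hom_complex P P').
have sG := res_semiprojective (hom_complex P P'); have qg : quasi_iso ga by apply: res_map_quasi_iso.
have qk := kappa_quasi_iso hphi hP hP' zP' sG qg; set G := res _ in ga sG qg qk.
have [z [hz ez]] := (qk 0).2 F hF.
have zG : zero_below G 0 by move=> i i0; apply/(hiso_zero (qg i)); apply: z0.
have [h hh] := partial_contraction (chain_id G) sG zG.
have psl := linear_sub (idfun : {linear G 0 -> G 0}) (lin_of (linear_comp (h (0 - 1) 0) (diff G 0 (0 - 1)))).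
pose psi : {linear G 0 -> G 0} := lin_of psl.
have psi_cycle x : is_cycle (psi x).
  have := hh (0 - 1) erefl (diff G 0 (0 - 1) x); rewrite [diff _ _ (0 - 1 - 1) _]diff_diff linear0 addr0 => E.
  rewrite /is_cycle -[psi x]/(x - h (0 - 1) 0 (diff G 0 (0 - 1) x)) linearB.
  by apply/eqP; rewrite subr_eq0; apply/eqP.
have zpsi : z = bc_map phi psi z.
  have E : forall z, bc_map phi psi z = z - bc_map phi (h (0 - 1) 0) (diff (bc G) 0 (0 - 1) z).
    apply: (@bc_eq_lin _ _ _ _ _ (bc_map phi psi) (lin_of (linear_sub (idfun : {linear bc G 0 -> bc G 0})
      (lin_of (linear_comp (bc_map phi (h (0 - 1) 0)) (diff (bc G) 0 (0 - 1))))))) => x.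
    change (bc_map phi psi (bt phi x 1) = bt phi x 1 - bc_map phi (h (0 - 1) 0) (bc_map phi (diff G 0 (0 - 1)) (bt phi x 1))).
    rewrite !bc_mapE; exact: (linearB (bunit phi (G 0))).
  by rewrite E (hz : diff (bc G) 0 (0 - 1) z = 0) linear0 subr0.
suff D (x : bc G 0) : exists n (s : 'I_n -> S) (al : 'I_n -> hom_complex P P' 0), (forall i, is_cycle (al i)) /\
    kappa phi ga 0 (bc_map phi psi x) = \sum_i s i *: (bch_hom phi (al i) : hom_complex (bc P) (bc P') 0).
  by have [n [s [al [h1 h2]]]] := D z; exists n, s, al; split=> //; rewrite /eqv -h2 -zpsi.
elim/bc_ind: (x : base_change phi (G 0)) => [|u v [n [s [al [h1 h2]]]] [n' [s' [al' [h1' h2']]]]|g s].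
- by exists 0%N, (fun _ => 0), (fun _ => 0); split; [case|rewrite big_ord0 !linear0].
- pose mix (T : Type) (f : 'I_n -> T) (f' : 'I_n' -> T) (i : 'I_(n + n')) :=
    match split i with inl j => f j | inr j => f' j end.
  have ml T f f' j : mix T f f' (lshift n' j) = f j by rewrite /mix -[lshift _ _]/(unsplit (inl j)) unsplitK.
  have mr T f f' j : mix T f f' (rshift n j) = f' j by rewrite /mix -[rshift _ _]/(unsplit (inr j)) unsplitK.
  exists (n + n')%N, (mix _ s s'), (mix _ al al'); split.
    by move=> i; rewrite /mix; case: (split i).
  rewrite big_split_ord (linearD (bc_map phi psi)) (linearD (kappa phi ga 0)) h2 h2'.
  by congr (_ + _); apply: eq_bigr => i _; rewrite ?ml ?mr.
exists 1%N, (fun _ => s), (fun _ => ga 0 (psi g)); split; first by move=> _; apply: cmap_cycle.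
rewrite big_ord1 bc_mapE; exact: cext_bt.
Qed.

(** [Hom (P, P')] has the homology of [Hom (P, P)], which is that of the ring placed in degree 0. *)
Lemma hom_zero_below (P P' : complex S) (g : chain_map P' P) : semiprojective P ->
  quasi_iso g -> quasi_iso (chi P) -> zero_below (hom_complex P P') 0.
Proof.
move=> sP qg qc i i0; apply/(hiso_zero (semiproj_post sP qg i)); apply/(hiso_zero (qc i)).
by move=> x _; rewrite (stalk_nz (i := i) _ x); [apply: boundary0|lia].
Qed.

Hypothesis hpic : pic_injective phi.

Lemma quasi_iso_descent (P P' : complex R) a a' b b' (be : chain_map (bc P) (bc P')) :
  finite_free_below P a -> finite_free_below P' a' -> zero_above P b -> zero_above P' b' ->
  quasi_iso (chi P) -> quasi_iso (chi P') -> quasi_iso be -> exists f : chain_map P P', quasi_iso f.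
Proof.
move=> hP hP' zP zP' cP cP' qb.
have sP := finite_free_semiprojective hP; have sP' := finite_free_semiprojective hP'.
have sbP := bc_semiprojective phi sP; have sbP' := bc_semiprojective phi sP'.
have [g [gb bg]] := semiproj_quasi_heq sbP sbP' qb.
have qg : quasi_iso g by apply: heq_quasi_iso; exists be.
have cbP : quasi_iso (chi (bc P)) by apply/(chi_transfer hR hphi hmax hP zP).
have cbP' : quasi_iso (chi (bc P')) by apply/(chi_transfer hR hphi hmax hP' zP').
(* [hom_decomposition] requires vanishing in negative degrees over [R]; it holds over [S], where [g]
   and [be] are quasi-isomorphisms, and is brought down by [transfer_zero]. *)
have z1 : zero_below (hom_complex P P') 0.
  by apply/(transfer_zero hR hphi hmax hP hP' zP'); apply: hom_zero_below qg cbP.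
have z2 : zero_below (hom_complex P' P) 0.
  by apply/(transfer_zero hR hphi hmax hP' hP zP); apply: hom_zero_below qb cbP'.
have [m [s [al [cal eal]]]] := hom_decomposition hP hP' zP' z1 (cyc_cycle be).
have [n [t [al' [cal' eal']]]] := hom_decomposition hP' hP zP z2 (cyc_cycle g).
have [r hr] : exists r : 'I_n -> 'I_m -> R, forall j i, eqv (comp (al' j) (al i)) (r j i *: one P).
  have H j i := cid (scalar_ex cP (comp_cycle (cal' j) (cal i))).
  by exists (fun j i => projT1 (H j i)) => j i; apply: projT2 (H j i).
have [w hw] : exists w : 'I_m -> 'I_n -> R, forall i j, eqv (comp (al i) (al' j)) (w i j *: one P').
  have H i j := cid (scalar_ex cP' (comp_cycle (cal i) (cal' j))).
  by exists (fun i j => projT1 (H i j)) => i j; apply: projT2 (H i j).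
have bcc (X Y : complex R) (f : hom_complex X Y 0) : is_cycle f -> is_cycle (bch_hom phi f : hom_complex (bc X) (bc Y) 0).
  exact: (@cmap_cycle _ _ _ (bch phi X Y) 0 f).
have bce (X : complex R) (f : hom_complex X X 0) x : eqv f (x *: one X) ->
    eqv (bch_hom phi f : hom_complex (bc X) (bc X) 0) (phi x *: one (bc X)).
  move=> /(@cmap_boundary _ _ _ (bch phi X X) 0); rewrite linearB linearZ_LR /eqv -bch_one; exact.
have sumc (X Y : complex R) k (u : 'I_k -> S) (f : 'I_k -> hom_complex X Y 0) : (forall i, is_cycle (f i)) ->
    is_cycle (\sum_i u i *: (bch_hom phi (f i) : hom_complex (bc X) (bc Y) 0)).
  move=> hf; apply: (submod_sum (P := cycles (hom_complex (bc X) (bc Y)) 0)) => i _; apply: cycleZ; exact: bcc.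
have sr : \sum_i \sum_j s i * t j * phi (r j i) = 1.
  apply: (scalar_inj cbP); rewrite scale1r; apply: eqv_sym.
  apply: eqv_trans (_ : eqv _ (comp (cyc g) (cyc be))) _.
    by rewrite comp_cyc; apply/homotopicP/homotopic_sym.
  apply: eqv_trans (eqv_comp (cyc_cycle g) (sumc _ _ _ s al cal) eal' eal) _.
  rewrite comp_sum scaler_suml; apply: eqv_sum => i; rewrite scaler_suml; apply: eqv_sum => j.
  by rewrite -[(_ * phi _) *: _]scalerA; apply: eqv_scale; rewrite -bch_comp; apply: bce.
have sw : \sum_i \sum_j s i * t j * phi (w i j) = 1.
  apply: (scalar_inj cbP'); rewrite scale1r; apply: eqv_sym.
  apply: eqv_trans (_ : eqv _ (comp (cyc be) (cyc g))) _.
    by rewrite comp_cyc; apply/homotopicP/homotopic_sym.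
  apply: eqv_trans (eqv_comp (cyc_cycle be) (sumc _ _ _ t al' cal') eal eal') _.
  rewrite comp_sum exchange_big scaler_suml; apply: eqv_sum => i; rewrite scaler_suml; apply: eqv_sum => j.
  by rewrite -[(_ * phi _) *: _]scalerA [t _ * s _]mulrC; apply: eqv_scale; rewrite -bch_comp; apply: bce.
have wA i j k l : w i j * w k l = r j k * w i l.
  exact: (scalar_assoc cP' (cal i) (cal k) (cal' j) (cal' l) (hw i j) (hw k l) (hr j k) (hw i l)).
have rB j i l k : r j i * r l k = w i l * r j k.
  exact: (scalar_assoc cP (cal' j) (cal' l) (cal i) (cal k) (hr j i) (hr l k) (hw i l) (hr j k)).
have [x [y [e1 e2]]] := picard_descent hR hmax hpic wA rB sw sr.
have cA : is_cycle (\sum_i x i *: al i).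
  by apply: (submod_sum (P := cycles (hom_complex P P') 0)) => i _; apply: cycleZ.
have cB : is_cycle (\sum_j y j *: al' j).
  by apply: (submod_sum (P := cycles (hom_complex P' P) 0)) => i _; apply: cycleZ.
exists (of_cycle cA); apply: heq_quasi_iso; exists (of_cycle cB); split; apply/homotopicP.
  rewrite -comp_cyc !of_cycleK -/(one P) -/(eqv _ _) comp_sum -[one P]scale1r -e1 scaler_suml.
  apply: eqv_sum => i; rewrite scaler_suml; apply: eqv_sum => j; rewrite -[(_ * r _ _) *: _]scalerA; exact: eqv_scale.
rewrite -comp_cyc !of_cycleK -/(one P') -/(eqv _ _) comp_sum exchange_big -[one P']scale1r -e2 scaler_suml.
apply: eqv_sum => i; rewrite scaler_suml; apply: eqv_sum => j; rewrite -[(_ * w _ _) *: _]scalerA [y _ * x _]mulrC; exact: eqv_scale.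
Qed.
End PicardDescent.

Lemma disomorphicP (R : comPzRingType) (C C' P P' : complex R) (p : chain_map P C) (p' : chain_map P' C') :
  semiprojective P -> semiprojective P' -> quasi_iso p -> quasi_iso p' ->
  disomorphic C C' <-> exists f : chain_map P P', quasi_iso f.
Proof.
have lift (X Y : complex R) (u : chain_map X Y) : semiprojective X -> quasi_iso u ->
    exists v : chain_map X (res Y), quasi_iso v.
  move=> sX qu; have qY := res_map_quasi_iso Y; have [v hv] := semiproj_lift u sX qY; exists v.
  by apply: (quasi_iso_compr qY); apply: heqv_quasi_iso (heqv_sym (homotopic_heqv hv)) qu.
have inv (X Y : complex R) (u : chain_map X Y) : semiprojective X -> semiprojective Y -> quasi_iso u ->
    exists v : chain_map Y X, quasi_iso v.
  by move=> sX sY /(semiproj_quasi_heq sX sY) [v [h1 h2]]; exists v; apply: heq_quasi_iso; exists u.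
move=> sP sP' qp qp'; have [l ql] := lift _ _ p sP qp; have [l' ql'] := lift _ _ p' sP' qp'.
have [k qk] := inv _ _ l sP (res_semiprojective C) ql; have [k' qk'] := inv _ _ l' sP' (res_semiprojective C') ql'.
split=> [[u /dmor_isoE qu]|[f qf]].
  by exists (chain_comp k' (chain_comp u l)); do 2!apply: quasi_iso_comp => //.
by exists (chain_comp l' (chain_comp f k)); apply/dmor_isoE; do 2!apply: quasi_iso_comp => //.
Qed.

(** * Boundedness of the homology *)

Section KoszulHom.
Variable R : comPzRingType.
Implicit Types W V L T : complex R.

Definition kos_hom L V W (u : chain_map W (hom_complex L V)) z : chain_map (kos W z) (hom_complex L (kos V z)) :=
  chain_comp (@hcone R L V V (cscale V z) (cscale (hom_complex L V) z) (fun n u i j x => erefl)) (kosm u z).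
Fixpoint kosl_hom L V W (u : chain_map W (hom_complex L V)) zs : chain_map (kosl W zs) (hom_complex L (kosl V zs)) :=
  match zs with [::] => u | z :: zs' => kos_hom (kosl_hom u zs') z end.

Fact kos_in_diff W z i j (w : W i) :
  inr_lin (W (j - 1)) (W j) (diff W i j w) = diff (kos W z) i j (inr_lin (W (i - 1)) (W i) w).
Proof. by congr pair; rewrite /= ?linear0 ?oppr0 // diag_fun0 add0r. Qed.
Definition kos_in W z : chain_map W (kos W z) :=
  @ChainMap R W (kos W z) (fun i => inr_lin (W (i - 1)) (W i)) (@kos_in_diff W z).
Fixpoint kosl_in W zs : chain_map W (kosl W zs) :=
  match zs with [::] => chain_id W | z :: zs' => chain_comp (kos_in (kosl W zs') z) (kosl_in W zs') end.

Lemma kosl_hom_in L V W (u : chain_map W (hom_complex L V)) zs i w :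
  kosl_hom u zs i (kosl_in W zs i w) = post L (kosl_in V zs) i (u i w).
Proof.
elim: zs => [|z zs IH]; first by apply: hom_ext.
apply: hom_ext => j k l; congr pair; rewrite [LHS]/=.
  rewrite [kosl_hom u zs (i - 1) 0]linear0; exact: erefl.
by rewrite [LHS]/= IH.
Qed.

(** Projection to the last component is compatible with the differentials because [zs] kills [T];
    the instance that matters is [R // zs -> R / I]. *)
Lemma kosl_augmentation W T (e : chain_map W T) zs :
  (forall z, z \in zs -> forall i (t : T i), z *: t = 0) ->
  exists eps : chain_map (kosl W zs) T, forall i w, eps i (kosl_in W zs i w) = e i w.
Proof.
elim: zs => [|z zs IH] k; first by exists e.
have [|eps heps] := IH; first by move=> y ys; apply: k; rewrite inE ys orbT.
have ed i j (x : kos (kosl W zs) z i) : lin_of (linear_comp (eps j) (snd_lin _ (kosl W zs j))) (diff (kos (kosl W zs) z) i j x) =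
    diff T i j (lin_of (linear_comp (eps i) (snd_lin (kosl W zs (i - 1)) _)) x).
  rewrite /= linearD cmap_diff; suff -> : eps j (diag_fun (cscale (kosl W zs) z) j x.1) = 0 by rewrite add0r.
  have [E|ne] := eqVneq (i - 1) j; last by rewrite diag_fun_ne ?linear0.
  by subst j; rewrite diag_funE /= (linearZ_LR (eps _)) k // mem_head.
exists (ChainMap ed) => i w; exact: heps.
Qed.

Lemma kosl_finite_free W a zs : finite_free_below W a -> finite_free_below (kosl W zs) a.
Proof.
move=> hW; elim: zs => //= z zs [h1 h2]; split=> [i|i ia [x y]]; first exact: fgp_prod.
by congr pair; apply: h2; lia.
Qed.

Lemma kosl_top W b zs : (forall i, b < i -> forall x : W i, x = 0) ->
  forall i, b + (size zs)%:Z < i -> forall x : kosl W zs i, x = 0.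
Proof.
move=> hW; elim: zs => [|z zs IH] i /= ib; first by apply: hW; lia.
by move=> [x y]; congr pair; apply: IH; lia.
Qed.

Lemma tcl_cscale W N z i (x : tc W N i) : cscale (tc W N) z i x = tcl (cscale W z) N i x.
Proof.
move: x; apply: (tens_eq_lin (f := cscale (tc W N) z i) (g := tcl (cscale W z) N i)) => w n.
by rewrite tcl_tp [LHS]/= tpZl.
Qed.

Definition kos_tensor W N z : chain_map (kos (tc W N) z) (tc (kos W z) N) :=
  chain_comp (tcone (cscale W z) N) (@cone_map R _ _ _ _ (cscale (tc W N) z) (tcl (cscale W z) N)
    (chain_id _) (chain_id _) (@tcl_cscale W N z)).
Lemma kos_tensor_hiso W N z i : hiso (kos_tensor W N z) i.
Proof.
apply: hiso_comp; last exact: tcone_hiso.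
move: i; apply: bij_hiso => i; first by move=> [x y] [x' y'] [-> ->].
by move=> y; exists y; case: y.
Qed.

Lemma te_kos_hom L V W (u : chain_map W (hom_complex L V)) z N n x :
  te (kos_hom u z) N n (kos_tensor W N z n x) =
  post L (kos_tensor V N z) n (hcone (f := cscale (tc V N) z) (g := cscale (hom_complex L (tc V N)) z)
    (fun n u i j x => erefl) n (kosm (te u N) z n x)).
Proof.
case: x => x1 x2; apply: hom_ext => i j l.
pose ev (C : complex R) d k : {linear hom_complex L C d -> C k} := lin_of (fun r (f g : hom_complex L C d) =>
  erefl (hom_fun (r *: f + g) i k l)).
have E2 : hom_fun (te (kos_hom u z) N n (tml (inr_lin (W (n - 1)) (W n)) x2)) i j l =
    tml (inr_lin (V (j - 1)) (V j)) (hom_fun (te u N n x2) i j l).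
  move: x2; apply: (tens_eq_lin
    (f := lin_of (linear_comp (ev _ n j) (lin_of (linear_comp (te (kos_hom u z) N n) (tml (inr_lin (W (n - 1)) (W n)))))))
    (g := lin_of (linear_comp (tml (inr_lin (V (j - 1)) (V j))) (lin_of (linear_comp (ev _ n j) (te u N n)))))) => w p.
  change (hom_fun (ht L (kos V z) N n (tcl (kos_hom u z) N n (tml (inr_lin (W (n - 1)) (W n)) (tp w p)))) i j l =
    tml (inr_lin (V (j - 1)) (V j)) (hom_fun (ht L V N n (tcl u N n (tp w p))) i j l)).
  rewrite tml_tp !tcl_tp !ht_tp tml_tp; congr (tp _ p); congr pair.
  by rewrite /= [u (n - 1) 0]linear0.
have E1 : hom_fun (te (kos_hom u z) N n (tml (inl_lin (W (n - 1)) (W n)) x1)) i j l =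
    tml (inl_lin (V (j - 1)) (V j)) (hom_fun (te u N (n - 1) x1) i (j - 1) l).
  move: x1; apply: (tens_eq_lin
    (f := lin_of (linear_comp (ev _ n j) (lin_of (linear_comp (te (kos_hom u z) N n) (tml (inl_lin (W (n - 1)) (W n)))))))
    (g := lin_of (linear_comp (tml (inl_lin (V (j - 1)) (V j))) (lin_of (linear_comp (ev _ (n - 1) (j - 1)) (te u N (n - 1))))))) => w p.
  change (hom_fun (ht L (kos V z) N n (tcl (kos_hom u z) N n (tml (inl_lin (W (n - 1)) (W n)) (tp w p)))) i j l =
    tml (inl_lin (V (j - 1)) (V j)) (hom_fun (ht L V N (n - 1) (tcl u N (n - 1) (tp w p))) i (j - 1) l)).
  rewrite tml_tp !tcl_tp !ht_tp tml_tp; congr (tp _ p); congr pair.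
  by rewrite /= [u n 0]linear0.
have D : te (kos_hom u z) N n (kos_tensor W N z n (x1, x2)) =
    te (kos_hom u z) N n (tml (inr_lin (W (n - 1)) (W n)) x2) + te (kos_hom u z) N n (tml (inl_lin (W (n - 1)) (W n)) x1).
  exact: linearD.
by rewrite D homDE E1 E2.
Qed.

Lemma te_kos_quasi_iso L V W (u : chain_map W (hom_complex L V)) z N : semiprojective L ->
  quasi_iso (te u N) -> quasi_iso (te (kos_hom u z) N).
Proof.
move=> sL q.
have q1 : quasi_iso (kos_tensor W N z) by move=> i; apply: kos_tensor_hiso.
have q2 : quasi_iso (post L (kos_tensor V N z)) by apply: semiproj_post => // i; apply: kos_tensor_hiso.
have q3 : quasi_iso (kosm (te u N) z) by move=> i; apply: kosm_hiso; apply: q.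
have q4 : quasi_iso (@hcone R L _ _ (cscale (tc V N) z) (cscale (hom_complex L (tc V N)) z) (fun n u i j x => erefl)).
  by move=> i; apply: hcone_hiso.
apply: (quasi_iso_compl q1).
apply: quasi_iso_eq (quasi_iso_comp (quasi_iso_comp q3 q4) q2) => n x.
have E := te_kos_hom u x; exact (esym E).
Qed.
End KoszulHom.

Section KoszulTransfer.
Variables (R S : comPzRingType) (phi : {rmorphism R -> S}).
Hypotheses (hR : noetherian R) (hphi : finite_flat_dim phi)
  (hmax : forall m : R -> Prop, is_maximal m ->
     exists q : S -> Prop, is_prime q /\ (forall r, m r <-> q (phi r))).

(** This is the comparison of [R // zs] with [Hom (L, L // zs)]. Over [S] it is obtained from the
    homothety one Koszul step at a time; [zV] allows the descent to [R]. *)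
Lemma kosl_chi_quasi_iso (L : complex R) a b zs : finite_free_below L a -> quasi_iso (chi (bc_complex phi L)) ->
  zero_above (kosl L zs) b -> quasi_iso (kosl_hom (chi L) zs).
Proof.
move=> hL qS zV; have sL := finite_free_semiprojective hL.
have ff := stalk_finite_free R; have fk := kosl_finite_free zs ff.
apply/(transfer_quasi_iso hR hphi hmax hL (kosl_finite_free zs hL) zV _ (finite_free_semiprojective fk) (finite_free_fg hR fk)).
apply/kappa_te => //.
elim: (zs) => [|z zs' IH]; last exact: te_kos_quasi_iso.
apply/(kappa_te phi) => //; apply: quasi_iso_eq (fun i x => esym (@kappa_chi _ _ phi L i x)) _.
exact: quasi_iso_comp (stalk_bc_quasi_iso phi) qS.
Qed.

(** The Koszul complex of [R] on [zs] ends in degree [size zs]. The bound depends neither on [b] nor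
    on the elements of [zs], a uniformity that [critical_top] exploits. *)
Lemma hom_kosl_above (L : complex R) a b zs : finite_free_below L a -> quasi_iso (chi (bc_complex phi L)) ->
  zero_above (kosl L zs) b -> zero_above (hom_complex L (kosl L zs)) (size zs)%:Z.
Proof.
move=> hL qS zV i iz; apply/(hiso_zero (kosl_chi_quasi_iso hL qS zV i)) => x _.
rewrite (kosl_top (W := stalk R^o) (b := 0) (zs := zs) _ _ x); first exact: boundary0.
  by move=> j j0; apply: stalk_nz; lia.
by rewrite add0r.
Qed.

(** The class of [L -> L // zs] corresponds to [1] in [H_0 (R // zs)], so [g] dies there; the
    augmentation to [R / I] then gives the claim. *)
Lemma kosl_annihilator (L : complex R) a b zs (I : submod (R^o : lmodType R)) g :
  finite_free_below L a -> quasi_iso (chi (bc_complex phi L)) -> zero_above (kosl L zs) b ->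
  (forall z, z \in zs -> I z) -> is_boundary (g *: cyc (kosl_in L zs)) -> I (g : R^o).
Proof.
move=> hL qS zV zI hb; have q := kosl_chi_quasi_iso hL qS zV.
have ep : is_boundary (kosl_in (stalk R^o) zs 0 (g : R^o)).
  apply: (q 0).1; first exact: cmap_cycle.
  rewrite kosl_hom_in; suff -> : post L (kosl_in L zs) 0 (chi L 0 (g : R^o)) = g *: cyc (kosl_in L zs) by [].
  apply: hom0_ext => i l.
  change (kosl_in L zs i (g *: diag_fun (chain_id L) i l) = g *: diag_fun (kosl_in L zs) i l).
  by rewrite !diag_funE linearZ_LR.
pose T := stalk (quo I).
pose e : chain_map (stalk R^o) T := @stalk_map R R^o T (quo_pi I : {linear R^o -> T 0}) (fun _ => erefl).
have [|eps heps] := @kosl_augmentation _ _ T e zs.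
  move=> z /zI hz i t; have [ei|ne] := eqVneq i 0; last by rewrite (stalk_nz ne t) scaler0.
  subst i; have [r <-] := quo_pi_surj (t : quo I); rewrite -(linearZ_LR (quo_pi I)); apply/quo_piE.
  by rewrite -[z *: r]mulrC; apply: (submodZ (s := I)).
have [y hy] := cmap_boundary eps ep; rewrite heps in hy.
by apply/quo_piE; apply: esym hy.
Qed.
End KoszulTransfer.

(** * Koszul quotients by a maximal ideal *)

Section KoszulBound.
Variables (R S : comPzRingType) (phi : {rmorphism R -> S}).
Hypotheses (hR : noetherian R) (hphi : finite_flat_dim phi)
  (hmax : forall m : R -> Prop, is_maximal m ->
     exists q : S -> Prop, is_prime q /\ (forall r, m r <-> q (phi r))).
Local Notation Sm := (ringmod phi).
Local Notation bc := (bc_complex phi).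

Definition tower_state := {W : complex R | (exists a, finite_free_below W a) /\ exists b, zero_above (bc W) b}.

(** [f] resolves the homology of [W] above [b], where [W (x) S] has none. As [L] starts in degree
    [b + 1], the composite of [f] with [W -> W (x) S] is null-homotopic, and the residue functional
    makes [f] null modulo [m]. The cone of [f] has homology bounded above, which keeps [L (x) S]
    bounded above. *)
Lemma tower_step (m : R -> Prop) (st : tower_state) : is_maximal m ->
  exists (st' : tower_state) (f : chain_map (sval st') (sval st)),
    (exists b, forall i, b <= i -> hiso f i) /\ mnull m (fun _ => True) f.
Proof.
move=> hm; case: st => W [[a hW] [b zb]] /=; have [q [hq mq]] := hmax hm.
have fW := finite_free_fg hR hW; have [pW _] := finite_free_semiprojective hW.
have [L [f [hL hf]]] := free_approximation (b + 1) hR fW.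
have [pL _] := finite_free_semiprojective hL.
have zc : zero_above (cone f) (b + 2).
  by move=> i ib; apply/cone_zeroP; split; [apply: (hf (i - 1) _).1|apply: (hf i _).2]; lia.
have pc i : projective (cone f i) := prod_projective (pL (i - 1)) (pW i).
have [b' zb'] := base_change_bounded_above hphi pc zc.
have zL : zero_above (bc L) (Num.max b b').
  move=> i; rewrite gt_max => /andP [ib ib'] x hx.
  have : homology_zero (cone (tcl f Sm)) (i + 1) by apply/tcl_cone_zero; apply: zb'; lia.
  move=> /cone_zeroP [inj _].
  have H k : k = i -> hinj (tcl f Sm) k -> hinj (tcl f Sm) i by move=> ->.
  apply: (H _ (addrK 1 i) inj) => //; apply: (zb i ib); exact: (cmap_cycle (tcl f Sm) hx).
exists (exist _ L (conj (ex_intro _ _ hL) (ex_intro _ _ zL))), f; split; first by exists (b + 1).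
have bd : is_boundary (cyc (chain_comp (unit_map phi W) f)).
  apply: (bounded_below_boundary hL.2 pL _ (cyc_cycle _)) => k.
  have [kb|kb] := ltP k (b + 1); first by left; apply: hL.2.
  by right; apply: (zb (k + 0)); lia.
have [h hh] := (hom_boundaryP _).1 bd.
apply: (mnull_base_change hm hq mq (h := fun i j => hom_lin h i j)) => // i _ w.
by have := hh i i w; rewrite cycE /hsign expr0 scale1r.
Qed.

(** The tower starts at [L]. After passing to Koszul complexes, a finite composite of its maps is
    zero with coefficients [R] and, from some degree on, an isomorphism on homology. *)
Lemma kosl_bounded (L : complex R) a (m : R -> Prop) xs : finite_free_below L a ->
  (exists b, zero_above (bc L) b) -> is_maximal m -> (forall r, m r -> spanned (xs : seq R^o) r) ->
  exists b, zero_above (kosl L xs) b.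
Proof.
move=> hL zL hm gen.
pose st0 : tower_state := exist _ L (conj (ex_intro _ _ hL) zL).
pose nx st := projT1 (cid (tower_step st hm)).
pose fs st := projT1 (cid (projT2 (cid (tower_step st hm)))).
have hfs st : (exists b, forall i, b <= i -> hiso (fs st) i) /\ mnull m (fun _ => True) (fs st) :=
  projT2 (cid (projT2 (cid (tower_step st hm)))).
pose st k := iter k nx st0.
pose V k := kosl (sval (st k)) xs.
pose th k : chain_map (V k.+1) (V k) := koslm (fs (st k)) xs.
pose Q (A B : complex R) (f : chain_map A B) := exists b, forall i, b <= i -> hiso f i.
have hQ A B C (g : chain_map B C) (f : chain_map A B) : Q _ _ f -> Q _ _ g -> Q _ _ (chain_comp g f).
  move=> [b hb] [b' hb']; exists (Num.max b b') => i; rewrite ge_max => /andP [ib ib'].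
  by apply: hiso_comp; [apply: hb|apply: hb'].
have pV k i : projective (V k i).
  apply: kosl_projective => j; have [[c hc] _] := proj2_sig (st k); exact: (finite_free_semiprojective hc).1.
have kQ A B (f : chain_map A B) ys : Q _ _ f -> Q _ _ (koslm f ys).
  move=> hf; elim: ys => [//|x ys [b' IH]].
  by exists (b' + 1) => i ib; apply: kosm_hiso; apply: IH; lia.
have Qth k : Q _ _ (th k).
  by apply: kQ; case: (hfs (st k)).
have kth (N : lmodType R) : (forall x, x \in xs -> forall n : N, x *: n = 0) -> forall k i, True -> tzero (th k) N i.
  move=> kN k i _ z hz; have [_ mn] := hfs (st k).
  have mk : mnull m (fun _ => True) (th k) by apply: mnull_koslm.
  apply: (mnull_tc mk _ (i := i) I hz); exact: kill_gen gen kN.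
have [k [c [[b hb] hc]]] := tlemma hQ (fun _ _ => I) pV (fun k x => @kosl_null _ (sval (st k)) xs x) Qth kth.
exists b => i ib; apply: (tzero_homology (c := c)); last exact: hc.
by apply: hb; lia.
Qed.
End KoszulBound.

(** * Homology killed by elements outside a prime *)

Section LocalVanishing.
Variable R : comPzRingType.

Definition kills (L : complex R) g i := forall z : L i, is_cycle z -> is_boundary (g *: z).

(** Each further degree costs a factor [g]: the homotopy so far leaves a map [e] with values in
    cycles, and [g *: e] lifts along the differential. *)
Lemma power_contraction (L : complex R) a (k : nat) g : (forall i, projective (L i)) ->
  (forall i, i < a -> forall x : L i, x = 0) -> (forall i, i < a + k%:Z -> kills L g i) ->
  exists (N : nat) (s : forall i j, {linear L i -> L j}), forall i, i < a + k%:Z -> forall x : L i,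
    g ^+ N *: x = diff L (i + 1) i (s i (i + 1) x) + s (i - 1) i (diff L i (i - 1) x).
Proof.
move=> pL La; elim: k => [|k IH] hk.
  exists 0%N, (fun _ _ => \0) => i ia x; rewrite (La i _ x); last by lia.
  by rewrite !linear0 addr0.
have [|N [s hs]] := IH; first by move=> i ik; apply: hk; lia.
pose e i : {linear L i -> L i} := lin_of (linear_sub (scale_lin (L i) (g ^+ N)) (lin_of (linear_comp (s (i - 1) i) (diff L i (i - 1))))).
have ec i : i = a + k%:Z -> forall x, is_cycle (e i x).
  move=> ei x; rewrite /is_cycle -[e i x]/(g ^+ N *: x - s (i - 1) i (diff L i (i - 1) x)) linearB linearZ_LR.
  have -> : g ^+ N *: diff L i (i - 1) x = diff L (i - 1 + 1) (i - 1) (s (i - 1) (i - 1 + 1) (diff L i (i - 1) x)).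
    by rewrite hs ?diff_diff ?linear0 ?addr0 //; lia.
  have H p : p = i -> diff L p (i - 1) (s (i - 1) p (diff L i (i - 1) x)) - diff L i (i - 1) (s (i - 1) i (diff L i (i - 1) x)) = 0.
    by move=> ->; rewrite subrr.
  by apply: H; rewrite subrK.
have lft i : exists u : {linear L i -> L (i + 1)}, i = a + k%:Z -> forall x, diff L (i + 1) i (u x) = g *: e i x.
  have [ei|ne] := eqVneq i (a + k%:Z); last by exists \0 => E; rewrite E eqxx in ne.
  have [u hu] := @projective_lift _ _ _ _ (diff L (i + 1) i) (lin_of (linear_scalef g (e i))) (pL i)
    (fun x => hk i (ltac:(rewrite ei; lia)) _ (ec i ei x)).
  by exists u => _ x; apply: hu.
pose u i := projT1 (cid (lft i)); have hu i := projT2 (cid (lft i)) : i = a + k%:Z -> forall x, diff L (i + 1) i (u i x) = g *: e i x.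
exists N.+1, (fun i j => if i < a + k%:Z then lin_of (linear_scalef g (s i j)) else lin_of (linear_comp (diag_lin (chain_id L) (i + 1) j) (u i))).
move=> i ik x; have [ia|ia] := ltP i (a + k%:Z).
  have -> : i - 1 < a + k%:Z by lia.
  by rewrite /= exprS -scalerA (hs i ia x) linearZ_LR -scalerDr.
have ei : i = a + k%:Z by lia.
have -> : i - 1 < a + k%:Z by lia.
rewrite /= diag_funE /= (hu i ei x) exprS -scalerA -scalerDr; congr (_ *: _).
by rewrite -[e i x]/(g ^+ N *: x - s (i - 1) i (diff L i (i - 1) x)) subrK.
Qed.

(** Nonzero finitely generated modules over the localization at [q] have nonzero cyclic quotients,
    with denominators cleared. Generators are divided out one at a time until the next one would
    kill the quotient locally. *)
Lemma cyclic_step (M : lmodType R) (q : R -> Prop) (Z B : submod M) (s : seq M) : is_prime q ->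
  (forall g, g \in s -> Z g) -> (forall x, Z x -> exists b, B b /\ spanned s (x - b)) ->
  (forall g, ~ q g -> ~ forall x, Z x -> B (g *: x)) ->
  exists (N : submod M) u h, [/\ forall x, B x -> N x, Z u, ~ q h,
    forall x, Z x -> exists r, N (h *: x - r *: u) & forall r, N (r *: u) -> q r].
Proof.
move=> [_ q1 qP]; elim: s B => [|g s IH] B sZ gen nk.
  case: (nk 1 q1) => x /gen [b [hb /eqP]]; rewrite subr_eq0 => /eqP ->; exact: submodZ.
pose N1p x := exists r, B (x - r *: g).
have N0 : N1p 0 by exists 0; rewrite scale0r subr0; apply: submod0.
have ND x y : N1p x -> N1p y -> N1p (x + y).
  move=> [r hr] [r' hr']; exists (r + r'); rewrite (_ : _ - _ = (x - r *: g) + (y - r' *: g)); first exact: submodD.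
  by rewrite scalerDl; zmod.
have NZ c x : N1p x -> N1p (c *: x).
  by move=> [r hr]; exists (c * r); rewrite -scalerA -scalerBr; apply: submodZ.
pose N1 := Submod N0 ND NZ.
have BN x : B x -> N1 x by move=> hx; exists 0; rewrite scale0r subr0.
case: (pselect (exists h, ~ q h /\ forall x, Z x -> N1 (h *: x))) => [[h [qh hN]]|no].
  exists B, g, h; split=> //; first by apply: sZ; rewrite mem_head.
  move=> r hr; apply: contrapT => nr; apply: (nk (r * h)); first by move=> /qP [].
  move=> x /hN [r' hr']; rewrite -scalerA -(subrK (r' *: g) (h *: x)) scalerDr.
  by apply: submodD; [apply: submodZ|rewrite scalerA mulrC -scalerA; apply: submodZ].
have [||h qh hN|N [u [h [NB Zu qh hx hr]]]] := IH N1.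
- by move=> x xs; apply: sZ; rewrite inE xs orbT.
- move=> x /gen [b [hb [r hr]]]; exists (b + r *: g); split.
    by apply: (ND); [apply: BN|exists r; rewrite subrr; apply: submod0].
  by move: hr; congr (spanned s); zmod.
- by apply: no; exists h.
by exists N, u, h; split=> // x /BN /NB.
Qed.

Lemma top_degree (V : complex R) i b : ~ homology_zero V i -> zero_above V b ->
  exists s, [/\ i <= s, ~ homology_zero V s & zero_above V s].
Proof.
move=> ni zb; have [k] : exists k : nat, b <= i + k%:Z by exists (absz (b - i)); lia.
elim: k i ni => [|k IH] i ni bk; first by exists i; split=> // j ij; apply: zb; lia.
case: (pselect (exists j, i < j /\ ~ homology_zero V j)) => [[j [ij nj]]|no].
  by have [|s [js ns zs]] := IH j nj; [lia|exists s; split=> //; lia].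
by exists i; split=> // j ij; apply: contrapT => nj; apply: no; exists j.
Qed.

Lemma bottom_degree (P : int -> Prop) a l : P l -> (forall i, i < a -> ~ P i) ->
  exists l', [/\ l' <= l, P l' & forall i, i < l' -> ~ P i].
Proof.
move=> pl ha; have [k] : exists k : nat, l <= a + k%:Z by exists (absz (l - a)); lia.
elim: k l pl => [|k IH] l pl lk; first by exists l; split=> // i il; apply: ha; lia.
case: (pselect (exists j, j < l /\ P j)) => [[j [jl pj]]|no].
  by have [|s [js ps zs]] := IH j pj; [lia|exists s; split=> //; lia].
by exists l; split=> // j jl pj; apply: no; exists j.
Qed.

Lemma kills_range (L : complex R) (q : R -> Prop) a (k : nat) : is_prime q ->
  (forall i, i < a -> forall x : L i, x = 0) -> (forall i, i < a + k%:Z -> exists g, ~ q g /\ kills L g i) ->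
  exists g, ~ q g /\ forall i, i < a + k%:Z -> kills L g i.
Proof.
move=> [_ q1 qP] La; elim: k => [|k IH] h.
  by exists 1; split=> // i ia z _; rewrite (La i _ z) ?scaler0; [apply: boundary0|lia].
have [|g [qg hg]] := IH; first by move=> i ik; apply: h; lia.
have [|g' [qg' hg']] := h (a + k%:Z); first by lia.
exists (g * g'); split; first by move=> /qP [].
move=> i ik z hz; have [ia|ia] := ltP i (a + k%:Z).
  by rewrite mulrC -scalerA; apply/boundaryZ/hg.
have ei : i = a + k%:Z by lia.
by subst i; rewrite -scalerA; apply/boundaryZ/hg'.
Qed.
End LocalVanishing.

(** * The critical prime and the upper bound on homology *)

Section Boundedness.
Variables (R S : comPzRingType) (phi : {rmorphism R -> S}).
Hypotheses (hR : noetherian R) (hphi : finite_flat_dim phi)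
  (hmax : forall m : R -> Prop, is_maximal m ->
     exists q : S -> Prop, is_prime q /\ (forall r, m r <-> q (phi r))).
Variables (L : complex R) (a : int).
Hypotheses (hL : finite_free_below L a) (qS : quasi_iso (chi (bc_complex phi L)))
  (zL : exists b, zero_above (bc_complex phi L) b).

Let bounded xs := exists b, zero_above (kosl L xs) b.

Section CriticalPrime.
Variables (p : R -> Prop) (xs : seq R).
Hypotheses (pI : is_ideal p) (xp : forall x, x \in xs -> p x) (gp : forall r, p r -> spanned (xs : seq R^o) r)
  (nb : ~ bounded xs) (hy : forall y, ~ p y -> bounded (y :: xs)).
Let Y := kosl L xs.

Lemma kosl_kills zs (q : R -> Prop) r i (z : kosl L zs i) : (forall r, q r -> spanned (zs : seq R^o) r) ->
  q r -> is_cycle z -> is_boundary (r *: z).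
Proof.
move=> gq qr hz.
pose An : submod (R^o : lmodType R) := @Submod R R^o (fun r : R^o => is_boundary ((r : R) *: z))
  (eq_ind_r _ (boundary0 _ _) (scale0r z))
  (fun x y hx hy' => eq_ind_r _ (boundaryD hx hy') (scalerDl z x y))
  (fun c x hx => eq_ind _ _ (boundaryZ c hx) _ (scalerA c x z)).
apply: (@spanned_sub _ _ _ An r _ (gq r qr)) => x xz.
by apply: (cnull_boundary0 (kosl_null L xz)).
Qed.

Lemma critical_not_one : ~ p 1.
Proof.
move=> p1; apply: nb; exists 0 => i _ z hz.
by rewrite -[z]scale1r; apply: (kosl_kills gp p1 hz).
Qed.

Lemma kos_bounded_iso y c i : zero_above (kos Y y) c -> c < i -> hiso (cscale Y y) i.
Proof.
move=> zc ci; have /cone_zeroP [_ s] := zc i ci.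
have /cone_zeroP [j _] : homology_zero (kos Y y) (i + 1) by apply: zc; lia.
split=> //; have H k : k = i -> hinj (cscale Y y) k -> hinj (cscale Y y) i by move=> ->.
exact: H (addrK 1 i) j.
Qed.

(** Elements outside [p] act bijectively on the high homology of [Y], whereas elements of [p] act by
    zero. *)
Lemma critical_prime : is_prime p.
Proof.
split; [exact: pI|exact: critical_not_one|move=> x y pxy].
apply: contrapT => /not_orP [/hy [b hb] /hy [b' hb']]; apply: nb; exists (Num.max b b') => i.
rewrite gt_max => /andP [ib ib'] z hz.
have [ix _] := kos_bounded_iso hb ib; have [iy _] := kos_bounded_iso hb' ib'.
apply: iy => //; apply: ix; first exact: cycleZ.
by rewrite /= scalerA; apply: (kosl_kills gp pxy hz).
Qed.

Lemma critical_not_maximal : ~ is_maximal p.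
Proof. by move=> hm; apply: nb; apply: (kosl_bounded hR hphi hmax hL zL hm gp). Qed.

Lemma critical_extension : exists m y, [/\ is_maximal m, forall x, p x -> m x, m y & ~ p y].
Proof.
have [m [hm pm]] := maximal_exists hR pI critical_not_one; exists m.
apply: contrapT => no; apply: critical_not_maximal.
suff -> : p = m by [].
apply/funext => x; apply/propext; split; first exact: pm.
by move=> mx; apply: contrapT => nx; apply: no; exists x.
Qed.

(** The same bound [c] serves all powers of [y], as [critical_support] requires. *)
Lemma power_bounded y c t : zero_above (kos Y y) c -> zero_above (kos Y (y ^+ t)) c.
Proof.
move=> zc i ci; apply/cone_zeroP; have /cone_zeroP [I J] := zc i ci.
elim: t => [|t [IH1 IH2]].
  by split=> x hx; rewrite /= expr0 ?scale1r //; exists x; rewrite scale1r subrr; split=> //; apply: boundary0.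
split=> x hx.
  move=> hb; apply: I => //; apply: IH1; first exact: cycleZ.
  by rewrite /= scalerA -exprSr.
have [x1 [hx1 e1]] := J x hx; have [x2 [hx2 e2]] := IH2 x1 hx1; exists x2; split=> //.
rewrite /= exprS -scalerA.
have -> : x - y *: (y ^+ t *: x2) = (x - y *: x1) + y *: (x1 - y ^+ t *: x2).
  by rewrite scalerBr; zmod.
by apply: boundaryD => //; apply: boundaryZ.
Qed.

(** Otherwise one [g] outside [p] kills the homology of [L] up to the common bound [c] of the
    complexes [L // (y^t, xs)]. A power [g^N] is null-homotopic in these degrees, so it kills the
    class of [L -> L // (y^t, xs)] and lies in [p + (y^t)] for every [t]. Krull's intersection
    argument, with [y] in a maximal ideal over [p], puts [g^N] into [p]. *)
Lemma critical_support : exists l, forall g, ~ p g -> ~ kills L g l.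
Proof.
have [m [y [[mI m1 _] pm my py]]] := critical_extension; have pp := critical_prime; have [_ p1 pP] := pp.
apply: contrapT => no.
have kl i : exists g, ~ p g /\ kills L g i.
  by apply: contrapT => ni; apply: no; exists i => g pg kg; apply: ni; exists g.
have [c zc] := hy py; pose k := absz (c - a + 1).
have [g [pg hg]] := @kills_range R L p a k pp hL.2 (fun i _ => kl i).
have [pL _] := finite_free_semiprojective hL; have [N [s hs]] := power_contraction pL hL.2 hg.
have pgN : ~ p (g ^+ N) by elim: (N) => [|n IH]; [rewrite expr0|rewrite exprS => /pP []].
pose J t : submod (R^o : lmodType R) := Submod (spanned0 ((y ^+ t :: xs) : seq R^o)) (@spannedD _ _ _) (@spannedZ _ _ _).
have JN t : J t (g ^+ N : R^o).
  have zV : zero_above (kosl L (y ^+ t :: xs)) c by apply: power_bounded.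
  apply: (kosl_annihilator hR hphi hmax hL qS zV (I := J t)); first by move=> z hz; apply: spanned_mem.
  set V := kosl L _ in zV *; set in' := kosl_in L _.
  have sL := finite_free_semiprojective hL.
  have q : quasi_iso (post L (btrunc_map V c)) by apply: semiproj_post => //; apply: btrunc_quasi_iso.
  apply: (q 0).1; first exact: cycleZ (cyc_cycle in').
  apply/hom_boundaryP.
  (* The partial contraction [s] reaches degree [c], and above it the truncated target is zero. *)
  pose hf i j (x : L i) : btrunc V c j := if j == i + (0 + 1) then btrunc_map V c j (in' j (s i j x)) else 0.
  have hl i j : linear (@hf i j).
    move=> r x x'; rewrite /hf; case: ifP => _; last by rewrite scaler0 addr0.
    by rewrite (linearP (s i j)) (linearP (in' j)) (linearP (btrunc_map V c j)).
  have hsh i j x : j != i + (0 + 1) -> @hf i j x = 0 by rewrite /hf => /negPf ->.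
  exists (HomDeg hl hsh) => i j x; rewrite /hsign expr0 scale1r.
  have [E|ne] := eqVneq i j; last first.
    have ne' : j != i + 0 by rewrite addr0 eq_sym.
    rewrite [LHS](hom_shape _ x ne') !hom_shape ?linear0 ?addr0 //; rewrite add0r.
      by rewrite subrK eq_sym.
    by rewrite (inj_eq (addIr 1)) eq_sym.
  subst j; have [ic|ic] := ltP c i; first by rewrite [LHS](btrunc_above _ ic) [RHS](btrunc_above _ ic).
  have E1 : hf i (i + 1) x = btrunc_map V c (i + 1) (in' (i + 1) (s i (i + 1) x)) by rewrite /hf add0r eqxx.
  have E2 z : hf (i - 1) i z = btrunc_map V c i (in' i (s (i - 1) i z)) by rewrite /hf add0r subrK eqxx.
  change (btrunc_map V c i (g ^+ N *: diag_fun in' i x) =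
    diff (btrunc V c) (i + 1) i (hf i (i + 1) x) + hf (i - 1) i (diff L i (i - 1) x)).
  rewrite E1 E2 diag_funE.
  rewrite -(cmap_diff (btrunc_map V c)) -(cmap_diff in') -(linearD (btrunc_map V c i)) -(linearD (in' i)).
  rewrite -hs; last by rewrite /k; lia.
  by rewrite (linearZ_LR (in' i)).
have pD := let: And3 _ D _ := pI in D; have pM := let: And3 _ _ M := pI in M.
have pX r : spanned (xs : seq R^o) r -> p r.
  have p0 := let: And3 z _ _ := pI in z.
  pose Pm : submod (R^o : lmodType R) := @Submod R R^o p p0 pD pM.
  exact: (@spanned_sub _ _ _ Pm).
have dec t : exists w : R, p (g ^+ N - y ^+ t * w).
  have [w hw] := JN t; exists w; rewrite mulrC; exact: pX.
have [w hw] := choice dec.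
have ypow t : ~ p (y ^+ t) by elim: (t) => [|n IH]; [rewrite expr0|rewrite exprS => /pP []].
have wS t : p (w t - y * w t.+1).
  have h : p (y ^+ t * (w t - y * w t.+1)).
    have -> : y ^+ t * (w t - y * w t.+1) = (g ^+ N - y ^+ t.+1 * w t.+1) + (-1) * (g ^+ N - y ^+ t * w t).
      by rewrite exprSr; ring.
    by apply: (pD) => //; apply: (pM).
  by case: (pP _ _ h) => // /ypow.
(* The ideals [p + (w t)] increase. Once they stop, [w t.+1] agrees with [d * y * w t.+1] modulo
   [p], and [1 - d * y] is outside [m], hence outside [p]. *)
pose I' t r := exists d, p (r - d * w t).
have [||t ht] := @noetherian_acc R hR I'.
- move=> t; split; first by exists 0; rewrite mul0r subr0; case: pI.
    move=> r r' [d hd] [d' hd']; exists (d + d'); rewrite (_ : _ - _ = (r - d * w t) + (r' - d' * w t)); first exact: pD.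
    by ring.
  by move=> b r [d hd]; exists (b * d); rewrite (_ : _ - _ = b * (r - d * w t)); [apply: (pM)|ring].
- move=> t r [d hd]; exists (d * y); rewrite (_ : _ - _ = (r - d * w t) + d * (w t - y * w t.+1)); last by ring.
  by apply: (pD) => //; apply: (pM).
have [d hd] : I' t (w t.+1) by apply: (ht t.+1); exists 1; rewrite mul1r subrr; case: pI.
have : p ((1 - d * y) * w t.+1).
  rewrite (_ : (1 - d * y) * w t.+1 = (w t.+1 - d * w t) + d * (w t - y * w t.+1)); last by ring.
  by apply: (pD) => //; apply: (pM).
case/pP => [h|h].
  have [_ mD mM] := mI; apply: m1; rewrite (_ : 1 = (1 - d * y) + d * y); last by ring.
  by apply: (mD); [apply: pm|apply: mM].
apply: pgN; rewrite (_ : g ^+ N = (g ^+ N - y ^+ t.+1 * w t.+1) + y ^+ t.+1 * w t.+1); last by ring.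
by apply: (pD) => //; apply: (pM).
Qed.

Lemma btrunc_map_zero (V : complex R) s (w : V s) : btrunc_map V s s w = 0 <-> is_boundary w.
Proof.
split=> [/quo_piE [->|[h|[_ h]]] //|h]; first exact: boundary0.
  by rewrite ltxx in h.
by apply/quo_piE; right; right.
Qed.

(** Locally at an associated prime [q] of [H_s V], the complex [L] begins in some degree [l' <= l]
    and the homology of [V] ends in degree [s]. A nonzero map [H_l' L -> H_s V] therefore gives a
    nonzero class of degree [s - l'] in [Hom (L, V)], and by [hom_kosl_above] this degree is at most
    the length of [y :: xs]. The proof carries this out with denominators cleared. *)
Lemma critical_top y l s : (forall g, ~ p g -> ~ kills L g l) -> ~ p y ->
  ~ homology_zero (kosl L (y :: xs)) s -> zero_above (kosl L (y :: xs)) s -> s <= (size xs).+1%:Z + l.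
Proof.
move=> hl py; set V := kosl L (y :: xs) => ns zs.
pose An (t : V s) (r : R) := is_boundary (r *: t).
have AnI t : is_ideal (An t).
  split; first by rewrite /An scale0r; apply: boundary0.
    by move=> r r' hr hr'; rewrite /An scalerDl; apply: boundaryD.
  by move=> b r hr; rewrite /An -scalerA; apply: boundaryZ.
have [t0 [ct0 nt0]] : exists t : V s, is_cycle t /\ ~ is_boundary t.
  by apply: contrapT => no; apply: ns => z hz; apply: contrapT => nz; apply: no; exists z.
(* A maximal annihilator of a nonzero homology class is prime. *)
have [q [[t [ct nt eq]] qmax]] := @noetherian_max R hR (fun I => exists t : V s, [/\ is_cycle t, ~ is_boundary t & I = An t])
  (An t0) (ex_intro _ t0 (And3 ct0 nt0 erefl)) (fun I h => let: ex_intro t (And3 _ _ e) := h in eq_ind_r (@is_ideal R) (AnI t) e).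
have qE r : q r <-> is_boundary (r *: t) by rewrite eq.
have qq : is_prime q.
  split; [by rewrite eq|by move=> /qE; rewrite scale1r|move=> r1 r2 h].
  case: (pselect (q r2)) => [|n2]; [by right|left].
  apply: (qmax (An (r2 *: t))); first by exists (r2 *: t); split=> //; [apply: cycleZ|move=> /qE].
    by move=> x /qE hx; rewrite /An scalerA mulrC -scalerA; apply: boundaryZ.
  by rewrite /An scalerA; apply/qE.
have [[q0 qD qM] q1 qP] := qq.
have pq r : p r -> q r.
  move=> pr; apply/qE; apply: (kosl_kills (q := p) _ pr ct) => x /gp hx; exists 0.
  by rewrite scale0r subr0.
(* The lowest degree in which the homology of [L] survives localization at [q]. It is at most [l]
   because [q] contains [p]. *)
have [l' [ll hl' hlow]] : exists l', [/\ l' <= l, forall g, ~ q g -> ~ kills L g l' &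
    forall i, i < l' -> ~ forall g, ~ q g -> ~ kills L g i].
  apply: (@bottom_degree (fun i => forall g, ~ q g -> ~ kills L g i) a l).
    by move=> g qg; apply: hl => /pq.
  by move=> i ia h; apply: (h 1 q1) => z _; rewrite (hL.2 i ia z) scaler0; apply: boundary0.
have la : a <= l'.
  rewrite leNgt; apply/negP => la; apply: (hl' 1 q1) => z _; rewrite (hL.2 _ la z) scaler0; exact: boundary0.
have [pL _] := finite_free_semiprojective hL; have sL := finite_free_semiprojective hL.
have ek : a + (absz (l' - a))%:Z = l' by lia.
have [|g0 [qg0 hg0]] := @kills_range R L q a (absz (l' - a)) qq hL.2.
  move=> i; rewrite ek => il; apply: contrapT => no; apply: (hlow i il) => g qg kg; apply: no; by exists g.
have [M [sg hsg]] := power_contraction pL hL.2 hg0; rewrite ek in hsg.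
pose g := g0 ^+ M.
have qg : ~ q g by rewrite /g; elim: (M) => [|n IH]; [rewrite expr0|rewrite exprS => /qP []].
have [sgen [sZ gen]] := (homology_fgP L l').1 (finite_free_fg hR hL l').
have [N [u [h [NB Zu qh hx hr]]]] := @cyclic_step R (L l') q (cycles L l') (boundaries L l') sgen qq sZ gen
  (fun g qg k => hl' g qg k).
pose Zl : lmodType R := sub_of (cycles L l').
(* Modulo [N], [h *: x] is a multiple of [u]. The coefficient is unique up to [q], which kills the
   class of [t], so sending [x] to the same multiple of that class is linear. *)
pose rr (x : Zl) := projT1 (cid (hx (sub_val x) (sub_valP x))).
have hrr (x : Zl) : N (h *: sub_val x - rr x *: u) := projT2 (cid (hx (sub_val x) (sub_valP x))).
pose V' := btrunc V s; pose pi := btrunc_map V s s.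
have pi0 r : q r -> pi (r *: t) = 0 by move=> /qE hb; apply/btrunc_map_zero.
have fl : linear (fun x : Zl => pi (rr x *: t)).
  move=> c x x'; apply/eqP; rewrite -subr_eq0; apply/eqP.
  have E : pi (rr (c *: x + x') *: t) - (c *: pi (rr x *: t) + pi (rr x' *: t)) = pi ((rr (c *: x + x') - (c * rr x + rr x')) *: t).
    rewrite scalerBl scalerDl -scalerA.
    exact: esym (etrans (linearB pi _ _) (congr1 _ (congr1 _ (etrans (linearD pi _ _) (congr1 (+%R^~ _) (linearZ_LR pi _ _)))))).
  rewrite E; apply: pi0; apply: hr.
  have := submodB (hrr (c *: x + x')) (submodD (submodZ c (hrr x)) (hrr x')) => H.
  have := submodN H; congr (in_submod N).
  have -> : sub_val (c *: x + x') = c *: sub_val x + sub_val x' by [].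
  by rewrite scalerBl !scalerDl !scalerBr !scalerDr -!scalerA [h *: (c *: _)]scalerA [h * c]mulrC -scalerA; zmod.
pose f : {linear Zl -> V' s} := lin_of fl.
have fN (x : Zl) : N (sub_val x) -> f x = 0.
  move=> nx; apply: pi0; apply: hr; have := submodB (submodZ h nx) (hrr x); congr (in_submod N); zmod.
(* Multiplication by [g] is contracted by [sg] below [l']; hence [e = g - sg d] maps degree [l']
   into cycles and equals [g] on cycles. *)
pose e : {linear L l' -> L l'} := lin_of (linear_sub (scale_lin (L l') g) (lin_of (linear_comp (sg (l' - 1) l') (diff L l' (l' - 1))))).
have ec x : cycles L l' (e x).
  rewrite /= /is_cycle linearB linearZ_LR.
  have -> : g *: diff L l' (l' - 1) x = diff L (l' - 1 + 1) (l' - 1) (sg (l' - 1) (l' - 1 + 1) (diff L l' (l' - 1) x)).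
    by rewrite hsg ?diff_diff ?linear0 ?addr0 //; lia.
  have H k : k = l' -> diff L k (l' - 1) (sg (l' - 1) k (diff L l' (l' - 1) x)) - diff L l' (l' - 1) (sg (l' - 1) l' (diff L l' (l' - 1) x)) = 0.
    by move=> ->; rewrite subrr.
  by apply: H; rewrite subrK.
pose F : {linear L l' -> V' s} := lin_of (linear_comp f (sub_lift (P := cycles L l') (f := e) ec)).
have eE x : is_cycle x -> e x = g *: x.
  by move=> hc; rewrite -[e x]/(g *: x - sg (l' - 1) l' (diff L l' (l' - 1) x)) (hc : diff L l' (l' - 1) x = 0) linear0 subr0.
rewrite leNgt; apply/negP => big.
(* [F] placed in degree [l']. The result is a cycle, since [F] has values in cycles and vanishes on
   boundaries. *)
pose Pf i j (x : L i) : V' j := diag_fun (chain_id V') j (F (diag_fun (chain_id L) l' x)).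
have Pl i j : linear (@Pf i j).
  exact: (linear_comp (diag_lin (chain_id V') s j) (lin_of (linear_comp F (diag_lin (chain_id L) i l')))).
have Ps i j x : j != i + (s - l') -> @Pf i j x = 0.
  move=> ne; rewrite /Pf; have [ei|ni] := eqVneq i l'; last by rewrite (@diag_fun_ne _ _ _ _ i) // linear0 diag_fun0.
  by rewrite (@diag_fun_ne _ _ _ _ s) //; apply: contraNneq ne => <-; rewrite ei; apply/eqP; ring.
pose P : hom_complex L V' (s - l') := HomDeg Pl Ps.
have cP : is_cycle P.
  apply/hom_cycleP => i j x.
  change (diff V' (j + 1) j (Pf i (j + 1) x) = hsign R (s - l') *: Pf (i - 1) j (diff L i (i - 1) x)).
  have -> : diff V' (j + 1) j (Pf i (j + 1) x) = 0.
    have dF x' k : diff V' s k (F x') = 0.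
      have [w hw] : exists w : Zl, F x' = pi (rr w *: t) by exists (sub_lift (P := cycles L l') (f := e) ec x').
      rewrite hw -(cmap_diff (btrunc_map V s)) linearZ_LR (cycle_diff k ct) scaler0; exact: linear0.
    rewrite /Pf; have [e1|n1] := eqVneq s (j + 1); last by rewrite diag_fun_ne ?linear0.
    move: (F _) (dF (diag_fun (chain_id L) l' x) j) => v; rewrite -e1 diag_funE; exact.
  have -> : Pf (i - 1) j (diff L i (i - 1) x) = 0; last by rewrite scaler0.
  rewrite /Pf; have [e1|n1] := eqVneq (i - 1) l'; last by rewrite (@diag_fun_ne _ _ _ _ (i - 1)) // linear0 diag_fun0.
  have -> : F (diag_fun (chain_id L) l' (diff L i (i - 1) x)) = 0; last exact: diag_fun0.
  subst l'; rewrite diag_funE; apply: fN; apply: NB.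
  have hB : is_boundary (g *: diff L i (i - 1) x) by apply: boundaryZ; apply: boundary_diff.
  by rewrite -eE in hB; [exact: hB|apply: diff_diff].
have qp : quasi_iso (post L (btrunc_map V s)) by apply: semiproj_post => //; apply: btrunc_quasi_iso.
have zH := hom_kosl_above hR hphi hmax hL qS zs.
have /hom_boundaryP [H hH] : is_boundary P.
  by apply: ((hiso_zero (qp (s - l'))).1 _ P cP); apply: zH; rewrite /=; lia.
(* Both terms of the null-homotopy vanish at the cycle [u], so [F u = 0]. Then the coefficient of
   [g *: u] lies in [q], and with it [h * g], although neither factor does. *)
have Hz : H l' (s + 1) u = 0 by apply: (@btrunc_above _ V s); lia.
have E1 : hom_fun P l' s u = F u by rewrite /= /Pf !diag_funE.
have Fu : F u = 0.
  apply: etrans (esym E1) _; apply: etrans (hH l' s u) _.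
  rewrite Hz (Zu : diff L l' (l' - 1) u = 0) hom_lin0 scaler0 addr0; exact: linear0.
have [w hw] : exists w : Zl, sub_val w = g *: u /\ F u = f w.
  by exists (sub_lift (P := cycles L l') (f := e) ec u); split=> //; apply: (eE u Zu).
have /btrunc_map_zero/qE qw : pi (rr w *: t) = 0 by rewrite -Fu hw.2.
have qhg : q (h * g - rr w).
  by apply: hr; have := hrr w; rewrite hw.1 scalerA scalerBl.
have := qD _ _ qhg qw; rewrite subrK => /qP [] //.
Qed.

(** The bound [c] is uniform in the element outside [p]. So the element [1 - d] that Nakayama
    produces from [y], unknown beforehand, is injective on homology in the very degrees where it
    acts by zero. *)
Lemma critical_contradiction : False.
Proof.
have [l hl] := critical_support; have [m [y [hm pm my py]]] := critical_extension.
pose c := (size xs).+1%:Z + l.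
have bnd z : ~ p z -> zero_above (kos Y z) c.
  move=> pz i ci; apply: contrapT => ni; have [b hb] := hy pz.
  have [s [is' ns zs]] := top_degree ni hb; have := critical_top hl pz ns zs.
  by rewrite -/c; lia.
apply: nb; exists c => i ci z hz.
have fY := kosl_fg hR xs (finite_free_fg hR hL).
have [mI m1 _] := hm; have [m0 mD mM] := mI.
have [|d [md hd]] := nakayama mI (Z := cycles Y i) (B := boundaries Y i) ((homology_fgP Y i).1 (fY i)).
  move=> x hx; have [x' [hx' e]] := (kos_bounded_iso (bnd y py) ci).2 x hx.
  exists [:: x']; split; first by move=> v; rewrite inE => /eqP ->.
  exists (x - y *: x'); split=> //; exists y; split=> //.
  by rewrite /= subKr subrr.
have pd : ~ p (1 - d).
  by move=> /pm h; apply: m1; rewrite -(subrK d 1); apply: (mD).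
exact: (kos_bounded_iso (bnd _ pd) ci).1 z hz (hd z hz).
Qed.
End CriticalPrime.

Theorem bounded_above : exists b, zero_above L b.
Proof.
apply: contrapT => no.
pose Fm (I : R -> Prop) := is_ideal I /\ exists xs : seq R, [/\ forall x, x \in xs -> I x,
  forall r, I r -> spanned (xs : seq R^o) r & ~ bounded xs].
have F0 : Fm (fun r => r = 0).
  split; last by exists [::]; split.
  by split=> // [x y -> ->|b x ->]; rewrite ?addr0 ?mulr0.
have [p [[pI [xs [xp gp nb]]] pmax]] := @noetherian_max R hR Fm _ F0 (fun I h => h.1).
apply: (@critical_contradiction p xs pI xp gp nb) => y py; apply: contrapT => nby; apply: py.
have yx r : spanned (xs : seq R^o) r -> spanned ((y :: xs) : seq R^o) r.
  by exists 0; rewrite scale0r subr0.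
apply: (pmax (fun r => spanned ((y :: xs) : seq R^o) r)).
- split; last by exists (y :: xs); split=> // x hx; apply: (@spanned_mem _ R^o).
  by split; [apply: (@spanned0 _ R^o)|apply: (@spannedD _ R^o)|apply: (@spannedZ _ R^o)].
- by move=> x /gp /yx.
- by apply: (@spanned_mem _ R^o); rewrite mem_head.
Qed.
End Boundedness.

(** * Base change of semidualizing complexes and their isomorphisms *)

Section Conclusion.
Variables (R S : comPzRingType) (phi : {rmorphism R -> S}).
Hypotheses (hR : noetherian R) (hS : noetherian S) (hphi : finite_flat_dim phi)
  (hmax : forall m : R -> Prop, is_maximal m ->
     exists q : S -> Prop, is_prime q /\ (forall r, m r <-> q (phi r))).

(** For descent, the lower bound on [C] comes from that of the base change and gives a resolution
    bounded below. Its upper bound is [bounded_above], and the bounded case applies. *)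
Lemma semidualizing_base_change (C : complex R) : degreewise_finite C ->
  semidualizing (Ltensor phi C) <-> semidualizing C.
Proof.
move=> fC; split=> [h|h]; last by apply/(semidualizing_bounded hR hS hphi hmax); case: h.
apply/(semidualizing_bounded hR hS hphi hmax) => //.
have [/homologically_finiteP [_ [a ha] [b hb]] hh] := h.
have zC : zero_below C a by apply/(Ltensor_zero hR hmax a fC).
have [L [l [hL ql]]] := free_resolution hR fC zC; have sL := finite_free_semiprojective hL.
have [lh qlh] := Ltensor_resolution phi sL ql.
have qS : quasi_iso (chi (bc_complex phi L)) by apply/(homothety_chi (bc_semiprojective phi sL) qlh).
have [|b' hb'] := bounded_above hR hphi hmax hL qS.
  by exists b => i ib; apply/(hiso_zero (qlh i)); apply: hb.
apply/homologically_finiteP; split=> //; first by exists a.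
by exists b' => i ib; apply/(hiso_zero (ql i)); apply: hb'.
Qed.

Lemma semidualizing_resolution (C : complex R) : semidualizing C -> exists (P : complex R) (p : chain_map P C) a b,
  [/\ finite_free_below P a, zero_above P b, quasi_iso p & quasi_iso (chi P)].
Proof.
move=> [/homologically_finiteP [fC [a ha] [b hb]] hh].
have [P [p [hP qp]]] := free_resolution hR fC ha; exists P, p, a, b; split=> //.
  by move=> i ib; apply/(hiso_zero (qp i)); apply: hb.
by apply/(homothety_chi (finite_free_semiprojective hP) qp).
Qed.

Lemma disomorphic_base_change (C C' : complex R) : pic_injective phi -> semidualizing C -> semidualizing C' ->
  disomorphic (Ltensor phi C) (Ltensor phi C') <-> disomorphic C C'.
Proof.
move=> hpic /semidualizing_resolution [P [p [a [b [hP zP qp cP]]]]] /semidualizing_resolution [P' [p' [a' [b' [hP' zP' qp' cP']]]]].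
have sP := finite_free_semiprojective hP; have sP' := finite_free_semiprojective hP'.
have [ph qph] := Ltensor_resolution phi sP qp; have [ph' qph'] := Ltensor_resolution phi sP' qp'.
have H1 := disomorphicP sP sP' qp qp'.
have H2 := disomorphicP (bc_semiprojective phi sP) (bc_semiprojective phi sP') qph qph'.
split=> [/H2 [be qb]|/H1 [f qf]].
  by apply/H1; apply: (quasi_iso_descent hR hphi hmax hpic hP hP' zP zP' cP cP' qb).
by apply/H2; exists (bcm phi f); apply: bcm_quasi_iso.
Qed.
End Conclusion.

Theorem mainTheorem2 (R S : comPzRingType) (phi : {rmorphism R -> S})
  (hR : noetherian R) (hS : noetherian S) (hphi : finite_flat_dim phi)
  (C C' X : complex R)
  (hC : degreewise_finite C) (hC' : degreewise_finite C')
  (hX : degreewise_finite X)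
  (hmax : forall m : R -> Prop, is_maximal m ->
     exists q : S -> Prop, is_prime q /\ (forall r, m r <-> q (phi r))) :
  (semidualizing (Ltensor phi C) <-> semidualizing C) /\
  (semidualizing C ->
     Gdim C X = Gdim (Ltensor phi C) (Ltensor phi X) /\
     (C_reflexive (Ltensor phi C) (Ltensor phi X) <-> C_reflexive C X)) /\
  (pic_injective phi -> semidualizing C -> semidualizing C' ->
     (disomorphic (Ltensor phi C) (Ltensor phi C') <-> disomorphic C C')).
Proof.
split; first exact: semidualizing_base_change.
split=> [[fC _]|]; last exact: disomorphic_base_change.
by split; [apply: Gdim_base_change|apply: reflexive_base_change].
Qed.
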